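(* Let $D\subset\mathbb{C}^n$ be a pseudoconvex domain with generic corners which satisfies Condition R. Let $G\subset\mathbb{C}^n$ be a domain and let $f:D\to G$ be a biholomorphic map. Then the following are equivalent: (1) $f$ extends as a $\mathcal{C}^\infty$-smooth diffeomorphism from $\overline{D}$ onto $\overline{G}$; (2) $G$ is a domain with generic corners and $G$ satisfies Condition R.
   Context: A bounded domain $\Omega\subset\mathbb{C}^n$ is a domain with generic corners if it can be written as $\Omega=\bigcap_{j=1}^N\Omega_j$, where each $\Omega_j$ is a domain with $\mathcal{C}^\infty$-smooth boundary, such that (i) all intersections of the boundaries $b\Omega_j$ are transverse, and (ii) for each subset $S\subset\{1,\dots,N\}$, the set $B_S=\bigcap_{j\in S}b\Omega_j$, if non-empty, is a CR manifold of CR-dimension $n-|S|$. Equivalently, with smooth defining functions $r_j$ ($\Omega_j=\{r_j<0\}$, $dr_j\neq 0$ on $b\Omega_j$): at each $p$ with $r_{j_1}(p)=\dots=r_{j_k}(p)=0$ one has $dr_{j_1}\wedge\dots\wedge dr_{j_k}(p)\neq0$ and $\bar\partial r_{j_1}\wedge\dots\wedge\bar\partial r_{j_k}(p)\neq 0$. A domain $\Omega$ satisfies Condition R if its Bergman projection $P$ (the orthogonal projection of $L^2(\Omega)$ onto the closed subspace of square-integrable holomorphic functions) maps $\mathcal{C}^\infty(\overline{\Omega})$ into $\mathcal{C}^\infty(\overline{\Omega})$. *)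

(* Defs.v *)
(* R : realType models the reals;
   C^n is identified with R^(2n) = 'rV[R]_(n + n) via
   z_j = x_j + i y_j, x_j = coordinate (lshift n j), y_j = coordinate (rshift n j).
   Complex-valued functions are represented by pairs (real part, imaginary part)
   of real-valued functions. *)
From mathcomp Require Import all_boot all_order all_algebra.
From mathcomp Require Import all_classical all_reals all_analysis.
Set Implicit Arguments. Unset Strict Implicit. Unset Printing Implicit Defensive.
Import Order.TTheory GRing.Theory Num.Theory numFieldTopology.Exports numFieldNormedType.Exports.
Local Open Scope ring_scope.
Local Open Scope classical_set_scope.

Section Defs.
Variable R : realType.

Section RealCalculus.
Variable m : nat.
Local Notation V := 'rV[R]_m.

Definition ebasis (i : 'I_m) : V := \row_k (if k == i then 1 else 0).

Definition pd (i : 'I_m) (f : V -> R) : V -> R := fun x => derive f x (ebasis i).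

Fixpoint pds (ds : seq 'I_m) (f : V -> R) : V -> R :=
  match ds with [::] => f | i :: ds' => pd i (pds ds' f) end.

Definition smooth_on (U : set V) (f : V -> R) : Prop :=
  forall ds : seq 'I_m,
    (forall x, U x -> forall i, derivable (pds ds f) x (ebasis i)) /\
    (forall x, U x -> {for x, continuous (pds ds f)}).

Definition C1_on (U : set V) (f : V -> R) : Prop :=
  (forall x, U x -> forall i, derivable f x (ebasis i)) /\
  (forall x, U x -> {for x, continuous f}) /\
  (forall i x, U x -> {for x, continuous (pd i f)}).

Definition smooth_upto (U : set V) (f : V -> R) : Prop :=
  smooth_on U f /\
  forall ds : seq 'I_m, forall p, closure U p ->
    exists l : R, pds ds f @ within U (nbhs p) --> l.

Definition grad (f : V -> R) (p : V) : V := \row_i pd i f p.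

(* Lebesgue integral over R^m of a nonnegative (extended) function, computed as
   an iterated one-dimensional Lebesgue integral (Tonelli); coordinates are
   integrated one at a time *)
Definition setc (x : V) (k : nat) (t : R) : V :=
  \row_j (if (j : nat) == k then t else x ord0 j).

Fixpoint iint (k : nat) (F : V -> \bar R) (x : V) : \bar R :=
  match k with
  | 0 => F x
  | k'.+1 => (\int[@lebesgue_measure R]_(t in [set: R]) iint k' F (setc x k' t))%E
  end.

Definition int_nonneg (F : V -> \bar R) : \bar R := iint m F 0.

Definition int_Rm (F : V -> R) : \bar R :=
  (int_nonneg (fun x => (Num.max (F x) 0)%:E) -
   int_nonneg (fun x => (Num.max (- F x) 0)%:E))%E.

Definition indic (U : set V) (x : V) : R := if `[< U x >] then 1 else 0.

End RealCalculus.

Section Complex.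
Variable n : nat.
Local Notation E := 'rV[R]_(n + n).

Definition xi (j : 'I_n) : 'I_(n + n) := lshift n j.
Definition yi (j : 'I_n) : 'I_(n + n) := rshift n j.

Definition cscale (s t : R) (b : E) : E :=
  \row_k match fintype.split k with
         | inl j => s * b ord0 (xi j) - t * b ord0 (yi j)
         | inr j => t * b ord0 (xi j) + s * b ord0 (yi j)
         end.

Definition holomorphic_on (U : set E) (u v : E -> R) : Prop :=
  C1_on U u /\ C1_on U v /\
  forall j x, U x ->
    pd (xi j) u x = pd (yi j) v x /\ pd (yi j) u x = - pd (xi j) v x.

Definition coord (F : E -> E) (k : 'I_(n + n)) : E -> R := fun x => F x ord0 k.

Definition holomorphic_map_on (U : set E) (F : E -> E) : Prop :=
  forall j : 'I_n, holomorphic_on U (coord F (xi j)) (coord F (yi j)).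

Definition biholomorphic (D G : set E) (f : E -> E) : Prop :=
  holomorphic_map_on D f /\
  exists g : E -> E,
    holomorphic_map_on G g /\
    (forall x, D x -> G (f x)) /\ (forall y, G y -> D (g y)) /\
    (forall x, D x -> g (f x) = x) /\ (forall y, G y -> f (g y) = y).

Definition domain (U : set E) : Prop := open U /\ connected U /\ U !=set0.

(* continuous phi is plurisubharmonic on U: sub-mean-value property on every
   closed complex-affine disc {a + zeta b : |zeta| <= 1} contained in U *)
Definition psh_on (U : set E) (phi : E -> R) : Prop :=
  forall a b : E,
    (forall s t : R, s ^+ 2 + t ^+ 2 <= 1 -> U (a + cscale s t b)) ->
    ((phi a)%:E <=
     ((2 * pi)^-1)%:E *
       \int[@lebesgue_measure R]_(th in [set th : R | (0 <= th <= 2 * pi)%R])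
          (phi (a + cscale (cos th) (sin th) b))%:E)%E.

Definition pseudoconvex (U : set E) : Prop :=
  domain U /\
  exists phi : E -> R,
    (forall x, U x -> {for x, continuous phi}) /\
    psh_on U phi /\
    forall c : R, exists K : set E,
      compact K /\ K `<=` U /\ [set x | U x /\ phi x < c] `<=` K.

(* d-bar r (p) has components  d r / d zbar_k = (1/2)(d_{x_k} r + i d_{y_k} r) *)
Definition dbar_re (r : E -> R) (p : E) (k : 'I_n) : R := 2^-1 * pd (xi k) r p.
Definition dbar_im (r : E -> R) (p : E) (k : 'I_n) : R := 2^-1 * pd (yi k) r p.

Definition generic_corners (U : set E) : Prop :=
  domain U /\ bounded_set U /\
  exists (N : nat) (r : 'I_N -> E -> R),
    (forall j, smooth_on setT (r j)) /\
    (forall j, domain [set x | r j x < 0]) /\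
    (forall j p, r j p = 0 -> grad (r j) p != 0) /\
    (U = [set x | forall j, r j x < 0]) /\
    (* transversality: dr_{j1} /\ ... /\ dr_{jk} (p) <> 0 *)
    (forall (S : {set 'I_N}) (p : E), (forall j, j \in S -> r j p = 0) ->
       forall c : 'I_N -> R,
         \sum_(j in S) c j *: grad (r j) p = 0 -> forall j, j \in S -> c j = 0) /\
    (* CR condition: dbar r_{j1} /\ ... /\ dbar r_{jk} (p) <> 0, i.e. the vectors
       dbar r_j (p) in C^n are C-linearly independent (complex coefficients
       a_j + i b_j, complex arithmetic written out in real/imaginary parts) *)
    (forall (S : {set 'I_N}) (p : E), (forall j, j \in S -> r j p = 0) ->
       forall a b : 'I_N -> R,
         (forall k : 'I_n,
            \sum_(j in S) (a j * dbar_re (r j) p k - b j * dbar_im (r j) p k) = 0 /\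
            \sum_(j in S) (a j * dbar_im (r j) p k + b j * dbar_re (r j) p k) = 0) ->
         forall j, j \in S -> a j = 0 /\ b j = 0).

Definition L2_on (U : set E) (u v : E -> R) : Prop :=
  (int_nonneg (fun x => (indic U x * (u x ^+ 2 + v x ^+ 2))%:E) < +oo)%E.

(* (u1 + i v1) is orthogonal to (u2 + i v2) in L^2(U):
   integral over U of (u1 + i v1) * conj(u2 + i v2) is 0 *)
Definition L2_orth (U : set E) (u1 v1 u2 v2 : E -> R) : Prop :=
  int_Rm (fun x => indic U x * (u1 x * u2 x + v1 x * v2 x)) = 0%E /\
  int_Rm (fun x => indic U x * (v1 x * u2 x - u1 x * v2 x)) = 0%E.

(* Condition R: for every phi in C^infinity(closure U), its Bergman projection
   P phi -- the (unique) square-integrable holomorphic h with phi - h orthogonal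
   to all square-integrable holomorphic functions -- lies in C^infinity(closure U) *)
Definition condition_R (U : set E) : Prop :=
  forall phu phv : E -> R,
    smooth_upto U phu -> smooth_upto U phv ->
    exists hu hv : E -> R,
      holomorphic_on U hu hv /\ L2_on U hu hv /\
      (forall gu gv : E -> R, holomorphic_on U gu gv -> L2_on U gu gv ->
         L2_orth U (fun x => phu x - hu x) (fun x => phv x - hv x) gu gv) /\
      smooth_upto U hu /\ smooth_upto U hv.

Definition extends_smooth_diffeo (D G : set E) (f : E -> E) : Prop :=
  exists F H : E -> E,
    (forall x, D x -> F x = f x) /\
    (forall x, closure D x -> closure G (F x)) /\
    (forall y, closure G y -> closure D (H y)) /\
    (forall x, closure D x -> H (F x) = x) /\
    (forall y, closure G y -> F (H y) = y) /\
    {within closure D, continuous F} /\ {within closure G, continuous H} /\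
    (forall k, smooth_upto D (coord F k)) /\
    (forall k, smooth_upto G (coord H k)).

End Complex.
End Defs.

(* Main.v *)
(* Let u = det f'. Change of variables gives P_D (u (phi o f)) = u (P_G phi o f).
   (2) => (1): at corners with independent complex gradients, any h holomorphic and smooth up to the boundary is
   P of a function vanishing there to high order, up to small errors in every C^k (Bell); under Condition R a
   gliding hump shows that P is bounded from finitely many derivatives to the sup norm. Applied to h = 1 and to the
   coordinates on G, the formula makes u, then u f_j, smooth up to bD, and the inverse map keeps u away from 0.
   (1) => (2): a Taylor expansion transverse to the corners and a partition of unity extend f smoothly across bD;
   the extension is locally invertible, so r_j o f^-1 is defined near f(bD), and adding flat functions of the other
   r_k confines the new defining functions to a neighbourhood of bG. The Cauchy-Riemann equations on bD carry over
   the independence of the complex gradients, and the formula carries over Condition R. *)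
Require Import Defs.
From HB Require Import structures.
From mathcomp Require Import all_boot all_order all_algebra.
From mathcomp Require Import all_classical all_reals all_analysis.
From mathcomp Require Import measurable_realfun ring lra.
From mathcomp Require complex perm fingroup.
Set Implicit Arguments. Unset Strict Implicit. Unset Printing Implicit Defensive.
Import Order.TTheory GRing.Theory Num.Theory numFieldTopology.Exports numFieldNormedType.Exports.
Local Open Scope ring_scope.
Local Open Scope classical_set_scope.

(** Smoothness up to the boundary is carried as boundedness of every derivative on the open set.
    This is stable under products and composition whatever the boundary looks like; corners enter
    when it is compared with the existence of boundary limits. Density is used in C^1 only: [h] is
    replaced by the projection [H] of a compactly supported function, so that [u (H o f)] is smooth
    up to bD while [u] itself is not yet controlled. With [H_0] close to 1 and [H_j] close to [z_j],
    the Wronskians of [u (H_j o f)] and [u (H_0 o f)] contain no derivative of [u] and equal [u^2]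
    times [f'] multiplied by a matrix close to the identity; solved for [f'], they gain one bounded
    derivative at each turn. The change of variables is obtained up to an unspecified constant
    factor, to which orthogonality is blind: by the Piola identity the pulled back integral kills
    derivatives, so its averages against a kernel are locally constant. The same kernel, whose
    derivative in the scale is a Laplacian, gives the mean value property and the interior estimates
    of holomorphic functions. *)

Section Main.
Context {R : realType}.

(** * Mean value theorem, differentiability from partial derivatives, chain rule *)

Section Frechet.

Lemma rV_norm_le m (x : 'rV[R]_m) (e : R) : 0 <= e ->
 (`|x| <= e) <-> (forall i, `|x ord0 i| <= e).
move=>e0;split=>[xe i|xe].
 apply: le_trans xe;rewrite [leRHS]/Num.Def.normr/= mx_normrE.
 exact: (le_bigmax _ (fun ij : 'I_1 * 'I_m => `|x ij.1 ij.2|) (ord0, i)).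
rewrite [leLHS]/Num.Def.normr/= mx_normrE (bigmax_le _ e0)//= => -[i j] _ /=.
by rewrite ord1.
Qed.

Lemma coord_le m (x : 'rV[R]_m) i : `|x ord0 i| <= `|x|.
by move: i;apply/rV_norm_le. Qed.

Lemma rV_sum_ebasis m (x : 'rV[R]_m) : x = \sum_i x ord0 i *: ebasis R i.
apply/rowP => j;rewrite summxE (bigD1 j) //= !mxE eqxx mulr1 big1 ?addr0 //.
by move=>i ij;rewrite !mxE eq_sym (negbTE ij) mulr0.
Qed.

Lemma norm_ebasis m (i : 'I_m) : `|ebasis R i| <= 1.
by apply/rV_norm_le=>// j;rewrite mxE;case: eqP;rewrite ?normr1 ?normr0.
Qed.

Lemma is_derive_line (V : normedModType R) (f : V -> R) (x v : V) (t d : R) :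
 is_derive (t *: v + x) v f d -> is_derive t 1 (fun s => f (s *: v + x)) d.
case=>fd <-;rewrite /derivable /derive in fd *.
have E: (fun h : R => h^-1 *: (((fun s : R => f (s *: v + x)) \o shift t) (h *: (1:R)) -
  f (t *: v + x))) = (fun h : R => h^-1 *: ((f \o shift (t *: v + x)) (h *: v) -
  f (t *: v + x))).
 by apply/funext => h /=;rewrite [h *: 1]mulr1 scalerDl addrA.
by split;rewrite /derivable /derive E.
Qed.

Lemma line_continuous (V : normedModType R) (x v : V) :
 continuous (fun s : R => s *: v + x).
by move=>s;apply: cvgD;[exact: scalel_continuous|exact: cvg_cst].
Qed.

(** The increment may have either sign, whence the two intervals. Of the intermediate point only |s|
    <= |t| is kept, the form used on symmetric neighbourhoods. *)
Lemma MVT_line (V : normedModType R) (f : V -> R) (x v : V) (t : R) :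
 (forall s, `|s| <= `|t| -> derivable f (s *: v + x) v) ->
 exists2 s, `|s| <= `|t| & f (t *: v + x) - f x = t * 'D_v f (s *: v + x).
move=>fd;pose g s:=f (s *: v + x);pose dg s:='D_v f (s *: v + x).
have gd (s : R) : `|s| <= `|t| -> is_derive s 1 g (dg s).
 by move=>st;apply: is_derive_line;apply: derivableP;exact: fd.
have gc (a b : R) : (forall s, s \in `[a, b]%R -> `|s| <= `|t|) ->
  {within `[a, b], continuous g}.
 by move=>ab;apply: derivable_within_continuous => s sab;have := gd s (ab s sab).
have [t0|t0]:=leP 0 t.
 have st s: s \in `[0, t]%R -> `|s| <= `|t|.
  by rewrite /= =>/andP[s0 st];rewrite !ger0_norm.
 have [||s s0t E]:=@MVT_segment R g dg 0 t t0.
 - by move=>s /subset_itv_oo_cc /st /gd.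
 - exact: gc.
 exists s;first exact: st.
 by move: E;rewrite /g scale0r add0r subr0 mulrC.
have st s: s \in `[t, 0]%R -> `|s| <= `|t|.
 by rewrite /= =>/andP[s0 st];rewrite !ler0_norm ?lerN2 // ltW.
have [||s s0t E]:=@MVT_segment R g dg t 0 (ltW t0).
- by move=>s /subset_itv_oo_cc /st /gd.
- exact: gc.
exists s;first exact: st.
move: E;rewrite /g scale0r add0r sub0r => E.
by rewrite -opprB E mulrN opprK mulrC.
Qed.

Definition lincomb m (c : 'I_m -> R) (w : 'rV[R]_m) : R := \sum_i w ord0 i * c i.

Lemma lincomb_is_linear m (c : 'I_m -> R) : linear (lincomb c).
move=>a u v;rewrite /lincomb scaler_sumr -big_split /=;apply: eq_bigr => i _.
by rewrite !mxE mulrDl -mulrA.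
Qed.

HB.instance Definition _ m (c : 'I_m -> R) :=
 GRing.isLinear.Build R 'rV[R]_m R _ (lincomb c) (lincomb_is_linear c).

Lemma sum_continuous (T : topologicalType) (I : Type) (r : seq I) (P : pred I)
  (f : I -> T -> R) (x : T) :
 (forall i, P i -> {for x, continuous (f i)}) ->
 {for x, continuous (fun y => \sum_(i <- r | P i) f i y)}.
by move=>fc;apply: cvg_big=>//;exact: add_continuous. Qed.

Lemma coord_cont m (i : 'I_m) (x : 'rV[R]_m) :
 {for x, continuous (fun y : 'rV[R]_m => y ord0 i)}.
exact: coord_continuous. Qed.

Lemma lincomb_continuous m (c : 'I_m -> R) : continuous (lincomb c).
move=>x;apply: sum_continuous => i _.
by apply: continuousM;[exact: coord_cont|exact: cst_continuous].
Qed.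

(** The point [x] is joined to [w + x] by changing one coordinate at a time; the mean value theorem
    on each edge turns the increment into a partial derivative at a point close to [x]. *)
Lemma frechet_of_partials m (f : 'rV[R]_m -> R) (x : 'rV[R]_m) (e : R) : 0 < e ->
 (\forall y \near x, forall i, derivable f y (ebasis R i)) ->
 (forall i, {for x, continuous (pd i f)}) ->
 \forall w \near (0 : 'rV[R]_m), `|f (w + x) - f x - lincomb (fun i => pd i f x) w| <= e * `|w|.
move=>e0 fd fc.
(* The share of the error allowed to each edge; [m.+1] instead of [m] also covers dimension 0. *)
have m0: 0 < e / m.+1%:R by rewrite divr_gt0.
have : \forall y \near x, forall i,
  derivable f y (ebasis R i) /\ `|pd i f y - pd i f x| <= e / m.+1%:R.
 near=> y => i;split;first by move: i;near: y.
 move: i;near: y;apply: filter_forall => j.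
 have /cvgrPdist_le/(_ _ m0) := fc j.
 by apply: filterS => y;rewrite distrC.
move=>/nbhs_ballP[d /= d0 Hd].
near=> w.
have wd: `|w| < d by near: w;apply/nbhs_ballP;exists d=>//= u;rewrite -ball_normE /= sub0r normrN.
pose y k : 'rV[R]_m := x + \sum_(j < m | (j < k)%N) w ord0 j *: ebasis R j.
have yS (k : 'I_m) : y k.+1 = w ord0 k *: ebasis R k + y k.
 rewrite addrCA;congr (_ + _);rewrite (bigD1 k) //=;congr (_ + _).
 by apply: eq_bigl => j;rewrite ltnS ltn_neqAle andbC.
have yn k: forall s, `|s| <= `|w ord0 k| -> `|s *: ebasis R k + y k - x| <= `|w|.
 move=>s sw;rewrite addrCA addrAC subrr add0r.
 apply/rV_norm_le=>// j;rewrite !mxE summxE.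
 have [->|kj]:=eqVneq.
  rewrite mulr1 big1 ?addr0;last first.
   move=>i ik;rewrite !mxE;case: eqP=>[ki|];last by rewrite mulr0.
   by rewrite ki ltnn in ik.
  exact: le_trans sw (coord_le _ _).
 rewrite mulr0 add0r.
 have [jk|jk]:=boolP (j < k)%N.
  rewrite (bigD1 j) //= !mxE eqxx mulr1 big1 ?addr0 ?coord_le //.
  by move=>i /andP[_ ij];rewrite !mxE eq_sym (negbTE ij) mulr0.
 rewrite big1 ?normr0 // => i ik;rewrite !mxE;case: eqP=>[ji|];last by rewrite mulr0.
 by rewrite ji ik in jk.
have step (k : 'I_m) : `|f (y k.+1) - f (y k) - w ord0 k * pd k f x| <= e / m.+1%:R * `|w|.
 rewrite yS;have [s sw|s sw ->]:=@MVT_line _ f (y k) (ebasis R k) (w ord0 k).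
  have /Hd/(_ k)[] // : ball x d (s *: ebasis R k + y k).
  by rewrite -ball_normE /= distrC;exact: le_lt_trans (yn _ _ sw) wd.
 have /Hd/(_ k)[_ H] : ball x d (s *: ebasis R k + y k).
  by rewrite -ball_normE /= distrC;exact: le_lt_trans (yn _ _ sw) wd.
 by rewrite -mulrBr normrM mulrC ler_pM // coord_le.
have -> : f (w + x) - f x = \sum_(k < m) (f (y k.+1) - f (y k)).
 rewrite -(big_mkord xpredT (fun k => f (y k.+1) - f (y k))) telescope_sumr //.
 congr (f _ - f _).
  rewrite addrC [in LHS](rV_sum_ebasis w);congr (_ + _).
  by apply: eq_bigl => j;rewrite ltn_ord.
 by rewrite /y big_pred0 ?addr0.
rewrite -sumrB;apply: le_trans (ler_norm_sum _ _ _) _.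
apply: le_trans (ler_sum _ (fun k _ => step k)) _.
rewrite sumr_const card_ord -[leLHS]mulr_natl mulrA;apply: ler_wpM2r=>//.
rewrite mulrCA;apply: ler_piMr;first exact: ltW.
by rewrite ler_pdivrMr // mul1r ler_nat.
Unshelve. all: by end_near. Qed.

Lemma differentiable_of_partials m (f : 'rV[R]_m -> R) (x : 'rV[R]_m) :
 (\forall y \near x, forall i, derivable f y (ebasis R i)) ->
 (forall i, {for x, continuous (pd i f)}) ->
 differentiable f x /\ 'd f x = lincomb (fun i => pd i f x) :> (_ -> _).
move=>fd fc.
have E: (f \o shift x : 'rV[R]_m -> R) =
  cst (f x) + (lincomb (fun i => pd i f x) : 'rV[R]_m -> R) +o_ (0 : 'rV[R]_m) id.
 apply/eqaddoP => e e0;have := frechet_of_partials e0 fd fc.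
 by apply: filterS => w;rewrite opprD addrA.
have D:=diff_unique (@lincomb_continuous _ _) E.
split=>//;apply/diff_locallyP;rewrite D;split=>//;exact: lincomb_continuous.
Qed.

Lemma derive_lincomb m (f : 'rV[R]_m -> R) (x v : 'rV[R]_m) :
 (\forall y \near x, forall i, derivable f y (ebasis R i)) ->
 (forall i, {for x, continuous (pd i f)}) ->
 is_derive x v f (\sum_i v ord0 i * pd i f x).
move=>fd fc;have [df dE]:=differentiable_of_partials fd fc.
split;first exact: diff_derivable.
by rewrite deriveE // dE.
Qed.

(** Of [F] only the derivative along [v] is given, so the rule is applied to the curve
    [t |-> F (t v + x)] at 0: in one variable derivability and differentiability coincide. *)
Lemma chain_rule m p (h : 'rV[R]_p -> R) (F : 'rV[R]_m -> 'rV[R]_p)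
  (x v : 'rV[R]_m) :
 (\forall y \near F x, forall l, derivable h y (ebasis R l)) ->
 (forall l, {for F x, continuous (pd l h)}) ->
 (forall l, derivable (fun y => F y ord0 l) x v) ->
 is_derive x v (fun y => h (F y)) (\sum_l 'D_v (fun y => F y ord0 l) x * pd l h (F x)).
move=>hd hc Fd;have [dh dhE]:=differentiable_of_partials hd hc.
have Fd': derivable F x v by apply/derivable_mxP => j;rewrite ord1.
pose c (t : R) := F (t *: v + x).
have c0: c 0 = F x by rewrite /c scale0r add0r.
have dc: differentiable c 0 by apply/derivable1_diffP;move/derivable1P: Fd'.
have dhc: differentiable h (c 0) by rewrite c0.
have E: is_diff 0 (h \o c) ('d h (c 0) \o 'd c 0).
 by split;[exact: differentiable_comp|exact: diff_comp].
have hcd: derivable (h \o c) 0 1 by apply/derivable1_diffP.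
have hFd: derivable (fun y => h (F y)) x v by apply/derivable1P.
split=>//.
have -> : 'D_v (fun y => h (F y)) x = 'D_1 (h \o c) 0.
 have /derivableP := hFd;rewrite -[x]add0r -[X in is_derive (X + _)](scale0r v).
 by move/is_derive_line=>[_ <-].
rewrite deriveE // diff_val /= c0 dhE;apply: eq_bigr => l _.
congr (_ * _);rewrite -deriveE //.
have -> : 'D_1 c 0 = 'D_v F x.
 rewrite /derive;set u1 := (fun _ : R => _);set u2 := (fun _ : R => _).
 suff -> : u1 = u2 by [].
 by apply/funext => t;rewrite /u1 /= c0 addr0 [t *: 1]mulr1.
by rewrite derive_mx // mxE.
Qed.

End Frechet.

(** * Classes of functions with continuous, optionally bounded, derivatives *)

Section SmoothClasses.

Lemma is_derive_of_line (V : normedModType R) (f : V -> R) (x v : V) (d : R) :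
 is_derive (0 : R) (1 : R) (fun s : R => f (s *: v + x)) d -> is_derive x v f d.
case=>fd <-.
have D: derivable f x v by apply/derivable1P.
split=>//;have /derivableP := D;rewrite -[x in is_derive x](add0r x).
by rewrite -[X in is_derive (X + _)](scale0r v)=>/is_derive_line [_ <-].
Qed.

Lemma is_derive_comp1 (V : normedModType R) (s : R -> R) (f : V -> R) (x v : V)
  (ds df : R) :
 is_derive (f x) 1 s ds -> is_derive x v f df ->
 is_derive x v (fun y => s (f y)) (ds * df).
move=>sd fd;apply: is_derive_of_line.
apply: (@is_derive1_comp _ s (fun t => f (t *: v + x))).
 by rewrite scale0r add0r.
by apply: is_derive_line;rewrite scale0r add0r.
Qed.

Lemma rV_continuous (T : topologicalType) p (F : T -> 'rV[R]_p) (x : T) :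
 (forall l, {for x, continuous (fun y => F y ord0 l)}) -> {for x, continuous F}.
move=>Fc;apply/cvgrPdist_le => e e0;near=> y.
apply/rV_norm_le;first exact: ltW.
move=>l;rewrite !mxE;move: l;near: y;apply: filter_forall => l.
by have /cvgrPdist_le/(_ _ e0) := Fc l.
Unshelve. all: by end_near. Qed.

Variable b : bool.

Section OneDomain.
Variables (m : nat) (U : set 'rV[R]_m).
Local Notation V := 'rV[R]_m.
Implicit Types f g : V -> R.

Definition cont_on f := forall x, U x -> {for x, continuous f}.
Definition bound_on f := exists M, forall x, U x -> `|f x| <= M.
Definition C0 f := cont_on f /\ (b -> bound_on f).

(* [b = true] additionally asks every derivative of order <= k to be bounded. *)
Fixpoint Cn (k : nat) f : Prop :=
 C0 f /\ match k with
 | 0 => True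
 | k'.+1 => (forall x, U x -> forall i, derivable f x (ebasis R i)) /\
      forall i, Cn k' (pd i f)
 end.

Definition Csm f := forall k, Cn k f.

Lemma Cn_C0 k f : Cn k f -> C0 f. Proof. by case: k=>[|k] []. Qed.

Lemma Cn_pd k i f : Cn k.+1 f -> Cn k (pd i f). Proof. by case=>_ [_ H];exact: H. Qed.

Lemma Cn_derivable k f x i : Cn k.+1 f -> U x -> derivable f x (ebasis R i).
by case=>_ [fd _] Ux;exact: fd. Qed.

Lemma Cn_derive k f x i : Cn k.+1 f -> U x -> is_derive x (ebasis R i) f (pd i f x).
by move=>fk Ux;apply: derivableP;exact: Cn_derivable fk Ux. Qed.

Lemma CnW k f : Cn k.+1 f -> Cn k f.
elim: k f=>[|k IH] f;first by move/Cn_C0.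
by case=>f0 [fd fk];split=>//;split=>// i;exact/IH/fk.
Qed.

Lemma Csm_pd i f : Csm f -> Csm (pd i f).
by move=>fs k;exact: Cn_pd. Qed.

Lemma Csm_pds ds f : Csm f -> Csm (pds ds f).
by elim: ds=>//= i ds IH fs;exact/Csm_pd/IH. Qed.

Hypothesis oU : open U.

Lemma near_in x : U x -> \forall y \near x, U y.
by move=>Ux;apply: open_nbhs_nbhs. Qed.

Lemma near_eqon f g x : (forall y, U y -> f y = g y) -> U x -> {near x, f =1 g}.
by move=>fg /near_in;apply: filterS => y /fg. Qed.

Lemma pd_eqon f g i x : (forall y, U y -> f y = g y) -> U x -> pd i f x = pd i g x.
by move=>fg Ux;apply: near_eq_derive;exact: near_eqon. Qed.

Lemma derivable_eqon f g v x : (forall y, U y -> f y = g y) -> U x ->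
 derivable f x v -> derivable g x v.
by move=>fg Ux;apply: near_eq_derivable;exact: near_eqon. Qed.

Lemma cont_eqon f g x : (forall y, U y -> f y = g y) -> U x ->
 {for x, continuous f} -> {for x, continuous g}.
move=>fg Ux fc;suff: g @ x --> f x by rewrite (fg x Ux).
have H:=near_eq_cvg (near_eqon fg Ux).
by move=>A fA;exact: H (fc _ fA).
Qed.

Lemma C0_eq f g : (forall y, U y -> f y = g y) -> C0 f -> C0 g.
move=>fg [fc fb];split=>[x Ux|/fb [M HM]];first exact: cont_eqon (fc x Ux).
by exists M => x Ux;rewrite -fg //;exact: HM.
Qed.

Lemma Cn_eq k f g : (forall y, U y -> f y = g y) -> Cn k f -> Cn k g.
elim: k f g=>[|k IH] f g fg [f0 fk];split=>//;try exact: C0_eq f0.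
case: fk => fd fk;split=>[x Ux i|i];first exact: derivable_eqon (fd x Ux i).
by apply: IH (fk i) => y;exact: pd_eqon.
Qed.

Lemma Csm_eq f g : (forall y, U y -> f y = g y) -> Csm f -> Csm g.
by move=>fg fs k;exact: Cn_eq (fs k). Qed.

Lemma pds_eqon ds f g x : (forall y, U y -> f y = g y) -> U x -> pds ds f x = pds ds g x.
by move=>fg;elim: ds x=>[|i ds IH] x;[exact: fg|exact: pd_eqon].
Qed.

(** Closure properties are proved by exhibiting a formula for the derivative; it has to agree with
    [pd] only on the open set, and the classes see nothing else. *)
Lemma Cn_intro k f (df : 'I_m -> V -> R) : C0 f ->
 (forall x i, U x -> is_derive x (ebasis R i) f (df i x)) ->
 (forall i, Cn k (df i)) -> Cn k.+1 f.
move=>f0 fd dk;split=>//;split=>[x Ux i|i];first by have := fd x i Ux.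
by apply: Cn_eq (dk i) => y Uy;have [_ <-]:=fd y i Uy.
Qed.

Lemma C0_cst c : C0 (fun _ => c).
by split=>[x _|_];[exact: cst_continuous|exists `|c|]. Qed.

Lemma C0D f g : C0 f -> C0 g -> C0 (fun x => f x + g x).
move=>[fc fb] [gc gb];split=>[x Ux|b1].
 by apply: continuousD;[exact: fc|exact: gc].
have [M HM]:=fb b1;have [N HN]:=gb b1;exists (M + N) => x Ux.
by apply: le_trans (ler_normD _ _) _;rewrite lerD ?HM ?HN.
Qed.

Lemma C0M f g : C0 f -> C0 g -> C0 (fun x => f x * g x).
move=>[fc fb] [gc gb];split=>[x Ux|b1].
 by apply: continuousM;[exact: fc|exact: gc].
have [M HM]:=fb b1;have [N HN]:=gb b1;exists (M * N) => x Ux.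
by rewrite normrM ler_pM ?HM ?HN.
Qed.

Lemma Cn_cst k c : Cn k (fun _ => c).
elim: k c=>[|k IH] c;first by split=>//;exact: C0_cst.
by apply: (@Cn_intro _ _ (fun _ _ => 0))=>//;exact: C0_cst.
Qed.

Lemma CnD k f g : Cn k f -> Cn k g -> Cn k (fun x => f x + g x).
elim: k f g=>[|k IH] f g fk gk.
 by split=>//;apply: C0D;[exact: Cn_C0 fk|exact: Cn_C0 gk].
apply: (@Cn_intro _ _ (fun i x => pd i f x + pd i g x)).
- by apply: C0D;[exact: Cn_C0 fk|exact: Cn_C0 gk].
- move=>x i Ux;have := Cn_derive i fk Ux;have := Cn_derive i gk Ux => ? ?.
 exact: is_deriveD.
- by move=>i;apply: IH;exact: Cn_pd.
Qed.

Lemma CnM k f g : Cn k f -> Cn k g -> Cn k (fun x => f x * g x).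
elim: k f g=>[|k IH] f g fk gk.
 by split=>//;apply: C0M;[exact: Cn_C0 fk|exact: Cn_C0 gk].
apply: (@Cn_intro _ _ (fun i x => f x * pd i g x + g x * pd i f x)).
- by apply: C0M;[exact: Cn_C0 fk|exact: Cn_C0 gk].
- move=>x i Ux;have := Cn_derive i fk Ux;have := Cn_derive i gk Ux => ? ?.
 exact: is_deriveM.
- by move=>i;apply: CnD;apply: IH;try exact: CnW;exact: Cn_pd.
Qed.

Lemma CnZ k c f : Cn k f -> Cn k (fun x => c * f x).
by move=>fk;apply: CnM=>//;exact: Cn_cst. Qed.

Lemma CnN k f : Cn k f -> Cn k (fun x => - f x).
by move/(CnZ (-1));apply: Cn_eq => x;rewrite mulN1r. Qed.

Lemma CnB k f g : Cn k f -> Cn k g -> Cn k (fun x => f x - g x).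
by move=>fk gk;apply: CnD=>//;exact: CnN. Qed.

Lemma Cn_sum k (I : Type) (r : seq I) (P : pred I) (f : I -> V -> R) :
 (forall i, P i -> Cn k (f i)) -> Cn k (fun x => \sum_(i <- r | P i) f i x).
move=>fk;elim: r=>[|i r IH].
 by apply: Cn_eq (Cn_cst k 0) => x;rewrite big_nil.
have [Pi|Pi]:=boolP (P i).
 by apply: Cn_eq (CnD (fk i Pi) IH) => x;rewrite big_cons Pi.
by apply: Cn_eq IH => x;rewrite big_cons (negbTE Pi).
Qed.

Lemma Cn_prod k (I : Type) (r : seq I) (P : pred I) (f : I -> V -> R) :
 (forall i, P i -> Cn k (f i)) -> Cn k (fun x => \prod_(i <- r | P i) f i x).
move=>fk;elim: r=>[|i r IH].
 by apply: Cn_eq (Cn_cst k 1) => x;rewrite big_nil.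
have [Pi|Pi]:=boolP (P i).
 by apply: Cn_eq (CnM (fk i Pi) IH) => x;rewrite big_cons Pi.
by apply: Cn_eq IH => x;rewrite big_cons (negbTE Pi).
Qed.

Lemma C0V f (c : R) : 0 < c -> C0 f -> (forall x, U x -> f x != 0) ->
 (b -> forall x, U x -> c <= `|f x|) -> C0 (fun x => (f x)^-1).
move=>c0 [fc _] fn0 fc0;split=>[x Ux|b1].
 by apply: continuousV;[exact: fn0|exact: fc].
exists c^-1 => x Ux;rewrite normfV lef_pV2 ?posrE ?fc0 // normr_gt0.
exact: fn0.
Qed.

(** The lower bound [c] is asked of |f| only when bounds are tracked. The derivative -(1/f)(1/f) f'
    is again a product of functions covered by the induction. *)
Lemma CnV k f (c : R) : 0 < c -> Cn k f -> (forall x, U x -> f x != 0) ->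
 (b -> forall x, U x -> c <= `|f x|) -> Cn k (fun x => (f x)^-1).
move=>c0 fk fn0 fc0;elim: k fk=>[|k IH] fk.
 by split=>//;apply: C0V c0 (Cn_C0 fk) _ _.
apply: (@Cn_intro _ _ (fun i x => - ((f x)^-1 * (f x)^-1 * pd i f x))).
- by apply: C0V c0 (Cn_C0 fk) _ _.
- move=>x i Ux;have := Cn_derive i fk Ux => fd.
 split;first by apply: derivableV;[exact: fn0|].
 rewrite deriveV;[|exact: fn0|by []].
 by rewrite invfM /GRing.scale /= mulNr.
- move=>i;apply/CnN/CnM;last exact: Cn_pd.
 by have H:=IH (CnW fk);exact: CnM.
Qed.

Lemma Cn_coord k i : (b -> bound_on (fun x => x ord0 i)) -> Cn k (fun x => x ord0 i).
move=>bU;have H0: C0 (fun x => x ord0 i).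
 by split=>// x _;exact: coord_cont.
case: k=>[|k];first by split.
apply: (@Cn_intro _ _ (fun j _ => (j == i)%:R))=>//;last first.
 by move=>j;exact: Cn_cst.
move=>x j _;apply: is_derive_of_line=>/=.
have -> : (fun s : R => (s *: ebasis R j + x) ord0 i) =
  (fun s : R => (j == i)%:R * s + x ord0 i).
 apply/funext => s;rewrite !mxE mulrC eq_sym;congr (_ * s + _).
 by case: eqP.
have := @is_deriveD _ _ _ (fun s : R => (j == i)%:R * s) (cst (x ord0 i)) 0 1 ((j == i)%:R) 0.
rewrite addr0;apply.
have := @is_deriveZ _ _ _ (id : R -> R) ((j == i)%:R : R) (0 : R) (1 : R) (1 : R)
 (is_derive_id _ _).
by rewrite /GRing.scale /= mulr1.
Qed.

End OneDomain.

Lemma Cn_sub m k (U W : set 'rV[R]_m) f : W `<=` U -> Cn U k f -> Cn W k f.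
move=>WU;elim: k f=>[|k IH] f [[fc fb] fk].
 split=>//;split=>[x /WU|b1];first exact: fc.
 by have [M HM]:=fb b1;exists M => x /WU;exact: HM.
case: fk => fd fk;split.
 split=>[x /WU|b1];first exact: fc.
 by have [M HM]:=fb b1;exists M => x /WU;exact: HM.
by split=>[x /WU|i];[exact: fd|exact: (IH _ (fk i))].
Qed.

Definition smooth1 (s : R -> R) := forall k x, derivable (s^`(k)%classic) x 1.

Lemma smooth1_cont s k : smooth1 s -> continuous (s^`(k)%classic).
by move=>ss x;apply/differentiable_continuous/derivable1_diffP. Qed.

(** When [f] is bounded its values lie in a compact interval, where [s] has a maximum. *)
Lemma C0_comp1 m (U : set 'rV[R]_m) (s : R -> R) f : continuous s ->
 C0 U f -> C0 U (fun x => s (f x)).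
move=>sc [fc fb];split=>[x Ux|b1].
 by apply: (@continuous_comp _ _ _ f s);[exact: fc|exact: sc].
have [M HM]:=fb b1;have [M0|M0]:=leP 0 M;last first.
 exists 0 => x /HM;rewrite leNgt (lt_le_trans M0) //.
have MM: - M <= M by lra.
have sc': {within `[- M, M], continuous (fun t => `|s t|)}.
 by apply: continuous_subspaceT => t;apply: (@continuous_comp _ _ _ s Num.norm);
  [exact: sc|exact: norm_continuous].
have [t _ tM]:=EVT_max MM sc';exists `|s t| => x /HM.
by rewrite ler_norml => xM;apply: tM.
Qed.

Lemma Cn_comp1 m (U : set 'rV[R]_m) k (s : R -> R) f : open U -> smooth1 s ->
 Cn U k f -> Cn U k (fun x => s (f x)).
move=>oU ss;suff H j : Cn U k f -> Cn U k (fun x => s^`(j)%classic (f x)) by exact: (H 0%N).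
elim: k j=>[|k IH] j fk.
 by split=>//;apply: C0_comp1 (Cn_C0 fk);exact: smooth1_cont.
apply: (@Cn_intro _ U oU _ _ (fun i (x : 'rV[R]_m) => (s^`(j.+1)%classic (f x) : R) * pd i f x)).
- by apply: C0_comp1 (Cn_C0 fk);exact: smooth1_cont.
- move=>x i Ux;apply: is_derive_comp1;last exact: Cn_derive fk Ux.
 by rewrite derive1nS derive1E.
- by move=>i;apply: CnM=>//;[exact/IH/CnW|exact: Cn_pd].
Qed.

Lemma C1_chain m p (U : set 'rV[R]_m) (W : set 'rV[R]_p) (h : 'rV[R]_p -> R)
  (F : 'rV[R]_m -> 'rV[R]_p) k x i : open U -> open W -> Cn W k.+1 h ->
 (forall l, derivable (fun y => F y ord0 l) x (ebasis R i)) -> W (F x) ->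
 is_derive x (ebasis R i) (fun y => h (F y))
  (\sum_l pd l h (F x) * pd i (fun y => F y ord0 l) x).
move=>oU oW hk Fd WF.
have := @chain_rule m p h F x (ebasis R i).
under eq_bigr do rewrite mulrC;apply.
- have := near_in oW WF;apply: filterS => y Wy l;exact: Cn_derivable hk Wy.
- by move=>l;have [+ _]:=Cn_C0 (Cn_pd l hk);apply.
- exact: Fd.
Qed.

(** With [b = true] this is what makes bounded derivatives a workable substitute for smoothness up
    to the boundary: the composite is estimated from the chain rule inside the open sets alone. *)
Lemma Cn_comp m p (U : set 'rV[R]_m) (W : set 'rV[R]_p) k (h : 'rV[R]_p -> R)
  (F : 'rV[R]_m -> 'rV[R]_p) : open U -> open W ->
 (forall x, U x -> W (F x)) -> Cn W k h ->
 (forall l, Cn U k (fun x => F x ord0 l)) -> Cn U k (fun x => h (F x)).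
move=>oU oW UW;elim: k h=>[|k IH] h hk Fk.
all: have H0: C0 U (fun x => h (F x)).
1,3: have [hc hb]:=Cn_C0 hk;split=>[x Ux|b1];last first.
1,3: by have [M HM]:=hb b1;exists M => x /UW;exact: HM.
1,2: apply: (@continuous_comp _ _ _ F h);last exact/hc/UW.
1,2: by apply: rV_continuous => l;have [+ _]:=Cn_C0 (Fk l);apply.
 by split.
apply: (@Cn_intro _ U oU _ _ (fun i x => \sum_l pd l h (F x) * pd i (fun y => F y ord0 l) x))=>//.
- move=>x i Ux;apply: (C1_chain oU oW hk);last exact: UW.
 by move=>l;exact: Cn_derivable.
- move=>i;apply: Cn_sum=>// l _;apply: CnM=>//;last exact: Cn_pd.
 by apply: IH;[exact: Cn_pd|move=>j;exact/CnW/Fk].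
Qed.

End SmoothClasses.

Section SmoothOn.
Variables (m : nat) (U : set 'rV[R]_m).
Implicit Types f : 'rV[R]_m -> R.

Lemma Csm_Cn b f : Csm b U f -> Csm false U f.
move=>fs k;elim: k f fs=>[|k IH] f fs.
 by have [[fc _] _]:=fs 0%N.
have [[fc _] [fd _]]:=fs 1%N;split;first by split.
by split=>// i;apply: IH;exact: Csm_pd.
Qed.

Lemma smooth_onP f : smooth_on U f <-> Csm false U f.
split=>[fs|fs ds].
 suff H ds k : Cn false U k (pds ds f) by move=>k;exact: (H [::]).
 elim: k ds=>[|k IH] ds;have [fd fc]:=fs ds;split=>//.
 by split=>// i;exact: (IH (i :: ds)).
have [[fc _] [fd _]]:=Csm_pds ds fs 1%N.
by split.
Qed.

Lemma bounded_pdsP f : Csm true U f <->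
 (smooth_on U f /\ forall ds, bound_on U (pds ds f)).
split=>[fs|[fs fb]].
 split=>[|ds];first by apply/smooth_onP;exact: Csm_Cn.
 by have [[_ +] _]:=Csm_pds ds fs 0%N;apply.
suff H ds k : Cn true U k (pds ds f) by move=>k;exact: (H [::]).
elim: k ds=>[|k IH] ds;have [fd fc]:=fs ds;split;try by split.
by split=>// i;exact: (IH (i :: ds)).
Qed.

End SmoothOn.

Hint Extern 0 (open setT) => exact: openT : core.

(** * Measurability on row vectors and the iterated integral as a measure *)

Section MeasurableRow.
Variable m : nat.

(** The sigma-algebra on row vectors is the one generated by these maps, so that a map into row
    vectors, [setc] in particular, is measurable as soon as its coordinates are. *)
Definition mcoor (i : 'I_m) (x : 'rV[R]_m) : R := x ord0 i.

Let row_set0 : g_sigma_preimage mcoor set0.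
exact: sigma_algebra0. Qed.

Let row_setC A : g_sigma_preimage mcoor A -> g_sigma_preimage mcoor (~` A).
exact: sigma_algebraC. Qed.

Let row_bigcup (F : _^nat) : (forall i, g_sigma_preimage mcoor (F i)) ->
 g_sigma_preimage mcoor (\bigcup_i (F i)).
exact: sigma_algebra_bigcup. Qed.

HB.instance Definition _ := @isMeasurable.Build default_measure_display
 'rV[R]_m (g_sigma_preimage mcoor) row_set0 row_setC row_bigcup.

Lemma measurable_mcoor i : measurable_fun [set: 'rV[R]_m] (mcoor i).
move=>_ Y mY;rewrite setTI;apply: sub_sigma_algebra=>/=.
rewrite -bigcup_seq/=;exists i=>/=;first by rewrite mem_index_enum.
by exists Y=>//;rewrite setTI.
Qed.

Lemma measurable_rV d (T : measurableType d) (f : T -> 'rV[R]_m) :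
 (forall i, measurable_fun [set: T] (fun x => f x ord0 i)) ->
 measurable_fun [set: T] f.
move=>mf;have H: g_sigma_preimage (fun i => mcoor i \o f) `<=` measurable.
 apply: smallest_sub;first exact: sigma_algebra_measurable.
 rewrite -bigcup_seq;apply: bigcup_sub => i _ A [B mB <-];exact: mf.
by rewrite g_sigma_preimage_comp in H => _ A mA;apply: H;exists A.
Qed.

(** The sigma-algebra is generated by coordinates and not by open sets; an open set is recovered as
    the countable union of the boxes with rational centre and radius 1/(k+1) that it contains. *)
Lemma measurable_boxes (A : set 'rV[R]_m) : open A -> measurable A.
move=>oA.
pose box (q : 'rV[rat]_m * nat) : set 'rV[R]_m :=
 [set x | forall i, `|x ord0 i - ratr (q.1 ord0 i)| < q.2.+1%:R^-1].
have mbox q: measurable (box q).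
 have -> : box q = \big[setI/setT]_(i < m)
   (mcoor i @^-1` [set t : R | `|t - ratr (q.1 ord0 i)| < q.2.+1%:R^-1]).
  apply/seteqP;split=>x.
   by move=>qx;rewrite -bigcap_seq => i _;exact: qx.
  by rewrite -bigcap_seq => qx i;apply: (qx i);rewrite /= mem_index_enum.
 apply: bigsetI_measurable => i _;rewrite -[X in measurable X]setTI.
 apply: measurable_mcoor=>//;apply: open_measurable.
 have -> : [set t : R | `|t - ratr (q.1 ord0 i)| < q.2.+1%:R^-1] =
   ball (ratr (q.1 ord0 i) : R) q.2.+1%:R^-1.
  by apply/seteqP;split=>t;rewrite /= distrC.
 exact: ball_open.
have -> : A = \bigcup_(q in [set q | box q `<=` A]) box q.
 apply/seteqP;split=>[x Ax|x [q]];last exact.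
 have /nbhs_ballP[e /= e0 xe] : nbhs x A by exact: open_nbhs_nbhs.
 have [k ke] : exists k : nat, k.+1%:R^-1 < e / 2.
  have e20: 0 < e / 2 by rewrite divr_gt0.
  exists (Num.truncn (e / 2)^-1);rewrite invf_plt ?posrE //.
  exact: truncnS_gt.
 have H i: exists q : rat, `|x ord0 i - ratr q| < k.+1%:R^-1.
  have [|q]:=@rat_in_itvoo R (x ord0 i - k.+1%:R^-1) (x ord0 i + k.+1%:R^-1).
   by rewrite ltrD2l gtrN.
  rewrite in_itv /= =>/andP[q1 q2];exists q.
  by move: q1 q2;set d := _^-1;rewrite ltr_norml => q2;lra.
 pose q:=(\row_i sval (cid (H i)), k).
 have qx: box q x.
  by move=>i;rewrite mxE;exact: (svalP (cid (H i))).
 exists q=>//= y qy;apply: xe;rewrite -ball_normE /=.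
 apply: le_lt_trans (_ : k.+1%:R^-1 + k.+1%:R^-1 < e);last by move: ke;set d := _^-1;lra.
 apply/rV_norm_le;first by rewrite addr_ge0.
 move=>i;rewrite !mxE;have := qx i;have := qy i.
 rewrite /= mxE=>/ltW y1 /ltW x1.
 have -> : x ord0 i - y ord0 i = (x ord0 i - ratr (sval (cid (H i)))) -
  (y ord0 i - ratr (sval (cid (H i)))) by ring.
 by apply: le_trans (ler_normB _ _) _;exact: lerD.
rewrite bigcup_mkcond;apply: countable_bigcupT_measurable.
 exact: countableP.
by move=>q;case: ifPn.
Qed.

Lemma cont_measurable (U : set 'rV[R]_m) (f : 'rV[R]_m -> R) : open U ->
 cont_on U f -> measurable_fun U f.
move=>oU fc;apply: (measurability _ (RGenOpens.measurableE R)).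
move=>_ [_ [a [b ->] <-]];apply: measurable_boxes.
rewrite openE => x [Ux fx];apply: filterI;first exact: near_in.
apply: (fc x Ux);apply: open_nbhs_nbhs;split=>//.
Qed.

Lemma indicM_measurable (U : set 'rV[R]_m) (f : 'rV[R]_m -> R) : open U ->
 cont_on U f -> measurable_fun setT (fun x => Defs.indic U x * f x).
move=>oU fc;have -> : (fun x => Defs.indic U x * f x) = f \_ U.
 apply/funext => x;rewrite /Defs.indic patchE.
 by case: asboolP => Ux;[rewrite mem_set // mul1r|rewrite memNset // mul0r].
apply/(measurable_restrict _ (measurable_boxes oU))=>//;rewrite setTI.
exact: cont_measurable.
Qed.

End MeasurableRow.

Section RowMeasure.
Import HBNNSimple.
Variable m : nat.
Local Notation V := 'rV[R]_m.
Local Notation leb := (@lebesgue_measure R).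
Local Open Scope ereal_scope.
Implicit Types F : V -> \bar R.

Definition nnm F := measurable_fun [set: V] F /\ forall x, 0 <= F x.

Definition cint (k : nat) F : V -> \bar R :=
 fun x => \int[leb]_(t in [set: R]) F (setc x k t).

Lemma iintS k F : iint k.+1 F = cint k (iint k F). Proof. by []. Qed.

Lemma setc_measurable k :
 measurable_fun [set: V * measurableTypeR R] (fun z : V * measurableTypeR R => setc z.1 k z.2).
apply: measurable_rV => i;rewrite /setc.
have [ik|ik]:=boolP ((i : nat) == k).
 have -> : (fun z : V * measurableTypeR R => (\row_j (if (j : nat) == k then z.2 else z.1 ord0 j) : V) ord0 i) = snd.
  by apply/funext => z;rewrite mxE ik.
 exact: measurable_snd.
have -> : (fun z : V * measurableTypeR R => (\row_j (if (j : nat) == k then z.2 else z.1 ord0 j) : V) ord0 i) =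
  mcoor i \o fst.
 by apply/funext => z;rewrite mxE (negbTE ik).
apply: measurableT_comp;[exact: measurable_mcoor|exact: measurable_fst].
Qed.

Lemma setc_measurable1 (x : V) k : measurable_fun [set: measurableTypeR R] (setc x k).
apply: measurable_rV => i;rewrite /setc.
have [ik|ik]:=boolP ((i : nat) == k).
 have -> : (fun z : measurableTypeR R => (\row_j (if (j : nat) == k then z else x ord0 j) : V) ord0 i) = id.
  by apply/funext => z;rewrite mxE ik.
 exact: measurable_id.
have -> : (fun z : measurableTypeR R => (\row_j (if (j : nat) == k then z else x ord0 j) : V) ord0 i) =
  cst (x ord0 i).
 by apply/funext => z;rewrite mxE (negbTE ik).
exact: measurable_cst.
Qed.

Lemma nnm_setc F x k : nnm F ->
 measurable_fun [set: measurableTypeR R] (fun t => F (setc x k t)).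
by move=>[mF _];apply: measurableT_comp mF _;exact: setc_measurable1. Qed.

Lemma nnm_cint k F : nnm F -> nnm (cint k F).
move=>[mF F0];split;last by move=>x;exact: integral_ge0.
apply: (@measurable_fun_fubini_tonelli_F _ _ _ _ R leb (fun z : V * measurableTypeR R => F (setc z.1 k z.2)))=>//.
by apply: measurableT_comp mF _;exact: setc_measurable.
Qed.

Lemma nnm_iint k F : nnm F -> nnm (iint k F).
by elim: k=>// k IH Fn;exact/nnm_cint/IH. Qed.

Lemma setcC (x : V) j k s t : j != k -> setc (setc x j s) k t = setc (setc x k t) j s.
move=>jk;apply/rowP => i;rewrite !mxE;case: eqP=>// ->.
by rewrite eq_sym (negbTE jk).
Qed.

Lemma cintC j k F : nnm F -> j != k -> cint j (cint k F) = cint k (cint j F).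
move=>[mF F0] jk;apply/funext => x;rewrite /cint.
pose G:=fun z : measurableTypeR R * measurableTypeR R => F (setc (setc x j z.1) k z.2).
have G0 z: 0 <= G z by exact: F0.
have mp: measurable_fun setT (fun z : measurableTypeR R * measurableTypeR R => (setc x j z.1, z.2)).
 apply/measurable_fun_pairP;split;last exact: measurable_snd.
 exact: (measurableT_comp (setc_measurable1 x j) measurable_fst).
have mG: measurable_fun setT G.
 exact: (measurableT_comp mF (measurableT_comp (setc_measurable k) mp)).
transitivity (\int[leb]_t \int[leb]_s G (s, t)).
 have := @fubini_tonelli _ _ _ _ R leb leb G mG G0;rewrite /G /= =>->.
 by [].
apply: eq_integral => t _;apply: eq_integral => s _.
by rewrite /G setcC.
Qed.

Lemma iint_cint j k F : nnm F -> (k <= j)%N -> iint k (cint j F) = cint j (iint k F).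
move=>Fn;elim: k=>// k IH kj;rewrite !iintS IH;last exact: ltnW.
by rewrite cintC //;[exact: nnm_iint|rewrite neq_ltn kj].
Qed.

(** By Tonelli the integration in coordinate [j] can be moved to the innermost place, so an identity
    of one-dimensional integrals along any single axis propagates to the iterated integral. *)
Lemma iint_eq_inner j k F F' : nnm F -> nnm F' -> (j < k)%N ->
 cint j F = cint j F' -> iint k F = iint k F'.
move=>Fn Fn' jk E;elim: k jk=>// k IH;rewrite ltnS leq_eqVlt=>/orP[/eqP jk|jk].
 by rewrite !iintS -jk -!iint_cint // E.
by rewrite !iintS IH.
Qed.

Lemma iint_nneseries k (F : nat -> V -> \bar R) : (forall n, nnm (F n)) ->
 iint k (fun x => \sum_(n <oo) F n x) = (fun x => \sum_(n <oo) iint k (F n) x).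
move=>Fn;elim: k=>// k IH;rewrite iintS IH;apply/funext => x.
rewrite /cint integral_nneseries // => n;first by apply: nnm_setc;exact: nnm_iint.
by move=>t;have [_]:=nnm_iint k (Fn n).
Qed.

Lemma iint_fsum k (I : choiceType) (A : set I) (F : I -> V -> \bar R) : finite_set A ->
 (forall n, nnm (F n)) ->
 iint k (fun x => \sum_(n \in A) F n x) = (fun x => \sum_(n \in A) iint k (F n) x).
move=>fA Fn;elim: k=>// k IH;rewrite iintS IH;apply/funext => x.
rewrite /cint ge0_integral_fsum // => n;first by apply: nnm_setc;exact: nnm_iint.
by move=>t;have [_]:=nnm_iint k (Fn n).
Qed.

Lemma iintZ k (c : R) F : (0 <= c)%R -> nnm F ->
 iint k (fun x => c%:E * F x) = (fun x => c%:E * iint k F x).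
move=>c0 Fn;elim: k=>// k IH;rewrite iintS IH;apply/funext => x.
rewrite /cint ge0_integralZl_EFin //;last by apply: nnm_setc;exact: nnm_iint.
by move=>t;have [_]:=nnm_iint k Fn.
Qed.

Lemma iint_lim k (F : nat -> V -> \bar R) : (forall n, nnm (F n)) ->
 (forall x a b, (a <= b)%N -> F a x <= F b x) ->
 (forall x a b, (a <= b)%N -> iint k (F a) x <= iint k (F b) x) /\
 iint k (fun x => limn (F ^~ x)) = (fun x => limn (fun n => iint k (F n) x)).
move=>Fn Fnd;elim: k=>// k [IHm IH];split=>[x a b ab|].
 rewrite !iintS;apply: ge0_le_integral=>//.
 - by move=>t;have [_]:=nnm_iint k (Fn a).
 - by apply: nnm_setc;exact: nnm_iint.
 - by apply: nnm_setc;exact: nnm_iint.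
 - by move=>t _;exact: IHm.
rewrite iintS IH;apply/funext => x;rewrite /cint monotone_convergence //.
- by move=>n;by apply: nnm_setc;exact: nnm_iint.
- by move=>n;have [_]:=nnm_iint k (Fn n).
- by move=>a b;exact: IHm.
Qed.

(** Making the iterated integral a measure gives access to dominated and monotone convergence and to
    Tonelli on products. *)
Definition rvol (A : set V) : \bar R := iint m (fun x => (\1_A x)%:E) 0%R.

Lemma nnm_indic (A : set V) : measurable A -> nnm (fun x => (\1_A x)%:E).
move=>mA;split;last by move=>x.
by apply/measurable_EFinP.
Qed.

Lemma iint0 k : iint k (fun _ : V => 0) = (fun _ => 0).
by elim: k=>// k IH;rewrite iintS IH;rewrite /cint integral0.
Qed.

Let rvol0 : rvol set0 = 0.
rewrite /rvol (_ : (fun x : V => _) = (fun _ => 0)) ?iint0 //.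
by apply/funext => x;rewrite indic0.
Qed.

Let rvol_ge0 A : 0 <= rvol A.
rewrite /rvol;set F := fun x => _.
suff H k x : 0 <= iint k F x by exact: H.
elim: k x=>[|k IH] x;first by rewrite lee_fin.
by rewrite iintS;apply: integral_ge0 => t.
Qed.

Let rvol_sigma : semi_sigma_additive rvol.
move=>F mF tF mUF.
have -> : rvol (\bigcup_n F n) = \sum_(n <oo) rvol (F n).
 rewrite /rvol (_ : (fun x => (\1_(\bigcup_n F n) x)%:E) =
  (fun x => \sum_(n <oo) (\1_(F n) x)%:E)).
  by rewrite iint_nneseries // => n;exact: nnm_indic.
 by apply/funext => x;exact: indic_bigcup.
by apply: is_cvg_nneseries => n.
Qed.

HB.instance Definition _ := isMeasure.Build _ _ _ rvol rvol0 rvol_ge0 rvol_sigma.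

(** Both sides agree on indicators by the definition of [rvol], hence on simple functions, and both
    commute with increasing limits. *)
Lemma iint_integral F : nnm F -> int_nonneg F = \int[rvol]_x F x.
move=>Fn;have [mF F0]:=Fn.
pose f_:=nnsfun_approx measurableT mF.
have fn n: nnm (fun x => (f_ n x)%:E).
 by split;[exact/measurable_EFinP/measurable_funPT|move=>x;rewrite lee_fin].
have fnd x a b: (a <= b)%N -> (f_ a x)%:E <= (f_ b x)%:E.
 by move=>ab;rewrite lee_fin;exact/lefP/nd_nnsfun_approx.
have FE: F = (fun x => limn (fun n => (f_ n x)%:E)).
 apply/funext => x;apply/esym/cvg_lim=>//.
 by apply: cvg_nnsfun_approx.
have [_ H]:=iint_lim m fn fnd.
rewrite {1}FE /int_nonneg H [in RHS]FE monotone_convergence //;last first.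
- by move=>a b;exact: fnd.
- by move=>n x;rewrite lee_fin.
- by move=>n;have []:=fn n.
congr (limn _);apply/funext => n.
have fE: (fun x => (f_ n x)%:E) = (fun x => \sum_(k \in range (f_ n))
  (k%:E * (\1_(f_ n @^-1` [set k]) x)%:E)).
 by apply/funext => x;rewrite fimfunE -fsumEFin.
have mk k: measurable (f_ n @^-1` [set k]) by [].
have iZ k: iint m (fun x => k%:E * (\1_(f_ n @^-1` [set k]) x)%:E) =
  (fun x => k%:E * iint m (fun x => (\1_(f_ n @^-1` [set k]) x)%:E) x).
 have [k0|k0]:=leP 0%R k;first by rewrite iintZ //;exact: nnm_indic.
 have E: f_ n @^-1` [set k] = set0.
  apply/seteqP;split=>x //= fk;move: k0;rewrite -fk ltNge.
  by have -> : (0 <= f_ n x)%R by [].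
 rewrite E (_ : (fun x : V => _) = (fun _ => 0));last first.
  by apply/funext => x;rewrite indic0 mule0.
 rewrite (_ : (fun x : V => (\1_set0 x)%:E) = (fun _ => 0)) ?iint0.
  by apply/funext => x;rewrite mule0.
 by apply/funext => x;rewrite indic0.
rewrite [in LHS]fE iint_fsum //;last first.
 move=>k;split;last by move=>x;exact: nnfun_muleindic_ge0.
 apply/measurable_EFinP;apply: measurable_funM=>//.
rewrite integral_nnsfun // sintegralE.
have -> : (f_ n : V -> R) \_ setT = f_ n.
 by apply/funext => x;rewrite patchE in_setT.
apply: eq_fsbigr => k;by rewrite iZ.
Qed.

Lemma int_Rm_integral (F : V -> R) : measurable_fun [set: V] F ->
 int_Rm F = \int[rvol]_x (F x)%:E.
move=>mF;rewrite /int_Rm !iint_integral.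
- rewrite [RHS]integralE.
 have -> : (fun x => (Num.max (F x) 0)%:E) = (fun x => (F x)%:E)^\+.
  by apply/funext => x;rewrite funeposE EFin_max.
 have -> // : (fun x => (Num.max (- F x) 0)%:E) = (fun x => (F x)%:E)^\-.
 by apply/funext => x;rewrite funenegE EFin_max.
- split;last by move=>x;rewrite lee_fin le_max lexx orbT.
 by apply/measurable_EFinP;apply: measurable_maxr=>//;exact: measurableT_comp.
- split;last by move=>x;rewrite lee_fin le_max lexx orbT.
 by apply/measurable_EFinP;apply: measurable_maxr.
Qed.

Lemma rvol_box (M : R) : (0 <= M)%R ->
 rvol [set x : V | forall i, (`|x ord0 i| <= M)%R] = ((2 * M) ^+ m)%:E.
move=>M0;set A := [set x | _].
(* The coordinates below [k] have been integrated out and are no longer constrained. *)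
pose B k : set V := [set x | forall i : 'I_m, (k <= i)%N -> (`|x ord0 i| <= M)%R].
have H k: (k <= m)%N -> forall x, iint k (fun x => (\1_A x)%:E) x =
 ((2 * M) ^+ k)%:E * (\1_(B k) x)%:E.
 elim: k=>[|k IH] km x.
  by rewrite mul1e;congr (\1_ _ _)%:E;apply/seteqP;split=>[y Hy i _|y Hy i];exact: Hy.
 rewrite iintS /cint.
 rewrite (_ : (fun t => _) = fun t => ((2 * M) ^+ k)%:E * ((\1_(B k.+1) x)%:E *
  (\1_(`[- M, M]%classic) t)%:E));last first.
  apply/funext => t;rewrite IH;last exact: ltnW.
  congr (_ * _);congr EFin;rewrite !indicE -natrM mulnb.
  congr (nat_of_bool _)%:R;apply/idP/andP=>[|[]];rewrite !inE /= => H.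
   split;last first.
    have := H (Ordinal km) (leqnn _);rewrite mxE eqxx => tM.
    by rewrite in_itv -ler_norml.
   move=>i ki;have := H i (ltnW ki).
   by rewrite mxE;case: eqP ki=>// ->;rewrite ltnn.
  rewrite in_itv -ler_norml => tM i;rewrite leq_eqVlt=>/orP[/eqP ki|ki].
   by rewrite mxE -ki eqxx.
  by rewrite mxE;case: eqP ki=>[->|_ /H].
 have mI: measurable_fun setT (fun t : R => (\1_(`[- M, M]%classic) t)%:E : \bar R).
  by apply/measurable_EFinP.
 rewrite ge0_integralZl_EFin ?exprn_ge0 ?mulr_ge0 //;last exact: emeasurable_funM.
 rewrite ge0_integralZl_EFin //.
 have LM: leb [set` (`[(- M)%R, M]%R)] = (2 * M)%:E.
  rewrite lebesgue_measure_itv lte_fin;case: ltP => MM;congr EFin;first by ring.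
  by apply/eqP;lra.
 have -> : \int[leb]_t (\1_(`[- M, M]%classic) t)%:E = (2 * M)%:E.
  by apply: etrans (integral_indic _ _ _) _=>//;rewrite setIT.
 by rewrite exprSr;congr EFin;ring.
have := H m (leqnn m) 0%R;rewrite /rvol=>->.
rewrite (_ : B m = setT) ?indicT ?mule1 //.
apply/seteqP;split=>// x _ i;by rewrite leqNgt ltn_ord.
Qed.

Lemma measurable_cube (M : R) :
 measurable [set x : V | forall i, (`|x ord0 i| <= M)%R].
rewrite -[X in measurable X]setCK;apply: measurableC;apply: measurable_boxes.
apply: closed_openC;rewrite (_ : [set x : V | _] =
 \bigcap_(i in [set: 'I_m]) [set x : V | (`|x ord0 i| <= M)%R]);last first.
 by apply/seteqP;split=>[x Hx i _|x Hx i];[exact: Hx|exact: (Hx i I)].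
apply: closed_bigI => i _;apply: (@closed_comp _ _ (fun x : V => `|x ord0 i|%R) [set t : R | (t <= M)%R])=>//.
 move=>x _;apply: (@continuous_comp _ _ _ (fun x : V => x ord0 i) Num.norm).
  exact: coord_cont.
 exact: norm_continuous.
Qed.

Let rvol_sfin : sigma_finite setT rvol.
exists (fun n=>[set x : V | forall i, (`|x ord0 i| <= n%:R)%R]);last first.
 by move=>n;split;[exact: measurable_cube|rewrite rvol_box ?ltry].
apply/esym/seteqP;split=>// x _;exists (Num.truncn `|x|).+1=>//= i.
by apply: le_trans (coord_le _ _) _;apply: ltW;exact: truncnS_gt.
Qed.

HB.instance Definition _ := @Measure_isSigmaFinite.Build _ _ _ rvol rvol_sfin.

End RowMeasure.

(** * The flat function exp(-1/t) and smooth steps *)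

Section Flat.
Implicit Types (p : {poly R}) (t s : R).

(** Polynomials in 1/t in front of exp(-1/t) make the family closed under differentiation, so that
    smoothness of all orders follows from a single derivative. *)
Definition flatp p t : R := if 0 < t then p.[t^-1] * expR (- t^-1) else 0.
Definition flat : R -> R := flatp 1%:P.

Lemma expR_ge_pow n s : 0 <= s -> (s / n.+1%:R) ^+ n.+1 <= expR s.
move=>s0;have -> : s = n.+1%:R * (s / n.+1%:R) by rewrite mulrCA divff ?mulr1.
rewrite expRM_natl;set u := s / _;rewrite mulrCA divff ?mulr1 //.
rewrite lerXn2r ?nnegrE ?divr_ge0 //.
by apply: le_trans (expR_ge1Dx _);rewrite lerDr.
Qed.

Lemma poly_le_pow p : exists C : R, 0 <= C /\
 forall s, 1 <= s -> `|p.[s]| <= C * s ^+ (size p).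
exists (\sum_(i < size p) `|p`_i|);split=>[|s s1];first exact: sumr_ge0.
rewrite horner_coef;apply: le_trans (ler_norm_sum _ _ _) _.
rewrite mulr_suml;apply: ler_sum => i;rewrite normrM ler_wpM2l //.
have s0: 0 <= s by exact: le_trans.
by rewrite ger0_norm ?exprn_ge0 // ler_weXn2l // ltnW.
Qed.

(** The exponential beats the power s^(k+2) of s = 1/t, two more than k = [size p]. The square that
    is left gives derivability at 0, with derivative 0. *)
Lemma flatp_small p : exists C : R, forall t, t <= 1 -> `|flatp p t| <= C * t ^+ 2.
have [C [C0 HC]]:=poly_le_pow p;set d := (size p).+1.
exists (C * d.+1%:R ^+ d.+1) => t t1;rewrite /flatp;case: ifPn => t0;last first.
 by rewrite normr0 mulr_ge0 ?sqr_ge0 // mulr_ge0.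
have s1: 1 <= t^-1 by rewrite invf_ge1.
have s0: 0 < t^-1 by rewrite invr_gt0.
rewrite normrM [`|expR _|]ger0_norm // expRN.
have H: (expR t^-1)^-1 <= (t^-1 / d.+1%:R) ^- d.+1.
 by rewrite lef_pV2 ?posrE ?expR_gt0 ?exprn_gt0 ?divr_gt0 //;apply: expR_ge_pow;exact: ltW.
have E0: 0 <= (expR t^-1)^-1 by rewrite invr_ge0.
apply: le_trans (ler_pM (normr_ge0 _) E0 (HC _ s1) H) _.
rewrite /d;move: (size p) => n;set c : R := n.+2%:R.
have E: t^-1 ^+ n * t^-1 ^- n.+2 = t ^+ 2.
 have tn: t^-1 ^+ n != 0 by rewrite expf_neq0 // gt_eqF.
 by rewrite -[n.+2]addn2 exprD invfM mulrA divff // mul1r -exprVn invrK.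
rewrite expr_div_n invfM invrK.
have -> : C * t^-1 ^+ n * (t^-1 ^- n.+2 * c ^+ n.+2) =
 C * c ^+ n.+2 * (t^-1 ^+ n * t^-1 ^- n.+2) by ring.
by rewrite E.
Qed.

Lemma flatp_derive p t : is_derive t 1 (flatp p) (flatp ((p - p^`()) * 'X^2) t).
have [t0|t0|t0]:=ltgtP t 0.
- apply: (@near_eq_is_derive _ _ _ (cst 0));last first.
  by rewrite /flatp ltNge (ltW t0);exact: is_derive_cst.
 have := lt_nbhsl t0;apply: filterS => s s0;by rewrite /flatp ltNge (ltW s0).
- apply: (@near_eq_is_derive _ _ _ (fun t => p.[t^-1] * expR (- t^-1))).
  have := lt_nbhsr t0;apply: filterS => s s0;by rewrite /flatp s0.
 have tn0: t != 0 by rewrite gt_eqF.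
 have dV: is_derive t 1 (fun t : R => t^-1) (- t^-1 ^+ 2).
  split;first by apply: derivableV.
  by rewrite deriveV // derive_val /GRing.scale /= mulr1 exprVn.
 have dE: is_derive t 1 (fun t : R => expR (- t^-1)) (expR (- t^-1) * t^-1 ^+ 2).
  have dN: is_derive t 1 (fun t : R => - t^-1) (t^-1 ^+ 2).
   by have := @is_deriveN _ _ _ (fun t : R => t^-1) t 1 _ dV;rewrite opprK.
  exact: (@is_derive1_comp _ expR (fun t : R => - t^-1) t _ _ (is_derive_expR _) dN).
 have dp: is_derive t 1 (fun t : R => p.[t^-1]) (p^`().[t^-1] * - t^-1 ^+ 2).
  have dh: is_derive t^-1 1 (horner p) p^`().[t^-1].
   split;first exact: derivable_horner.
   by rewrite -derive1E -derivE.
  exact: (@is_derive1_comp _ (horner p) (fun t : R => t^-1) t _ _ dh dV).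
 have [D1 D2]:=is_deriveM dp dE.
 split;first exact: D1.
 apply: etrans D2 _.
 rewrite /flatp t0 /GRing.scale /= hornerM hornerXn hornerD hornerN.
 by move: (expR _) p^`().[_] => e q;ring.
- rewrite t0 {t0 t};have [C HC]:=flatp_small p.
 have Z q: flatp q 0 = 0 by rewrite /flatp ltxx.
 have H: h^-1 *: (flatp p (h + 0) - flatp p 0) @[h --> 0^'] --> (0 : R).
  apply/cvgrPdist_le => e e0;near=> h.
  have h1: `|h| <= 1 by near: h;apply: dnbhs0_le.
  have hn0: h != 0 by near: h;exact: nbhs_dnbhs_neq.
  rewrite Z addr0 subr0 sub0r normrN /GRing.scale normrM normfV.
  rewrite ler_pdivrMl ?normr_gt0 //.
  apply: le_trans (HC h _) _;first exact: le_trans (ler_norm _) h1.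
  apply: (@le_trans _ _ (`|C| * h ^+ 2));first by rewrite ler_wpM2r ?sqr_ge0 // ler_norm.
  have -> : h ^+ 2 = `|h| * `|h| by rewrite -expr2 real_normK ?num_real.
  rewrite mulrCA ler_wpM2l //.
  have C1: 0 < `|C| + 1 by rewrite ltr_wpDl.
  have : `|h| <= e / (`|C| + 1) by near: h;apply: dnbhs0_le;rewrite divr_gt0.
  rewrite ler_pdivlMr // mulrDr mulr1 mulrC => Hh.
  by apply: le_trans Hh;rewrite lerDl.
 rewrite Z;split.
  apply/cvg_ex;exists (0 : R).
  by under eq_fun do rewrite [_%:A]mulr1.
 apply: cvg_lim=>//.
 by under eq_fun do rewrite [_%:A]mulr1.
Unshelve. all: by end_near. Qed.

Lemma flatp_smooth p : smooth1 (flatp p).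
have E q: (flatp q)^`()%classic = flatp ((q - q^`()) * 'X^2).
 by apply/funext => t;rewrite derive1E;have [_ ->]:=flatp_derive q t.
have H k: exists q, (flatp p)^`(k)%classic = flatp q.
 elim: k=>[|k [q IH]];first by exists p.
 by rewrite derive1nS IH;exists ((q - q^`()) * 'X^2).
move=>k;have [q ->]:=H k;by have := flatp_derive.
Qed.

Lemma flat_smooth : smooth1 flat. Proof. exact: flatp_smooth. Qed.

Lemma flat_gt0 t : 0 < t -> 0 < flat t.
by move=>t0;rewrite /flat /flatp t0 hornerE mul1r expR_gt0. Qed.

Lemma flat_le0 t : t <= 0 -> flat t = 0.
by rewrite /flat /flatp leNgt=>/negbTE ->. Qed.

Lemma flat_ge0 t : 0 <= flat t.
by have [/flat_le0 ->|/flat_gt0/ltW]:=leP t 0. Qed.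

Lemma derive1_flat t : flat^`()%classic t = if 0 < t then t^-1 ^+ 2 * expR (- t^-1) else 0.
rewrite derive1E;have [_ ->]:=flatp_derive 1%:P t.
by rewrite /flatp;rewrite derivC subr0 !hornerE.
Qed.

Lemma derive1_flat_gt0 t : 0 < t -> 0 < flat^`()%classic t.
by move=>t0;rewrite derive1_flat t0 mulr_gt0 ?expR_gt0 ?exprn_gt0 ?invr_gt0. Qed.

Lemma derive1_flat_le0 t : t <= 0 -> flat^`()%classic t = 0.
by rewrite derive1_flat leNgt=>/negbTE ->. Qed.

Lemma is_derive_flat t : is_derive t 1 flat (flat^`()%classic t).
by rewrite derive1E;have := flatp_derive 1%:P. Qed.

Lemma flat_le t s : t <= s -> flat t <= flat s.
have [t0|t0]:=leP t 0;first by move=>_;rewrite (flat_le0 t0) flat_ge0.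
move=>ts;have s0: 0 < s by exact: lt_le_trans ts.
rewrite /flat /flatp t0 s0 !hornerE ler_expR lerN2 lef_pV2 //.
Qed.

Lemma flat_lt t s : 0 < s -> t < s -> flat t < flat s.
move=>s0 ts;have [t0|t0]:=leP t 0;first by rewrite (flat_le0 t0) flat_gt0.
by rewrite /flat /flatp t0 s0 !hornerE ltr_expR ltrN2 ltf_pV2.
Qed.

(** Functions of one real variable inherit the calculus of the classes [Cn] by being read as
    functions of 1 by 1 row vectors. *)
Lemma smooth1_of_rV (s : R -> R) :
 Csm false setT (fun x : 'rV[R]_1 => s (x ord0 ord0)) -> smooth1 s.
have step (f : R -> R) : Csm false setT (fun x : 'rV[R]_1 => f (x ord0 ord0)) ->
  (forall t, derivable f t 1) /\
  Csm false setT (fun x : 'rV[R]_1 => f^`()%classic (x ord0 ord0)).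
 move=>fs.
 have D (x : 'rV[R]_1) : is_derive (x ord0 ord0) 1 f
   (pd ord0 (fun x : 'rV[R]_1 => f (x ord0 ord0)) x).
  have xE: x = x ord0 ord0 *: ebasis R ord0 + 0.
   by apply/rowP => i;rewrite ord1 !mxE mulr1 addr0.
  have := @Cn_derive _ _ _ _ _ x ord0 (fs 1%N) I.
  rewrite {1}xE=>/is_derive_line.
  set u := fun _ : R => _;have -> // : u = f.
  by apply/funext => t;rewrite /u !mxE mulr1 addr0.
 split=>[t|].
  by have := D (const_mx t);rewrite mxE => -[].
 apply: Csm_eq (Csm_pd ord0 fs);first exact: openT.
 by move=>x;rewrite derive1E;have [_ ->]:=D x.
move=>fs k;apply: (proj1 (step (s^`(k)%classic) _)).
by elim: k=>// k IH;have []:=step _ IH.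
Qed.

Definition eta (t : R) : R := flat t / (flat t + flat (1 - t)).

Lemma eta_den t : 0 < flat t + flat (1 - t).
have [t0|t0]:=ltP 0 t;first by rewrite ltr_pwDl ?flat_gt0 ?flat_ge0.
by rewrite ltr_wpDl ?flat_ge0 // flat_gt0 // subr_gt0 (le_lt_trans t0).
Qed.

Lemma eta_smooth : smooth1 eta.
apply: smooth1_of_rV => k;have oT:=@openT 'rV[R]_1.
have c1: Cn false setT k (fun x : 'rV[R]_1 => x ord0 ord0) by exact: Cn_coord.
have f1:=Cn_comp1 oT flat_smooth c1.
have f2: Cn false setT k (fun x : 'rV[R]_1 => flat (1 - x ord0 ord0)).
 by apply: (Cn_comp1 oT flat_smooth);apply: CnB=>//;exact: Cn_cst.
apply: CnM=>//;apply: (@CnV _ _ _ oT _ _ 1)=>//;first exact: CnD.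
by move=>x;rewrite gt_eqF // eta_den.
Qed.

Lemma eta_le0 t : t <= 0 -> eta t = 0.
by move=>t0;rewrite /eta flat_le0 // mul0r. Qed.

Lemma eta_ge1 t : 1 <= t -> eta t = 1.
move=>t1;rewrite /eta [flat (1 - t)]flat_le0 ?subr_le0 // addr0 divff //.
by rewrite gt_eqF // flat_gt0 // (lt_le_trans _ t1).
Qed.

Lemma eta_ge0 t : 0 <= eta t.
by rewrite divr_ge0 ?flat_ge0 // ltW // eta_den. Qed.

Lemma eta_le1 t : eta t <= 1.
by rewrite ler_pdivrMr ?eta_den // mul1r lerDl flat_ge0. Qed.

End Flat.

(** * Compactness, extension by zero, bumps and partitions of unity *)

Section Topology.

Lemma cont_bounded m (K : set 'rV[R]_m) (f : 'rV[R]_m -> R) : compact K ->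
 (forall x, K x -> {for x, continuous f}) -> bound_on K f.
move=>cK fc;have [K0|/set0P K0]:=eqVneq K set0.
 by exists 0 => x;rewrite K0.
have fc': {within K, continuous (fun x => `|f x|)}.
 apply: continuous_in_subspaceT => x;rewrite inE => Kx.
 by apply: (@continuous_comp _ _ _ f Num.norm);[exact: fc|exact: norm_continuous].
have [c _ Hc]:=compact_EVT_max K0 cK fc'.
by exists `|f c| => x Kx;apply: Hc;rewrite inE.
Qed.

Lemma rV_compactP m (K : set 'rV[R]_m) : compact K <-> closed K /\ bounded_set K.
split=>[cK|[cK bK]];last exact: bounded_closed_compact.
by split;[apply: compact_closed=>//;exact: norm_hausdorff|exact: compact_bounded].
Qed.

Lemma bounded_setP m (K : set 'rV[R]_m) :
 bounded_set K <-> exists M, forall x, K x -> `|x| <= M.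
split=>[[M [Mr HM]]|[M HM]].
 exists (`|M| + 1) => x Kx;apply: HM=>//.
 by rewrite (le_lt_trans (ler_norm M)) // ltrDl.
exists M;split;first exact: num_real.
by move=>N MN x Kx;exact: le_trans (HM x Kx) (ltW MN).
Qed.

Lemma closure_bounded m (K : set 'rV[R]_m) : bounded_set K -> bounded_set (closure K).
move/bounded_setP=>[M HM];apply/bounded_setP;exists M => x xK.
rewrite leNgt;apply/negP => Mx.
have xM: 0 < `|x| - M by rewrite subr_gt0.
have [y [Ky]]:=xK _ (nbhsx_ballx x _ xM).
rewrite -ball_normE /= => xy.
have := ler_normD (x - y) y;rewrite subrK.
have := HM y Ky;lra.
Qed.

Lemma closure_compact m (K : set 'rV[R]_m) : bounded_set K -> compact (closure K).
by move=>bK;apply/rV_compactP;split;[exact: closed_closure|exact: closure_bounded].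
Qed.

(** A Lebesgue number argument: a radius [e] valid at [p] serves, once halved, every centre within
    [e / 2] of [p]. The property may itself mention the radius, provided it survives shrinking
    it. *)
Lemma compact_radius m (K : set 'rV[R]_m) (P : 'rV[R]_m -> R -> Prop) : compact K ->
 (forall p d e, e <= d -> P p d -> P p e) ->
 (forall p, K p -> exists2 d : R, 0 < d & forall x, `|x - p| < d -> P x d) ->
 exists2 d : R, 0 < d & forall p x, K p -> `|x - p| < d -> P x d.
move=>cK Pm HP;move/compact_near_coveringP: (cK) => nc.
have H: \forall d \near (0 : R)^'+, K `<=` [set p | forall x, `|x - p| < d -> P x d].
 apply: nc => p Kp;have [e e0 He]:=HP p Kp.
 have e20: 0 < e / 2 by rewrite divr_gt0.
 exists (ball p (e / 2), [set d | d < e / 2])=>/=.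
  split;first exact: nbhsx_ballx.
  by apply: nbhs_right_lt.
 case=>q d [/=];rewrite -ball_normE /= => pq de x xq.
 apply: (Pm _ e);first by lra.
 apply: He;rewrite -(subrKA q);apply: le_lt_trans (ler_normD _ _) _.
 by move: de;rewrite [`|q - p|]distrC;lra.
near (0 : R)^'+ => d;exists d;first by near: d;exact: nbhs_right_gt.
move=>p x Kp;have : K `<=` [set p | forall x, `|x - p| < d -> P x d] by near: d.
by apply.
Unshelve. all: by end_near. Qed.

End Topology.

Lemma rV_norm_lt m (x : 'rV[R]_m) (e : R) : 0 < e ->
 (`|x| < e) <-> (forall i, `|x ord0 i| < e).
move=>e0;split=>[xe i|xe];first exact: le_lt_trans (coord_le _ _) xe.
rewrite [ltLHS]/Num.Def.normr/= mx_normrE bigmax_lt // => -[i j] _ /=.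
by rewrite ord1.
Qed.

Lemma pos_lower_bound (T : eqType) (s : seq T) (f : T -> R) :
 (forall p, p \in s -> 0 < f p) -> exists2 e, 0 < e & forall p, p \in s -> e <= f p.
elim: s=>[|q s IH] fs;first by exists 1.
have [|e e0 He]:=IH;first by move=>p ps;apply: fs;rewrite inE ps orbT.
exists (Num.min (f q) e);first by rewrite lt_min fs ?mem_head.
by move=>p;rewrite inE=>/predU1P[->|/He pe];rewrite ge_min ?lexx // pe orbT.
Qed.

Lemma ball_lt m (p x : 'rV[R]_m) d : ball p d x = (`|x - p| < d) :> Prop.
by rewrite -ball_normE /ball_ /= distrC. Qed.

Lemma open_ball_lt m (p : 'rV[R]_m) d : open [set x | `|x - p| < d].
have -> : [set x | `|x - p| < d] = ball p d by apply/seteqP;split=>x;rewrite ball_lt.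
exact: ball_open.
Qed.

Lemma closure_pick m (U : set 'rV[R]_m) p (d : R) : closure U p -> 0 < d -> exists2 x, U x & `|x - p| < d.
by move=>cp d0;have [x [Ux]]:=cp _ (nbhsx_ballx p d d0);rewrite ball_lt;exists x. Qed.

Lemma closure_intro m (U : set 'rV[R]_m) p : (forall e : R, 0 < e -> exists2 x, U x & `|x - p| <= e) -> closure U p.
move=>H B /nbhs_ballP[d /= d0 Hd];have d2: 0 < d / 2 by rewrite divr_gt0.
have [x Ux xp]:=H _ d2;exists x;split=>//;apply: Hd;rewrite ball_lt.
by apply: le_lt_trans xp _;rewrite gtr_pMr // invf_lt1 // ltr1n.
Qed.

Section CompactSupport.
Variables (m : nat).
Implicit Types (U K : set 'rV[R]_m) (a : 'rV[R]_m -> R).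

Definition zext U a : 'rV[R]_m -> R := fun x => Defs.indic U x * a x.

Lemma zextT U a x : U x -> zext U a x = a x.
by move=>Ux;rewrite /zext /Defs.indic asboolT // mul1r. Qed.

Lemma zextF U a x : ~ U x -> zext U a x = 0.
by move=>Ux;rewrite /zext /Defs.indic asboolF // mul0r. Qed.

Definition supp_in U K a := forall x, U x -> ~ K x -> a x = 0.

Lemma zext_off U K a x : supp_in U K a -> ~ K x -> zext U a x = 0.
by move=>sa Kx;have [Ux|Ux]:=pselect (U x);[rewrite zextT // sa|rewrite zextF].
Qed.

Lemma supp_pd U K a i : open U -> closed K -> supp_in U K a -> supp_in U K (pd i a).
move=>oU cK sa x Ux Kx.
have oW: open (U `&` ~` K) by apply: openI=>//;exact: closed_openC.
rewrite (@pd_eqon _ _ oW a (cst 0)) //;first by rewrite /pd derive_cst.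
by move=>y [Uy Ky];exact: sa.
Qed.

Lemma zext_pd U K a i x : open U -> closed K -> K `<=` U -> supp_in U K a ->
 pd i (zext U a) x = zext U (pd i a) x.
move=>oU cK KU sa;have [Ux|Ux]:=pselect (U x).
 by rewrite zextT //;apply: (pd_eqon oU)=>// y Uy;rewrite zextT.
rewrite zextF //;have Kx: ~ K x by move/KU.
rewrite (@pd_eqon _ _ (closed_openC cK) _ (cst 0)) //;first by rewrite /pd derive_cst.
by move=>y Ky;exact: zext_off Ky.
Qed.

(** Off [K] the extension is locally zero, so differentiating commutes with extending. The bounds of
    the conclusion come from compactness of [K], whatever [b] was. *)
Lemma Cn_zext b U K k a : open U -> compact K -> K `<=` U -> supp_in U K a ->
 Cn b U k a -> Cn true setT k (zext U a).
move=>oU cK KU;have clK: closed K by have []:=(rV_compactP K).1.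
elim: k a=>[|k IH] a sa ak.
all: have H0: C0 true setT (zext U a).
1,3: have [ac _]:=Cn_C0 ak;have ac' x: {for x, continuous (zext U a)}.
1,3: have [Ux|Ux]:=pselect (U x).
1,3: by apply: (@cont_eqon _ _ oU a)=>//;[move=>y Uy;rewrite zextT|exact: ac].
1,2: have Kx: ~ K x by move/KU.
1,2: apply: (@cont_eqon _ _ (closed_openC clK) (cst 0))=>//;last exact: cst_continuous.
1,2: by move=>y Ky;rewrite (zext_off sa).
1,2: split=>// _;have [M HM]:=cont_bounded cK (fun x _ => ac' x).
1,2: exists `|M| => x _;have [Kx|Kx]:=pselect (K x);last by rewrite (zext_off sa) // normr0.
1,2: by apply: le_trans (HM x Kx) (ler_norm M).
 by [].
split=>//;split=>[x _ i|i].
 have [Ux|Ux]:=pselect (U x).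
  apply: (@derivable_eqon _ _ oU a)=>//;last exact: Cn_derivable ak Ux.
  by move=>y Uy;rewrite zextT.
 have Kx: ~ K x by move/KU.
 apply: (@derivable_eqon _ _ (closed_openC clK) (cst 0))=>//.
 by move=>y Ky;rewrite (zext_off sa).
apply: (@Cn_eq _ _ _ openT _ (zext U (pd i a))).
 by move=>x;rewrite (@zext_pd U K).
by apply: IH;[exact: supp_pd|exact: Cn_pd].
Qed.

Lemma Csm_zext b U K a : open U -> compact K -> K `<=` U -> supp_in U K a ->
 Csm b U a -> Csm true setT (zext U a).
by move=>oU cK KU sa ak k;exact: (Cn_zext oU cK KU sa (ak k)). Qed.

Lemma Csm_csupp K a : compact K -> (forall x, ~ K x -> a x = 0) ->
 Csm false setT a -> Csm true setT a.
move=>cK aK ak;apply: (@Csm_eq _ _ _ openT (zext setT a)).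
 by move=>x;rewrite zextT.
by apply: (Csm_zext openT cK)=>// x _;exact: aK.
Qed.

Definition cube (p : 'rV[R]_m) (r : R) : set 'rV[R]_m := [set x | `|x - p| <= r].

Lemma cube_compact p r : compact (cube p r).
apply/rV_compactP;split.
 apply: (@closed_comp _ _ (fun x : 'rV[R]_m => `|x - p|) [set t | t <= r]).
  move=>x _;apply: (@continuous_comp _ _ _ (fun x : 'rV[R]_m => x - p) Num.norm).
   by apply: continuousB;[exact: cvg_id|exact: cst_continuous].
  exact: norm_continuous.
 exact: closed_le.
apply/bounded_setP;exists (r + `|p|) => x xp.
by rewrite -(subrK p x);apply: le_trans (ler_normD _ _) _;rewrite lerD2r.
Qed.

(** Equal to 1 on [-1/2, 1/2] and to 0 when |t| >= 1. Products over the coordinates give bumps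
    adapted to the sup norm, whose balls are cubes. *)
Definition bump1 (t : R) : R := eta (2 * (1 + t)) * eta (2 * (1 - t)).

Definition bump (p : 'rV[R]_m) (r : R) : 'rV[R]_m -> R :=
 fun x => \prod_(i < m) bump1 ((x ord0 i - p ord0 i) / r).

Lemma bump1_ge0 t : 0 <= bump1 t. Proof. by rewrite mulr_ge0 // eta_ge0. Qed.
Lemma bump1_le1 t : bump1 t <= 1.
by rewrite mulr_ile1 ?eta_ge0 ?eta_le1. Qed.

Lemma bump1_out t : 1 <= `|t| -> bump1 t = 0.
rewrite /bump1;case: (leP 0 t) => t0.
 rewrite ger0_norm // => t1;rewrite [X in _ * X]eta_le0 ?mulr0 //.
 by rewrite pmulr_rle0 // subr_le0.
by rewrite ltr0_norm // => t1;rewrite eta_le0;lra.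
Qed.

Lemma bump1_in t : `|t| <= 2^-1 -> bump1 t = 1.
by rewrite ler_norml=>/andP[t1 t2];rewrite /bump1 !eta_ge1;lra. Qed.

Lemma bump_ge0 p r x : 0 <= bump p r x.
by apply: prodr_ge0 => i _;exact: bump1_ge0. Qed.

Lemma bump_le1 p r x : bump p r x <= 1.
rewrite /bump;apply: prodr_ile1 => i;by rewrite bump1_ge0 bump1_le1.
Qed.

Lemma bump_out p r x : 0 < r -> r <= `|x - p| -> bump p r x = 0.
move=>r0 rx;have [i ri] : exists i, r <= `|x ord0 i - p ord0 i|.
 apply: contrapT=>/forallNP H;have : `|x - p| < r.
  apply/rV_norm_lt=>// i;rewrite !mxE ltNge;apply/negP;exact: H.
 by rewrite ltNge rx.
rewrite /bump (bigD1 i) //= bump1_out ?mul0r // normrM normfV (gtr0_norm r0).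
by rewrite ler_pdivlMr // mul1r.
Qed.

Lemma bump_in p r x : 0 < r -> `|x - p| <= r / 2 -> bump p r x = 1.
move=>r0 rx;rewrite /bump big1 // => i _;apply: bump1_in.
rewrite normrM normfV (gtr0_norm r0) ler_pdivrMr // mulrC.
by apply: le_trans rx;have := coord_le (x - p) i;rewrite !mxE.
Qed.

Lemma bump_smooth p r : 0 < r -> Csm true setT (bump p r).
move=>r0;have H:=@Csm_csupp _ (bump p r) (@cube_compact p r);apply: H.
 move=>x /negP;rewrite -ltNge=>/ltW;exact: bump_out.
move=>k;apply: (Cn_prod (@openT _)) => i _.
have c1: Cn false setT k (fun x : 'rV[R]_m => (x ord0 i - p ord0 i) / r).
 apply: (CnM (@openT _));last exact: Cn_cst.
 by apply: (CnB (@openT _));[exact: Cn_coord|exact: Cn_cst].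
apply: (CnM (@openT _));apply: (Cn_comp1 (@openT _) eta_smooth);
 apply: (CnM (@openT _));do ?exact: Cn_cst.
 by apply: (CnD (@openT _))=>//;exact: Cn_cst.
by apply: (CnB (@openT _))=>//;exact: Cn_cst.
Qed.

(* Replacing [b_i / sum b] by [b_i * prod_(j < i) (1 - b_j)] avoids dividing:
   the latter add up to [1 - prod (1 - b_j)]. *)
Fixpoint pou (d : 'rV[R]_m -> R) (rem : 'rV[R]_m -> R) (ps : seq 'rV[R]_m) :
  seq ('rV[R]_m * ('rV[R]_m -> R)) :=
 if ps is p :: ps' then
  (p, fun x => bump p (d p) x * rem x) :: pou d (fun x => (1 - bump p (d p) x) * rem x) ps'
 else [::].

Lemma pou_sum d rem ps x :
 \sum_(pc <- pou d rem ps) pc.2 x = rem x * (1 - \prod_(p <- ps) (1 - bump p (d p) x)).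
elim: ps rem=>[|p ps IH] rem /=;first by rewrite !big_nil subrr mulr0.
by rewrite !big_cons IH /=;ring.
Qed.

Lemma pou_mem d rem ps pc : (forall p, p \in ps -> 0 < d p) -> Csm true setT rem ->
 pc \in pou d rem ps ->
 [/\ pc.1 \in ps, Csm true setT pc.2 & forall x, d pc.1 <= `|x - pc.1| -> pc.2 x = 0].
elim: ps rem=>// p ps IH rem dp rs /=;have p0: 0 < d p by rewrite dp // mem_head.
have bs:=bump_smooth p p0;rewrite inE=>/predU1P[-> /=|H].
 split;[exact: mem_head|by move=>k;apply: CnM;[exact: openT|exact: bs|exact: rs]|].
 by move=>x px;rewrite bump_out // mul0r.
have [||c1 c2 c3]:=IH (fun x => (1 - bump p (d p) x) * rem x) _ _ H.
- by move=>q qs;apply: dp;rewrite inE qs orbT.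
- by move=>k;apply: CnM;[by []|apply: CnB;[by []|exact: Cn_cst|exact: bs]|exact: rs].
- by split=>//;rewrite inE c1 orbT.
Qed.

(** The sum is 1 minus the product of the 1 - b_p, so it equals 1 as soon as one bump does; this
    happens on a whole neighbourhood of [K] of uniform width [e]. *)
Lemma partition_of_unity K (d : 'rV[R]_m -> R) : compact K ->
 (forall p, K p -> 0 < d p) ->
 exists (s : seq ('rV[R]_m * ('rV[R]_m -> R))) (e : R),
  [/\ forall pc, pc \in s -> [/\ K pc.1, Csm true setT pc.2 &
     forall x, d pc.1 <= `|x - pc.1| -> pc.2 x = 0],
    forall x, 0 <= \sum_(pc <- s) pc.2 x <= 1,
    0 < e & forall p x, K p -> `|x - p| < e -> \sum_(pc <- s) pc.2 x = 1].
move=>cK dK;have cK':=cK;rewrite compact_cover in cK'.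
have [|p Kp|D DK KD]:=cK' _ K (fun p => ball p (d p / 4)).
- by move=>p Kp;exact: ball_open.
- by exists p=>//;apply: ballxx;rewrite divr_gt0 // dK.
have DK' p: p \in finmap.enum_fset D -> K p by move=>pD;have := DK p pD;rewrite inE.
pose ps:=finmap.enum_fset D.
(* A quarter of [d] for the covering and a quarter for the margin stay within the half where the
   bump is 1. *)
have [|e e0 He]:=@pos_lower_bound _ ps (fun p => d p / 4).
 by move=>p pD;rewrite divr_gt0 //;exact/dK/DK'.
exists (pou d (cst 1) ps), e;split=>//.
- move=>pc H;have [||c1 c2 c3]:=pou_mem _ _ H.
 + by move=>p pD;exact/dK/DK'.
 + by move=>k;exact: Cn_cst.
 + by split=>//;exact: DK'.
- move=>x;rewrite pou_sum mul1r;apply/andP;split;last first.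
  rewrite gerBl;apply: prodr_ge0 => p;by rewrite subr_ge0 bump_le1.
 rewrite subr_ge0;apply: prodr_ile1 => p _.
 by rewrite subr_ge0 bump_le1 gerBl bump_ge0.
- move=>p x Kp xp;rewrite pou_sum mul1r;have [q qD]:=KD p Kp.
 rewrite -ball_normE /= => qp;have q0: 0 < d q by exact/dK/DK'.
 rewrite (big_rem q) //= bump_in ?subrr ?mul0r ?subr0 //.
 have eq:=He q qD.
 rewrite -(subrKA p);apply: le_trans (ler_normD _ _) _.
 by move: qp;rewrite [`|q - p|]distrC;lra.
Qed.

End CompactSupport.

Lemma is_derive_eps (V : normedModType R) (f : V -> R) (x v : V) (a : R) :
 (forall e, 0 < e -> exists2 d : R, 0 < d & forall h, `|h| < d -> `|f (h *: v + x) - f x - h * a| <= e * `|h|) ->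
 is_derive x v f a.
move=>H;suff E : h^-1 *: ((f \o shift x) (h *: v) - f x) @[h --> 0^'] --> a.
 by split;[apply/cvg_ex;exists a|apply: cvg_lim].
apply/cvgrPdist_le => e e0;have [d d0 Hd]:=H e e0;near=> h.
have hn0: h != 0 by near: h;exact: nbhs_dnbhs_neq.
have h0: 0 < `|h| by rewrite normr_gt0.
have -> : a - h^-1 *: ((f \o shift x) (h *: v) - f x) = - (h^-1 * (f (h *: v + x) - f x - h * a)).
 by rewrite /GRing.scale /= [in RHS]mulrBr [X in _ = - (_ - X)]mulrA mulVf // mul1r opprB.
rewrite normrN normrM normfV ler_pdivrMl // [leRHS]mulrC;apply: Hd.
by near: h;apply: dnbhs0_lt.
Unshelve. all: by end_near. Qed.

Lemma is_derive_quadratic (f : R -> R) (t d C r : R) : 0 < r ->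
 (forall h, `|h| < r -> `|f (t + h) - f t - h * d| <= C * h ^+ 2) -> is_derive t 1 f d.
move=>r0 H;apply: is_derive_eps => e e0;have C1: 0 < `|C| + 1 by rewrite ltr_wpDl.
exists (Num.min r (e / (`|C| + 1)))=>[|h];first by rewrite lt_min r0 divr_gt0.
rewrite lt_min=>/andP[hr he];rewrite -[h *: 1]/(h * 1) mulr1 [h + t]addrC;apply: le_trans (H h hr) _.
rewrite -real_normK ?num_real // expr2 mulrA ler_wpM2r //.
apply: (@le_trans _ _ ((`|C| + 1) * `|h|));last by rewrite mulrC -ler_pdivlMr // ltW.
by rewrite ler_wpM2r // (le_trans (ler_norm C)) // lerDl.
Qed.

(** * Real integrals, differentiation under the integral, integrals of derivatives *)

Section RealIntegral.
Variable m : nat.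
Local Notation V := 'rV[R]_m.
Local Notation mu := (@rvol m).
Implicit Types f g : V -> R.

Definition lint f := mu.-integrable setT (EFin \o f).
Definition rint f : R := \int[mu]_(x in setT) f x.

Lemma lint_meas f : lint f -> measurable_fun setT f.
by move=>/measurable_int /measurable_EFinP. Qed.

Lemma lint_le f g : measurable_fun setT f -> (forall x, `|f x| <= `|g x|) -> lint g -> lint f.
move=>mf fg;apply: le_integrable=>//;first exact/measurable_EFinP.
by move=>x;rewrite lee_fin.
Qed.

Lemma lint_abs f : lint f -> lint (fun x => `|f x|).
move=>lf;have mf:=lint_meas lf;apply: (lint_le _ _ lf).
 exact: measurableT_comp.
by move=>x;rewrite normr_id.
Qed.

Lemma lint_bounded f (C M : R) : measurable_fun setT f -> (forall x, `|f x| <= C) ->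
 (forall x, M < `|x| -> f x = 0) -> lint f.
move=>mf fC fM;pose A : set V := [set x | forall i, `|x ord0 i| <= `|M|].
have mA: measurable A by exact: measurable_cube.
have E: EFin \o f = (EFin \o f) \_ A.
 apply/funext => x;rewrite patchE;case: ifPn=>//;rewrite notin_setE => Ax.
 rewrite /= fM //;rewrite ltNge;apply/negP => xM;apply: Ax => i.
 by apply: le_trans (coord_le x i) _;apply: le_trans xM _;exact: ler_norm.
rewrite /lint E;apply: (integrable_mkcond (EFin \o f) mA).1.
apply: measurable_bounded_integrable=>//.
- by change (rvol A < +oo)%E;rewrite rvol_box ?ltry.
- exact: measurable_funTS.
- exists C;split;first exact: num_real.
 by move=>D CD x _;exact: le_trans (ltW CD).
Qed.

Lemma lintD f g : lint f -> lint g -> lint (fun x => f x + g x).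
by move=>lf lg;have := integrableD measurableT lf lg. Qed.

Lemma lintZ c f : lint f -> lint (fun x => c * f x).
by move=>lf;have := integrableZl measurableT c lf. Qed.

Lemma lintN f : lint f -> lint (fun x => - f x).
move=>lf;have := lintZ (-1) lf;congr lint.
by apply/funext => x;rewrite mulN1r.
Qed.

Lemma lintB f g : lint f -> lint g -> lint (fun x => f x - g x).
by move=>lf /lintN;exact: lintD. Qed.

Lemma lint0 : lint (fun _ => 0).
exact: integrable0. Qed.

Lemma lint_sum (I : Type) (s : seq I) (P : pred I) (F : I -> V -> R) :
 (forall i, P i -> lint (F i)) -> lint (fun x => \sum_(i <- s | P i) F i x).
move=>lF;elim: s=>[|i s IH].
 by rewrite (_ : (fun x => _) = fun _ => 0);[exact: lint0|apply/funext => x;rewrite big_nil].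
have [Pi|Pi]:=boolP (P i).
 rewrite (_ : (fun x => _) = fun x => F i x + \sum_(j <- s | P j) F j x).
  by apply: lintD=>//;exact: lF.
 by apply/funext => x;rewrite big_cons Pi.
by rewrite (_ : (fun x => _) = fun x => \sum_(j <- s | P j) F j x) //;
 apply/funext => x;rewrite big_cons (negbTE Pi).
Qed.

Lemma rintD f g : lint f -> lint g -> rint (fun x => f x + g x) = rint f + rint g.
by move=>lg;exact: RintegralD. Qed.

Lemma rintB f g : lint f -> lint g -> rint (fun x => f x - g x) = rint f - rint g.
by move=>lg;exact: RintegralB. Qed.

Lemma rintZ c f : lint f -> rint (fun x => c * f x) = c * rint f.
by move=>lf;exact: RintegralZl. Qed.

Lemma rintN f : lint f -> rint (fun x => - f x) = - rint f.
move=>lf;rewrite -mulN1r -rintZ //;congr rint.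
by apply/funext => x;rewrite mulN1r.
Qed.

Lemma rint0 : rint (fun _ => 0) = 0.
by rewrite /rint /Rintegral integral0. Qed.

Lemma rint_sum (I : Type) (s : seq I) (P : pred I) (F : I -> V -> R) :
 (forall i, P i -> lint (F i)) ->
 rint (fun x => \sum_(i <- s | P i) F i x) = \sum_(i <- s | P i) rint (F i).
move=>lF;elim: s=>[|i s IH].
 by rewrite big_nil (_ : (fun x => _) = fun _ => 0) ?rint0 //;apply/funext => x;rewrite big_nil.
rewrite big_cons;case: ifPn => Pi;last first.
 by rewrite -IH;congr rint;apply/funext => x;rewrite big_cons (negbTE Pi).
rewrite -IH -rintD;[|exact: lF|exact: lint_sum].
by congr rint;apply/funext => x;rewrite big_cons Pi.
Qed.

Lemma rint_le f g : lint f -> lint g -> (forall x, f x <= g x) -> rint f <= rint g.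
by move=>lf lg fg;apply: le_Rintegral. Qed.

Lemma rint_ge0 f : (forall x, 0 <= f x) -> 0 <= rint f.
by move=>f0;apply: Rintegral_ge0. Qed.

Lemma rint_abs_le f g : lint f -> lint g -> (forall x, `|f x| <= g x) -> `|rint f| <= rint g.
move=>lf lg fg;apply: le_trans (le_normr_Rintegral measurableT lf) _.
by apply: rint_le=>//;exact: lint_abs.
Qed.

Lemma rint_EFin f : lint f -> (\int[mu]_x (f x)%:E)%E = (rint f)%:E.
by move=>lf;rewrite fineK //;exact: integrable_fin_num. Qed.

Lemma int_Rm_rint f : lint f -> int_Rm f = (rint f)%:E.
by move=>lf;rewrite int_Rm_integral ?rint_EFin //;exact: lint_meas. Qed.

Lemma int_nonneg_lint f : measurable_fun setT f -> (forall x, 0 <= f x) ->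
 (int_nonneg (fun x => (f x)%:E) < +oo)%E <-> lint f.
move=>mf f0;rewrite iint_integral;last first.
 by split;[exact/measurable_EFinP|move=>x;rewrite lee_fin].
have E: (\int[mu]_x `|(f x)%:E| = \int[mu]_x (f x)%:E)%E.
 by apply: eq_integral => x;rewrite gee0_abs // lee_fin.
rewrite -E;split=>[H|/integrableP[]//].
by apply/integrableP;split=>//;exact/measurable_EFinP.
Qed.

Lemma int_nonneg_rint f : (forall x, 0 <= f x) -> lint f ->
 int_nonneg (fun x => (f x)%:E) = (rint f)%:E.
move=>f0 lf;rewrite iint_integral ?rint_EFin //.
split;last by move=>x;rewrite lee_fin.
by apply/measurable_EFinP;exact: lint_meas.
Qed.

Lemma rint_dct (F : nat -> V -> R) f g : (forall n, measurable_fun setT (F n)) ->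
 measurable_fun setT f -> (forall x, F ^~ x @ \oo --> f x) ->
 (forall n x, `|F n x| <= g x) -> lint g -> (fun n => rint (F n)) @ \oo --> rint f.
move=>mF mf Ff Fg lg.
have lF n: lint (F n).
 by apply: lint_le lg=>// x;apply: le_trans (ler_norm _).
have [||||lf _ H]:=@dominated_convergence _ _ R mu setT measurableT
 (fun n x => (F n x)%:E) (fun x => (f x)%:E) (fun x => (g x)%:E) _ _ _ lg.
- by move=>n;exact/measurable_EFinP.
- exact/measurable_EFinP.
- by apply: aeW => x _;apply/cvg_EFin=>//;[exact: nearW|exact: Ff].
- by apply: aeW => x n;rewrite lee_fin.
move: H;rewrite rint_EFin //;under eq_fun do rewrite rint_EFin //.
by move/fine_cvgP=>[_].
Qed.

(** A quadratic remainder with integrable coefficient [b] can be integrated as it stands: the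
    difference quotient of the integral then has an error of order |h|. *)
Lemma rint_derive (F : R -> V -> R) (D b : V -> R) (t r : R) : 0 < r ->
 (forall h, `|h| < r -> lint (F (t + h))) -> lint D -> lint b ->
 (forall h x, `|h| < r -> `|F (t + h) x - F t x - h * D x| <= b x * h ^+ 2) ->
 is_derive t 1 (fun t => rint (F t)) (rint D).
move=>r0 lF lD lb H;apply: (@is_derive_quadratic _ _ _ (rint b) r r0) => h hr.
have l0: lint (F t) by have := lF 0;rewrite normr0 addr0;apply.
have l1:=lF h hr;have l2:=lintB l1 l0;have l3:=lintZ h lD.
rewrite -(rintZ h lD) -(rintB l1 l0) -(rintB l2 l3).
rewrite mulrC -(rintZ _ lb);apply: rint_abs_le.
- exact: lintB.
- exact: lintZ.
- by move=>x;rewrite [leRHS]mulrC;exact: H.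
Qed.

Lemma setc_line (x : V) (i : 'I_m) t : setc x i t = t *: ebasis R i + setc x i 0.
apply/rowP => j;rewrite !mxE;case: eqP=>[/val_inj ->|ji].
 by rewrite eqxx mulr1 addr0.
by case: eqP=>[ji'|_];[case: ji;rewrite ji'|rewrite mulr0 add0r].
Qed.

Lemma C0_meas b (U : set V) f : open U -> C0 b U f -> measurable_fun setT (zext U f).
by move=>oU [fc _];exact: indicM_measurable. Qed.

Lemma C0T_measurable b f : C0 b setT f -> measurable_fun setT f.
by move=>[fc _];exact: cont_measurable. Qed.

Lemma lint_csupp b K f : C0 b setT f -> compact K -> (forall x, ~ K x -> f x = 0) -> lint f.
move=>f0 cK fK;have [fc _]:=f0.
have [C HC]:=cont_bounded cK (fun x _ => fc x I).
have [clK /bounded_setP[M HM]]:=(rV_compactP K).1 cK.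
apply: (@lint_bounded _ `|C| M);first exact: C0T_measurable f0.
 move=>x;have [/HC xC|/fK ->]:=pselect (K x);last by rewrite normr0.
 exact: le_trans (ler_norm _).
by move=>x Mx;apply: fK=>/HM;rewrite leNgt Mx.
Qed.

(** Iterated integrals are formed of nonnegative functions, so the fundamental theorem along the
    i-th axis is phrased as equality of the inner integrals of the positive and negative parts of
    the derivative; Tonelli carries it to the full integral. *)
Lemma rint_pd i K a : Cn true setT 1 a -> compact K -> (forall x, ~ K x -> a x = 0) ->
 lint (pd i a) /\ rint (pd i a) = 0.
move=>a1 cK aK;have g0:=Cn_C0 (Cn_pd i a1);have [gc gb]:=g0.
have [clK /bounded_setP[M HM]]:=(rV_compactP K).1 cK.
have aM x: M < `|x| -> a x = 0 by move=>Mx;apply: aK=>/HM;rewrite leNgt Mx.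
have gK x: ~ K x -> pd i a x = 0.
 by move=>Kx;apply: (@supp_pd _ setT K)=>// y _;exact: aK.
have lg: lint (pd i a) by exact: lint_csupp g0 cK gK.
split=>//;set g := pd i a in lg g0 gc gb gK *.
pose P x:=Num.max (g x) 0;pose N x:=Num.max (- g x) 0.
have mg:=lint_meas lg.
have nP: nnm (fun x => (P x)%:E).
 split;last by move=>x;rewrite lee_fin le_max lexx orbT.
 by apply/measurable_EFinP;apply: measurable_maxr.
have nN: nnm (fun x => (N x)%:E).
 split;last by move=>x;rewrite lee_fin le_max lexx orbT.
 by apply/measurable_EFinP;apply: measurable_maxr=>//;exact: measurableT_comp.
have E: cint i (fun x => (P x)%:E) = cint i (fun x => (N x)%:E).
 apply/funext => x;rewrite /cint.
 pose phi t:=a (setc x i t);pose dphi t:=g (setc x i t).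
 pose x0:=setc x i 0.
 have phiE: phi = fun t => a (t *: ebasis R i + x0).
  by apply/funext => t;rewrite /phi setc_line.
 have dphiE: dphi = fun t => g (t *: ebasis R i + x0).
  by apply/funext => t;rewrite /dphi setc_line.
 have dp (t : R) : is_derive t (1 : R) phi (dphi t).
  by rewrite phiE dphiE;apply: is_derive_line;exact: Cn_derive a1 _.
 have dc: continuous dphi.
  move=>t;rewrite dphiE.
  apply: (@continuous_comp _ _ _ (fun s : R => s *: ebasis R i + x0) g).
   exact: line_continuous.
  exact: gc.
 pose L:=`|M| + 1;have L0: - L < L by rewrite /L;have := normr_ge0 M;lra.
 have out t: L <= `|t| -> a (setc x i t) = 0 /\ dphi t = 0.
  move=>Lt;have H: M < `|setc x i t|.
   apply: lt_le_trans (coord_le _ i);rewrite mxE eqxx.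
   apply: lt_le_trans Lt;rewrite /L;have := ler_norm M;lra.
  by split;[exact: aM|apply: gK=>/HM;rewrite leNgt H].
 have F0: (\int[lebesgue_measure]_(t in `[(- L)%R, L]) (dphi t)%:E = 0)%E.
  rewrite (@continuous_FTC2 _ dphi phi (- L) L) //.
  - have nL: `|L| = L by rewrite ger0_norm /L.
   by rewrite /phi !(out _ _).1 ?normrN ?nL // subee.
  - exact: continuous_subspaceT.
  - have pc: continuous phi.
    by move=>t;apply/differentiable_continuous/derivable1_diffP.
   split=>[t _| |];first by have := dp.
    exact: cvg_at_right_filter (pc _).
   exact: cvg_at_left_filter (pc _).
  - by move=>t;rewrite derive1E;have [_ ->]:=dp t.
 have li: lebesgue_measure.-integrable `[(- L)%R, L] (EFin \o dphi).
  apply: continuous_compact_integrable;first exact: segment_compact.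
  exact: continuous_subspaceT.
 have mI: measurable (`[(- L)%R, L]%classic : set (measurableTypeR R)) by [].
 (* [s] is the positive or the negative part: both vanish at 0, so the integral over the line
    reduces to the segment carrying the support. *)
 have H (s : R -> R) : s 0 = 0 -> (\int[lebesgue_measure]_t (s (dphi t))%:E =
   \int[lebesgue_measure]_(t in `[(- L)%R, L]) (s (dphi t))%:E)%E.
  move=>s0;rewrite [RHS]integral_mkcond;apply: eq_integral => t _.
  rewrite patchE;case: ifPn=>//;rewrite notin_setE /= in_itv -ler_norml=>/negP.
  by rewrite -ltNge=>/ltW /out [_ ->];rewrite s0.
 rewrite (H (fun u => Num.max u 0)) ?maxxx // (H (fun u => Num.max (- u) 0)) ?oppr0 ?maxxx //.
 have Fp:=integrable_pos_fin_num mI li;have Fn:=integrable_neg_fin_num mI li.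
 rewrite integralE in F0;move/eqP: F0;rewrite sube_eq //= ?add0e=>/eqP F0.
 apply: etrans (etrans _ F0) _;apply: eq_integral => t _.
  by rewrite funeposE EFin_max.
 by rewrite funenegE EFin_max.
have Z:=iint_eq_inner nP nN (ltn_ord i) E.
have I0: int_Rm g = 0%E.
 rewrite /int_Rm;have -> : int_nonneg (fun x => (Num.max (g x) 0)%:E) =
  int_nonneg (fun x => (Num.max (- g x) 0)%:E) by rewrite /int_nonneg Z.
 rewrite subee // ge0_fin_numE.
  apply/(int_nonneg_lint _ _)=>//;last first.
   by apply: lint_le lg=>[|x];[apply: measurable_maxr=>//;exact: measurableT_comp|];
    rewrite ger0_norm ?le_max ?lexx ?orbT // ge_max normr_ge0 -normrN ler_norm.
  by move=>x;rewrite le_max lexx orbT.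
  by apply: measurable_maxr=>//;exact: measurableT_comp.
 by rewrite iint_integral //;apply: integral_ge0 => x;rewrite lee_fin le_max lexx orbT.
by move: I0;rewrite int_Rm_rint // => -[].
Qed.

Lemma rint_pd_on i (U K : set V) a : open U -> compact K -> K `<=` U -> supp_in U K a ->
 Cn false U 1 a -> lint (zext U (pd i a)) /\ rint (zext U (pd i a)) = 0.
move=>oU cK KU sa a1;have z1:=Cn_zext oU cK KU sa a1.
have [clK _]:=(rV_compactP K).1 cK.
have <- : pd i (zext U a) = zext U (pd i a).
 by apply/funext => x;rewrite (zext_pd i x oU clK KU sa).
by apply: (rint_pd i z1 cK) => x;exact: zext_off.
Qed.

End RealIntegral.

(** * Derivation rules and Taylor remainders *)

Section DerivationRules.
Context (V : normedModType R) (x v : V).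
Implicit Types (f g : V -> R) (d e : R).

Lemma dv_eq f g d e : is_derive x v f d -> f =1 g -> d = e -> is_derive x v g e.
by move=>D /funext <- <-. Qed.

Lemma dv_cst (c : R) : is_derive x v (fun _ => c) 0.
exact: is_derive_cst. Qed.

Lemma dvD f g d e : is_derive x v f d -> is_derive x v g e ->
 is_derive x v (fun y => f y + g y) (d + e).
by move=>dg;exact: is_deriveD. Qed.

Lemma dvB f g d e : is_derive x v f d -> is_derive x v g e ->
 is_derive x v (fun y => f y - g y) (d - e).
by move=>dg;exact: is_deriveB. Qed.

Lemma dvM f g d e : is_derive x v f d -> is_derive x v g e ->
 is_derive x v (fun y => f y * g y) (d * g x + f x * e).
move=>df dg;apply: dv_eq (fun _ => erefl) _.
by rewrite /GRing.scale addrC mulrC.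
Qed.

Lemma dvZ c f d : is_derive x v f d -> is_derive x v (fun y => c * f y) (c * d).
by move=>df;exact: is_deriveZ. Qed.

Lemma dvN f d : is_derive x v f d -> is_derive x v (fun y => - f y) (- d).
by move=>df;exact: is_deriveN. Qed.

Lemma dvX k f d : is_derive x v f d ->
 is_derive x v (fun y => f y ^+ k) (k%:R * f x ^+ k.-1 * d).
move=>df;elim: k=>[|k IH].
 by apply: dv_eq (dv_cst 1) _ _=>[y|];rewrite ?mul0r.
apply: dv_eq (dvM df IH) _ _=>[y|];first by rewrite exprS.
by rewrite -[k.+1%:R]natr1;case: (k)=>[|j];rewrite ?exprS;ring.
Qed.

Lemma dv_sum (I : Type) (r : seq I) (P : pred I) (F : I -> V -> R) (dF : I -> R) :
 (forall i, P i -> is_derive x v (F i) (dF i)) ->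
 is_derive x v (fun y => \sum_(i <- r | P i) F i y) (\sum_(i <- r | P i) dF i).
move=>FD;elim: r=>[|i r IH].
 by apply: dv_eq=>[y|];rewrite big_nil.
apply: (@dv_eq (fun y => (if P i then F i y else 0) + \sum_(j <- r | P j) F j y)
 _ ((if P i then dF i else 0) + \sum_(j <- r | P j) dF j)).
- by apply: dvD=>//;case: ifP=>[/FD //|_];exact: dv_cst.
- by move=>y;rewrite big_cons;case: ifP;rewrite ?add0r.
by rewrite big_cons;case: ifP;rewrite ?add0r.
Qed.

Lemma dv_comp1 (s : R -> R) f d e : is_derive (f x) (1 : R) s d -> is_derive x v f e ->
 is_derive x v (fun y => s (f y)) (d * e).
exact: is_derive_comp1. Qed.

End DerivationRules.

Lemma dv_id (t : R) : is_derive t (1 : R) (fun s : R => s) 1.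
exact: is_derive_id. Qed.

Lemma dv_coord m (x : 'rV[R]_m) i j :
 is_derive x (ebasis R i) (fun y : 'rV[R]_m => y ord0 j) (if j == i then 1 else 0).
apply: is_derive_of_line.
apply: dv_eq (dvD (dvZ (if j == i then 1 else 0) (dv_id 0)) (dv_cst _ _ (x ord0 j))) _ _.
 by move=>s;rewrite !mxE mulrC.
by rewrite addr0 mulr1.
Qed.

Section Taylor.

Lemma taylor_line b m (U : set 'rV[R]_m) (K : 'rV[R]_m -> R) i x h C :
 Cn b U 2 K -> (forall s, `|s| <= `|h| -> U (s *: ebasis R i + x)) ->
 (forall s, `|s| <= `|h| -> `|pd i (pd i K) (s *: ebasis R i + x)| <= C) ->
 `|K (h *: ebasis R i + x) - K x - h * pd i K x| <= C * h ^+ 2.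
move=>K2 Uh HC.
have [s sh|s sh ->]:=@MVT_line _ K x (ebasis R i) h.
 exact: Cn_derivable K2 (Uh s sh).
have [t ts|t ts E]:=@MVT_line _ (pd i K) x (ebasis R i) s.
 by apply: Cn_derivable (Cn_pd i K2) (Uh t _);exact: le_trans sh.
rewrite -mulrBr E normrM normrM -/(pd i (pd i K) _).
have -> : C * h ^+ 2 = `|h| * (`|h| * C).
 by rewrite mulrA -expr2 real_normK ?num_real // mulrC.
by rewrite ler_wpM2l // ler_pM // HC // (le_trans ts).
Qed.

Lemma MVT_seg (V : normedModType R) (f : V -> R) (x v : V) :
 (forall s, 0 <= s <= 1 -> derivable f (s *: v + x) v) ->
 exists2 s, 0 <= s <= 1 & f (v + x) - f x = 'D_v f (s *: v + x).
move=>fd;pose g s:=f (s *: v + x);pose dg s:='D_v f (s *: v + x).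
have gd (s : R) : 0 <= s <= 1 -> is_derive s 1 g (dg s).
 by move=>st;apply: is_derive_line;apply: derivableP;exact: fd.
have [||s s01 E]:=@MVT_segment R g dg 0 1 ler01.
- by move=>s /subset_itv_oo_cc;exact: gd.
- apply: derivable_within_continuous => s;rewrite in_itv /= => s01.
 by have []:=gd s.
exists s;first by move: s01.
by move: E;rewrite /g scale0r add0r scale1r subr0 mulr1.
Qed.

Lemma derive0_const (f : R -> R) (a b : R) :
 (forall t, a < t < b -> is_derive t 1 f 0) ->
 forall s t, a < s < b -> a < t < b -> f s = f t.
move=>f0;suff H s t : a < s < b -> a < t < b -> s <= t -> f s = f t.
 move=>s t sab tab;have [st|/ltW ts]:=leP s t;first exact: H.
 by apply/esym;exact: H.
move=>/andP[as_ sb] /andP[at_ tb] st.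
have H u: u \in `[s, t]%R -> a < u < b.
 by rewrite in_itv=>/andP[su ut];rewrite (lt_le_trans as_ su) (le_lt_trans ut tb).
have [||c _ E]:=@MVT_segment R f (fun _ => 0) s t st.
- by move=>u /subset_itv_oo_cc /H;exact: f0.
- by apply: derivable_within_continuous => u /H /f0.
by move: E;rewrite mul0r=>/subr0_eq.
Qed.

End Taylor.

Lemma csm_derive b m (U : set 'rV[R]_m) (K : 'rV[R]_m -> R) z v :
 open U -> Cn b U 1 K -> U z -> is_derive z v K (\sum_i v ord0 i * pd i K z).
move=>oU K1 Uz;apply: derive_lincomb.
 have := near_in oU Uz;apply: filterS => u Uu i;exact: Cn_derivable K1 _.
by move=>i;have [[+ _] _]:=Cn_pd i K1;apply.
Qed.

Lemma csm_lipschitz b m (U : set 'rV[R]_m) (K : 'rV[R]_m -> R) C x y :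
 open U -> Cn b U 1 K -> (forall s, 0 <= s <= 1 -> U (s *: (x - y) + y)) ->
 (forall i z, U z -> `|pd i K z| <= C) -> `|K x - K y| <= m%:R * C * `|x - y|.
move=>oU K1 Us HC;have [s s01|s s01 E]:=@MVT_seg _ K y (x - y).
 by have := csm_derive (x - y) oU K1 (Us s s01).
have -> : K x = K ((x - y) + y) by rewrite subrK.
rewrite E;have [_ ->]:=csm_derive (x - y) oU K1 (Us s s01).
apply: le_trans (ler_norm_sum _ _ _) _.
apply: (@le_trans _ _ (\sum_(i < m) (C * `|x - y|))).
 by apply: ler_sum => i;rewrite normrM mulrC ler_pM ?coord_le ?HC //;exact: Us.
by rewrite sumr_const card_ord -[leLHS]mulr_natl mulrA.
Qed.

(** * Regularisation by kernels whose derivative in the scale is a Laplacian *)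

Section Kernel.
Variable m : nat.
Local Notation V := 'rV[R]_m.
Implicit Types (q K : V -> R) (f : V -> V).

(** The regularisation at [y] of the push-forward under [f] of the density [q]. The identity for [f]
    serves holomorphic functions, a biholomorphic map serves the change of variables. *)
Definition conv q f K (y : V) : R := rint (fun x => q x * K (f x - y)).

Lemma measurable_comp_shift f K y : measurable_fun setT f -> measurable_fun setT K ->
 measurable_fun setT (fun x => K (f x - y)).
move=>mf mK;apply: measurableT_comp mK _;apply: measurable_rV => i.
rewrite (_ : (fun x => _) = fun x => mcoor i (f x) - y ord0 i);last first.
 by apply/funext => x;rewrite !mxE.
apply: measurable_funB;last exact: measurable_cst.
by apply: measurableT_comp mf;exact: measurable_mcoor.
Qed.

Lemma lint_mul_bounded q K : lint q -> measurable_fun setT K -> bound_on setT K ->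
 lint (fun x => q x * K x).
move=>lq mK [C HC];have mq:=lint_meas lq.
apply: (@lint_le _ _ (fun x => `|C| * q x));last exact: lintZ.
 exact: measurable_funM.
move=>x;rewrite !normrM normr_id mulrC ler_wpM2r //.
by apply: le_trans (HC x I) (ler_norm _).
Qed.

Lemma conv_lint q f K y : lint q -> measurable_fun setT f -> C0 true setT K ->
 lint (fun x => q x * K (f x - y)).
move=>lq mf K0;have [_ /(_ isT)[C HC]]:=K0;apply: lint_mul_bounded=>//.
 by apply: measurable_comp_shift=>//;exact: C0T_measurable K0.
by exists C => x _;exact: HC.
Qed.

Lemma conv_is_derive q f K y i : lint q -> measurable_fun setT f -> Csm true setT K ->
 is_derive y (ebasis R i) (conv q f K) (- conv q f (pd i K) y).
move=>lq mf Ks;apply: is_derive_of_line;have mq:=lint_meas lq.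
have K0:=Cn_C0 (Ks 0%N);have Ki:=Cn_C0 (Cn_pd i (Ks 1%N)).
have [_ /(_ isT) [C HC]]:=Cn_C0 (Cn_pd i (Cn_pd i (Ks 2%N))).
rewrite /conv -rintN;last exact: conv_lint.
pose F t x:=q x * K (f x - (t *: ebasis R i + y)).
apply: (@rint_derive _ F _ (fun x => C * `|q x|) 0 1)=>//.
- by move=>h _;exact: conv_lint.
- by apply: lintN;exact: conv_lint.
- exact/lintZ/lint_abs.
move=>h x _;rewrite /F add0r scale0r add0r.
have -> : f x - (h *: ebasis R i + y) = (- h) *: ebasis R i + (f x - y).
 by rewrite opprD scaleNr addrCA.
have -> : q x * K (- h *: ebasis R i + (f x - y)) - q x * K (f x - y) -
  h * - (q x * pd i K (f x - y)) =
 q x * (K (- h *: ebasis R i + (f x - y)) - K (f x - y) - (- h) * pd i K (f x - y)) by ring.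
rewrite normrM mulrAC mulrC -(sqrrN h) ler_wpM2r //.
by apply: (@taylor_line true _ setT)=>// s _;exact: HC.
Qed.

Lemma conv_bound q f K C y : lint q -> measurable_fun setT f -> C0 true setT K ->
 (forall x, `|K x| <= C) -> `|conv q f K y| <= C * rint (fun x => `|q x|).
move=>lq mf K0 HC;rewrite -rintZ;last exact: lint_abs.
apply: rint_abs_le;[exact: conv_lint|exact/lintZ/lint_abs|].
by move=>x;rewrite normrM mulrC ler_wpM2r.
Qed.

(** Bounded first derivatives make [K] Lipschitz, and the Lipschitz bound passes to the
    regularisation with the L^1 norm of [q] as a factor. *)
Lemma conv_C0 q f K : lint q -> measurable_fun setT f -> Csm true setT K ->
 C0 true setT (conv q f K).
move=>lq mf Ks;have K0:=Cn_C0 (Ks 0%N).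
have [B B0 HB] : exists2 B, 0 <= B & forall i x, `|pd i K x| <= B.
 have /choice[B HB] : forall i, exists B, forall x, `|pd i K x| <= B.
  by move=>i;have [[_ /(_ isT)[B HB]] _]:=Cn_pd i (Ks 1%N);exists B => x;exact: HB.
 exists (\sum_i `|B i|)=>[|i x];first exact: sumr_ge0.
 apply: le_trans (HB i x) _;rewrite (bigD1 i) //=.
 by apply: le_trans (ler_norm _) _;rewrite lerDl sumr_ge0.
pose L:=m%:R * B * rint (fun x => `|q x|).
have L0: 0 <= L by rewrite !mulr_ge0 // rint_ge0.
have Lip y z: `|conv q f K y - conv q f K z| <= L * `|y - z|.
 rewrite -rintB;[|exact: conv_lint|exact: conv_lint].
 have -> : L * `|y - z| = rint (fun x => m%:R * B * `|y - z| * `|q x|).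
  by rewrite rintZ;[rewrite /L mulrAC|exact: lint_abs].
 apply: rint_abs_le;[by apply: lintB;exact: conv_lint|exact/lintZ/lint_abs|].
 move=>x;rewrite -mulrBr normrM mulrC ler_wpM2r //.
 have := csm_lipschitz (x := f x - y) (y := f x - z) openT (Ks 1%N) (fun _ _ => I) (fun i z _ => HB i z).
 by have -> : f x - y - (f x - z) = z - y;[apply/rowP=> k;rewrite !mxE;ring|rewrite [`|z - y|]distrC].
split=>[y _|_].
 apply/(@cvgrPdist_le _ _ _ (nbhs y) _ (conv q f K)) => e e0.
 have L1: 0 < L + 1 by rewrite ltr_wpDl.
 apply/nbhs_ballP;exists (e / (L + 1));first by rewrite /= divr_gt0.
 move=>z;rewrite -ball_normE=>/ltW.
 rewrite ler_pdivlMr // mulrDr mulr1 mulrC => H;apply: le_trans (Lip y z) _.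
 by apply: le_trans H;rewrite lerDl.
have [_ /(_ isT)[C HC]]:=K0;exists (C * rint (fun x => `|q x|)) => y _.
by apply: conv_bound=>// x;exact: HC.
Qed.

Lemma conv_Csm q f K : lint q -> measurable_fun setT f -> Csm true setT K ->
 Csm true setT (conv q f K).
move=>lq mf Ks k;elim: k K Ks=>[|k IH] K Ks;first by split=>//;exact: conv_C0.
apply: (@Cn_intro _ _ _ openT _ _ (fun i y => - conv q f (pd i K) y)).
- exact: conv_C0.
- by move=>y i _;exact: conv_is_derive.
- by move=>i;apply: CnN=>//;apply: IH;exact: Csm_pd.
Qed.

Lemma conv_pd q f K i y : lint q -> measurable_fun setT f -> Csm true setT K ->
 pd i (conv q f K) y = - conv q f (pd i K) y.
by move=>lq mf Ks;have [_ <-]:=conv_is_derive y i lq mf Ks. Qed.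

End Kernel.

Section HeatKernel.
Implicit Types (p : {poly R}) (t s : R).

Definition dpoly p : {poly R} := (p - p^`()) * 'X^2.

Lemma flatp_bound p : exists2 B, 0 <= B & forall t, t <= 1 -> `|flatp p t| <= B.
have [C HC]:=flatp_small p;exists `|C|=>// t t1.
have [t0|t0]:=leP t 0;first by rewrite /flatp ltNge t0 normr0.
apply: le_trans (HC t t1) _;apply: le_trans (ler_norm _) _;rewrite normrM [`|t ^+ 2|]ger0_norm ?sqr_ge0 //.
by rewrite ler_piMr // mulr_ile1 // ltW.
Qed.

Lemma flatp_le0 p t : t <= 0 -> flatp p t = 0.
by rewrite /flatp ltNge=>->. Qed.

Lemma is_derive_kertime p k s t :
 is_derive t (1 : R) (fun t => t ^+ k * flatp p (1 - t * s))
  (k%:R * t ^+ k.-1 * flatp p (1 - t * s) - s * t ^+ k * flatp (dpoly p) (1 - t * s)).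
have D1:=dvB (dv_cst t 1 1) (dvZ s (dv_id t)).
apply: dv_eq (dvM (dvX k (dv_id t)) (dv_comp1 (flatp_derive p _) D1)) _ _.
 by move=>u;rewrite [s * u]mulrC.
by rewrite [s * t]mulrC;ring.
Qed.

Variable n : nat.
Local Notation V := 'rV[R]_(n + n).

Definition sqn (w : V) : R := \sum_i w ord0 i ^+ 2.
(** Supported where |w|^2 <= 1/t. The polynomial and the power index a family that contains its own
    partial derivatives up to factors [w_i]; in real dimension 2n the power k = n is the one that
    preserves mass. *)
Definition ker p k t (w : V) : R := t ^+ k * flatp p (1 - t * sqn w).

Lemma sqn_ge0 w : 0 <= sqn w. Proof. by apply: sumr_ge0 => i _;exact: sqr_ge0. Qed.

Lemma sqn_ge w : `|w| ^+ 2 <= sqn w.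
have H i: w ord0 i ^+ 2 <= sqn w.
 by rewrite /sqn (bigD1 i) //= lerDl sumr_ge0 // => j _;exact: sqr_ge0.
rewrite -[leRHS]sqr_sqrtr ?sqn_ge0 // ler_sqr ?nnegrE //.
apply/rV_norm_le=>[|i];first exact: sqrtr_ge0.
by rewrite -[leLHS]ger0_norm // -ler_sqr ?nnegrE // sqr_sqrtr ?sqn_ge0 // ger0_norm // real_normK ?num_real.
Qed.

Lemma ker_out p k t w : 0 < t -> t^-1 <= `|w| ^+ 2 -> ker p k t w = 0.
move=>t0 tw;rewrite /ker flatp_le0 ?mulr0 // subr_le0 -ler_pdivrMl // mulr1.
exact: le_trans (sqn_ge w).
Qed.

Lemma sqn_smooth : Csm false setT sqn.
move=>k;apply: Cn_sum=>// i _.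
have H: Cn false [set: V] k (fun x => x ord0 i) by exact: Cn_coord.
by apply: (CnM openT H H) => _.
Qed.

Lemma pd_sqn i w : pd i sqn w = 2 * w ord0 i.
rewrite /pd;suff [_ ->] : is_derive w (ebasis R i) sqn (2 * w ord0 i) by [].
apply: dv_eq (dv_sum _ (fun j _ => dvX 2 (dv_coord w i j))) (fun _ => erefl) _.
rewrite (bigD1 i) //= eqxx big1=>[|j /negbTE ->];first by rewrite mulr1 addr0.
by rewrite mulr0.
Qed.

Lemma ker_smooth p k t : 0 < t -> Csm true setT (ker p k t).
move=>t0;apply: (@Csm_csupp _ (@cube _ 0 (t^-1 + 1)))=>[|w|].
- exact: cube_compact.
- move=>/negP;rewrite subr0 -ltNge => tw;apply: ker_out=>//.
 have t1: 0 < t^-1 by rewrite invr_gt0.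
 have w1: 1 <= `|w| by apply: ltW;apply: le_lt_trans tw;rewrite lerDr ltW.
 rewrite expr2;apply: (@le_trans _ _ `|w|);last by rewrite ler_peMr.
 by apply/ltW/(le_lt_trans _ tw);rewrite lerDl.
move=>j;apply: CnM=>//;first exact: Cn_cst.
apply: Cn_comp1=>//;first exact: flatp_smooth.
by apply: CnB=>//;[exact: Cn_cst|apply: CnZ=>//;exact: sqn_smooth].
Qed.

Lemma pd_ker p k t i w : pd i (ker p k t) w = 2 * w ord0 i * - ker (dpoly p) k.+1 t w.
have D:=Cn_derive i (sqn_smooth 1) (I : setT w).
rewrite pd_sqn in D.
have D1:=dvB (dv_cst w (ebasis R i) 1) (dvZ t D).
have [_ D2]:=dvZ (t ^+ k) (dv_comp1 (flatp_derive p _) D1).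
by apply: etrans D2 _;rewrite /ker -/(dpoly p) exprS;ring.
Qed.

Lemma ker_lap p k t w : 0 < t -> \sum_i pd i (pd i (ker p k t)) w =
 4 * (sqn w * ker (dpoly (dpoly p)) k.+2 t w - n%:R * ker (dpoly p) k.+1 t w).
move=>t0;have H i: pd i (pd i (ker p k t)) w =
  4 * (w ord0 i ^+ 2 * ker (dpoly (dpoly p)) k.+2 t w) - 2 * ker (dpoly p) k.+1 t w.
 rewrite (_ : pd i (ker p k t) = fun w => - 2 * (w ord0 i * ker (dpoly p) k.+1 t w));last first.
  by apply/funext => x;rewrite pd_ker;ring.
 have D1:=Cn_derive i (ker_smooth (dpoly p) k.+1 t0 1) (I : setT w).
 have [_ D2]:=dvZ (- 2) (dvM (dv_coord w i i) D1).
 by apply: etrans D2 _;rewrite eqxx pd_ker;ring.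
rewrite (eq_bigr _ (fun i _ => H i)) sumrB -mulr_sumr -mulr_suml -/(sqn w).
rewrite sumr_const card_ord;ring.
Qed.

(* The kernel is a radial profile scaled so that its integral does not depend on
   the scale; its derivative in the scale is then a Laplacian. *)
Lemma ker_time t w : 0 < t -> is_derive t (1 : R) (fun t => ker (dpoly 1) n t w)
 (- (4 * t ^+ 2)^-1 * \sum_i pd i (pd i (ker 1 n t)) w).
move=>t0;have [D1 D2]:=is_derive_kertime (dpoly 1) n (sqn w) t.
split;first exact: D1.
apply: etrans D2 _;rewrite ker_lap // /ker !exprS.
case: (n)=>[|k];rewrite ?exprS;field;lra.
Qed.

End HeatKernel.

Lemma cont_epsP m (f : 'rV[R]_m -> R) x : {for x, continuous f} <->
 forall e, 0 < e -> exists2 d, 0 < d & forall y, `|y - x| < d -> `|f y - f x| <= e.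
split=>[fc e e0|H].
 have /(@cvgrPdist_le _ _ _ (nbhs x) _ f)/(_ e e0) := fc.
 case/nbhs_ballP => d d0 Hd;exists d=>// y yx;rewrite distrC;apply: Hd.
 by rewrite ball_lt.
apply/(@cvgrPdist_le _ _ _ (nbhs x) _ f) => e /H[d d0 Hd].
apply/nbhs_ballP;exists d=>// y;rewrite -ball_normE /ball_ /= => yx.
by rewrite distrC Hd // distrC.
Qed.

Lemma taylor1 (g dg ddg : R -> R) (t h C : R) :
 (forall u, `|u| <= `|h| -> is_derive (t + u) (1 : R) g (dg (t + u))) ->
 (forall u, `|u| <= `|h| -> is_derive (t + u) (1 : R) dg (ddg (t + u))) ->
 (forall u, `|u| <= `|h| -> `|ddg (t + u)| <= C) ->
 `|g (t + h) - g t - h * dg t| <= C * h ^+ 2.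
move=>g1 g2 HC;have E u: u *: (1 : R) + t = t + u by rewrite /GRing.scale /= mulr1 addrC.
have [s sh|s sh]:=@MVT_line R g t 1 h;rewrite E;first by have []:=g1 s sh.
rewrite E;have [_ ->]:=g1 s sh;move=>->.
have sh' (u : R) : `|u| <= `|s| -> `|u| <= `|h| by move/le_trans;apply.
have [u us|u us]:=@MVT_line R dg t 1 s;rewrite -?[`|u|]/(`|(u : R)|);rewrite E;first by have []:=g2 (u : R) (sh' (u : R) us).
rewrite E -mulrBr;have [_ ->]:=g2 (u : R) (sh' (u : R) us);move=>->;rewrite normrM normrM.
have -> : C * h ^+ 2 = `|h| * (`|h| * C).
 by rewrite mulrA -expr2 real_normK ?num_real // mulrC.
by rewrite ler_wpM2l // ler_pM // HC //;exact: (sh' (u : R)).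
Qed.

Lemma dv_shift (V : normedModType R) (K : V -> R) (x y v : V) d :
 is_derive (x - y) v K d -> is_derive x v (fun x => K (x - y)) d.
move=>D;apply: is_derive_of_line.
have := @is_derive_line V K (x - y) v 0 d;rewrite scale0r add0r=>/(_ D) H.
by apply: dv_eq H _ _=>// s;rewrite addrA.
Qed.

Section ShiftSmooth.
Variable m : nat.
Implicit Types K : 'rV[R]_m -> R.

Lemma Cn_shift b k K y : Cn b setT k K -> Cn b setT k (fun x => K (x - y)).
elim: k K=>[|k IH] K KS.
 have [Kc Kb]:=Cn_C0 KS;split=>//;split=>[x _|/Kb [C HC]];last by exists C => x _;exact: HC.
 apply/cont_epsP => e e0;have [d d0 Hd]:=(cont_epsP _ _).1 (Kc (x - y) I) e e0.
 by exists d=>// z zx;apply: Hd;rewrite opprB addrA subrK.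
apply: (@Cn_intro _ _ _ openT _ _ (fun i x => pd i K (x - y))).
- exact: Cn_C0 (IH _ (CnW KS)).
- by move=>x i _;apply: dv_shift;exact: Cn_derive KS _.
- by move=>i;apply: IH;exact: Cn_pd.
Qed.

Lemma pd_shift i K x y : Cn false setT 1 K -> pd i (fun x => K (x - y)) x = pd i K (x - y).
by move=>KS;have [_ <-]:=dv_shift (Cn_derive i KS (I : setT (x - y))). Qed.

End ShiftSmooth.

Lemma cube_closed m (p : 'rV[R]_m) r : closed (cube p r).
by have []:=(rV_compactP _).1 (@cube_compact m p r). Qed.

Section ConvConst.
Variable n : nat.
Local Notation V := 'rV[R]_(n + n).
Implicit Types (q K : V -> R) (f : V -> V).

Definition lapker (t : R) (w : V) : R := \sum_i pd i (pd i (ker 1 n t)) w.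

(** The gradient of the regularisation is, up to sign, the regularisation by the gradient of [K];
    where all of these vanish the function is constant along segments from the centre. *)
Lemma conv_const_ball q f K y0 r : lint q -> measurable_fun setT f -> Csm true setT K ->
 (forall i y, `|y - y0| < r -> conv q f (pd i K) y = 0) ->
 forall y, `|y - y0| < r -> conv q f K y = conv q f K y0.
move=>lq mf Ks H y yr;have Cs:=conv_Csm lq mf Ks.
have [s s01|s s01 E]:=@MVT_seg _ (conv q f K) y0 (y - y0).
 by have []:=csm_derive (y - y0) openT (Cs 1%N) (I : setT (s *: (y - y0) + y0)).
move: E;rewrite subrK;have [_ ->]:=csm_derive (y - y0) openT (Cs 1%N) (I : setT (s *: (y - y0) + y0)).
rewrite big1=>[/eqP|i _];first by rewrite subr_eq0=>/eqP.
rewrite conv_pd // H ?oppr0 ?mulr0 // addrK normrZ.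
case/andP: s01 => s0 s1;rewrite ger0_norm //;apply: le_lt_trans yr.
by rewrite ler_piMl.
Qed.

(** For |h| < t/2 the scale stays between t/2 and 2t, and the profile vanishes unless |w|^2 <= 2/t;
    hence its second derivative in the scale is bounded uniformly in [w]. [B] adds up the terms of
    that derivative. *)
Lemma ker_time_bound (t : R) : 0 < t -> exists2 B, 0 <= B & forall w h, `|h| < t / 2 ->
 `|ker (dpoly 1) n (t + h) w - ker (dpoly 1) n t w -
  h * (- (4 * t ^+ 2)^-1 * lapker t w)| <= B * h ^+ 2.
move=>t0;have [B1 B10 HB1]:=@flatp_bound (dpoly 1).
have [B2 B20 HB2]:=@flatp_bound (dpoly (dpoly 1)).
have [B3 B30 HB3]:=@flatp_bound (dpoly (dpoly (dpoly 1))).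
pose M k:=(2 * t) ^+ k;pose s0:=2 / t.
have M0 k: 0 <= M k by rewrite exprn_ge0 // mulr_ge0 // ltW.
have s00: 0 <= s0 by rewrite divr_ge0 // ltW.
pose B:=n%:R * (n.-1%:R * M n.-1.-1 * B1 + s0 * M n.-1 * B2) + s0 * (n%:R * M n.-1 * B2 + s0 * M n * B3).
have BB: 0 <= B by rewrite /B;do ?[exact: s00|exact: M0|exact: ler0n|apply: addr_ge0|apply: mulr_ge0].
exists B=>[//|w h ht].
pose s:=sqn w;have s_ge0: 0 <= s by exact: sqn_ge0.
pose g u : R := u ^+ n * flatp (dpoly 1) (1 - u * s).
pose dg u : R := n%:R * u ^+ n.-1 * flatp (dpoly 1) (1 - u * s)
 - s * u ^+ n * flatp (dpoly (dpoly 1)) (1 - u * s).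
pose ddg u : R := n%:R * (n.-1%:R * u ^+ n.-1.-1 * flatp (dpoly 1) (1 - u * s)
 - s * u ^+ n.-1 * flatp (dpoly (dpoly 1)) (1 - u * s)) -
 s * (n%:R * u ^+ n.-1 * flatp (dpoly (dpoly 1)) (1 - u * s)
 - s * u ^+ n * flatp (dpoly (dpoly (dpoly 1))) (1 - u * s)).
have gd u: is_derive u (1 : R) g (dg u) by exact: is_derive_kertime.
have -> : - (4 * t ^+ 2)^-1 * lapker t w = dg t.
 by have [_ <-]:=ker_time w t0;have [_ <-]:=gd t.
apply: (@taylor1 g dg ddg t h B) => u uh.
 apply: dv_eq (dvB (dvZ n%:R (is_derive_kertime (dpoly 1) n.-1 s _))
  (dvZ s (is_derive_kertime (dpoly (dpoly 1)) n s _))) _ _=>[v|//].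
 by rewrite /dg;ring.
have {uh ht} : `|u| < t / 2 by exact: le_lt_trans ht.
rewrite ltr_norml=>/andP[u1 u2];set a := t + u.
have a0: t / 2 <= a by rewrite /a;lra.
have a2: a <= 2 * t by rewrite /a;lra.
have ap: 0 < a by apply: lt_le_trans a0;rewrite divr_gt0.
have [as1|as1]:=leP 1 (a * s).
 rewrite /ddg !flatp_le0 ?subr_le0 // !(mulr0, subr0) normr0.
 exact: BB.
have ss0: s <= s0.
 rewrite /s0 ler_pdivlMr //;have : t / 2 * s < 1 by apply: le_lt_trans as1;rewrite ler_wpM2r.
 lra.
have aM k: a ^+ k <= M k by rewrite lerXn2r ?nnegrE ?mulr_ge0 // ltW.
have ak k: 0 <= a ^+ k by rewrite exprn_ge0 // ltW.
have as_: 1 - a * s <= 1 by rewrite gerBl mulr_ge0 // ltW.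
have T (x : R) k (F : R -> R) D B' : 0 <= x <= D -> 0 <= B' -> (forall t, t <= 1 -> `|F t| <= B') ->
 `|x * a ^+ k * F (1 - a * s)| <= D * M k * B'.
 move=>/andP[x0 xD] B'0 HF;rewrite !normrM (ger0_norm x0) (ger0_norm (ak k)).
 by rewrite !ler_pM ?mulr_ge0 ?HF.
rewrite /ddg;apply: le_trans (ler_normB _ _) _;rewrite !normrM ger0_norm // (ger0_norm s_ge0).
apply: lerD;[rewrite ler_wpM2l //|apply: ler_pM=>//].
 by apply: le_trans (ler_normB _ _) _;apply: lerD;apply: T;rewrite ?lexx ?ler0n ?s_ge0.
by apply: le_trans (ler_normB _ _) _;apply: lerD;apply: T;rewrite ?lexx ?ler0n ?s_ge0.
Qed.

Lemma ker_lap_smooth t : 0 < t ->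
 Csm true setT (lapker t).
by move=>t0 k;apply: Cn_sum=>// i _;do 2!apply: Csm_pd;exact: ker_smooth. Qed.

(** The derivative in the scale of the regularisation by the kernel is a multiple of the
    regularisation by its Laplacian. An equation in the space variable thus yields independence of
    the scale. *)
Lemma conv_ker_const q f y (T : R) : lint q -> measurable_fun setT f -> 0 < T ->
 (forall t, T < t -> conv q f (lapker t) y = 0) ->
 forall s t, T < s -> T < t ->
 conv q f (ker (dpoly 1) n s) y = conv q f (ker (dpoly 1) n t) y.
move=>lq mf T0 H s t Ts Tt.
have D0 u: T < u -> is_derive u (1 : R) (fun u => conv q f (ker (dpoly 1) n u) y) 0.
 move=>Tu;have u0:=lt_trans T0 Tu;have [B B0 HB]:=ker_time_bound u0.
 pose L w:=- (4 * u ^+ 2)^-1 * lapker u w.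
 have Ls: Csm true setT L by move=>k;apply: CnZ=>//;exact: ker_lap_smooth.
 have -> : 0 = rint (fun x => q x * L (f x - y)).
  rewrite (_ : (fun x => _) = fun x => - (4 * u ^+ 2)^-1 *
   (q x * lapker u (f x - y)));last first.
   by apply/funext => x;rewrite /L;ring.
  rewrite rintZ ?(H u Tu) ?mulr0 //;last exact: conv_lint lq mf (Cn_C0 (ker_lap_smooth u0 0%N)).
  by rewrite -[X in _ * X]/(conv q f _ y) H ?mulr0.
 apply: (@rint_derive _ (fun u x => q x * ker (dpoly 1) n u (f x - y)) _ (fun x => B * `|q x|) u (u / 2)).
 - by rewrite divr_gt0.
 - move=>h hu;apply: conv_lint lq mf (Cn_C0 (@ker_smooth _ _ _ _ _ 0%N)).
  by move: hu;rewrite ltr_norml=>/andP[];lra.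
 - exact: conv_lint lq mf (Cn_C0 (Ls 0%N)).
 - exact/lintZ/lint_abs.
 move=>h x hu;have -> : q x * ker (dpoly 1) n (u + h) (f x - y) - q x * ker (dpoly 1) n u (f x - y)
  - h * (q x * L (f x - y)) = q x * (ker (dpoly 1) n (u + h) (f x - y) - ker (dpoly 1) n u (f x - y) -
  h * L (f x - y)) by ring.
 by rewrite normrM mulrAC mulrC ler_wpM2r // HB.
apply: (@derive0_const (fun u => conv q f (ker (dpoly 1) n u) y) T (s + t))=>[u /andP[Tu _]| |];first exact: D0.
 by rewrite Ts ltrDl (lt_trans T0).
by rewrite Tt ltrDr (lt_trans T0).
Qed.

Definition hker (t : R) : V -> R := ker (dpoly 1) n t.
Definition hmass : R := rint (hker 1).

Lemma hker_ge0 t w : 0 < t -> 0 <= hker t w.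
move=>t0;rewrite /hker /ker mulr_ge0 ?exprn_ge0 ?(ltW t0) // /flatp;case: ifP=>// _.
by rewrite /dpoly derivC subr0 mul1r hornerXn mulr_ge0 ?expR_ge0 // exprn_even_ge0.
Qed.

Lemma hker_smooth t : 0 < t -> Csm true setT (hker t).
exact: ker_smooth. Qed.

Lemma hker_out t r w : 0 < t -> 0 < r -> t^-1 <= r ^+ 2 -> r <= `|w| -> hker t w = 0.
move=>t0 r0 tr rw;apply: ker_out=>//;apply: le_trans tr _.
by rewrite ler_sqr ?nnegrE // ltW.
Qed.

Lemma lint_ker (p : {poly R}) k t y : 0 < t -> lint (fun x : V => ker p k t (x - y)).
move=>t0;have r0: 0 < t^-1 + 1 by rewrite addr_gt0 ?invr_gt0.
have [_ /(_ isT)[C HC]]:=Cn_C0 (@ker_smooth n p k t t0 0%N).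
apply: (@lint_bounded _ _ C (`|y| + (t^-1 + 1)))=>[|x|x xM].
- apply: (@measurable_comp_shift _ id)=>//.
 exact: C0T_measurable (Cn_C0 (@ker_smooth n p k t t0 0%N)).
- exact: HC.
apply: ker_out=>//;have : t^-1 + 1 <= `|x - y|.
 by rewrite -(lerD2l `|y|);apply: le_trans (ltW xM) _;rewrite -{1}[x](subrK y) [leRHS]addrC ler_normD.
move=>xy;rewrite expr2;apply: (@le_trans _ _ `|x - y|);first by apply: le_trans xy;rewrite lerDl.
by rewrite ler_peMr // (le_trans _ xy) // lerDr invr_ge0 ltW.
Qed.

Lemma lint_bump z r : 0 < r -> lint (bump z r : V -> R).
move=>r0;apply: (@lint_csupp _ true (cube z r));first exact: Cn_C0 (bump_smooth z r0 0%N).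
 exact: cube_compact.
by move=>x /negP;rewrite -ltNge=>/ltW;exact: bump_out.
Qed.

(* A large bump function acts as the constant 1 on the support of the kernel. *)
Lemma conv_big (K : V -> R) M r y : 0 < M -> (forall w, r <= `|w| -> K w = 0) ->
 `|y| + r <= M -> conv (bump 0 (2 * M)) id K y = rint (fun x => K (x - y)).
move=>M0 Kr yM;congr rint;apply/funext => x /=.
have [xr|xr]:=leP r `|x - y|;first by rewrite Kr // mulr0.
rewrite bump_in ?mul1r ?mulr_gt0 // subr0 mulrC mulKf //.
rewrite -[x](subrK y);apply: le_trans (ler_normD _ _) _;apply: le_trans yM.
by rewrite addrC lerD2l ltW.
Qed.

Lemma rint_pd_shift i (K : V -> R) r y : Csm true setT K -> (forall w, r <= `|w| -> K w = 0) ->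
 rint (fun x => pd i K (x - y)) = 0.
move=>Ks Kr;have [|||_ <-]:=@rint_pd _ i (cube y r) (fun x => K (x - y)).
- by apply: Cn_shift;exact: Ks.
- exact: cube_compact.
- by move=>x /negP;rewrite -ltNge=>/ltW;exact: Kr.
by congr rint;apply/funext => x;rewrite pd_shift //;exact: Csm_Cn Ks 1%N.
Qed.

(** Translation invariance follows from the vanishing of integrals of derivatives: as a function of
    the shift the integral has zero gradient. The large bump supplies an integrable density that
    equals 1 wherever the kernel lives. *)
Lemma rint_shift (K : V -> R) r y : Csm true setT K -> (forall w, r <= `|w| -> K w = 0) ->
 rint (fun x => K (x - y)) = rint K.
move=>Ks Kr;pose r1:=Num.max r 1;have r10: 0 < r1 by rewrite lt_max ltr01 orbT.
have Kr1 w: r1 <= `|w| -> K w = 0 by rewrite ge_max=>/andP[/Kr].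
have Kp i w: r1 + 1 <= `|w| -> pd i K w = 0.
 move=>wr;have := @supp_pd _ setT (cube 0 r1) K i openT _ _;apply=> //.
 - exact: cube_closed.
 - by move=>x _ /negP;rewrite /cube /= subr0 -ltNge=>/ltW;exact: Kr1.
 - by rewrite /cube /= subr0 => H;move: (le_trans wr H);rewrite gerDl ler10.
pose M:=`|y| + 1 + (r1 + 1);have M0: 0 < M by rewrite /M;have := normr_ge0 y;lra.
have r1r: r1 <= r1 + 1 by rewrite lerDl.
have B z: `|z| <= `|y| + 1 -> `|z| + (r1 + 1) <= M by rewrite /M lerD2r.
have lb: lint (bump 0 (2 * M) : V -> R) by apply: lint_bump;rewrite mulr_gt0.
have H i z: `|z - 0| < `|y| + 1 -> conv (bump 0 (2 * M)) id (pd i K) z = 0.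
 rewrite subr0=>/ltW zy;rewrite (@conv_big _ M (r1 + 1)) //;first exact: rint_pd_shift Ks Kr1.
  exact: Kp.
 exact: B.
have := conv_const_ball lb (@measurable_id _ _ _) Ks H (y := y);rewrite subr0 ltrDl ltr01=>/(_ isT).
rewrite !(@conv_big _ M (r1 + 1)) //.
- by move=>->;congr rint;apply/funext => x;rewrite subr0.
- by move=>w /(le_trans r1r);exact: Kr1.
- by apply: B;rewrite normr0 addr_ge0.
- by move=>w /(le_trans r1r);exact: Kr1.
- by apply: B;rewrite lerDl.
Qed.

Lemma lapker_rint (q : V -> R) (f : V -> V) y t :  0 < t -> lint q -> measurable_fun setT f ->
 conv q f (lapker t) y = \sum_i conv q f (pd i (pd i (ker 1 n t))) y.
move=>t0 lq mf;rewrite -rint_sum=>[|i _].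
 by congr rint;apply/funext => x;rewrite mulr_sumr.
apply: conv_lint lq mf _;apply: (@Cn_C0 _ _ _ 0).
by do 2!apply: Csm_pd;exact: ker_smooth.
Qed.

(** The same argument in the scale: the derivative of the mass is the integral of a Laplacian. [T]
    is chosen below both [t] and 1. *)
Lemma rint_hker t y : 0 < t -> rint (fun x => hker t (x - y)) = hmass.
move=>t0;pose T:=Num.min t 1 / 2.
have [Tt T1 T0] : [/\ T < t, T < 1 & 0 < T].
 have m0: 0 < Num.min t 1 by rewrite lt_min t0 ltr01.
 have H: T < Num.min t 1 by rewrite /T;lra.
 by move: (H);rewrite lt_min=>/andP[-> ->];split=>//;rewrite divr_gt0.
pose r:=T^-1 + 1;have T'0: 0 < T^-1 by rewrite invr_gt0.
have r0: 0 < r by rewrite addr_gt0.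
have ko p k u w: T < u -> r <= `|w| -> ker (n := n) p k u w = 0.
 move=>Tu rw;have u0:=lt_trans T0 Tu;apply: ker_out=>//.
 apply: (@le_trans _ _ T^-1);first by rewrite lef_pV2 ?posrE // ltW.
 apply: (@le_trans _ _ r);first by rewrite lerDl.
 apply: (le_trans rw);rewrite expr2 ler_peMr //;apply: le_trans rw.
 by rewrite lerDr ltW.
have kp p k u i w: T < u -> r + 1 <= `|w| -> pd i (ker (n := n) p k u) w = 0.
 move=>Tu rw;rewrite pd_ker ko ?oppr0 ?mulr0 //.
 by apply: le_trans rw;rewrite lerDl.
rewrite (@rint_shift _ r)=>[||w];[|exact: hker_smooth|exact: ko].
pose M:=r + 3;have M0: 0 < M by rewrite /M;lra.
have B u: T < u -> rint (hker u) = conv (bump 0 (2 * M)) id (hker u) 0.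
 move=>Tu;rewrite (@conv_big _ M r)=>[|//|w|];last by rewrite normr0 /M;lra.
  by congr rint;apply/funext => x;rewrite subr0.
 exact: ko.
rewrite (B t Tt) /hmass (B 1 T1).
have lb: lint (bump 0 (2 * M) : V -> R) by apply: lint_bump;rewrite mulr_gt0.
apply: (@conv_ker_const _ _ _ T lb (@measurable_id _ _ _) T0 _ t 1 Tt T1) => u Tu.
have u0:=lt_trans T0 Tu.
rewrite (lapker_rint 0 u0 lb (@measurable_id _ _ _)) big1 // => i _.
rewrite (@conv_big _ M (r + 2))=>[|//|w rw|];last by rewrite normr0 /M;lra.
 apply: (@rint_pd_shift i _ (r + 1))=>[|w];last exact: kp.
 by apply: Csm_pd;exact: ker_smooth.
have := @supp_pd _ setT (cube 0 (r + 1)) (pd i (ker (n := n) 1 n u)) i openT _ _;apply=> //.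
- exact: cube_closed.
- by move=>x _ /negP;rewrite /cube /= subr0 -ltNge=>/ltW;exact: kp.
- by rewrite /cube /= subr0 => H;move: (le_trans rw H);lra.
Qed.

Lemma hmass_gt0 : 0 < hmass.
have hs:=hker_smooth ltr01;have hc:=(Cn_C0 (hs 0%N)).1 0 I.
have h0: 0 < hker 1 0.
 rewrite /hker /ker expr1n mul1r /sqn big1 ?mulr0 ?subr0=>[|i _];last by rewrite mxE expr0n.
 rewrite /flatp ltr01 /dpoly derivC subr0 mul1r hornerXn invr1 expr1n mul1r;exact: expR_gt0.
have [d d0 Hd]:=(cont_epsP _ _).1 hc _ (divr_gt0 h0 (ltr0n _ 2)).
pose A:=[set x : V | forall i, `|x ord0 i| <= d / 2].
have mA: measurable A by exact: measurable_cube.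
have lA: lint (\1_A : V -> R).
  apply: (@lint_bounded _ _ 1 d)=>[|x|x dx];first exact: measurable_indic.
   by rewrite indicE;case: (x \in A);rewrite ?normr1 ?normr0.
  rewrite indicE memNset //= => Ax;have : `|x| <= d / 2 by apply/rV_norm_le=>//;rewrite divr_ge0 // ltW.
  by lra.
have rA: rint (fun x => hker 1 0 / 2 * \1_A x) = hker 1 0 / 2 * (2 * (d / 2)) ^+ (n + n).
 rewrite rintZ //;congr (_ * _);apply: EFin_inj.
 rewrite -rint_EFin // integral_indic // setIT.
 by apply: etrans (@rvol_box (n + n) (d / 2) _) _=>//;lra.
apply: (@lt_le_trans _ _ (hker 1 0 / 2 * (2 * (d / 2)) ^+ (n + n))).
 by rewrite mulr_gt0 ?divr_gt0 ?exprn_gt0 // mulr_gt0 ?divr_gt0.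
rewrite -rA;apply: rint_le.
- exact: lintZ.
- by have := lint_ker (dpoly 1) n 0 ltr01;congr lint;apply/funext => x;rewrite subr0.
move=>x;rewrite indicE;case: (boolP (x \in A))=>[/set_mem xA|_];last by rewrite mulr0 hker_ge0.
have xd: `|x - 0| < d.
 rewrite subr0;apply: (@le_lt_trans _ _ (d / 2));last by lra.
 by apply/rV_norm_le=>//;rewrite divr_ge0 // ltW.
by have := Hd x xd;rewrite mulr1 ler_norml=>/andP[];lra.
Qed.

End ConvConst.

Opaque pd derive rint ker hker hmass bump.

(** * Symmetry of second derivatives *)

Section Schwarz.
Variables (m : nat) (b : bool) (U : set 'rV[R]_m).
Implicit Types f : 'rV[R]_m -> R.

Lemma second_difference f i j x s : Cn b U 2 f -> 0 < s ->
 (forall y, `|y - x| <= 2 * s -> U y) ->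
 exists2 y, `|y - x| <= 2 * s &
  f (s *: ebasis R j + (s *: ebasis R i + x)) - f (s *: ebasis R i + x)
  - (f (s *: ebasis R j + x) - f x) = s ^+ 2 * pd j (pd i f) y.
move=>f2 s0 HU;pose G y:=f (s *: ebasis R j + y) - f y.
have ne k t: `|t| <= s -> `|t *: ebasis R k| <= s.
 by move=>ts;rewrite normrZ;apply: le_trans ts;rewrite ler_piMr // norm_ebasis.
have ss: `|s| = s by rewrite gtr0_norm.
have GD t: `|t| <= s -> is_derive (t *: ebasis R i + x) (ebasis R i) G
  (pd i f (s *: ebasis R j + (t *: ebasis R i + x)) - pd i f (t *: ebasis R i + x)).
 move=>ts;apply: dvB.
  have D: is_derive ((t *: ebasis R i + x) - (- (s *: ebasis R j))) (ebasis R i) f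
   (pd i f (s *: ebasis R j + (t *: ebasis R i + x))).
   rewrite opprK addrC;apply: (Cn_derive (k := 1) i f2);apply: HU.
   rewrite addrA addrK mulr_natl mulr2n;apply: le_trans (ler_normD _ _) _.
   by rewrite lerD // ne // ss.
  apply: dv_eq (dv_shift D) _ _=>// y;by rewrite opprK addrC.
 apply: (Cn_derive (k := 1) i f2);apply: HU;rewrite addrK.
 apply: (@le_trans _ _ s);first exact: ne.
 by rewrite mulr_natl mulr2n lerDl ltW.
have [t|t]:=@MVT_line _ G x (ebasis R i) s;rewrite ss;first by case/GD.
move=>ts;have [_ ->]:=GD t ts;rewrite /G=>->.
have tU r: `|r| <= s -> `|(r *: ebasis R j + (t *: ebasis R i + x)) - x| <= 2 * s.
 move=>rs;rewrite addrA addrK mulr_natl mulr2n;apply: le_trans (ler_normD _ _) _.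
 by rewrite lerD // ne.
have [r|r]:=@MVT_line _ (pd i f) (t *: ebasis R i + x) (ebasis R j) s;rewrite ss.
 by move=>rs;apply: (Cn_derivable (Cn_pd i f2));apply: HU;exact: tU.
move=>rs ->;exists (r *: ebasis R j + (t *: ebasis R i + x));first exact: tU.
by rewrite mulrA expr2.
Qed.

(** Both mixed derivatives, taken at suitable points near [x], are the same second difference
    divided by s^2, an expression symmetric in [i] and [j]; continuity brings the points back to
    [x]. *)
Lemma pd_swap f i j x : open U -> Cn b U 2 f -> U x -> pd i (pd j f) x = pd j (pd i f) x.
move=>oU f2 Ux;apply/eqP;rewrite -subr_eq0 -normr_le0;apply/ler_addgt0Pl => e e0;rewrite addr0.
have e2: 0 < e / 2 by rewrite divr_gt0.
have cij:=(Cn_C0 (Cn_pd i (Cn_pd j f2))).1 x Ux.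
have cji:=(Cn_C0 (Cn_pd j (Cn_pd i f2))).1 x Ux.
have [d1 d10 H1]:=(cont_epsP _ _).1 cij _ e2.
have [d2 d20 H2]:=(cont_epsP _ _).1 cji _ e2.
have /nbhs_ballP[d3 /= d30 H3] := near_in oU Ux.
pose s:=Num.min d1 (Num.min d2 d3) / 3.
have m0: 0 < Num.min d1 (Num.min d2 d3) by rewrite !lt_min d10 d20 d30.
have s0: 0 < s by rewrite divr_gt0.
have sm: 2 * s < Num.min d1 (Num.min d2 d3) by rewrite /s;lra.
move: sm;rewrite !lt_min=>/and3P[sd1 sd2 sd3].
have HU y: `|y - x| <= 2 * s -> U y.
 by move=>yx;apply: H3;rewrite ball_lt;exact: le_lt_trans sd3.
have [y yx E1]:=second_difference i j f2 s0 HU.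
have [z zx E2]:=second_difference j i f2 s0 HU.
have E: pd i (pd j f) z = pd j (pd i f) y.
 have n0: s ^+ 2 != 0 by rewrite expf_neq0 // gt_eqF.
 have EE: s *: ebasis R i + (s *: ebasis R j + x) = s *: ebasis R j + (s *: ebasis R i + x) by exact: addrCA.
 apply: (mulfI n0);apply: etrans (esym E2) (etrans _ E1);rewrite EE.
 by move: (f _) (f _) (f _) (f _) => A B C D;clear;ring.
have := H1 z (le_lt_trans zx sd1);have := H2 y (le_lt_trans yx sd2);rewrite E.
set A := pd j (pd i f) y;set B := pd i (pd j f) x;set C := pd j (pd i f) x.
by move: A B C => A B C;clear;rewrite !ler_norml=>/andP[? ?] /andP[? ?];apply/andP;split;lra.
Qed.

Lemma C1_onP f : C1_on U f <-> Cn false U 1 f.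
split=>[[fd [fc fdc]]|[[fc _] [fd fdc]]].
 by split=>//;split=>// i;split=>//;split=>// x;exact: fdc.
by split=>//;split=>// i x Ux;have [[+ _] _]:=fdc i;apply.
Qed.

Lemma Csm_local f : (forall x, U x -> exists W, [/\ open W, W x & Csm false W f]) ->
 Csm false U f.
move=>H;apply/smooth_onP => ds;split=>x Ux;have [W [_ Wx /smooth_onP Ws]]:=H x Ux.
 by move=>i;have [+ _]:=Ws ds;apply.
by have [_ +]:=Ws ds;apply.
Qed.

End Schwarz.

Lemma rintB0 m (f g : 'rV[R]_m -> R) : lint f -> lint g ->
 rint f = 0 -> rint g = 0 -> rint (fun x => f x - g x) = 0.
by move=>lf lg f0 g0;rewrite rintB // f0 g0 subr0. Qed.

Lemma cr_cancel (A B C D E F : R) :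
 A * B + (- C) * D - (A * B + E * F - (C * D + E * F)) = 0.
by ring. Qed.

(** * Mean value property, smoothness and interior estimates of holomorphic functions *)

Section Holomorphic.
Variable n : nat.
Local Notation V := 'rV[R]_(n + n).
Implicit Types (U : set V) (u v : V -> R).

(** Multiplication by -i. Statements on real parts are transported to imaginary parts by it. *)
Lemma hol_rot U u v : open U -> holomorphic_on U u v -> holomorphic_on U v (fun x => - u x).
move=>oU [/C1_onP u1 [/C1_onP v1 CR]];split;first exact/C1_onP.
split;first by apply/C1_onP;exact: CnN.
move=>j x Ux;have [E1 E2]:=CR j x Ux.
have N i: pd i (fun x => - u x) x = - pd i u x by have [_ <-]:=dvN (Cn_derive i u1 Ux).
by rewrite !N E1 E2 !opprK.
Qed.

(** The bump turns [u] into an integrable density on the whole space; kernels of small support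
    centred near [z] only meet the cube on which the bump is 1. *)
Definition hq U u z r : V -> R := zext U (fun x => bump z r x * u x).

Lemma hq_lint U u z r : open U -> C0 false U u -> 0 < r -> cube z r `<=` U -> lint (hq U u z r).
move=>oU u0 r0 zU;have S: supp_in U (cube z r) (fun x => bump z r x * u x).
 by move=>x _ /negP;rewrite -ltNge=>/ltW xr;rewrite bump_out ?mul0r.
have C: Cn true setT 0 (hq U u z r).
 apply: (@Cn_zext _ false _ (cube z r))=>//;first exact: cube_compact.
 apply: CnM=>//;apply: (@Cn_sub _ _ _ setT)=>//.
 exact: Csm_Cn (bump_smooth z r0) 0%N.
apply: (@lint_csupp _ true (cube z r))=>//;first exact: Cn_C0 C;first exact: cube_compact.
by move=>x;exact: zext_off.
Qed.

(** With [a] the kernel moved to [z], u Lap(a) = div(u grad a) - grad u . grad a, and the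
    Cauchy-Riemann equations turn the last product into the sum over j of d_y(v a_x) - d_x(v a_y).
    Every term is a derivative with compact support. Only first derivatives of [u] and [v] occur, as
    the C^1 definition of holomorphy requires. *)
Lemma hol_lapker U u v z r t : open U -> holomorphic_on U u v -> 0 < r -> cube z r `<=` U ->
 0 < t -> t^-1 <= (r / 4) ^+ 2 -> conv (hq U u z r) id (lapker t) z = 0.
move=>oU [/C1_onP u1 [/C1_onP v1 CR]] r0 zU t0 tr.
pose a x:=ker 1 n t (x - z);pose K:=cube z (r / 2).
have r4: 0 < r / 4 by rewrite divr_gt0.
have as_ k: Cn false setT k a.
 by apply: Cn_shift;exact: Csm_Cn (@ker_smooth n 1 n t t0) k.
have aU k: Cn false U k a by exact: Cn_sub (@subsetT _ U) (as_ k).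
have KU: K `<=` U by move=>x xK;apply: zU;apply: le_trans xK _;lra.
have cK: compact K by exact: cube_compact.
have clK: closed K by exact: cube_closed.
have sa: supp_in setT K a.
 move=>x _ /negP;rewrite -ltNge => xr;apply: ker_out=>//;apply: le_trans tr _.
 by rewrite ler_sqr ?nnegrE ?(ltW r4) //;lra.
have sd i: supp_in setT K (pd i a) by exact: supp_pd.
have sdd i j: supp_in setT K (pd i (pd j a)) by exact: supp_pd.
have T i w: Cn false U 1 w -> forall k, lint (zext U (pd k (fun x => w x * pd i a x))) /\
  rint (zext U (pd k (fun x => w x * pd i a x))) = 0.
 move=>w1 k;apply: (@rint_pd_on _ k U K)=>//.
  by move=>x Ux xK;rewrite (sd i x I xK) mulr0.
 by apply: CnM=>//;exact: Cn_pd (aU 2%N).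
have Dm i w k x: Cn false U 1 w -> U x ->
  pd k (fun x => w x * pd i a x) x = pd k w x * pd i a x + w x * pd k (pd i a) x.
 move=>w1 Ux;have [_ <-]:=dvM (Cn_derive k w1 Ux) (Cn_derive k (Cn_pd i (aU 2%N)) Ux).
 by [].
have lapE x: lapker t (x - z) = \sum_i pd i (pd i a) x.
 have ks:=Csm_Cn (@ker_smooth n 1 n t t0).
 apply: eq_bigr => i _;have E1 y: pd i a y = pd i (ker 1 n t) (y - z) by exact: pd_shift (ks 1%N).
 rewrite (_ : pd i a = fun y => pd i (ker 1 n t) (y - z));last exact/funext.
 by apply/esym;exact: pd_shift (Cn_pd i (ks 2%N)).
have E x: hq U u z r x * lapker t (x - z) =
  \sum_i zext U (pd i (fun x => u x * pd i a x)) x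
  - \sum_(j < n) (zext U (pd (yi j) (fun x => v x * pd (xi j) a x)) x -
    zext U (pd (xi j) (fun x => v x * pd (yi j) a x)) x).
 have [Ux|nUx]:=pselect (U x);last first.
  rewrite /hq !zextF // mul0r big1 ?sub0r=>[|i _];last by rewrite zextF.
  rewrite big1 ?oppr0 // => j _.
  by apply: etrans (subrr (0 : R));congr (_ - _);exact: zextF.
 transitivity (u x * lapker t (x - z)).
  rewrite /hq zextT // lapE;have [xr|xr]:=leP `|x - z| (r / 2).
   by rewrite bump_in // mul1r.
  rewrite big1 ?mulr0 // => i _;apply: sdd=>//;by apply/negP;rewrite -ltNge.
 rewrite (eq_bigr (fun i => pd i u x * pd i a x + u x * pd i (pd i a) x));last first.
  by move=>i _;rewrite zextT // Dm.
 rewrite big_split /= -mulr_sumr -lapE big_split_ord /= -big_split /= addrAC -sumrB big1 ?add0r //.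
 move=>j _;have Z i k: zext U (pd k (fun x => v x * pd i a x)) x =
  pd k v x * pd i a x + v x * pd k (pd i a) x by rewrite zextT //;exact: Dm.
 have S:=pd_swap (xi j) (yi j) oU (aU 2%N) Ux;have [C1 C2]:=CR j x Ux.
 apply: etrans (_ : _ = pd (xi j) u x * pd (xi j) a x + pd (yi j) u x * pd (yi j) a x -
  (pd (yi j) v x * pd (xi j) a x + v x * pd (yi j) (pd (xi j) a) x -
  (pd (xi j) v x * pd (yi j) a x + v x * pd (xi j) (pd (yi j) a) x))) _.
  by congr (_ - (_ - _));exact: Z.
 by rewrite C1 C2 S;exact: cr_cancel.
transitivity (rint (fun x => \sum_i zext U (pd i (fun x => u x * pd i a x)) x
  - \sum_(j < n) (zext U (pd (yi j) (fun x => v x * pd (xi j) a x)) x -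
    zext U (pd (xi j) (fun x => v x * pd (yi j) a x)) x))).
 by congr rint;apply/funext => x;exact: E.
rewrite rintB ?rint_sum.
- rewrite !big1 ?subr0 // =>[j _|i _];last by have []:=T i u u1 i.
 have [l1 E1]:=T (xi j) v v1 (yi j);have [l2 E2]:=T (yi j) v v1 (xi j).
 exact: (rintB0 l1 l2 E1 E2).
- by move=>j _;apply: lintB;[have []:=T (xi j) v v1 (yi j)|have []:=T (yi j) v v1 (xi j)].
- by move=>i _;have []:=T i u u1 i.
- by apply: lint_sum => i _;have []:=T i u u1 i.
apply: lint_sum => j _.
by apply: lintB;[have []:=T (xi j) v v1 (yi j)|have []:=T (yi j) v v1 (xi j)].
Qed.

(** The weighted mean of [u] around [z] does not depend on the scale by [hol_lapker]; as the scale
    grows the kernel concentrates at [z] with constant mass, so the mean can only be [hmass] times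
    [u z]. *)
Lemma hol_mean U u v z r t : open U -> holomorphic_on U u v -> 0 < r -> cube z r `<=` U ->
 (r / 4) ^- 2 < t -> conv (hq U u z r) id (hker t) z = hmass n * u z.
move=>oU huv r0 zU tr;have [/C1_onP u1 _]:=huv.
have r4: 0 < r / 4 by rewrite divr_gt0.
have T0: 0 < (r / 4) ^- 2 by rewrite invr_gt0 exprn_gt0.
have lq:=hq_lint oU (Cn_C0 u1) r0 zU;have mi:=@measurable_id _ V setT.
have Z: U z by apply: zU;rewrite /cube /= subrr normr0 ltW.
have C s: (r / 4) ^- 2 < s -> conv (hq U u z r) id (hker s) z = conv (hq U u z r) id (hker t) z.
 move=>Ts;apply: (conv_ker_const lq mi T0)=>// w Tw;have w0:=lt_trans T0 Tw.
 apply: (hol_lapker oU huv r0 zU w0).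
 have : w^-1 <= ((r / 4) ^- 2)^-1 by apply: ltW;rewrite ltf_pV2 ?posrE.
 by rewrite invrK.
have m0:=hmass_gt0 n.
apply/eqP;rewrite -subr_eq0 -normr_le0;apply/ler_addgt0Pl => e e0;rewrite addr0.
have e1: 0 < e / hmass n by rewrite divr_gt0.
have [d d0 Hd]:=(cont_epsP _ _).1 ((Cn_C0 u1).1 z Z) _ e1.
pose d':=Num.min d (r / 2);have d'0: 0 < d' by rewrite lt_min d0 divr_gt0.
(* A scale large enough for the kernel to live where [u] is within the tolerance of [u z] and where
   the bump equals 1. *)
pose s:=Num.max (d' ^- 2) ((r / 4) ^- 2) + 1.
have s1: d' ^- 2 < s by rewrite ltr_pwDr // le_max lexx.
have s2: (r / 4) ^- 2 < s by rewrite ltr_pwDr // le_max lexx orbT.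
have s0:=lt_trans T0 s2.
rewrite -(C s s2) -(rint_hker z s0) mulrC -rintZ;last exact: lint_ker.
rewrite -rintB;[|exact: conv_lint lq mi (Cn_C0 (hker_smooth _ s0 0%N))|by apply: lintZ;exact: lint_ker].
have -> : e = rint (fun x => (e / hmass n) * hker s (x - z)).
 by rewrite rintZ ?rint_hker ?divfK ?gt_eqF //;exact: lint_ker.
apply: rint_abs_le.
- by apply: lintB;[exact: conv_lint lq mi (Cn_C0 (hker_smooth _ s0 0%N))|apply: lintZ;exact: lint_ker].
- by apply: lintZ;exact: lint_ker.
move=>x;rewrite -mulrBl normrM (ger0_norm (hker_ge0 _ s0)).
have [xd|xd]:=leP d' `|x - z|.
 rewrite (@hker_out _ s d') ?mulr0 // -[leRHS]invrK lef_pV2 ?posrE ?(ltW s1) //.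
 by rewrite invr_gt0 exprn_gt0.
apply: ler_wpM2r;first exact: hker_ge0.
move: xd;rewrite lt_min=>/andP[xd xr];rewrite /hq zextT.
 by rewrite bump_in ?mul1r ?Hd // ltW.
by apply: zU;rewrite /cube /=;apply: ltW;apply: lt_trans xr _;lra.
Qed.

Lemma bump_mask (z0 z x : V) r : 0 < r -> `|z - z0| < r / 4 -> `|x - z| < r / 4 ->
 bump z0 r x = 1.
move=>r0 zz xz;rewrite bump_in //.
have -> : x - z0 = (x - z) + (z - z0) by rewrite addrA subrK.
by apply: le_trans (ler_normD _ _) _;move: zz xz;set a := `|z - z0|;set b := `|x - z|;lra.
Qed.

Definition hscale (r : R) := (r / 16) ^- 2 + 1.

(** In [hol_mean] the density moves with the centre. Here it is frozen at [z0], which changes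
    nothing on the support of the kernel, and all dependence on [z] sits in the smooth kernel. The
    16 in [hscale] is the 4 of the mean value property applied to a cube of radius r/4. *)
Lemma hol_repr U u v z0 r z : open U -> holomorphic_on U u v -> 0 < r -> cube z0 r `<=` U ->
 `|z - z0| < r / 4 -> u z = (hmass n)^-1 * conv (hq U u z0 r) id (hker (hscale r)) z.
move=>oU huv r0 zU zz;have r4: 0 < r / 4 by rewrite divr_gt0.
have m0:=hmass_gt0 n;pose t:=hscale r.
have r16: 0 < (r / 16) ^- 2 by rewrite invr_gt0 exprn_gt0 // divr_gt0.
have ts: (r / 4 / 4) ^- 2 < t.
 have -> : r / 4 / 4 = r / 16 by field.
 by rewrite /t ltrDl.
have t0: 0 < t by rewrite /t /hscale addr_gt0.
have zU': cube z (r / 4) `<=` U.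
 move=>x xz;apply: zU;rewrite /cube /= -[x](subrK z) -addrA.
 by apply: le_trans (ler_normD _ _) _;move: xz;rewrite /cube /=;move: zz;set a := `|z - z0|;set b := `|x - z|;lra.
have H:=hol_mean oU huv r4 zU' ts.
suff -> : conv (hq U u z0 r) id (hker (hscale r)) z = hmass n * u z by rewrite mulKf // gt_eqF.
rewrite -H -/t.
congr rint;apply/funext => x;have [xz|xz]:=leP (r / 8) `|x - z|.
 rewrite (@hker_out _ t (r / 8)) ?mulr0 // ?divr_gt0 //.
 rewrite -[leRHS]invrK lef_pV2 ?posrE ?invr_gt0 ?exprn_gt0 ?divr_gt0 //.
 apply: le_trans (ltW ts);rewrite lef_pV2 ?posrE ?exprn_gt0 ?divr_gt0 //.
 by rewrite lerXn2r ?nnegrE ?divr_ge0 ?(ltW r0) //;lra.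
congr (_ * _);rewrite /hq /zext (bump_mask r0 zz);last by apply: lt_trans xz _;lra.
by rewrite bump_in // ltW //;apply: lt_le_trans xz _;lra.
Qed.

Lemma hol_smooth U u v : open U -> holomorphic_on U u v -> Csm false U u /\ Csm false U v.
move=>oU huv;suff H w w' : holomorphic_on U w w' -> Csm false U w.
 by split;[exact: H huv|exact: H (hol_rot oU huv)].
move=>hw;apply: Csm_local => z0 Uz0;have /nbhs_ballP[d /= d0 Hd] := near_in oU Uz0.
pose r:=d / 2;have r0: 0 < r by rewrite divr_gt0.
have zU: cube z0 r `<=` U.
 move=>x xz;apply: Hd;rewrite ball_lt;apply: le_lt_trans xz _.
 by rewrite /r;lra.
exists (ball z0 (r / 4));split;[exact: ball_open|by apply: ballxx;rewrite divr_gt0|].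
have [/C1_onP w1 _]:=hw;have lq:=hq_lint oU (Cn_C0 w1) r0 zU.
have t0: 0 < hscale r by rewrite addr_gt0 // invr_gt0 exprn_gt0 // divr_gt0.
have oB: open (ball z0 (r / 4)) by exact: ball_open.
apply: (@Csm_eq _ _ _ oB (fun z => (hmass n)^-1 * conv (hq U w z0 r) id (hker (hscale r)) z)).
 by move=>y;rewrite ball_lt => yz;rewrite -(hol_repr oU hw r0 zU yz).
move=>k;apply: (Cn_sub (@subsetT _ _));apply: CnZ=>//;apply: (Csm_Cn (b := true)).
by apply: conv_Csm;[|exact: measurable_id|exact: hker_smooth].
Qed.

Lemma conv_pds (q K : V -> R) f ds y : lint q -> measurable_fun setT f -> Csm true setT K ->
 pds ds (conv q f K) y = (-1) ^+ size ds * conv q f (pds ds K) y.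
move=>lq mf;elim: ds K y=>[|i ds IH] K y Ks /=;first by rewrite mul1r.
rewrite exprS mulN1r mulNr -mulrN -conv_pd //;last exact: Csm_pds.
rewrite (_ : pds ds (conv q f K) = fun y => (-1) ^+ size ds * conv q f (pds ds K) y);last first.
 by apply/funext => x;exact: IH.
have D:=Cn_derive i (conv_Csm lq mf (Csm_pds ds Ks) 1%N) (I : setT y).
by have [_ <-]:=dvZ ((-1) ^+ size ds) D.
Qed.

(** In the representation formula the derivatives fall on the kernel, so the constant depends on
    [ds] and [r] alone, neither on the open set nor on the function or the point. *)
Lemma hol_bound ds r : 0 < r -> exists2 C : R, 0 <= C & forall U u v z0, open U ->
 holomorphic_on U u v -> cube z0 r `<=` U ->
 `|pds ds u z0| <= C * rint (fun x => `|hq U u z0 r x|).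
move=>r0;have t0: 0 < hscale r by rewrite addr_gt0 // invr_gt0 exprn_gt0 // divr_gt0.
have hs:=@hker_smooth n _ t0.
have Kb:=Cn_C0 (Csm_pds ds hs 0%N);have [_ /(_ isT)[C HC]]:=Kb.
exists ((hmass n)^-1 * `|C|)=>[|U u v z0 oU huv zU].
 by rewrite mulr_ge0 // invr_ge0 ltW // hmass_gt0.
have [/C1_onP u1 _]:=huv;have lq:=hq_lint oU (Cn_C0 u1) r0 zU.
have mi:=@measurable_id _ V setT.
pose g z:=(hmass n)^-1 * conv (hq U u z0 r) id (hker (hscale r)) z.
have oB: open (ball z0 (r / 4)) by exact: ball_open.
have E y: ball z0 (r / 4) y -> u y = g y.
 by rewrite ball_lt => yz;rewrite (hol_repr oU huv r0 zU yz).
rewrite (pds_eqon oB ds E);last by apply: ballxx;rewrite divr_gt0.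
have Z c (w : V -> R) x : Csm true setT w -> pds ds (fun x => c * w x) x = c * pds ds w x.
 move=>ws;elim: ds x {Kb HC}=>[|i ds IH] x //=.
 rewrite (_ : pds ds _ = fun x => c * pds ds w x);last exact/funext.
 by have [_ <-]:=dvZ c (Cn_derive i (Csm_pds ds ws 1%N) (I : setT x)).
rewrite Z;last exact: conv_Csm.
rewrite conv_pds // !normrM normrX normrN1 expr1n mul1r ger0_norm;last first.
 by rewrite invr_ge0 ltW // hmass_gt0.
rewrite -mulrA ler_wpM2l ?invr_ge0 ?(ltW (hmass_gt0 n)) //.
by apply: conv_bound=>// x;apply: le_trans (HC x I) (ler_norm _).
Qed.

End Holomorphic.

Import complex perm fingroup.
Import ComplexField.
Local Open Scope complex_scope.
Local Notation Re := (@complex.Re _).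
Local Notation Im := (@complex.Im _).

(** * Complex-valued functions, Wirtinger derivatives and holomorphic maps *)

Section ComplexFunctions.
Variables (m : nat).
Local Notation V := 'rV[R]_m.
Implicit Types (F H : V -> R[i]) (U : set V).

Definition CC b U k F := Cn b U k (fun x => Re (F x)) /\ Cn b U k (fun x => Im (F x)).
Definition dvC i F x d := is_derive x (ebasis R i) (fun x => Re (F x)) (Re d) /\
 is_derive x (ebasis R i) (fun x => Im (F x)) (Im d).
Definition pdC i F x : R[i] := pd i (fun x => Re (F x)) x +i* pd i (fun x => Im (F x)) x.

Lemma cReD (a c : R[i]) : Re (a + c) = Re a + Re c. Proof. by case: a;case: c. Qed.
Lemma cImD (a c : R[i]) : Im (a + c) = Im a + Im c. Proof. by case: a;case: c. Qed.
Lemma cReM (a c : R[i]) : Re (a * c) = Re a * Re c - Im a * Im c. Proof. by case: a;case: c. Qed.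
Lemma cImM (a c : R[i]) : Im (a * c) = Re a * Im c + Im a * Re c. Proof. by case: a;case: c. Qed.
Lemma cReN (a : R[i]) : Re (- a) = - Re a. Proof. by case: a. Qed.
Lemma cImN (a : R[i]) : Im (- a) = - Im a. Proof. by case: a. Qed.
Lemma complexP (a c : R[i]) : Re a = Re c -> Im a = Im c -> a = c.
by case: a;case: c=>/= ? ? ? ? -> ->. Qed.

Lemma cRe_sum (I : Type) (r : seq I) (P : pred I) (F : I -> R[i]) :
 Re (\sum_(i <- r | P i) F i) = \sum_(i <- r | P i) Re (F i).
by apply: big_morph=>//;exact: cReD. Qed.

Lemma cIm_sum (I : Type) (r : seq I) (P : pred I) (F : I -> R[i]) :
 Im (\sum_(i <- r | P i) F i) = \sum_(i <- r | P i) Im (F i).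
by apply: big_morph=>//;exact: cImD. Qed.

Section Rules.
Variables (b : bool) (U : set V).
Hypothesis oU : open U.

Lemma CC_eq k F H : (forall y, U y -> F y = H y) -> CC b U k F -> CC b U k H.
by move=>FH [F1 F2];split;[apply: Cn_eq F1|apply: Cn_eq F2]=>// y Uy;rewrite FH. Qed.

Lemma CC_cst k c : CC b U k (fun _ => c). Proof. by split;exact: Cn_cst. Qed.

Lemma CC_real k (f : V -> R) : Cn b U k f -> CC b U k (fun x => (f x)%:C).
by move=>fk;split=>//;exact: Cn_cst. Qed.

Lemma CCD k F H : CC b U k F -> CC b U k H -> CC b U k (fun x => F x + H x).
move=>[F1 F2] [H1 H2];split.
 by apply: Cn_eq (CnD oU F1 H1)=>// y _;rewrite cReD.
by apply: Cn_eq (CnD oU F2 H2)=>// y _;rewrite cImD.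
Qed.

Lemma CCM k F H : CC b U k F -> CC b U k H -> CC b U k (fun x => F x * H x).
move=>[F1 F2] [H1 H2];split.
 by apply: Cn_eq (CnB oU (CnM oU F1 H1) (CnM oU F2 H2))=>// y _;rewrite cReM.
by apply: Cn_eq (CnD oU (CnM oU F1 H2) (CnM oU F2 H1))=>// y _;rewrite cImM.
Qed.

Lemma CCN k F : CC b U k F -> CC b U k (fun x => - F x).
by move/(CCM (CC_cst k (- 1)));apply: CC_eq => y _;rewrite mulN1r. Qed.

Lemma CC_conj k F : CC b U k F -> CC b U k (fun x => (F x)^*).
move=>[F1 F2];split;first by apply: Cn_eq F1=>// y _;case: (F y).
by apply: Cn_eq (CnN oU F2)=>// y _;case: (F y).
Qed.

Lemma CC_sum k (I : Type) (r : seq I) (P : pred I) (F : I -> V -> R[i]) :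
 (forall i, P i -> CC b U k (F i)) -> CC b U k (fun x => \sum_(i <- r | P i) F i x).
move=>Fk;elim: r=>[|i r IH].
 by apply: CC_eq (CC_cst k 0) => y _;rewrite big_nil.
case Pi: (P i);last by apply: CC_eq IH => y _;rewrite big_cons Pi.
by apply: CC_eq (CCD (Fk i Pi) IH) => y _;rewrite big_cons Pi.
Qed.

Lemma CC_prod k (I : Type) (r : seq I) (P : pred I) (F : I -> V -> R[i]) :
 (forall i, P i -> CC b U k (F i)) -> CC b U k (fun x => \prod_(i <- r | P i) F i x).
move=>Fk;elim: r=>[|i r IH].
 by apply: CC_eq (CC_cst k 1) => y _;rewrite big_nil.
case Pi: (P i);last by apply: CC_eq IH => y _;rewrite big_cons Pi.
by apply: CC_eq (CCM (Fk i Pi) IH) => y _;rewrite big_cons Pi.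
Qed.

Lemma CC_det k p (A : V -> 'M[R[i]]_p) : (forall i j, CC b U k (fun x => A x i j)) ->
 CC b U k (fun x => \det (A x)).
move=>Ak;apply: CC_sum => s _;apply: CCM;first exact: CC_cst.
by apply: CC_prod => i _;exact: Ak.
Qed.

Definition nsq (a : R[i]) : R := Re a ^+ 2 + Im a ^+ 2.

Lemma nsq_ge0 a : 0 <= nsq a. Proof. by rewrite addr_ge0 ?sqr_ge0. Qed.

Lemma nsq_eq0 a : (nsq a == 0) = (a == 0).
by rewrite paddr_eq0 ?sqr_ge0 // !sqrf_eq0 eq_complex. Qed.

Lemma normsqM a c : nsq (a * c) = nsq a * nsq c.
by rewrite /nsq cReM cImM;case: a c=>[p q] [r s] /=;ring. Qed.

Lemma mulCJ (a : R[i]) : a * a^* = (nsq a)%:C.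
by case: a => p q;apply: complexP;rewrite ?cReM ?cImM /nsq /=;ring. Qed.

Lemma Cn_nsq k F : CC b U k F -> Cn b U k (fun x => nsq (F x)).
move=>Fk;have [H _]:=CCM Fk (CC_conj Fk).
by apply: Cn_eq H=>// y _;rewrite mulCJ.
Qed.

Lemma invCE (a : R[i]) : a^-1 = ((nsq a)^-1)%:C * a^*.
have [->|a0]:=eqVneq a 0;first by rewrite invr0;apply: complexP;rewrite ?cReM ?cImM /= ?oppr0 !(mulr0,mul0r) ?subr0 ?addr0.
have n0: ((nsq a)%:C : R[i]) != 0 by rewrite (inj_eq (@complexI R) _ 0) nsq_eq0.
apply: (mulfI a0);rewrite divff // mulrCA mulCJ -rmorphM /= mulVf //.
by rewrite nsq_eq0.
Qed.

Lemma CCV k F c : 0 < c -> CC b U k F -> (forall x, U x -> F x != 0) ->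
 (b -> forall x, U x -> c <= nsq (F x)) -> CC b U k (fun x => (F x)^-1).
move=>c0 Fk F0 Fc;apply: (@CC_eq _ (fun x => ((nsq (F x))^-1)%:C * (F x)^*)).
 by move=>y _;rewrite -invCE.
apply: CCM;last exact: CC_conj.
apply: CC_real;apply: (CnV oU c0 (Cn_nsq Fk))=>[x Ux|b1 x Ux].
 by rewrite nsq_eq0 F0.
by rewrite ger0_norm ?nsq_ge0 // Fc.
Qed.

Lemma CC_dv k F x i : CC b U k.+1 F -> U x -> dvC i F x (pdC i F x).
by move=>[F1 F2] Ux;split;[exact: Cn_derive F1 _|exact: Cn_derive F2 _]. Qed.

Lemma CC_pd k F i : CC b U k.+1 F -> CC b U k (pdC i F).
by move=>[F1 F2];split;exact: Cn_pd. Qed.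

End Rules.

Lemma dvC_pd i F x d : dvC i F x d -> pdC i F x = d.
by move=>[[_ D1] [_ D2]];apply: complexP=>/=;[exact: D1|exact: D2]. Qed.

Lemma dvC_eq i F H x d e : dvC i F x d -> F =1 H -> d = e -> dvC i H x e.
by move=>D /funext <- <-. Qed.

Lemma dvC_cst i x c : dvC i (fun _ => c) x 0.
by split;exact: dv_cst. Qed.

Lemma dvCD i F H x d e : dvC i F x d -> dvC i H x e -> dvC i (fun x => F x + H x) x (d + e).
move=>[D1 D2] [E1 E2];split.
 by apply: dv_eq (dvD D1 E1) _ _=>[y|];rewrite cReD.
by apply: dv_eq (dvD D2 E2) _ _=>[y|];rewrite cImD.
Qed.

Lemma dvCM i F H x d e : dvC i F x d -> dvC i H x e ->
 dvC i (fun x => F x * H x) x (d * H x + F x * e).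
move=>[D1 D2] [E1 E2];split.
 apply: dv_eq (dvB (dvM D1 E1) (dvM D2 E2)) _ _=>[y|];first by rewrite cReM.
 by rewrite cReD !cReM;ring.
apply: dv_eq (dvD (dvM D1 E2) (dvM D2 E1)) _ _=>[y|];first by rewrite cImM.
by rewrite cImD !cImM;ring.
Qed.

Lemma dvCZ i F x c d : dvC i F x d -> dvC i (fun x => c * F x) x (c * d).
by move=>D;apply: dvC_eq (dvCM (dvC_cst i x c) D) _ _=>//;rewrite mul0r add0r. Qed.

Lemma dvC_conj i F x d : dvC i F x d -> dvC i (fun x => (F x)^*) x d^*.
move=>[D1 D2];split;first by apply: dv_eq D1 _ _=>[y|];[case: (F y)|case: d D2].
by apply: dv_eq (dvN D2) _ _=>[y|];[case: (F y)|case: d D1 D2].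
Qed.

Lemma dvC_sum i x (I : Type) (r : seq I) (P : pred I) (F : I -> V -> R[i]) (d : I -> R[i]) :
 (forall j, P j -> dvC i (F j) x (d j)) ->
 dvC i (fun y => \sum_(j <- r | P j) F j y) x (\sum_(j <- r | P j) d j).
move=>Fd;elim: r=>[|j r IH].
 by apply: dvC_eq (dvC_cst i x 0) _ _=>[y|];rewrite big_nil.
case Pj: (P j);last by apply: dvC_eq IH _ _=>[y|];rewrite big_cons Pj.
by apply: dvC_eq (dvCD (Fd j Pj) IH) _ _=>[y|];rewrite big_cons Pj.
Qed.

Lemma dvC_prod i x (I : eqType) (r : seq I) (F : I -> V -> R[i]) (d : I -> R[i]) : uniq r ->
 (forall j, dvC i (F j) x (d j)) ->
 dvC i (fun y => \prod_(j <- r) F j y) x (\sum_(j <- r) d j * \prod_(l <- r | l != j) F l x).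
move=>+ Fd;elim: r=>[_|j r IH /= /andP[jr /IH {}IH]].
 by apply: dvC_eq (dvC_cst i x 1) _ _=>[y|];rewrite big_nil.
apply: dvC_eq (dvCM (Fd j) IH) _ _=>[y|];rewrite big_cons //.
congr (_ + _).
 congr (_ * _);rewrite big_cons eqxx /= big_seq [RHS]big_seq_cond [RHS]big_mkcondr /=.
 by apply: eq_bigr => l lr;case: eqVneq jr=>// <-;rewrite lr.
rewrite mulr_sumr [LHS]big_seq [RHS]big_seq;apply: eq_bigr => l lr.
rewrite big_cons;case: eqVneq jr=>[->|_ _];first by rewrite lr.
by rewrite mulrCA.
Qed.

(** Jacobi's formula: the Leibniz expansion is differentiated row by row, and the determinant whose
    j-th row is replaced by its derivative is expanded along that row. *)
Lemma dvC_det i x p (A : V -> 'M[R[i]]_p) (dA : 'M[R[i]]_p) :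
 (forall j k, dvC i (fun y => A y j k) x (dA j k)) ->
 dvC i (fun y => \det (A y)) x (\sum_j \sum_k dA j k * cofactor (A x) j k).
move=>Ad;pose Aj j : 'M[R[i]]_p := \matrix_(a, c) if a == j then dA a c else A x a c.
have E j: \sum_k dA j k * cofactor (A x) j k = \det (Aj j).
 rewrite (expand_det_row _ j);apply: eq_bigr => k _;rewrite mxE eqxx;congr (_ * _).
 rewrite /cofactor;congr (_ * \det _);apply/matrixP => a c;rewrite !mxE.
 by rewrite eq_sym (negbTE (neq_lift _ _)).
rewrite (eq_bigr _ (fun j _ => E j)).
have H (s : 'S_p) : dvC i (fun y => (-1) ^+ s * \prod_j A y j (s j)) x
 ((-1) ^+ s * \sum_j dA j (s j) * \prod_(l | l != j) A x l (s l)).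
 apply: dvCZ;apply: dvC_eq (dvC_prod (index_enum_uniq _) (fun j => Ad j (s j))) _ _=>//.
apply: dvC_eq (dvC_sum _ (fun s _ => H s)) _ _=>//.
rewrite (eq_bigr _ (fun s _ => mulr_sumr _ _ _ _)) exchange_big /=;apply: eq_bigr => j _.
apply: eq_bigr => s _;congr (_ * _);rewrite [RHS](bigD1 j) //= !mxE eqxx;congr (_ * _).
by apply: eq_bigr => l /negbTE lj;rewrite mxE lj.
Qed.

End ComplexFunctions.

Section HolomorphicC.
Variable n : nat.
Local Notation V := 'rV[R]_(n + n).
Implicit Types (F H : V -> R[i]) (U : set V).

Definition hol U F := holomorphic_on U (fun x => Re (F x)) (fun x => Im (F x)).

Lemma holP U F : hol U F <-> CC false U 1 F /\
 forall j x, U x -> pdC (yi j) F x = 'i * pdC (xi j) F x.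
split=>[[/C1_onP F1 [/C1_onP F2 CR]]|[[F1 F2] CR]].
 split=>// j x Ux;have [E1 E2]:=CR j x Ux.
 by apply: complexP;rewrite ?cReM ?cImM /= ?E1 ?E2;ring.
split;first exact/C1_onP;split;first exact/C1_onP.
move=>j x Ux;have := CR j x Ux;rewrite /pdC => E.
have := congr1 Re E;have := congr1 Im E;rewrite cReM cImM /= =>-> ->.
by split;ring.
Qed.

Variable U : set V.
Hypothesis oU : open U.

Lemma hol_CC k F : hol U F -> CC false U k F.
by move=>/(hol_smooth oU)[F1 F2];split. Qed.

Lemma hol_dv F x i : hol U F -> U x -> dvC i F x (pdC i F x).
by move=>/(hol_CC 1%N) F1 Ux;exact: CC_dv F1 Ux. Qed.

Lemma hol_CR F x j : hol U F -> U x -> pdC (yi j) F x = 'i * pdC (xi j) F x.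
by move=>/holP[_ +] Ux;apply. Qed.

Lemma hol_cst c : hol U (fun _ => c).
apply/holP;split=>[|j x _];first exact: CC_cst.
by rewrite !(dvC_pd (dvC_cst _ x c)) mulr0.
Qed.

Lemma holD F H : hol U F -> hol U H -> hol U (fun x => F x + H x).
move=>hF hH;have [F1 FC]:=(holP U F).1 hF;have [H1 HC]:=(holP U H).1 hH.
apply/holP;split=>[|j x Ux];first exact: CCD.
rewrite !(dvC_pd (dvCD (hol_dv _ hF Ux) (hol_dv _ hH Ux))).
by rewrite FC // HC // mulrDr.
Qed.

Lemma holM F H : hol U F -> hol U H -> hol U (fun x => F x * H x).
move=>hF hH;have [F1 FC]:=(holP U F).1 hF;have [H1 HC]:=(holP U H).1 hH.
apply/holP;split=>[|j x Ux];first exact: CCM.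
rewrite !(dvC_pd (dvCM (hol_dv _ hF Ux) (hol_dv _ hH Ux))).
rewrite FC // HC //;move: (pdC _ F x) (pdC _ H x) (F x) (H x);clear => A B C D.
by ring.
Qed.

Lemma hol_eq F H : (forall x, U x -> F x = H x) -> hol U F -> hol U H.
move=>FH /holP[F1 FC];apply/holP;split=>[|j x Ux];first exact: CC_eq F1.
have E i: pdC i H x = pdC i F x.
 by rewrite /pdC;congr Complex;apply: (pd_eqon oU)=>// y Uy;rewrite FH.
by rewrite !E FC.
Qed.

Lemma hol_sum (I : Type) (r : seq I) (P : pred I) (F : I -> V -> R[i]) :
 (forall i, P i -> hol U (F i)) -> hol U (fun x => \sum_(i <- r | P i) F i x).
move=>Fk;elim: r=>[|i r IH].
 by apply: hol_eq (hol_cst 0) => y _;rewrite big_nil.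
case Pi: (P i);last by apply: hol_eq IH => y _;rewrite big_cons Pi.
by apply: hol_eq (holD (Fk i Pi) IH) => y _;rewrite big_cons Pi.
Qed.

Lemma hol_prod (I : Type) (r : seq I) (P : pred I) (F : I -> V -> R[i]) :
 (forall i, P i -> hol U (F i)) -> hol U (fun x => \prod_(i <- r | P i) F i x).
move=>Fk;elim: r=>[|i r IH].
 by apply: hol_eq (hol_cst 1) => y _;rewrite big_nil.
case Pi: (P i);last by apply: hol_eq IH => y _;rewrite big_cons Pi.
by apply: hol_eq (holM (Fk i Pi) IH) => y _;rewrite big_cons Pi.
Qed.

Lemma hol_det p (A : V -> 'M[R[i]]_p) : (forall i j, hol U (fun x => A x i j)) ->
 hol U (fun x => \det (A x)).
move=>Ak;apply: hol_sum => s _;apply: holM;first exact: hol_cst.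
by apply: hol_prod => i _;exact: Ak.
Qed.

Lemma pdCC F i j x : CC false U 2 F -> U x -> pdC i (pdC j F) x = pdC j (pdC i F) x.
move=>[F1 F2] Ux;apply: complexP;rewrite /pdC /=.
 exact: (pd_swap i j oU F1 Ux).
exact: (pd_swap i j oU F2 Ux). Qed.

Lemma hol_pd F k : hol U F -> hol U (pdC (xi k) F).
move=>hF;have [_ FC]:=(holP U F).1 hF;have F2:=hol_CC 2 hF.
apply/holP;split=>[|j x Ux];first exact: CC_pd.
rewrite pdCC // [pdC (xi j) _ x]pdCC //.
have E: pdC (xi k) (pdC (yi j) F) x = pdC (xi k) (fun x => 'i * pdC (xi j) F x) x.
 by rewrite [LHS]/pdC [RHS]/pdC;congr Complex;apply: (pd_eqon oU)=>// y Uy;rewrite FC.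
rewrite E;exact: dvC_pd (dvCZ 'i (CC_dv _ (CC_pd (xi j) F2) Ux)).
Qed.

(* The two components of a map V -> V read as n complex functions. *)
Definition comp (f : V -> V) (j : 'I_n) : V -> R[i] :=
 fun x => f x ord0 (xi j) +i* f x ord0 (yi j).

Lemma holomorphic_mapP f : holomorphic_map_on U f <-> forall j, hol U (comp f j).
by []. Qed.

Lemma hol_map f j : holomorphic_map_on U f -> hol U (comp f j).
exact. Qed.

Lemma sum_xy (A : nmodType) (F : 'I_(n + n) -> A) :
 \sum_i F i = \sum_(j < n) (F (xi j) + F (yi j)).
by rewrite big_split_ord big_split. Qed.

(** The Wirtinger derivative d/dw_j of a real function; [dz] below is the same operator for
    complex-valued functions. *)
Definition dw (j : 'I_n) (phi : V -> R) (y : V) : R[i] :=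
 2^-1 * (pd (xi j) phi y -i* pd (yi j) phi y).

Definition dz (k : 'I_n) F x : R[i] := 2^-1 * (pdC (xi k) F x - 'i * pdC (yi k) F x).

Lemma map_comp (f : V -> V) k : holomorphic_map_on U f -> forall l, Cn false U k (fun x => f x ord0 l).
move=>hf l;case: (split_ordP l) => j ->.
 have [H1 _]:=hol_CC k (hol_map j hf);exact: H1.
have [_ H1]:=hol_CC k (hol_map j hf);exact: H1.
Qed.

Lemma pd_comp_map (W : set V) (f : V -> V) (phi : V -> R) i x : open W ->
 holomorphic_map_on U f -> (forall y, U y -> W (f y)) -> Cn false W 1 phi -> U x ->
 pd i (fun y => phi (f y)) x = \sum_(j < n) (pd (xi j) phi (f x) * Re (pdC i (comp f j) x) +
  pd (yi j) phi (f x) * Im (pdC i (comp f j) x)).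
move=>oW hf fU ph1 Ux.
have [_ E]:=@C1_chain false _ _ U W phi f 0 x i oU oW ph1 (fun l => Cn_derivable (map_comp 1 hf l) Ux) (fU _ Ux).
by apply: etrans E (sum_xy _).
Qed.

(** [f] being holomorphic, the conjugate part of the chain rule drops out and only the derivatives
    d/dw_j of [phi] appear. *)
Lemma dz_comp (W : set V) (f : V -> V) (phi : V -> R) k x : open W ->
 holomorphic_map_on U f -> (forall y, U y -> W (f y)) -> Cn false W 1 phi -> U x ->
 dz k (fun y => (phi (f y))%:C) x = \sum_j dw j phi (f x) * pdC (xi k) (comp f j) x.
move=>oW hf fU ph1 Ux.
have D i:=pd_comp_map i oW hf fU ph1 Ux.
have CR j:=hol_CR k (hol_map j hf) Ux.
have E0 i: pdC i (fun y => (phi (f y))%:C) x = (pd i (fun y => phi (f y)) x)%:C.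
 by apply: complexP=>//;have [_ Ec]:=dv_cst x (ebasis R i) (0 : R);exact: Ec.
rewrite /dz !E0 !D /dw raddf_sum [X in _ - _ * X]raddf_sum /= mulr_sumr -sumrB mulr_sumr.
have C1 j: pd (yi k) (fun y => f y ord0 (xi j)) x = - pd (xi k) (fun y => f y ord0 (yi j)) x.
 by have := congr1 Re (CR j);rewrite cReM /= mul0r mul1r sub0r.
have C2 j: pd (yi k) (fun y => f y ord0 (yi j)) x = pd (xi k) (fun y => f y ord0 (xi j)) x.
 by have := congr1 Im (CR j);rewrite cImM /= mul0r mul1r add0r.
apply: eq_bigr => j _;rewrite C1 C2 -mulrA;congr (_ * _);rewrite /pdC /comp /=.
move: (pd _ phi _) (pd _ phi _) (pd _ _ x) (pd _ _ x);clear => p q c d.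
by apply: complexP;rewrite ?(cReD,cImD,cReM,cImM,cReN,cImN) /= ?(cReD,cImD,cReM,cImM,cReN,cImN) /=;ring.
Qed.

Lemma half_C : (2^-1 : R[i]) = (2^-1 : R)%:C.
by rewrite fmorphV rmorph_nat. Qed.

Lemma Re_dz k F x : Re (dz k F x) =
 2^-1 * (pd (xi k) (fun x => Re (F x)) x + pd (yi k) (fun x => Im (F x)) x).
by rewrite /dz half_C cReM cReD cReN cReM /=;ring. Qed.

Lemma Im_dz k F x : Im (dz k F x) =
 2^-1 * (pd (xi k) (fun x => Im (F x)) x - pd (yi k) (fun x => Re (F x)) x).
by rewrite /dz half_C cImM cImD cImN cImM /=;ring. Qed.

Lemma pdC_comp (W : set V) (f : V -> V) F i x : open W -> holomorphic_map_on U f ->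
 (forall y, U y -> W (f y)) -> hol W F -> U x ->
 pdC i (fun x => F (f x)) x = \sum_j pdC (xi j) F (f x) * pdC i (comp f j) x.
move=>oW hf fU /holP[[F1 F2] FC] Ux.
have CR j:=FC j (f x) (fU x Ux).
rewrite [LHS]/pdC (pd_comp_map i oW hf fU F1 Ux) (pd_comp_map i oW hf fU F2 Ux).
have [E1 E2] : (forall j, pd (yi j) (fun x => Re (F x)) (f x) = - pd (xi j) (fun x => Im (F x)) (f x)) /\
  (forall j, pd (yi j) (fun x => Im (F x)) (f x) = pd (xi j) (fun x => Re (F x)) (f x)).
 split=>j;[have := congr1 Re (CR j)|have := congr1 Im (CR j)];rewrite ?cReM ?cImM /= =>->.
  by rewrite mul0r mul1r sub0r.
 by rewrite mul0r mul1r add0r.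
apply: complexP;rewrite ?cRe_sum ?cIm_sum;apply: eq_bigr => j _;rewrite ?E1 ?E2 ?cReM ?cImM.
 by rewrite mulNr.
exact: addrC.
Qed.

Lemma hol_comp (W : set V) (f : V -> V) F : open W -> holomorphic_map_on U f ->
 (forall y, U y -> W (f y)) -> hol W F -> hol U (fun x => F (f x)).
move=>oW hf fU hF;have [[F1 F2] _]:=(holP W F).1 hF.
apply/holP;split=>[|j x Ux].
 by split;[apply: Cn_comp fU F1 _|apply: Cn_comp fU F2 _]=>// l;exact: map_comp.
rewrite !(pdC_comp _ oW hf fU hF Ux) mulr_sumr;apply: eq_bigr => k _.
by rewrite (hol_CR j (hol_map k hf) Ux) mulrCA.
Qed.

End HolomorphicC.

Lemma zext_eq m (U : set 'rV[R]_m) (h h' : 'rV[R]_m -> R) :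
 (forall x, U x -> h x = h' x) -> zext U h = zext U h'.
move=>hh;apply/funext => x;have [Ux|nUx]:=pselect (U x);first by rewrite !zextT // hh.
by rewrite !zextF.
Qed.

(** * The complex Jacobian, Piola identity and invariance of the pulled back integral *)

Section Jacobian.
Variable n : nat.
Local Notation V := 'rV[R]_(n + n).
Implicit Types (F H : V -> R[i]) (f : V -> V).

Definition jacm f x : 'M[R[i]]_n := \matrix_(j, k) pdC (xi k) (comp f j) x.
Definition jac f x : R[i] := \det (jacm f x).

Lemma hol_jac (D : set V) f : open D -> holomorphic_map_on D f -> hol D (jac f).
move=>oD hf;apply: hol_det=>// j k.
by apply: (hol_eq oD _ (hol_pd oD k (hol_map j hf))) => x;rewrite mxE.
Qed.

Lemma pdC_comp_id k i x : pdC (xi i) (comp (fun x : V => x) k) x = (k == i)%:R :> R[i].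
have [_ E1]:=dv_coord x (xi i) (xi k);have [_ E2]:=dv_coord x (xi i) (yi k).
apply: complexP;first by apply: etrans E1 _;rewrite (inj_eq (@lshift_inj _ _));case: eqP.
by apply: etrans E2 _;rewrite eq_rlshift;case: eqP.
Qed.

(** The product rule for d/dz of P Q W with [Q] holomorphic and [W] antiholomorphic: the derivative
    of [W] disappears. [I] stands for the imaginary unit, of which only I * I = -1 matters. *)
Lemma dz_product (I P Px Py Q Qx W Wx : R[i]) : I * I = -1 ->
 2^-1 * (((Px * Q + P * Qx) * W + P * Q * Wx) - I * ((Py * Q + P * (I * Qx)) * W + P * Q * (- I * Wx))) =
 2^-1 * (Px - I * Py) * (Q * W) + P * Qx * W.
move=>I2;have -> : 2^-1 * (((Px * Q + P * Qx) * W + P * Q * Wx) -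
  I * ((Py * Q + P * (I * Qx)) * W + P * Q * (- I * Wx))) =
 2^-1 * (Px - I * Py) * (Q * W) + 2^-1 * (P * Qx * W) * (1 - I * I) + 2^-1 * P * Q * Wx * (1 + I * I) by ring.
by rewrite I2;field.
Qed.

Lemma dz_rearrange (a c d e h : R[i]) : a * c * (d * h * e) = d * e * (a * (c * h)).
by ring. Qed.

(** Exchanging [k] and [c] maps one term to the other, by symmetry of the second derivatives of each
    component of [f]. *)
Lemma piola_cancel (A : comNzRingType) p (dA : 'I_p -> 'I_p -> 'I_p -> A) (B : 'I_p -> 'I_p -> A)
  (b : 'I_p -> A) : (forall k a c, dA k a c = dA c a k) ->
 \sum_k \sum_a \sum_c (dA k a c * B c a * b k - B k a * dA k a c * b c) = 0.
move=>dAC;rewrite exchange_big /= big1 // => a _.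
under eq_bigr do rewrite sumrB.
rewrite sumrB [X in _ - X]exchange_big /= -sumrB big1 // => k _.
by rewrite -sumrB big1 // => c;rewrite (dAC k a c) [B c a * _]mulrC subrr.
Qed.

Lemma Re_realM (a : R) (z : R[i]) : Re (a%:C * z) = a * Re z.
by rewrite cReM mul0r subr0. Qed.

Lemma Im_realM (a : R) (z : R[i]) : Im (a%:C * z) = a * Im z.
by rewrite cImM mul0r addr0. Qed.

Lemma Re_dw j (phi : V -> R) y : Re (dw j phi y) = 2^-1 * pd (xi j) phi y.
by rewrite /dw half_C Re_realM. Qed.

Lemma Im_dw j (phi : V -> R) y : Im (dw j phi y) = - (2^-1 * pd (yi j) phi y).
by rewrite /dw half_C Im_realM mulrN. Qed.

Variables (D G : set V) (f g : V -> V).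
Hypotheses (oD : open D) (oG : open G).
Hypotheses (hf : holomorphic_map_on D f) (hg : holomorphic_map_on G g).
Hypotheses (fD : forall x, D x -> G (f x)) (gG : forall y, G y -> D (g y)).
Hypotheses (gf : forall x, D x -> g (f x) = x) (fg : forall y, G y -> f (g y) = y).

Definition ijac x : 'M[R[i]]_n := jacm g (f x).

Lemma ijacE x : D x -> ijac x *m jacm f x = 1%:M.
move=>Dx;apply/matrixP => k i;rewrite !mxE -(pdC_comp_id k i x).
rewrite (eq_bigr (fun j => pdC (xi j) (comp g k) (f x) * pdC (xi i) (comp f j) x));last first.
 by move=>j;rewrite !mxE.
rewrite -(pdC_comp oD (xi i) oG hf fD (hol_map k hg) Dx).
by rewrite [RHS]/pdC;congr Complex;apply: (pd_eqon oD)=>// y Dy;rewrite /comp gf.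
Qed.

Lemma hol_ijac k j : hol D (fun x => ijac x k j).
apply: (hol_eq oD _ (hol_comp oD oG hf fD (hol_pd oG j (hol_map k hg)))) => x _.
by rewrite !mxE.
Qed.

Lemma jac_neq0 x : D x -> jac f x != 0.
move=>Dx;have := congr1 determinant (ijacE Dx);rewrite det_mulmx det1 => E.
by apply/eqP => E0;move: E;rewrite -/(jac f x) E0 mulr0=>/eqP;rewrite eq_sym oner_eq0.
Qed.

Lemma jac_inv x : D x -> jac g (f x) * jac f x = 1.
by move=>Dx;rewrite -det_mulmx ijacE // det1. Qed.

(* The Piola identity. *)
Lemma piola j x : D x -> \sum_k pdC (xi k) (fun x => jac f x * ijac x k j) x = 0.
move=>Dx;pose A:=jacm f x;pose B:=ijac x;pose w:=jac f x.
have BA: B *m A = 1%:M by exact: ijacE.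
have AB: A *m B = 1%:M by exact: mulmx1C.
have hA a c: hol D (fun x => jacm f x a c).
 by apply: (hol_eq oD _ (hol_pd oD c (hol_map a hf))) => y;rewrite mxE.
pose dA k : 'M[R[i]]_n := \matrix_(a, c) pdC (xi k) (fun x => jacm f x a c) x.
pose dB k : 'M[R[i]]_n := \matrix_(a, c) pdC (xi k) (fun x => ijac x a c) x.
have dvA k a c: dvC (xi k) (fun x => jacm f x a c) x (dA k a c).
 have -> : dA k a c = pdC (xi k) (fun x => jacm f x a c) x by rewrite [LHS]mxE.
 exact: (hol_dv oD (xi k) (hA a c) Dx).
have dvB k a c: dvC (xi k) (fun x => ijac x a c) x (dB k a c).
 have -> : dB k a c = pdC (xi k) (fun x => ijac x a c) x by rewrite [LHS]mxE.
 exact: (hol_dv oD (xi k) (hol_ijac a c) Dx).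
have dAC k a c: dA k a c = dA c a k.
 have E k' c': dA k' a c' = pdC (xi k') (pdC (xi c') (comp f a)) x.
  by rewrite [LHS]mxE;congr pdC;apply/funext => y;rewrite mxE.
 exact: (etrans (E k c) (etrans (pdCC oD (xi k) (xi c) (hol_CC oD 2 (hol_map a hf)) Dx) (esym (E c k)))).
have EB k: dB k = - (B *m dA k *m B).
 have H: dB k *m A + B *m dA k = 0.
  apply/matrixP => a c;rewrite !mxE.
  have D1:=dvC_sum _ (fun l (_ : true) => dvCM (dvB k a l) (dvA k l c)).
  have E:=dvC_pd (D1 (index_enum _)).
  rewrite -big_split;apply: etrans (esym E) _.
  have := dvC_pd (dvC_cst (xi k) x ((a == c)%:R));apply: etrans.
  rewrite [RHS]/pdC;congr Complex;apply: (pd_eqon oD)=>// y Dy;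
   by have := congr1 (fun M : 'M[R[i]]_n => M a c) (ijacE Dy);rewrite !mxE=>->.
 have H': dB k *m A = - (B *m dA k) by apply/eqP;rewrite -addr_eq0 H.
 by rewrite -[dB k]mulmx1 -AB mulmxA H' mulNmx.
have Ew k: dvC (xi k) (jac f) x (w * \sum_a \sum_c dA k a c * B c a).
 apply: dvC_eq (dvC_det (dvA k)) _ _=>//;rewrite mulr_sumr;apply: eq_bigr => a _.
 rewrite mulr_sumr;apply: eq_bigr => c _;rewrite [RHS]mulrCA;congr (_ * _).
 have -> : cofactor A a c = (\adj A) c a by rewrite mxE.
 have -> : \adj A = w *: B by rewrite -[\adj A]mul1mx -BA -mulmxA mul_mx_adj mul_mx_scalar.
 by rewrite mxE.
have E k: pdC (xi k) (fun x => jac f x * ijac x k j) x =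
  w * \sum_a \sum_c (dA k a c * B c a * B k j - B k a * dA k a c * B c j).
 rewrite (dvC_pd (dvCM (Ew k) (dvB k k j))) EB -/w -/B.
 rewrite -[w * _ * B k j]mulrA -mulrDr;congr (_ * _).
 have -> : (- (B *m dA k *m B)) k j = - \sum_a \sum_c B k a * dA k a c * B c j.
  rewrite [LHS]mxE [X in - X]mxE exchange_big /=;congr (- _);apply: eq_bigr => c _.
  by rewrite mxE mulr_suml.
 rewrite mulr_suml -sumrB;apply: eq_bigr => a _.
 by rewrite mulr_suml -sumrB.
rewrite (eq_bigr _ (fun k _ => E k)) -mulr_sumr.
by rewrite (@piola_cancel _ n (fun k a c => dA k a c) (fun a c => B a c) (fun k => B k j) dAC) mulr0.
Qed.

Lemma continuous_onG y : G y -> {for y, continuous g}.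
move=>Gy;apply: rV_continuous => l.
by have [+ _]:=Cn_C0 (map_comp oG 0 hg l);apply.
Qed.

Lemma compact_image K : compact K -> K `<=` G -> compact (g @` K).
move=>cK KG;apply: continuous_compact=>//;apply: continuous_in_subspaceT => y /set_mem Ky.
by apply: continuous_onG;exact: KG.
Qed.

(** Writing B for the inverse Jacobian matrix, the sum over k of d/dz_k of (phi o f) (u B_kj)
    conj(u) equals |u|^2 (d phi/dw_j) o f: the holomorphic factor is divergence free by Piola, and
    d/dz kills conj(u). Real and imaginary parts give the derivatives in x_j and y_j. *)
Lemma cov_ibp i (phi : V -> R) K : compact K -> K `<=` G -> Cn false G 1 phi -> supp_in G K phi ->
 lint (zext D (fun x => pd i phi (f x) * nsq (jac f x))) /\
 rint (zext D (fun x => pd i phi (f x) * nsq (jac f x))) = 0.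
move=>cK KG ph1 sphi;pose K':=g @` K.
have cK': compact K' by exact: compact_image.
have K'D: K' `<=` D by move=>_ [y /KG Gy <-];exact: gG.
pose w:=jac f;have hw: hol D w by exact: hol_jac.
pose T j k x : R[i] := (phi (f x))%:C * (w x * ijac x k j) * (w x)^*.
have hwB j k: hol D (fun x => w x * ijac x k j) by apply: holM=>//;exact: hol_ijac.
have P1: CC false D 1 (fun x => (phi (f x))%:C).
 apply: CC_real=>//;have H: Cn false D 1 (fun x => phi (f x)).
  by apply: (Cn_comp (b := false) oD oG fD)=>//;exact: map_comp.
 exact: H.
have T1 j k: CC false D 1 (T j k).
 by apply: CCM=>//;[apply: CCM=>//;exact: hol_CC|apply: CC_conj=>//;exact: hol_CC].
have sT j k x: D x -> ~ K' x -> T j k x = 0.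
 move=>Dx K'x;rewrite /T sphi ?mul0r //;first exact: fD.
 by move=>Kf;apply: K'x;exists (f x)=>//;exact: gf.
have I0 j k l: [/\ lint (zext D (pd l (fun x => Re (T j k x)))),
  rint (zext D (pd l (fun x => Re (T j k x)))) = 0,
  lint (zext D (pd l (fun x => Im (T j k x)))) &
  rint (zext D (pd l (fun x => Im (T j k x)))) = 0].
 have [R1 R2]:=T1 j k.
 have [|A1 A2]:=rint_pd_on l oD cK' K'D _ R1;first by move=>x Dx K'x;rewrite sT.
 by have [|A3 A4]:=rint_pd_on l oD cK' K'D _ R2;first by move=>x Dx K'x;rewrite sT.
have E j x: D x -> \sum_k dz k (T j k) x = (nsq (w x))%:C * dw j phi (f x).
 move=>Dx;have E1 k: dz k (T j k) x =
   dz k (fun x => (phi (f x))%:C) x * (w x * ijac x k j * (w x)^*) +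
   (phi (f x))%:C * pdC (xi k) (fun x => w x * ijac x k j) x * (w x)^*.
  have DT l:=dvC_pd (dvCM (dvCM (CC_dv l P1 Dx) (hol_dv oD l (hwB j k) Dx))
   (dvC_conj (hol_dv oD l hw Dx))).
  rewrite [LHS]/dz !DT (hol_CR k (hwB j k) Dx) (hol_CR k hw Dx).
  have -> : ('i * pdC (xi k) w x)^* = - 'i * (pdC (xi k) w x)^*.
   by case: (pdC _ w x) => p q;apply: complexP;rewrite /=;ring.
  apply: dz_product;exact: sqr_i.
 rewrite (eq_bigr _ (fun k _ => E1 k)) big_split /=.
 rewrite [X in _ + X = _](_ : _ = 0) ?addr0;last first.
  by rewrite -mulr_suml -mulr_sumr piola // mulr0 mul0r.
 have AB l: \sum_k jacm f x l k * ijac x k j = (l == j)%:R.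
  have := congr1 (fun M : 'M[R[i]]_n => M l j) (mulmx1C (ijacE Dx)).
  by rewrite [LHS]mxE [RHS]mxE.
 rewrite (eq_bigr (fun k => \sum_l (nsq (w x))%:C * (dw l phi (f x) * (jacm f x l k * ijac x k j)))).
  rewrite exchange_big (bigD1 j) //= [X in _ + X]big1 ?addr0=>[|l lj].
   rewrite -mulr_sumr -mulr_sumr;congr (_ * _);rewrite -[RHS]mulr1;congr (_ * _).
   by rewrite AB eqxx.
  by rewrite -mulr_sumr -mulr_sumr AB (negbTE lj) !mulr0.
 move=>k _;rewrite (dz_comp oD k oG hf fD ph1 Dx) mulr_suml;apply: eq_bigr => l _.
 have -> : jacm f x l k = pdC (xi k) (comp f l) x by rewrite mxE.
 by rewrite -mulCJ;exact: dz_rearrange.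
have ER j x: D x -> pd (xi j) phi (f x) * nsq (w x) =
  \sum_k (pd (xi k) (fun x => Re (T j k x)) x + pd (yi k) (fun x => Im (T j k x)) x).
 move=>Dx;have := congr1 (@complex.Re R) (E j x Dx).
 rewrite cRe_sum Re_realM (eq_bigr _ (fun k _ => Re_dz k (T j k) x)) -mulr_sumr Re_dw.
 set a := _ phi _;set s := \sum_k _=>/(congr1 ( *%R 2)).
 by rewrite mulVKf // =>->;field.
have EI j x: D x -> pd (yi j) phi (f x) * nsq (w x) =
  \sum_k (pd (yi k) (fun x => Re (T j k x)) x - pd (xi k) (fun x => Im (T j k x)) x).
 move=>Dx;have := congr1 (@complex.Im R) (E j x Dx).
 rewrite cIm_sum Im_realM (eq_bigr _ (fun k _ => Im_dz k (T j k) x)) -mulr_sumr Im_dw.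
 have -> : \sum_k (pd (yi k) (fun x => Re (T j k x)) x - pd (xi k) (fun x => Im (T j k x)) x) =
   - \sum_k (pd (xi k) (fun x => Im (T j k x)) x - pd (yi k) (fun x => Re (T j k x)) x).
  by rewrite -sumrN;apply: eq_bigr => k;rewrite opprB.
 set a := _ phi _;set s := \sum_k _=>/(congr1 ( *%R 2)).
 by rewrite mulVKf // =>->;field.
have Z (h : 'I_n -> V -> R) : (forall k, lint (zext D (h k)) /\ rint (zext D (h k)) = 0) ->
  lint (zext D (fun x => \sum_k h k x)) /\ rint (zext D (fun x => \sum_k h k x)) = 0.
 move=>H;have -> : zext D (fun x => \sum_k h k x) = fun x => \sum_k zext D (h k) x.
  by apply/funext => x;rewrite /zext mulr_sumr.
 split;first by apply: lint_sum => k;have []:=H k.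
 by rewrite rint_sum=>[|k _];[rewrite big1 // => k _|];have []:=H k.
have Zeq h h': (forall x, D x -> h x = h' x) -> lint (zext D h') /\ rint (zext D h') = 0 ->
  lint (zext D h) /\ rint (zext D h) = 0.
 by move=>/zext_eq ->.
have Zadd h h': lint (zext D h) -> rint (zext D h) = 0 -> lint (zext D h') -> rint (zext D h') = 0 ->
  (lint (zext D (fun x => h x + h' x)) /\ rint (zext D (fun x => h x + h' x)) = 0) /\
  (lint (zext D (fun x => h x - h' x)) /\ rint (zext D (fun x => h x - h' x)) = 0).
 move=>l1 z1 l2 z2;split.
  have -> : zext D (fun x => h x + h' x) = fun x => zext D h x + zext D h' x.
   by apply/funext => x;rewrite /zext mulrDr.
  by split;[exact: lintD|rewrite rintD // z1 z2 addr0].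
 have -> : zext D (fun x => h x - h' x) = fun x => zext D h x - zext D h' x.
  by apply/funext => x;rewrite /zext mulrBr.
 by split;[exact: lintB|exact: rintB0].
case: (split_ordP i) => j ->.
 apply: (Zeq _ _ (ER j));apply: Z => k.
 have [l1 z1 _ _]:=I0 j k (xi k);have [_ _ l2 z2]:=I0 j k (yi k).
 exact: (Zadd _ _ l1 z1 l2 z2).1.
apply: (Zeq _ _ (EI j));apply: Z => k.
have [l1 z1 _ _]:=I0 j k (yi k);have [_ _ l2 z2]:=I0 j k (xi k).
exact: (Zadd _ _ l1 z1 l2 z2).2.
Qed.

End Jacobian.

Lemma compact_cutoff m (K G : set 'rV[R]_m) : compact K -> open G -> K `<=` G ->
 exists (chi : 'rV[R]_m -> R) (K' : set 'rV[R]_m) (e : R),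
  [/\ Csm true setT chi, forall x, 0 <= chi x <= 1, compact K' /\ K' `<=` G,
    forall x, ~ K' x -> chi x = 0 &
    0 < e /\ forall p x, K p -> `|x - p| < e -> chi x = 1].
move=>cK oG KG.
have /choice[d Hd] : forall p, exists d : R, K p -> 0 < d /\ cube p d `<=` G.
 move=>p;have [Kp|nKp]:=pselect (K p);last by exists 0.
 have /nbhs_ballP[d /= d0 Hd] := near_in oG (KG p Kp);exists (d / 2) => _.
 split;first by rewrite divr_gt0.
 move=>x xp;apply: Hd;rewrite ball_lt;apply: le_lt_trans xp _.
 by rewrite ltr_pdivrMr // ltr_pMr // ltr1n.
have [s [e [Hs s01 e0 He]]]:=@partition_of_unity m K d cK (fun p Kp => (Hd p Kp).1).
pose K' x:=exists2 pc, pc \in s & cube pc.1 (d pc.1) x.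
exists (fun x => \sum_(pc <- s) pc.2 x), K', e;split=>//.
- move=>k;rewrite (_ : (fun x => _) = fun x => \sum_(pc <- s | pc \in s) pc.2 x);last first.
  by apply/funext => x;rewrite big_seq.
 by apply: Cn_sum=>// pc ps;have [_ H _]:=Hs pc ps.
- split=>[|x [pc ps xp]];last by have [Kp _ _]:=Hs pc ps;exact: (Hd _ Kp).2.
 have -> : K' = \bigcup_(pc in [set` s]) cube pc.1 (d pc.1).
  by apply/seteqP;split=>x [pc ps xp];exists pc.
 rewrite bigcup_seq;elim: (s)=>[|pc s' IH];first by rewrite big_nil;exact: compact0.
 by rewrite big_cons;apply: compactU=>//;exact: cube_compact.
move=>x K'x;rewrite big_seq big1 // => pc ps;have [_ _ H]:=Hs pc ps;apply: H.
by rewrite leNgt;apply/negP=>/ltW xp;apply: K'x;exists pc.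
Qed.

Lemma Cn_unbounded m b (U : set 'rV[R]_m) k (h : 'rV[R]_m -> R) :
 Cn b U k h -> Cn false U k h.
elim: k h=>[|k IH] h [[hc _] hk];first by split.
by case: hk => hd hk;split;[split|split=>// i;apply: IH;exact: hk].
Qed.

Lemma zext_swap m (U : set 'rV[R]_m) (h w : 'rV[R]_m -> R) (c d : R) x :
 (U x -> c * h x = d) -> c * zext U (fun x => h x * w x) x = zext U w x * d.
move=>H;have [Ux|nUx]:=pselect (U x);last by rewrite !zextF // mulr0 mul0r.
by rewrite !zextT // -H // mulrA mulrC.
Qed.

Lemma cvg_Z1 (c : R) (u : nat -> R) : u @ \oo --> (1 : R) ->
 (fun i => c * u i) @ \oo --> c.
by move=>u1;rewrite -[X in _ --> X](mulr1 c);apply: cvgM=>//;exact: cvg_cst. Qed.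

Lemma rint_mono_cvg m (h : nat -> 'rV[R]_m -> R) (F : 'rV[R]_m -> R) :
 (forall i, measurable_fun setT (h i)) -> (forall i x, 0 <= h i x) ->
 (forall x i j, (i <= j)%N -> h i x <= h j x) -> (forall x, h ^~ x @ \oo --> F x) ->
 (\int[@rvol m]_x (h i x)%:E)%E @[i --> \oo] --> (\int[@rvol m]_x (F x)%:E)%E.
move=>mh h0 hm hF.
have -> : (\int[@rvol m]_x (F x)%:E = \int[@rvol m]_x limn (fun i => (h i x)%:E))%E.
 apply: eq_integral => x _;apply/esym/cvg_lim=>//;apply: cvg_EFin;first exact: nearW.
 exact: hF.
apply: (@cvg_monotone_convergence _ _ _ (@rvol m) setT measurableT (fun i x => (h i x)%:E)).
- by move=>i;apply/measurable_EFinP;exact: mh.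
- by move=>i x _;rewrite lee_fin.
- by move=>x _ i j ij;rewrite lee_fin;exact: hm.
Qed.

(** * Change of variables under a biholomorphic map, up to a constant *)

Section ChangeOfVariables.
Variable n : nat.
Local Notation V := 'rV[R]_(n + n).
Variables (D G : set V) (f g : V -> V).
Hypotheses (oD : open D) (oG : open G).
Hypotheses (hf : holomorphic_map_on D f) (hg : holomorphic_map_on G g).
Hypotheses (fD : forall x, D x -> G (f x)) (gG : forall y, G y -> D (g y)).
Hypotheses (gf : forall x, D x -> g (f x) = x) (fg : forall y, G y -> f (g y) = y).

(** |det f'|^2, the real Jacobian determinant of a holomorphic map. *)
Definition wJ x : R := nsq (jac f x).
(** Extended by 0 to be measurable on the whole space; it is only used against densities that vanish
    off [D]. *)
Definition ft x : V := if `[< D x >] then f x else 0.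
(** A positive functional of [phi], which the section shows to be a multiple of Lebesgue integration
    over [G]. *)
Definition lam (phi : V -> R) : R := rint (zext D (fun x => phi (f x) * wJ x)).

Lemma wJ_smooth k : Cn false D k wJ.
by apply: Cn_nsq=>//;apply: hol_CC=>//;exact: hol_jac. Qed.

Lemma wJ_ge0 x : 0 <= wJ x. Proof. exact: nsq_ge0. Qed.

Lemma ftE x : D x -> ft x = f x. Proof. by rewrite /ft;case: asboolP. Qed.

Lemma ft_measurable : measurable_fun setT ft.
apply: measurable_rV => l;rewrite (_ : (fun x => _) = zext D (fun x => f x ord0 l)).
 exact: C0_meas (Cn_C0 (map_comp oD 0 hf l)).
apply/funext => x;have [Dx|nDx]:=pselect (D x);first by rewrite ftE // zextT.
by rewrite zextF // /ft;case: asboolP=>// _;rewrite mxE.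
Qed.

Lemma comp_smooth b k (phi : V -> R) : Cn b setT k phi -> Cn false D k (fun x => phi (f x)).
move=>ph;have ph': Cn false setT k phi by exact: Cn_unbounded ph.
by apply: (Cn_comp (b := false) oD openT)=>// l;exact: map_comp.
Qed.

Lemma lam_csupp (phi : V -> R) K : C0 false setT phi -> compact K -> K `<=` G ->
 (forall y, ~ K y -> phi y = 0) -> lint (zext D (fun x => phi (f x) * wJ x)).
move=>ph cK KG phK;have ph0: Cn false setT 0 phi by split.
have S: supp_in D (g @` K) (fun x => phi (f x) * wJ x).
 move=>x Dx nK;rewrite phK ?mul0r // => Kf;apply: nK;exists (f x)=>//;exact: gf.
have cK':=compact_image oG hg cK KG.
have K'D: g @` K `<=` D by move=>_ [y /KG Gy <-];exact: gG.
have C: Cn true setT 0 (zext D (fun x => phi (f x) * wJ x)).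
 by apply: (Cn_zext oD cK' K'D S (b := false));apply: CnM=>//;[exact: comp_smooth ph0|exact: wJ_smooth].
by apply: lint_csupp (Cn_C0 C) cK' _ => x;exact: zext_off.
Qed.

Definition cq y0 r := zext D (fun x => bump y0 r (f x) * wJ x).

Lemma cq_lint y0 r : 0 < r -> cube y0 r `<=` G -> lint (cq y0 r).
move=>r0 rG;apply: (@lam_csupp (bump y0 r) _ _ (@cube_compact _ y0 r) rG).
 exact: Cn_C0 (Csm_Cn (bump_smooth y0 r0) 0%N).
by move=>y /negP;rewrite -ltNge=>/ltW;exact: bump_out.
Qed.

Lemma conv_cq y0 r (K : V -> R) y : 0 < r -> `|y - y0| < r / 4 ->
 (forall w, r / 4 <= `|w| -> K w = 0) -> conv (cq y0 r) ft K y = lam (fun z => K (z - y)).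
move=>r0 yr Kr;congr rint;apply/funext => x.
have [Dx|nDx]:=pselect (D x);last by rewrite /cq !zextF // mul0r.
rewrite /cq !zextT // ftE //;have [fr|fr]:=leP (r / 4) `|f x - y|.
 by rewrite Kr // mulr0 mul0r.
by rewrite (bump_mask r0 yr) // mul1r mulrC.
Qed.

Lemma cov_zero y0 r i (K : V -> R) y : 0 < r -> cube y0 r `<=` G -> `|y - y0| < r / 4 ->
 Csm true setT K -> (forall w, r / 4 <= `|w| -> K w = 0) ->
 conv (cq y0 r) ft (pd i K) y = 0.
move=>r0 rG yr Ks Kr;have r4: 0 < r / 4 by rewrite divr_gt0.
have cl: closed (cube (0 : V) (r / 4)) by exact: cube_closed.
have sK: supp_in setT (cube 0 (r / 4)) K.
 by move=>w _ /negP;rewrite /cube /= subr0 -ltNge=>/ltW;exact: Kr.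
have sK': supp_in setT (cube y (r / 4)) (fun z => K (z - y)).
 by move=>w _ /negP;rewrite -ltNge=>/ltW;exact: Kr.
have dK w: r / 4 < `|w| -> pd i K w = 0.
 move=>wr;apply: (@supp_pd _ setT (cube 0 (r / 4)) K i openT cl sK w I);rewrite /cube /= subr0.
 by apply/negP;rewrite -ltNge.
have rG': cube y (r / 4) `<=` G.
 move=>x xy;apply: rG;rewrite /cube /= -[x](subrK y) -addrA;apply: le_trans (ler_normD _ _) _.
 by move: xy yr;rewrite /cube /=;set a := `|x - y|;set c := `|y - y0|;lra.
have ph1: Cn false G 1 (fun z => K (z - y)).
 by apply: Cn_sub (@subsetT _ G) _;apply: Cn_shift;exact: Csm_Cn Ks 1%N.
have [_ E]:=cov_ibp oD oG hf hg fD gG gf i (@cube_compact _ y (r / 4)) rG' ph1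
 (fun x _ => sK' x I).
rewrite /conv -[RHS]E;congr rint;apply/funext => x.
have [Dx|nDx]:=pselect (D x);last by rewrite /cq !zextF // mul0r.
rewrite /cq !zextT // ftE // pd_shift;last exact: Csm_Cn Ks 1%N.
have [fr|fr]:=leP `|f x - y| (r / 4);last by rewrite dK // mulr0 mul0r.
rewrite bump_in // ?mul1r 1?mulrC //.
rewrite -[f x](subrK y) -addrA;apply: le_trans (ler_normD _ _) _.
by move: fr yr;set a := `|f x - y|;set c := `|y - y0|;lra.
Qed.

Definition mt t y : R := lam (fun z => hker t (z - y)).

(** [cov_ibp] kills the first derivatives of the kernel and its Laplacian, so the average depends
    neither on the point nor on the scale. The condition on [t] confines the kernel to a cube of
    radius r/4. *)
Lemma mt_local y0 r : 0 < r -> cube y0 r `<=` G -> exists k : R,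
 forall t y, (r / 4) ^- 2 < t -> `|y - y0| < r / 4 -> mt t y = k.
move=>r0 rG;have r4: 0 < r / 4 by rewrite divr_gt0.
have T0: 0 < (r / 4) ^- 2 by rewrite invr_gt0 exprn_gt0.
have lq:=cq_lint r0 rG;have mf:=ft_measurable.
have ko p k t w: (r / 4) ^- 2 < t -> r / 4 <= `|w| -> ker (n := n) p k t w = 0.
 move=>Tt wr;have t0:=lt_trans T0 Tt;apply: ker_out=>//.
 apply: (@le_trans _ _ ((r / 4) ^+ 2));last by rewrite ler_sqr ?nnegrE ?(ltW r4).
 by have : t^-1 <= ((r / 4) ^- 2)^-1;[rewrite lef_pV2 ?posrE // ltW|rewrite invrK].
have kp p k t i w: (r / 4) ^- 2 < t -> r / 4 <= `|w| -> pd i (ker (n := n) p k t) w = 0.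
 by move=>Tt wr;rewrite pd_ker ko // oppr0 mulr0.
exists (mt ((r / 4) ^- 2 + 1) y0) => t y Tt yr.
have y00: `|y0 - y0| < r / 4 by rewrite subrr normr0.
have t0:=lt_trans T0 Tt.
rewrite /mt -(conv_cq r0 yr)=>[|w];last exact: ko.
rewrite -(conv_cq r0 y00)=>[|w];last by apply: ko;rewrite ltrDl.
have H i z: `|z - y0| < r / 4 -> conv (cq y0 r) ft (pd i (hker t)) z = 0.
 by move=>zr;apply: cov_zero=>//;[exact: hker_smooth|move=>w;exact: ko].
rewrite (conv_const_ball lq mf (hker_smooth n t0) H yr).
apply: (@conv_ker_const _ _ _ _ _ lq mf T0 _ t)=>//;last by rewrite ltrDl.
move=>u Tu;rewrite (lapker_rint y0 (lt_trans T0 Tu) lq mf) big1 // => i _.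
apply: cov_zero=>//;last by move=>w;exact: kp.
by apply: Csm_pd;apply: ker_smooth;exact: lt_trans Tu.
Qed.

(** The local constants agree by connectedness: the sets of points where a given value occurs are
    open and pairwise disjoint. *)
Lemma mt_const : connected G -> exists2 k : R, 0 <= k & forall y, G y ->
 exists2 r, 0 < r & forall t z, (r / 4) ^- 2 < t -> `|z - y| < r / 4 -> mt t z = k.
move=>cG;have [[y0 Gy0]|nG]:=pselect (exists y, G y);last first.
 by exists 0=>// y Gy;exfalso;apply: nG;exists y.
have H y: G y -> exists r k, 0 < r /\
  forall t z, (r / 4) ^- 2 < t -> `|z - y| < r / 4 -> mt t z = k.
 move=>Gy;have /nbhs_ballP[d /= d0 Hd] := near_in oG Gy.
 have r0: 0 < d / 2 by rewrite divr_gt0.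
 have [|k Hk]:=@mt_local y _ r0;last by exists (d / 2), k.
 move=>x xp;apply: Hd;rewrite ball_lt;apply: le_lt_trans xp _.
 by rewrite ltr_pdivrMr // ltr_pMr // ltr1n.
(* The points of [G] near which the averages take the value [k] at all large scales. *)
pose A k:=[set y | G y /\ exists2 r, 0 < r &
 forall t z, (r / 4) ^- 2 < t -> `|z - y| < r / 4 -> mt t z = k].
have oA k: open (A k).
 rewrite openE => y [Gy [r r0 Hr]];have /nbhs_ballP[d /= d0 Hd] := near_in oG Gy.
 apply/nbhs_ballP;exists (Num.min d (r / 8));first by rewrite /= lt_min d0 divr_gt0.
 move=>z;rewrite -ball_normE /ball_ /= lt_min=>/andP[zd zr].
 split;first by apply: Hd;rewrite -ball_normE.
 exists (r / 2);first by rewrite divr_gt0.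
 move=>t w wt wz;apply: Hr.
  apply: le_lt_trans wt;rewrite lef_pV2 ?posrE ?exprn_gt0 ?divr_gt0 //.
  by rewrite lerXn2r ?nnegrE ?divr_ge0 ?(ltW r0) //;lra.
 rewrite -[w](subrK z) -addrA;apply: le_lt_trans (ler_normD _ _) _.
 by move: zr wz;rewrite distrC;set a := `|z - y|;set c := `|w - z|;lra.
have [r [k [r0 Hr]]]:=H _ Gy0;exists k=>[|y Gy].
 have p: 0 < (r / 4) ^- 2 + 1 by rewrite addr_gt0 // invr_gt0 exprn_gt0 // divr_gt0.
 rewrite -(Hr ((r / 4) ^- 2 + 1) y0) ?ltrDl // ?subrr ?normr0 ?divr_gt0 //.
 apply: rint_ge0 => x;have [Dx|nDx]:=pselect (D x);last by rewrite zextF.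
 by rewrite zextT // mulr_ge0 ?wJ_ge0 //;exact: hker_ge0.
have AG: A k = G.
 apply: cG;first by exists y0;split=>//;exists r.
  by exists (A k)=>//;apply/seteqP;split=>[z []|z [_]].
 exists (~` \bigcup_(l in [set l | l != k]) A l).
  by apply: open_closedC;apply: bigcup_open => l _;exact: oA.
 apply/seteqP;split=>z.
  move=>[Gz [s s0 Hs]];split=>// -[l /= /eqP lk [_ [u u0 Hu]]];apply: lk.
  pose t:=(s / 4) ^- 2 + (u / 4) ^- 2 + 1.
  have p1: 0 < (s / 4) ^- 2 by rewrite invr_gt0 exprn_gt0 ?divr_gt0.
  have p2: 0 < (u / 4) ^- 2 by rewrite invr_gt0 exprn_gt0 ?divr_gt0.
  rewrite -(Hs t z) -?(Hu t z) ?subrr ?normr0 ?divr_gt0 // /t;lra.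
 move=>[Gz nz];have [s [l [s0 Hs]]]:=H z Gz;split=>//;exists s=>// t w wt wz.
 have [<-|lk]:=eqVneq l k;first exact: Hs.
 by exfalso;apply: nz;exists l=>//;split=>//;exists s.
by move: Gy;rewrite -AG => -[].
Qed.

Lemma hker_sym t (w : V) : hker t (- w) = hker t w.
Transparent hker ker.
by rewrite /hker /ker;congr (_ * flatp _ (1 - t * _));apply: eq_bigr => i _;rewrite mxE sqrrN.
Opaque hker ker.
Qed.

Lemma hker_symB t (y : V) x : D x -> hker t (f x - y) = hker t (y - ft x).
move=>Dx;have E: f x - y = - (y - ft x) by rewrite opprB ftE.
exact: (etrans (congr1 (hker t) E) (hker_sym t _)).
Qed.

Lemma unif_cont (phi : V -> R) K e : C0 false setT phi -> compact K -> (forall y, ~ K y -> phi y = 0) ->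
 0 < e -> exists2 d, 0 < d & forall x y, `|x - y| < d -> `|phi x - phi y| <= e.
move=>[ph _] cK phK e0.
pose P (x : V) d := forall y, `|y - x| < d -> `|phi y - phi x| <= e.
have [||d d0 Hd]:=@compact_radius _ K P cK.
- by move=>p d d' dd Pd y /lt_le_trans/(_ dd);exact: Pd.
- move=>p _;have e2: 0 < e / 2 by rewrite divr_gt0.
 have [d d0 Hd]:=(cont_epsP _ _).1 (ph p I) _ e2.
 exists (d / 2);first by rewrite divr_gt0.
 move=>x xp y yx;have H1: `|phi x - phi p| <= e / 2 by apply: Hd;apply: lt_le_trans xp _;lra.
 have H2: `|phi y - phi p| <= e / 2.
  apply: Hd;rewrite -[y](subrK x) -addrA;apply: le_lt_trans (ler_normD _ _) _.
  by move: xp yx;set a := `|x - p|;set c := `|y - x|;lra.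
 rewrite -[phi y](subrK (phi p)) -addrA;apply: le_trans (ler_normD _ _) _.
 rewrite [`|phi p - _|]distrC;move: H1 H2;set a := `|phi x - _|;set c := `|phi y - _|;lra.
exists d=>// x y xy;have [Ky|nKy]:=pselect (K y).
 by apply: (Hd y y Ky _ x xy);rewrite subrr normr0.
have [Kx|nKx]:=pselect (K x).
 by rewrite distrC;apply: (Hd x x Kx);rewrite ?subrr ?normr0 // distrC.
by rewrite !phK // subrr normr0 ltW.
Qed.

Lemma lint_C0c (phi : V -> R) K : C0 false setT phi -> compact K ->
 (forall y, ~ K y -> phi y = 0) -> lint phi.
exact: lint_csupp. Qed.

Lemma heat_approx (phi : V -> R) K e : C0 false setT phi -> compact K -> (forall y, ~ K y -> phi y = 0) ->
 0 < e -> exists2 T, 0 < T & forall t z, T < t ->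
  `|conv phi id (hker t) z - hmass n * phi z| <= e.
move=>ph cK phK e0;have m0:=hmass_gt0 n.
have [d d0 Hd]:=unif_cont ph cK phK (divr_gt0 e0 m0).
have T0: 0 < d ^- 2 by rewrite invr_gt0 exprn_gt0.
exists (d ^- 2)=>// t z Tt;have t0:=lt_trans T0 Tt.
have lp :=lint_C0c ph cK phK;have mi:=@measurable_id _ V setT.
have lk:=lint_ker (dpoly 1) n z t0.
have lc: lint (fun y => phi y * hker t (y - z)) by exact: conv_lint lp mi (Cn_C0 (hker_smooth n t0 0%N)).
rewrite -(rint_hker z t0) mulrC -rintZ //= -rintB //;last exact: lintZ.
have -> : e = rint (fun x => (e / hmass n) * hker t (x - z)).
 by rewrite rintZ // rint_hker // divfK // gt_eqF.
apply: rint_abs_le;[by apply: lintB=>//;exact: lintZ|exact: lintZ|].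
move=>x;rewrite -mulrBl normrM (ger0_norm (hker_ge0 _ t0)).
have [xz|xz]:=leP d `|x - z|.
 rewrite (hker_out t0 d0 _ xz) ?mulr0 //.
 have : t^-1 <= (d ^- 2)^-1 by rewrite lef_pV2 ?posrE // ltW.
 by rewrite invrK.
by apply: ler_wpM2r;[exact: hker_ge0|exact: Hd].
Qed.

(** Integrating the averages of the functional against [phi] is applying the functional to the
    average of [phi]; the kernel being even, the two points may be exchanged in it. *)
Lemma lam_tonelli (phi : V -> R) K t : C0 false setT phi -> compact K -> K `<=` G ->
 (forall y, ~ K y -> phi y = 0) -> (forall y, 0 <= phi y) -> 0 < t ->
 (forall y, K y -> lint (zext D (fun x => hker t (f x - y) * wJ x))) ->
 (\int[@rvol (n + n)]_y (phi y * mt t y)%:E)%E =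
 (\int[@rvol (n + n)]_x (zext D (fun x => conv phi id (hker t) (f x) * wJ x) x)%:E)%E.
move=>ph cK KG phK ph0 t0 lK;have lp :=lint_C0c ph cK phK.
have mi:=@measurable_id _ V setT;have hk:=Cn_C0 (hker_smooth n t0 0%N).
have mk: measurable_fun setT (hker t : V -> R) := C0T_measurable hk.
have mw: measurable_fun setT (zext D wJ) := C0_meas oD (Cn_C0 (wJ_smooth 0)).
have w0 x: 0 <= zext D wJ x.
 by have [Dx|nDx]:=pselect (D x);[rewrite zextT // wJ_ge0|rewrite zextF].
pose F (z : V * V) : \bar R := (zext D wJ z.1 * (phi z.2 * hker t (z.2 - ft z.1)))%:E.
have mF: measurable_fun setT F.
 apply/measurable_EFinP;apply: measurable_funM.
  exact: measurableT_comp mw measurable_fst.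
 apply: measurable_funM;first exact: measurableT_comp (lint_meas lp) measurable_snd.
 apply: measurableT_comp mk _;apply: measurable_rV => l.
 rewrite (_ : (fun z => _) = fun z : V * V => mcoor l z.2 - mcoor l (ft z.1));last first.
  by apply/funext => z;rewrite /mcoor !mxE.
 apply: measurable_funB;first exact: measurableT_comp (measurable_mcoor l) measurable_snd.
 apply: measurableT_comp (measurable_mcoor l) _.
 exact: measurableT_comp ft_measurable measurable_fst.
have F0 z: (0 <= F z)%E by rewrite lee_fin mulr_ge0 // mulr_ge0 //;exact: hker_ge0.
have E:=@fubini_tonelli _ _ V V R (@rvol (n + n)) (@rvol (n + n)) F mF F0.
transitivity (\int[@rvol (n + n)]_y \int[@rvol (n + n)]_x F (x, y))%E.
 apply: eq_integral => y _;have [Ky|nKy]:=pselect (K y);last first.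
  rewrite (phK y nKy) mul0r;apply/esym;apply: integral0_eq => x _.
  by rewrite /F /= (phK y nKy) mul0r mulr0.
 rewrite -[phi y * _]rintZ;last exact: lK.
 rewrite -rint_EFin;last by apply: lintZ;exact: lK.
 apply: eq_integral => x _;rewrite /F /=;congr EFin.
 apply: (@zext_swap _ D (fun x => hker t (f x - y)) wJ (phi y)) => Dx.
 exact: (congr1 ( *%R (phi y)) (hker_symB t y Dx)).
rewrite -E;apply: eq_integral => x _;rewrite /F /=.
have lc z: lint (fun y => phi y * hker t (y - z)) by exact: conv_lint lp mi hk.
rewrite rint_EFin;last exact/lintZ/lc.
rewrite rintZ;last exact: lc.
apply: (congr1 EFin);apply: etrans (mul1r _);apply/esym.
apply: (@zext_swap _ D (fun x => conv phi id (hker t) (f x)) wJ 1) => Dx.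
exact: (etrans (mul1r _) (congr1 (conv phi id (hker t)) (esym (ftE Dx)))).
Qed.

(** The functional is evaluated on the regularisation of [phi]. By Tonelli and [mt_const] the result
    is [k] times the integral of [phi]; by uniform convergence it tends to [hmass] times the
    functional at [phi], with an error controlled by a cut-off [chi] equal to 1 near the support. *)
Lemma lam_int : connected G -> exists2 k : R, 0 <= k & forall (phi : V -> R) K, C0 false setT phi -> compact K ->
 K `<=` G -> (forall y, ~ K y -> phi y = 0) -> (forall y, 0 <= phi y) ->
 hmass n * lam phi = k * rint phi.
move=>/mt_const[k k0 Hk];exists k=>// phi K ph cK KG phK ph0.
have m0:=hmass_gt0 n.
have [chi [K' [e0 [chs ch01 [cK' K'G] chK' [e00 che]]]]]:=compact_cutoff cK oG KG.
have chc:=Cn_C0 (Csm_Cn chs 0%N).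
have lch:=lam_csupp chc cK' K'G chK'.
have [d d0 Hd] : exists2 d, 0 < d & forall p, K p -> forall t, d ^- 2 < t -> mt t p = k.
 pose P (p : V) d := 0 < d -> forall t, d ^- 2 < t -> mt t p = k.
 have [||d d0 Hd]:=@compact_radius _ K P cK.
 - move=>p d d' dd Pd d'0 t tt;apply: Pd;first exact: lt_le_trans dd.
  apply: le_lt_trans tt;rewrite lef_pV2 ?posrE ?exprn_gt0 ?(lt_le_trans d'0 dd) //.
  by rewrite lerXn2r ?nnegrE ?(ltW d'0) // (le_trans (ltW d'0)).
 - move=>p Kp;have [r r0 Hr]:=Hk p (KG p Kp);exists (r / 4);first by rewrite divr_gt0.
  by move=>x xp _ t tt;exact: Hr.
 by exists d=>// p Kp;apply: (Hd p p Kp)=>//;rewrite subrr normr0.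
suff H e : 0 < e -> `|hmass n * lam phi - k * rint phi| <= e * lam chi.
 apply/eqP;rewrite -subr_eq0 -normr_le0;apply/ler_addgt0Pl => e e1;rewrite addr0.
 have l0: 0 <= lam chi.
  apply: rint_ge0 => x;have [Dx|nDx]:=pselect (D x);last by rewrite zextF.
  by rewrite zextT // mulr_ge0 ?wJ_ge0 //;case/andP: (ch01 (f x)).
 have l1: 0 < lam chi + 1 by rewrite ltr_wpDl.
 apply: le_trans (H (e / (lam chi + 1)) _) _;first by rewrite divr_gt0.
 by rewrite mulrAC ler_pdivrMr // ler_pM2l // lerDl.
move=>e1;have [T T0 HT]:=heat_approx ph cK phK e1.
pose t:=T + d ^- 2 + e0 ^- 2.
have d2: 0 < d ^- 2 by rewrite invr_gt0 exprn_gt0.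
have e2: 0 < e0 ^- 2 by rewrite invr_gt0 exprn_gt0.
have [tT td te] : [/\ T < t, d ^- 2 < t & e0 ^- 2 < t] by rewrite /t;split;lra.
have t0:=lt_trans T0 tT;have mi:=@measurable_id _ V setT.
have lp :=lint_C0c ph cK phK;have hk:=hker_smooth n t0.
have ko w: e0 <= `|w| -> hker t w = 0.
 move=>ew;apply: (hker_out t0 e00 _ ew).
 have : t^-1 <= (e0 ^- 2)^-1 by rewrite lef_pV2 ?posrE // ltW.
 by rewrite invrK.
have far z: ~ (exists2 p, K p & `|z - p| < e0) -> conv phi id (hker t) z = 0 /\ phi z = 0.
 move=>nz;split;last by apply: phK => Kz;apply: nz;exists z=>//;rewrite subrr normr0.
 rewrite -[RHS](@rint0 (n + n));congr rint;apply/funext => y /=.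
 have [Ky|nKy]:=pselect (K y);last by rewrite phK // mul0r.
 rewrite ko ?mulr0 // leNgt;apply/negP => yz;apply: nz;exists y=>//.
 by rewrite distrC.
have Hc: C0 false setT (conv phi id (hker t)) := Cn_C0 (Csm_Cn (conv_Csm lp mi hk) 0%N).
have HK' z: ~ K' z -> conv phi id (hker t) z = 0.
 move=>nK;apply: (far z _).1 => -[p Kp zp];have := chK' z nK.
 by rewrite (che p z Kp zp)=>/eqP;rewrite oner_eq0.
have lH:=lam_csupp Hc cK' K'G HK'.
have lphi:=lam_csupp ph cK KG phK.
have E: k * rint phi = lam (conv phi id (hker t)).
 apply: EFin_inj;rewrite -rintZ // -[RHS]rint_EFin //.
 rewrite -(lam_tonelli ph cK KG phK ph0 t0);last first.
  move=>y Ky;apply: (@lam_csupp (fun z => hker t (z - y)) K')=>//.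
   exact: Cn_C0 (Cn_shift y (Csm_Cn hk 0%N)).
  move=>z nK;apply: ko;rewrite leNgt;apply/negP => zy.
  by have := chK' z nK;rewrite (che y z Ky zy)=>/eqP;rewrite oner_eq0.
 rewrite -rint_EFin;last exact: lintZ.
 apply: eq_integral => y _;have [Ky|nKy]:=pselect (K y);last by rewrite phK // mul0r mulr0.
 by rewrite (Hd y Ky t td) mulrC.
rewrite E distrC -rintZ // /lam -rintB //;last exact: lintZ.
rewrite -rintZ //;apply: rint_abs_le;[by apply: lintB=>//;exact: lintZ|exact: lintZ|].
move=>x;have [Dx|nDx]:=pselect (D x);last by rewrite !zextF // !mulr0 subr0 normr0.
rewrite !zextT // mulrA -mulrBl normrM (ger0_norm (wJ_ge0 x)) mulrA ler_wpM2r ?wJ_ge0 //.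
have [near|/far[-> ->]]:=pselect (exists2 p, K p & `|f x - p| < e0).
 by have [p Kp fp]:=near;rewrite (che p _ Kp fp) mulr1;exact: HT.
by rewrite mulr0 subr0 normr0 mulr_ge0 ?(ltW e1) //;case/andP: (ch01 (f x)).
Qed.

Definition exhaustion (chi : nat -> V -> R) (K : nat -> set V) :=
 forall k, [/\ C0 false setT (chi k), compact (K k), K k `<=` D,
  (forall x, ~ K k x -> chi k x = 0) & forall x, 0 <= chi k x] /\
  (forall x, chi k x <= chi k.+1 x) /\ (forall x, D x -> chi ^~ x @ \oo --> (1 : R)).

(** Compactly supported functions are exhausted monotonically, so the identity passes to nonnegative
    continuous functions, infinite integrals included. The factor [k] is never identified: only its
    independence of [F] matters. *)
Lemma cov_nonneg chi K : connected G -> D !=set0 -> exhaustion chi K ->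
 exists2 k : R, 0 <= k & forall F : V -> R, C0 false G F -> (forall y, G y -> 0 <= F y) ->
 int_nonneg (fun x => (zext D (fun x => F (f x) * wJ x) x)%:E) =
 (k%:E * int_nonneg (fun y => (zext G F y)%:E))%E.
move=>cG [x0 Dx0] chiK;have [k k0 Hk]:=lam_int cG;have m0:=hmass_gt0 n.
have mono x i j: (i <= j)%N -> chi i x <= chi j x.
 by elim: j=>[|j IH];[rewrite leqn0=>/eqP ->|rewrite leq_eqVlt=>/orP[/eqP ->//|/IH H];
  apply: le_trans H _;have [_ [+ _]]:=chiK j;apply].
have ch0 i x: 0 <= chi i x by have [[_ _ _ _ +] _]:=chiK i;apply.
have Fi (F : V -> R) : C0 false G F -> (forall y, G y -> 0 <= F y) ->
  ((hmass n)%:E * int_nonneg (fun x => (zext D (fun x => F (f x) * wJ x) x)%:E) =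
  k%:E * int_nonneg (fun y => (zext G F y)%:E))%E.
 move=>Fc F0;have FG: Cn false G 0 F by split.
 have FD: Cn false D 0 (fun x => F (f x)).
  by apply: (Cn_comp (b := false) oD oG fD)=>// l;exact: map_comp.
 have mD: measurable_fun setT (zext D (fun x => F (f x) * wJ x)).
  by apply: C0_meas oD (Cn_C0 (CnM oD FD (wJ_smooth 0))).
 have mG: measurable_fun setT (zext G F) := C0_meas oG Fc.
 have D0 x: 0 <= zext D (fun x => F (f x) * wJ x) x.
  have [Dx|nDx]:=pselect (D x);last by rewrite zextF.
  by rewrite zextT // mulr_ge0 ?wJ_ge0 // F0 //;exact: fD.
 have G0 x: 0 <= zext G F x.
  by have [Gx|nGx]:=pselect (G x);[rewrite zextT // F0|rewrite zextF].
 rewrite !iint_integral;[|by split;[exact/measurable_EFinP|move=>x;rewrite lee_fin]..].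
 (* The cut-offs live on [D] and are moved to [G] by [g], so that both sides are exhausted by the
    same sequence. *)
 pose phi i:=zext G (fun y => F y * chi i (g y)).
 have pK i: [/\ C0 false setT (phi i), compact (f @` K i), f @` K i `<=` G,
   forall y, ~ (f @` K i) y -> phi i y = 0 & forall y, 0 <= phi i y].
  have [[cc cK KD chK _] _]:=chiK i.
  have S: supp_in G (f @` K i) (fun y => F y * chi i (g y)).
   move=>y Gy nK;rewrite chK ?mulr0 // => Kg;apply: nK;exists (g y)=>//;exact: fg.
  have cfK: compact (f @` K i) by exact: (compact_image oD hf cK KD).
  have fKG: f @` K i `<=` G by move=>_ [x /KD Dx <-];exact: fD.
  have cg: Cn false G 0 (fun y => chi i (g y)).
   by apply: (Cn_comp (b := false) oG openT)=>// l;exact: map_comp.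
  split=>//.
  - apply: Cn_C0 (Cn_unbounded (b := true) (k := 0) _).
   by apply: (Cn_zext oG cfK fKG S (b := false));exact: CnM.
  - by move=>y nK;exact: (zext_off S nK).
  - move=>y;have [Gy|nGy]:=pselect (G y);last by rewrite /phi zextF.
   by rewrite /phi zextT // mulr_ge0 // F0.
 have phiE i x: D x -> phi i (f x) = F (f x) * chi i x.
  by move=>Dx;rewrite /phi zextT ?gf //;exact: fD.
 have lD i: lint (zext D (fun x => phi i (f x) * wJ x)).
  by have [p1 p2 p3 p4 _]:=pK i;exact: lam_csupp p1 p2 p3 p4.
 have lG i: lint (phi i) by have [p1 p2 p3 p4 _]:=pK i;exact: lint_C0c p1 p2 p4.
 have cvx x: D x -> chi ^~ x @ \oo --> (1 : R) by have [_ [_ +]]:=chiK 0%N;apply.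
 have cD: (\int[@rvol (n + n)]_x (zext D (fun x => phi i (f x) * wJ x) x)%:E)%E @[i --> \oo] -->
  (\int[@rvol (n + n)]_x (zext D (fun x => F (f x) * wJ x) x)%:E)%E.
  apply: rint_mono_cvg=>[i|i x|x i j ij|x];first exact: lint_meas (lD i).
  - have [Dx|nDx]:=pselect (D x);last by rewrite zextF.
   by rewrite zextT // mulr_ge0 ?wJ_ge0 //;have [_ _ _ _ +]:=pK i;apply.
  - have [Dx|nDx]:=pselect (D x);last by rewrite !zextF.
   rewrite !zextT // ler_wpM2r ?wJ_ge0 // !phiE // ler_wpM2l ?mono // F0 //;exact: fD.
  have [Dx|nDx]:=pselect (D x);last first.
   by rewrite zextF //;under eq_fun do rewrite /= zextF //;exact: cvg_cst.
  rewrite zextT //;under eq_fun do rewrite /= zextT // phiE // mulrAC.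
  by apply: cvg_Z1;exact: cvx.
 have cG': (\int[@rvol (n + n)]_x (phi i x)%:E)%E @[i --> \oo] -->
  (\int[@rvol (n + n)]_x (zext G F x)%:E)%E.
  apply: rint_mono_cvg=>[i|i x|x i j ij|x];first exact: lint_meas (lG i).
  - by have [_ _ _ _ +]:=pK i;apply.
  - have [Gx|nGx]:=pselect (G x);last by rewrite /phi !zextF.
   by rewrite /phi !zextT // ler_wpM2l ?mono // F0.
  have [Gx|nGx]:=pselect (G x);last first.
   by rewrite zextF //;under eq_fun do rewrite /phi /= zextF //;exact: cvg_cst.
  rewrite zextT //;under eq_fun do rewrite /phi /= zextT //.
  by apply: cvg_Z1;apply: cvx;exact: gG.
 have E i: ((hmass n)%:E * \int[@rvol (n + n)]_x (zext D (fun x => phi i (f x) * wJ x) x)%:E =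
   k%:E * \int[@rvol (n + n)]_x (phi i x)%:E)%E.
  rewrite !rint_EFin // -!EFinM;congr EFin.
  by have [p1 p2 p3 p4 p5]:=pK i;exact: Hk p1 p2 p3 p4 p5.
 have c1:=cvgeZl (y := (hmass n)%:E) isT cD.
 have c2:=cvgeZl (y := k%:E) isT cG'.
 move: c1;under eq_fun do rewrite E;move=>c1.
 exact: cvg_unique c1 c2.
exists (k / hmass n);first by rewrite divr_ge0 // ltW.
move=>F Fc F0;rewrite mulrC EFinM -muleA -Fi // muleA -EFinM mulVf ?gt_eqF // mul1e;exact: erefl.
Qed.

End ChangeOfVariables.

Transparent bump.
(** Cut-offs c_i of an increasing sequence of compacts need not increase; 1 - prod (1 - c_i) over i
    <= k does, and equals 1 wherever one of the factors is 1. *)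
Lemma exhaustion_exists n (D : set 'rV[R]_(n + n)) : open D -> exists chi K, exhaustion D chi K.
move=>oD;pose L k:=[set x | cube 0 k%:R x /\ forall y, ~ D y -> k.+1%:R^-1 <= `|x - y|].
have LD k: L k `<=` D.
 by move=>x [_ h];apply: contrapT=>/h;rewrite subrr normr0 leNgt invr_gt0 ltr0n.
have cL k: compact (L k).
 have -> : L k = cube 0 k%:R `&` [set x | forall y, ~ D y -> k.+1%:R^-1 <= `|x - y|] by [].
 apply: compact_closedI;first exact: cube_compact.
 move=>x cx y nD;apply/ler_addgt0Pl => e e0;have [x' h xx]:=closure_pick cx e0.
 apply: le_trans (h y nD) _;rewrite -[x' - y](subrKA x);apply: le_trans (ler_normD _ _) _.
 by rewrite lerD2r ltW.
have /choice[c Hc] : forall k, exists c : ('rV[R]_(n + n) -> R) * set 'rV[R]_(n + n), [/\ Csm true setT c.1, forall x, 0 <= c.1 x <= 1,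
  compact c.2 /\ c.2 `<=` D, forall x, ~ c.2 x -> c.1 x = 0 & forall x, L k x -> c.1 x = 1].
 move=>k;have [c [K [e [h1 h2 h3 h4 [e0 h5]]]]]:=compact_cutoff (cL k) oD (@LD k).
 by exists (c, K);split=>// x Lx;apply: (h5 x)=>//;rewrite subrr normr0.
pose K:=fix K k : set 'rV[R]_(n + n) := if k is k'.+1 then K k' `|` (c k).2 else (c 0%N).2.
have c01 k x: 0 <= 1 - (c k).1 x <= 1.
 by have [_ /(_ x)/andP[a b] _ _ _]:=Hc k;rewrite subr_ge0 b gerBl.
have p01 k x: 0 <= \prod_(i < k) (1 - (c i).1 x) <= 1.
 elim: k=>[|k /andP[a b]];first by rewrite big_ord0 ler01 lexx.
 by have /andP[d e] := c01 k x;rewrite big_ord_recr /= mulr_ge0 // mulr_ile1.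
have cK k: compact (K k) /\ K k `<=` D.
 elim: k=>[|k [a b]] /=;first by have [_ _]:=Hc 0%N.
 by have [_ _ [d e] _ _]:=Hc k.+1;split;[exact: compactU|move=>x [/b|/e]].
exists (fun k x => 1 - \prod_(i < k.+1) (1 - (c i).1 x)), K => k;split;first split.
- apply: (@Cn_C0 _ _ _ 0);apply: (CnB openT);first exact: Cn_cst.
 apply: (Cn_prod openT) => i _;apply: (CnB openT);first exact: Cn_cst.
 by have [h _ _ _ _]:=Hc i;exact: Csm_Cn h 0%N.
- exact: (cK k).1.
- exact: (cK k).2.
- elim: k=>[|k IH] x nK;first by have [_ _ _ h _]:=Hc 0%N;rewrite big_ord1 h // subr0 subrr.
 have [_ _ _ h _]:=Hc k.+1;rewrite big_ord_recr /= h ?subr0 ?mulr1;last by move=>kx;apply: nK;right.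
 by apply: IH => kx;apply: nK;left.
- by move=>x;rewrite subr_ge0;have /andP[] := p01 k.+1 x.
split=>[x|x Dx].
 have /andP[a b] := c01 k.+1 x;have /andP[d _] := p01 k.+1 x.
 by rewrite lerB // [X in X <= _]big_ord_recr /= ler_piMr.
have /nbhs_ballP[d /= d0 Hd] := open_nbhs_nbhs (conj oD Dx).
pose q:=Num.bound (`|x| + d^-1);have q1: `|x| + d^-1 < q%:R.
 by apply: archi_boundP;rewrite addr_ge0 // invr_ge0 ltW.
have Lx: L q x.
 split=>[|y nD];first by rewrite /cube /= subr0 (le_trans _ (ltW q1)) // lerDl invr_ge0 ltW.
 rewrite leNgt;apply/negP => h;apply: nD;apply: Hd;rewrite ball_lt distrC;apply: lt_le_trans h _.
 rewrite -[d]invrK lef_pV2 ?posrE ?ltr0n ?invr_gt0 //;apply: le_trans (_ : q%:R <= _);last by rewrite ler_nat.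
 by apply: le_trans (ltW q1);rewrite lerDr.
apply: cvg_near_cst;exists q=>// k' /= qk.
have [_ _ _ _ /(_ x Lx) h]:=Hc q.
by rewrite (bigD1 (Ordinal (qk : (q < k'.+1)%N))) //= h subrr mul0r subr0.
Qed.

Lemma bump_shift m (z : 'rV[R]_m) r x : bump z r x = bump 0 r (x - z).
by apply: eq_bigr => i _;rewrite !mxE subr0. Qed.
Opaque bump.

(** * Bergman projection and its transformation under biholomorphic maps *)

Section Bergman.
Variable n : nat.
Local Notation V := 'rV[R]_(n + n).
Implicit Types (F H P : V -> R[i]) (U : set V).

Definition A2 U F := hol U F /\ lint (zext U (fun x => nsq (F x))).

Definition orth U P H :=
 rint (zext U (fun x => Re (P x * (H x)^*))) = 0 /\
 rint (zext U (fun x => Im (P x * (H x)^*))) = 0.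

(** Projection is a relation and existence is never presupposed: it is supplied by Condition R, by
    the transformation formula or by linearity, and [isproj_uniq] identifies the results. *)
Definition isproj U P H := A2 U H /\ forall K, A2 U K -> orth U (fun x => P x - H x) K.

Definition upto U P := smooth_upto U (fun x => Re (P x)) /\ smooth_upto U (fun x => Im (P x)).

Lemma normsq_mul_le (a c : R[i]) : `|Re (a * c^*)| <= nsq a + nsq c /\
 `|Im (a * c^*)| <= nsq a + nsq c.
case: a c=>[p q] [r s];rewrite cReM cImM /nsq /=.
split;rewrite ler_norml;apply/andP;split;rewrite -subr_ge0.
- have -> : p * r - q * - s - - (p ^+ 2 + q ^+ 2 + (r ^+ 2 + s ^+ 2)) =
  2^-1 * ((p + r) ^+ 2 + (q + s) ^+ 2 + p ^+ 2 + q ^+ 2 + r ^+ 2 + s ^+ 2) by field.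
 by rewrite mulr_ge0 // !addr_ge0 // sqr_ge0.
- have -> : p ^+ 2 + q ^+ 2 + (r ^+ 2 + s ^+ 2) - (p * r - q * - s) =
  2^-1 * ((p - r) ^+ 2 + (q - s) ^+ 2 + p ^+ 2 + q ^+ 2 + r ^+ 2 + s ^+ 2) by field.
 by rewrite mulr_ge0 // !addr_ge0 // sqr_ge0.
- have -> : p * - s + q * r - - (p ^+ 2 + q ^+ 2 + (r ^+ 2 + s ^+ 2)) =
  2^-1 * ((p - s) ^+ 2 + (q + r) ^+ 2 + p ^+ 2 + q ^+ 2 + r ^+ 2 + s ^+ 2) by field.
 by rewrite mulr_ge0 // !addr_ge0 // sqr_ge0.
have -> : p ^+ 2 + q ^+ 2 + (r ^+ 2 + s ^+ 2) - (p * - s + q * r) =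
  2^-1 * ((p + s) ^+ 2 + (q - r) ^+ 2 + p ^+ 2 + q ^+ 2 + r ^+ 2 + s ^+ 2) by field.
by rewrite mulr_ge0 // !addr_ge0 // sqr_ge0.
Qed.

Lemma normsqB_le (a c : R[i]) : nsq (a - c) <= 2 * (nsq a + nsq c).
case: a c=>[p q] [r s];rewrite /nsq /= -subr_ge0.
have -> : 2 * (p ^+ 2 + q ^+ 2 + (r ^+ 2 + s ^+ 2)) - ((p - r) ^+ 2 + (q - s) ^+ 2) =
 (p + r) ^+ 2 + (q + s) ^+ 2 by ring.
by rewrite addr_ge0 // sqr_ge0.
Qed.

Lemma zext_le U (a b : V -> R) : (forall x, U x -> `|a x| <= b x) ->
 forall x, `|zext U a x| <= `|zext U b x|.
move=>ab x;have [Ux|nUx]:=pselect (U x);last by rewrite !zextF.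
by rewrite !zextT //;apply: le_trans (ab x Ux) (ler_norm _).
Qed.

Lemma zextD U (a b : V -> R) : zext U (fun x => a x + b x) = fun x => zext U a x + zext U b x.
by apply/funext => x;rewrite /zext mulrDr. Qed.

Lemma zextZ U c (a : V -> R) : zext U (fun x => c * a x) = fun x => c * zext U a x.
by apply/funext => x;rewrite /zext mulrCA. Qed.

Section OneDomain.
Variable U : set V.
Hypothesis oU : open U.

Lemma lint_mulconj P H : CC false U 0 P -> CC false U 0 H ->
 lint (zext U (fun x => nsq (P x))) -> lint (zext U (fun x => nsq (H x))) ->
 lint (zext U (fun x => Re (P x * (H x)^*))) /\ lint (zext U (fun x => Im (P x * (H x)^*))).
move=>cP cH lP lH;have [c1 c2]:=CCM oU cP (CC_conj oU cH).
have l: lint (zext U (fun x => nsq (P x) + nsq (H x))) by rewrite zextD;exact: lintD.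
split.
 apply: (lint_le (C0_meas oU (Cn_C0 c1)) _ l);apply: zext_le => x _.
 by have []:=normsq_mul_le (P x) (H x).
apply: (lint_le (C0_meas oU (Cn_C0 c2)) _ l);apply: zext_le => x _.
by have []:=normsq_mul_le (P x) (H x).
Qed.

Lemma lint_nsqB P H : CC false U 0 P -> CC false U 0 H ->
 lint (zext U (fun x => nsq (P x))) -> lint (zext U (fun x => nsq (H x))) ->
 lint (zext U (fun x => nsq (P x - H x))).
move=>cP cH lP lH;have c1:=Cn_nsq oU (CCD oU cP (CCN oU cH)).
have l: lint (zext U (fun x => 2 * (nsq (P x) + nsq (H x)))).
 by rewrite zextZ zextD;apply: lintZ;exact: lintD.
apply: (lint_le (C0_meas oU (Cn_C0 c1)) _ l);apply: zext_le => x _.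
by rewrite ger0_norm ?nsq_ge0 // normsqB_le.
Qed.

Lemma holB F H : hol U F -> hol U H -> hol U (fun x => F x - H x).
move=>hF hH;apply: (hol_eq oU _ (holD oU hF (holM oU (hol_cst oU (- 1)) hH))) => x _.
by rewrite mulN1r.
Qed.

Lemma A2B F H : A2 U F -> A2 U H -> A2 U (fun x => F x - H x).
move=>[hF lF] [hH lH];split;first exact: holB.
by apply: lint_nsqB=>//;exact: hol_CC.
Qed.

(* |a| <= e + a^2 / e turns the L^1 bound of a holomorphic function into an L^2 bound. *)
Lemma hol_bound2 ds r : 0 < r -> exists2 C : R, 0 <= C & forall (W : set V) F z e, open W ->
 A2 W F -> cube z r `<=` W -> 0 < e ->
 `|pds ds (fun x => Re (F x)) z| <= C * (e + e^-1 * rint (zext W (fun x => nsq (F x)))).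
move=>r0;have [C C0' HC]:=hol_bound ds r0.
pose B:=rint (bump (0 : V) r);have B0: 0 <= B by apply: rint_ge0 => x;exact: bump_ge0.
have Bz (z : V) : rint (bump z r) = B.
 rewrite (_ : bump z r = fun x => bump 0 r (x - z));last by apply/funext => x;exact: bump_shift.
 apply: (@rint_shift n (bump 0 r) r z (bump_smooth 0 r0)) => w wr.
 by apply: bump_out=>//;rewrite subr0.
exists (C * (B + 1))=>[|W F z e oW [hF lF] zW e0];first by rewrite mulr_ge0 // addr_ge0.
apply: le_trans (HC W _ _ z oW hF zW) _;rewrite -mulrA ler_wpM2l //.
have N0: 0 <= rint (zext W (fun x => nsq (F x))).
 apply: rint_ge0 => x;have [Wx|nWx]:=pselect (W x);last by rewrite zextF.
 by rewrite zextT // nsq_ge0.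
have lb: lint (bump z r : V -> R) := lint_bump z r0.
have hF0:=Cn_C0 (hol_CC oW 0 hF).1.
apply: (@le_trans _ _ (e * B + e^-1 * rint (zext W (fun x => nsq (F x)))));last first.
 set X := e^-1 * _;have X0: 0 <= X by rewrite mulr_ge0 // invr_ge0 ltW.
 have BX: 0 <= B * X by rewrite mulr_ge0.
 by rewrite mulrDl mul1r mulrDr [B * e]mulrC;move: (e * B) (B * X) BX => p q;lra.
rewrite -(Bz z) -!rintZ // -rintD;[|exact: lintZ|exact: lintZ].
apply: rint_le;first by apply: lint_abs;exact: hq_lint.
 by apply: lintD;exact: lintZ.
move=>x;rewrite /hq;have [Wx|nWx]:=pselect (W x);last first.
 by rewrite !zextF // normr0 mulr0 addr0 mulr_ge0 ?(ltW e0) ?bump_ge0.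
rewrite !zextT // normrM ger0_norm ?bump_ge0 //.
set b := bump z r x;have b0: 0 <= b by exact: bump_ge0.
have b1: b <= 1 by exact: bump_le1.
set a := Re (F x);have aN: a ^+ 2 <= nsq (F x) by rewrite lerDl sqr_ge0.
apply: (@le_trans _ _ (e * b + b * (e^-1 * a ^+ 2)));last first.
 rewrite lerD2l;apply: (@le_trans _ _ (e^-1 * a ^+ 2));last by rewrite ler_pM2l ?invr_gt0.
 by rewrite ler_piMl // mulr_ge0 ?sqr_ge0 // invr_ge0 ltW.
rewrite [e * b]mulrC -mulrDr ler_wpM2l // -(ler_pM2l e0) mulrDr mulVKf ?gt_eqF //.
rewrite -[a ^+ 2]real_normK ?num_real // -subr_ge0.
have -> : e * e + `|a| ^+ 2 - e * `|a| = 2^-1 * ((e - `|a|) ^+ 2 + e ^+ 2 + `|a| ^+ 2) by field.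
by rewrite mulr_ge0 // !addr_ge0 // sqr_ge0.
Qed.

Lemma hol_mulI F : hol U F -> hol U (fun x => - 'i * F x).
by move=>hF;apply: holM=>//;exact: hol_cst. Qed.

Lemma A2_mulI F : A2 U F -> A2 U (fun x => - 'i * F x).
move=>[hF lF];split;first exact: hol_mulI.
rewrite (@zext_eq _ U _ (fun x => nsq (F x))) // => x _.
by rewrite normsqM /nsq /= oppr0 expr0n add0r sqrrN expr1n mul1r.
Qed.

(** In the estimate [hol_bound2] the integral term vanishes, and its free parameter can be made
    arbitrarily small. *)
Lemma A2_zero F : A2 U F -> rint (zext U (fun x => nsq (F x))) = 0 -> forall x, U x -> F x = 0.
suff H K : A2 U K -> rint (zext U (fun x => nsq (K x))) = 0 -> forall x, U x -> Re (K x) = 0.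
 move=>aF F0 x Ux;apply: complexP;first exact: H.
 have E: rint (zext U (fun x => nsq (- 'i * F x))) = 0.
  rewrite -[RHS]F0;congr rint;apply: zext_eq => y _.
  by rewrite normsqM /nsq /= oppr0 expr0n add0r sqrrN expr1n mul1r.
 by have := H _ (A2_mulI aF) E x Ux;rewrite cReM /= => <-;ring.
move=>aK K0 x Ux;have /nbhs_ballP[d /= d0 Hd] := near_in oU Ux.
have r0: 0 < d / 2 by rewrite divr_gt0.
have [C C0' HC]:=hol_bound2 [::] r0.
apply/eqP;rewrite -normr_le0;apply/ler_addgt0Pl => e e0;rewrite addr0.
have C1: 0 < C + 1 by rewrite ltr_wpDl.
have := HC U K x (e / (C + 1)) oU aK;rewrite K0 mulr0 addr0 /= => H.
apply: (@le_trans _ _ (C * (e / (C + 1))));last first.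
 by rewrite mulrCA ler_piMr ?(ltW e0) // ler_pdivrMr // mul1r lerDl.
apply: H;last by rewrite divr_gt0.
move=>y yx;apply: Hd;rewrite ball_lt;apply: le_lt_trans yx _.
 by rewrite ltr_pdivrMr // ltr_pMr // ltr1n.
Qed.

Lemma rint_ge0_zext (a : V -> R) : (forall x, U x -> 0 <= a x) -> 0 <= rint (zext U a).
move=>a0;apply: rint_ge0 => x;have [Ux|nUx]:=pselect (U x);last by rewrite zextF.
by rewrite zextT // a0.
Qed.

Lemma isproj_uniq P H H' : CC false U 0 P -> lint (zext U (fun x => nsq (P x))) ->
 isproj U P H -> isproj U P H' -> forall x, U x -> H x = H' x.
move=>cP lP [aH oH] [aH' oH'] x Ux;apply/eqP;rewrite -subr_eq0;apply/eqP.
have aK:=A2B aH aH';apply: (A2_zero aK)=>//.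
have [E1 _]:=oH _ aK;have [E2 _]:=oH' _ aK.
have cH:=hol_CC oU 0 aH.1;have cH':=hol_CC oU 0 aH'.1;have cK:=hol_CC oU 0 aK.1.
have L Q: A2 U Q -> lint (zext U (fun x => Re ((P x - Q x) * (H x - H' x)^*))).
 move=>aQ;have cQ:=hol_CC oU 0 aQ.1.
 exact: (lint_mulconj (CCD oU cP (CCN oU cQ)) cK (lint_nsqB cP cQ lP aQ.2) aK.2).1.
have := rintB (L _ aH') (L _ aH);rewrite E1 E2 subr0 => E;rewrite -[RHS]E;congr rint.
apply/funext => y;rewrite /zext -mulrBr;congr (_ * _).
have -> : nsq (H y - H' y) = Re ((H y - H' y) * (H y - H' y)^*) by rewrite mulCJ.
rewrite !cReM;move: (P y) (H y) (H' y)=>[? ?] [? ?] [? ?] /=;ring.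
Qed.

Lemma isproj_norm P H : CC false U 0 P -> lint (zext U (fun x => nsq (P x))) -> isproj U P H ->
 rint (zext U (fun x => nsq (H x))) <= rint (zext U (fun x => nsq (P x))).
move=>cP lP [aH oH];have [E1 _]:=oH _ aH.
have cH:=hol_CC oU 0 aH.1.
have [L _]:=@lint_mulconj (fun x => P x - H x) H (CCD oU cP (CCN oU cH)) cH (lint_nsqB cP cH lP aH.2) aH.2.
rewrite -subr_ge0 -rintB //;last exact: aH.2.
have E' x: zext U (fun x => nsq (P x)) x - zext U (fun x => nsq (H x)) x =
  zext U (fun x => nsq (P x - H x)) x + 2 * zext U (fun x => Re ((P x - H x) * (H x)^*)) x.
 rewrite /zext -mulrBr mulrCA -mulrDr;congr (_ * _).
 by rewrite cReM /nsq;move: (P x) (H x)=>[? ?] [? ?] /=;ring.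
rewrite (_ : (fun x => _) = fun x => zext U (fun x => nsq (P x - H x)) x +
 2 * zext U (fun x => Re ((P x - H x) * (H x)^*)) x);last exact/funext.
rewrite rintD ?rintZ // ?E1 ?mulr0 ?addr0;[|exact: lint_nsqB aH.2|exact: lintZ].
by apply: rint_ge0_zext => x _;exact: nsq_ge0.
Qed.

End OneDomain.

(** The unitary-type operator u (F o f) between Bergman spaces; it multiplies inner products by the
    constant of the change of variables. *)
Definition pull (f : V -> V) (F : V -> R[i]) x : R[i] := jac f x * F (f x).

Section Transfer.
Variables (D G : set V) (f g : V -> V).
Hypotheses (oD : open D) (oG : open G) (cD : connected D) (cG : connected G) (D0 : D !=set0).
Hypotheses (hf : holomorphic_map_on D f) (hg : holomorphic_map_on G g).
Hypotheses (fD : forall x, D x -> G (f x)) (gG : forall y, G y -> D (g y)).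
Hypotheses (gf : forall x, D x -> g (f x) = x) (fg : forall y, G y -> f (g y) = y).

(** Signed functions are reduced to nonnegative continuous ones with the same constant [k]. *)
Lemma cov_lint chi K : exhaustion D chi K -> exists2 k : R, 0 <= k & forall F : V -> R,
 C0 false G F -> lint (zext G F) -> lint (zext D (fun x => F (f x) * wJ f x)) /\
 rint (zext D (fun x => F (f x) * wJ f x)) = k * rint (zext G F).
move=>ex;have [k k0 Hk]:=cov_nonneg oD oG hf hg fD gG gf fg cG D0 ex.
exists k=>// F cF lF;have FG: Cn false G 0 F by split.
have P (H : V -> R) : C0 false G H -> (forall y, G y -> 0 <= H y) -> lint (zext G H) ->
  lint (zext D (fun x => H (f x) * wJ f x)) /\
  rint (zext D (fun x => H (f x) * wJ f x)) = k * rint (zext G H).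
 move=>cH H0 lH;have E:=Hk H cH H0.
 have HD: Cn false D 0 (fun x => H (f x)).
  by apply: (Cn_comp (b := false) oD oG fD)=>[|l];[split|exact: map_comp].
 have mD: measurable_fun setT (zext D (fun x => H (f x) * wJ f x)).
  by apply: C0_meas oD (Cn_C0 (CnM oD HD (wJ_smooth oD hf 0))).
 have zD x: 0 <= zext D (fun x => H (f x) * wJ f x) x.
  have [Dx|nDx]:=pselect (D x);last by rewrite zextF.
  by rewrite zextT // mulr_ge0 ?wJ_ge0 // H0 //;exact: fD.
 have zG x: 0 <= zext G H x.
  by have [Gx|nGx]:=pselect (G x);[rewrite zextT // H0|rewrite zextF].
 have lD: lint (zext D (fun x => H (f x) * wJ f x)).
  by apply/(int_nonneg_lint mD zD);rewrite E (int_nonneg_rint zG lH) -EFinM ltry.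
 by split=>//;apply: EFin_inj;rewrite -(int_nonneg_rint zD lD) E (int_nonneg_rint zG lH) EFinM.
have ca: C0 false G (fun y => `|F y|).
 by split=>// x Gx;apply: continuous_comp (cF.1 x Gx) _;exact: norm_continuous.
have la: lint (zext G (fun y => `|F y|)).
 rewrite (_ : zext G _ = fun y => `|zext G F y|);first exact: lint_abs.
 apply/funext => y;have [Gy|nGy]:=pselect (G y);first by rewrite !zextT.
 by rewrite !zextF // normr0.
have [l1 r1]:=P _ ca (fun _ _ => normr_ge0 _) la.
(* [F] is the difference of |F| + F and |F|, both nonnegative, continuous and integrable. *)
pose F' y:=`|F y| + F y;have cF': C0 false G F' by exact: C0D.
have F'0 y: G y -> 0 <= F' y by move=>_;rewrite /F';have := ler_norm (- F y);rewrite normrN;lra.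
have lF': lint (zext G F') by rewrite /F' zextD;exact: lintD.
have [l2 r2]:=P _ cF' F'0 lF'.
have E: zext D (fun x => F (f x) * wJ f x) =
  fun x => zext D (fun x => F' (f x) * wJ f x) x - zext D (fun x => `|F (f x)| * wJ f x) x.
 by apply/funext => x;rewrite /zext -mulrBr -mulrBl /F' addrC addKr.
rewrite E;split;first exact: lintB.
by rewrite rintB // r1 r2 -mulrBr /F' zextD rintD // addrC addKr.
Qed.

Lemma pull_A2 chi K F : exhaustion D chi K -> A2 G F -> A2 D (pull f F).
move=>ex [hF lF];split;first by apply: holM=>//;[exact: hol_jac|exact: hol_comp hF].
have [k _ Hk]:=cov_lint ex.
have [l _]:=Hk _ (Cn_C0 (Cn_nsq oG (hol_CC oG 0 hF))) lF.
rewrite (@zext_eq _ D _ (fun x => nsq (F (f x)) * wJ f x)) // => x _.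
by rewrite normsqM mulrC.
Qed.

End Transfer.

Lemma mulCACA (a b c d : R[i]) : a * c * (b * d) = c * d * (a * b).
by ring. Qed.

Section Transfer2.
Variables (D G : set V) (f g : V -> V).
Hypotheses (oD : open D) (oG : open G) (cD : connected D) (cG : connected G) (D0 : D !=set0).
Hypotheses (hf : holomorphic_map_on D f) (hg : holomorphic_map_on G g).
Hypotheses (fD : forall x, D x -> G (f x)) (gG : forall y, G y -> D (g y)).
Hypotheses (gf : forall x, D x -> g (f x) = x) (fg : forall y, G y -> f (g y) = y).

(** Every test function [Q] on [D] is the pull-back of its own transport [Q'] to [G], since the two
    Jacobians are inverse to each other. The inner products on [D] are thus, up to [k], inner
    products on [G]. *)
Lemma transfer chi K P H : exhaustion D chi K -> CC false G 0 P ->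
 lint (zext G (fun x => nsq (P x))) -> isproj G P H -> isproj D (pull f P) (pull f H).
move=>ex cP lP [aH oH];split;first exact: (pull_A2 oD oG cG D0 hf hg fD gG gf fg ex aH).
move=>Q [hQ lQ].
pose Q':=pull g Q.
have G0: G !=set0 by have [x0 Dx0]:=D0;exists (f x0);exact: fD.
have [chi' [K' ex']]:=exhaustion_exists oG.
have aQ': A2 G Q' by exact: (pull_A2 oG oD cD G0 hg hf gG fD fg gf ex' (conj hQ lQ)).
have [z1 z2]:=oH _ aQ'.
have [k _ Hk]:=cov_lint oD oG cG D0 hf hg fD gG gf fg ex.
have cPH: CC false G 0 (fun x => P x - H x) by apply: CCD=>//;apply: CCN=>//;exact: hol_CC aH.1.
have lPH:=lint_nsqB oG cP (hol_CC oG 0 aH.1) lP aH.2.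
have cQ':=hol_CC oG 0 aQ'.1.
have [l1 l2]:=lint_mulconj oG cPH cQ' lPH aQ'.2.
have [c1 c2]:=CCM oG cPH (CC_conj oG cQ').
have [_ r1]:=Hk _ (Cn_C0 c1) l1;have [_ r2]:=Hk _ (Cn_C0 c2) l2.
have E x: D x -> (pull f P x - pull f H x) * (Q x)^* =
  ((P (f x) - H (f x)) * (Q' (f x))^*) * (wJ f x)%:C.
 move=>Dx;have -> : Q x = jac f x * Q' (f x).
  by rewrite /Q' /pull gf // mulrA [jac f x * _]mulrC (jac_inv oD oG hf hg fD gf Dx) mul1r.
 rewrite {1 2}/pull /wJ -mulCJ -mulrBr rmorphM /=.
 exact: mulCACA.
split.
 rewrite (@zext_eq _ D _ (fun x => Re ((P (f x) - H (f x)) * (Q' (f x))^*) * wJ f x)).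
  by rewrite r1 z1 mulr0.
 by move=>x Dx;rewrite E // mulrC Re_realM mulrC.
rewrite (@zext_eq _ D _ (fun x => Im ((P (f x) - H (f x)) * (Q' (f x))^*) * wJ f x)).
 by rewrite r2 z2 mulr0.
by move=>x Dx;rewrite E // mulrC Im_realM mulrC.
Qed.

End Transfer2.
End Bergman.

Opaque bump.

(** * Geometrically convergent series of smooth functions *)

Section GeometricSeries.
Implicit Types (u w : nat -> R) (c : R).

Definition geo c u := forall j, `|u j| <= c * 2^-1 ^+ j.
Definition tsum u : R := limn (series u).

Lemma geo_cvg c u : geo c u -> series u @ \oo --> tsum u.
move=>uc;apply: normed_cvg.
have c0: 0 <= c by have := uc 0%N;rewrite expr0 mulr1;apply: le_trans.
apply: (@series_le_cvg _ _ (fun j => c * 2^-1 ^+ j))=>[j|j|j|];[exact: normr_ge0| |exact: uc|].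
 by rewrite mulr_ge0 // exprn_ge0 // invr_ge0.
by apply: is_cvg_geometric_series;rewrite ger0_norm ?invr_ge0 // invf_lt1 // ltr1n.
Qed.

Lemma geo_psum c u k l : geo c u -> (k <= l)%N ->
 `|\sum_(k <= j < l) u j| <= 2 * c * 2^-1 ^+ k.
move=>uc kl;have c0: 0 <= c by have := uc 0%N;rewrite expr0 mulr1;apply: le_trans.
suff H : \sum_(k <= j < l) `|u j| <= 2 * c * (2^-1 ^+ k - 2^-1 ^+ l).
 apply: le_trans (ler_norm_sum _ _ _) _;apply: le_trans H _.
 by rewrite ler_wpM2l ?mulr_ge0 // gerBl exprn_ge0 // invr_ge0.
elim: l kl=>[|l IH];first by rewrite leqn0=>/eqP ->;rewrite big_geq // subrr mulr0.
rewrite leq_eqVlt=>/orP[/eqP ->|kl];first by rewrite big_geq // subrr mulr0.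
rewrite big_nat_recr //=;apply: le_trans (lerD (IH kl) (uc l)) _.
by rewrite exprS;move: (2^-1 ^+ k) (2^-1 ^+ l) => p q;rewrite le_eqVlt;apply/orP;left;apply/eqP;field.
Qed.

Lemma tsum_tail c u k : geo c u -> `|tsum u - \sum_(0 <= j < k) u j| <= 2 * c * 2^-1 ^+ k.
move=>uc;apply/ler_addgt0Pl => e e0.
have [N _ HN] : \forall l \near \oo, `|tsum u - series u l| <= e.
 by have /cvgrPdist_le/(_ e e0) := geo_cvg uc.
pose l:=maxn N k;have := HN l (leq_maxl _ _).
have kl: (k <= l)%N by exact: leq_maxr.
rewrite /series /= (@big_cat_nat _ _ _ k) //= => H.
have -> : tsum u - \sum_(0 <= j < k) u j =
  (tsum u - (\sum_(0 <= j < k) u j + \sum_(k <= j < l) u j)) + \sum_(k <= j < l) u j.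
 by rewrite opprD addrA subrK.
by apply: le_trans (ler_normD _ _) _;apply: lerD=>//;exact: geo_psum.
Qed.

Lemma tsum_le c u : geo c u -> `|tsum u| <= 2 * c.
by move=>uc;have := tsum_tail 0 uc;rewrite big_geq // subr0 mulr1. Qed.

Lemma half_pow_small c e : 0 < e -> exists k, c * 2^-1 ^+ k <= e.
move=>e0;have H: (fun k => c * 2^-1 ^+ k) @ \oo --> (0 : R).
 rewrite -[X in _ --> X](mulr0 c);apply: cvgM;first exact: cvg_cst.
 by apply: cvg_expr;rewrite ger0_norm ?invr_ge0 // invf_lt1 // ltr1n.
have [N _ HN] : \forall l \near \oo, `|0 - c * 2^-1 ^+ l| <= e by have /cvgrPdist_le/(_ e e0) := H.
by exists N;have := HN N (leqnn N);rewrite sub0r normrN;apply: le_trans;exact: ler_norm.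
Qed.

Lemma tsum_uniq c u (L C : R) : geo c u -> (forall k, `|L - \sum_(0 <= j < k) u j| <= C * 2^-1 ^+ k) ->
 L = tsum u.
move=>uc H;apply/eqP;rewrite -subr_eq0 -normr_le0;apply/ler_addgt0Pl => e e0;rewrite addr0.
have [k Hk]:=half_pow_small (C + 2 * c) e0;apply: le_trans Hk.
rewrite -[L](subrK (\sum_(0 <= j < k) u j)) -addrA;apply: le_trans (ler_normD _ _) _.
by rewrite mulrDl lerD // distrC;exact: tsum_tail.
Qed.

Variables (m : nat) (U : set 'rV[R]_m).
Hypothesis oU : open U.
Implicit Types f : nat -> 'rV[R]_m -> R.

(** The constant may depend on the derivative, the ratio 1/2 may not: this is what allows termwise
    differentiation to every order. *)
Definition geofam f := (forall j, Csm true U (f j)) /\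
 forall ds, exists c, forall x, U x -> geo c (fun j => pds ds (f j) x).

Definition fsum f x := tsum (f ^~ x).

Lemma pds_rcons (h : 'rV[R]_m -> R) ds i : pds (rcons ds i) h = pds ds (pd i h).
by elim: ds=>//= j ds ->. Qed.

Lemma geofam_pd f i : geofam f -> geofam (fun j => pd i (f j)).
move=>[fs fb];split=>[j|ds];first exact: Csm_pd.
by have [c Hc]:=fb (rcons ds i);exists c => x Ux j;rewrite -pds_rcons;exact: Hc.
Qed.

Lemma fsum_derive f x i : geofam f -> U x ->
 is_derive x (ebasis R i) (fsum f) (fsum (fun j => pd i (f j)) x).
move=>[fs fb] Ux;apply: is_derive_of_line.
have [c0 H0]:=fb [::];have [c1 H1]:=fb [:: i];have [c2 H2]:=fb [:: i;i].
have /nbhs_ballP[d /= d0 Hd] := near_in oU Ux.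
have line s: `|s| < d -> U (s *: ebasis R i + x).
 move=>sd;apply: Hd;rewrite -ball_normE /ball_ /= opprD addrCA subrr addr0 normrN normrZ.
 by apply: le_lt_trans sd;rewrite ler_piMr // norm_ebasis.
apply: (@is_derive_quadratic _ _ _ (2 * c2) d)=>// h hd;rewrite add0r scale0r add0r.
have Uh:=line h hd.
pose w j:=f j (h *: ebasis R i + x) - f j x - h * pd i (f j) x.
have wg: geo (c2 * h ^+ 2) w.
 move=>j;rewrite mulrAC;apply: (taylor_line (fs j 2%N)) => s sh.
  by apply: line;exact: le_lt_trans hd.
 by apply: H2;apply: line;exact: le_lt_trans hd.
suff -> : fsum f (h *: ebasis R i + x) - fsum f x - h * fsum (fun j => pd i (f j)) x = tsum w.
 by rewrite -mulrA;exact: tsum_le.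
apply: (tsum_uniq (C := 2 * c0 + 2 * c0 + `|h| * (2 * c1)) wg) => k;rewrite /w !sumrB -mulr_sumr.
have E1:=tsum_tail k (H0 _ Uh);have E2:=tsum_tail k (H0 _ Ux);have E3:=tsum_tail k (H1 _ Ux).
move: E1 E2 E3;rewrite /fsum /=;set A := tsum _;set B := tsum _;set C := tsum _.
set a := \sum_(0 <= j < k) _;set b := \sum_(0 <= j < k) _;set c := \sum_(0 <= j < k) _ => E1 E2 E3.
have -> : A - B - h * C - (a - b - h * c) = (A - a) - (B - b) - h * (C - c) by ring.
apply: le_trans (ler_normB _ _) _;rewrite mulrDl lerD //.
 by apply: le_trans (ler_normB _ _) _;rewrite mulrDl lerD.
by rewrite normrM -mulrA ler_wpM2l.
Qed.

Lemma fsum_C0 f : geofam f -> C0 true U (fsum f).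
move=>fg;have [fs fb]:=fg;have [c0 H0]:=fb [::];split=>[x Ux|_];last first.
 by exists (2 * c0) => x Ux;exact: tsum_le (H0 x Ux).
apply/cont_epsP => e e0;have e3: 0 < e / 3 by rewrite divr_gt0.
have [k Hk]:=half_pow_small (2 * c0) e3.
have sc: {for x, continuous (fun y => \sum_(0 <= j < k) f j y)}.
 by apply: sum_continuous => j _;exact: (Cn_C0 (fs j 0%N)).1.
have [d d0 Hd]:=(cont_epsP _ _).1 sc _ e3.
have /nbhs_ballP[d' /= d'0 Hd'] := near_in oU Ux.
exists (Num.min d d')=>[|y];first by rewrite lt_min d0.
rewrite lt_min=>/andP[/Hd yd yd'].
have Uy: U y by apply: Hd';rewrite ball_lt.
have E1:=le_trans (tsum_tail k (H0 _ Ux)) Hk;have E2:=le_trans (tsum_tail k (H0 _ Uy)) Hk.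
move: E1 E2 yd;rewrite /fsum /=;move: (tsum _) (tsum _) (\sum_(0 <= j < k) _) (\sum_(0 <= j < k) _).
by move=>A B a b;rewrite !ler_norml=>/andP[? ?] /andP[? ?] /andP[? ?];apply/andP;split;lra.
Qed.

Lemma fsum_Csm f : geofam f -> Csm true U (fsum f).
move=>+ k;elim: k f=>[|k IH] f fg;first by split=>//;exact: fsum_C0.
apply: (@Cn_intro _ _ _ oU _ _ (fun i x => fsum (fun j => pd i (f j)) x)).
- exact: fsum_C0.
- by move=>x i Ux;exact: fsum_derive.
- by move=>i;apply: IH;exact: geofam_pd.
Qed.

End GeometricSeries.

Section PdsLinear.
Variables (m : nat) (b : bool) (U : set 'rV[R]_m).
Hypothesis oU : open U.
Implicit Types h : 'rV[R]_m -> R.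

Lemma pdsD h h' ds x : Csm b U h -> Csm b U h' -> U x ->
 pds ds (fun x => h x + h' x) x = pds ds h x + pds ds h' x.
move=>hs hs';elim: ds x=>//= i ds IH x Ux.
rewrite (pd_eqon oU i IH Ux);have D1:=Cn_derive i (Csm_pds ds hs 1%N) Ux.
by have [_ <-]:=dvD D1 (Cn_derive i (Csm_pds ds hs' 1%N) Ux).
Qed.

Lemma pdsZ c h ds x : Csm b U h -> U x -> pds ds (fun x => c * h x) x = c * pds ds h x.
move=>hs;elim: ds x=>//= i ds IH x Ux.
by rewrite (pd_eqon oU i IH Ux);have [_ <-]:=dvZ c (Cn_derive i (Csm_pds ds hs 1%N) Ux).
Qed.

Lemma pdsB h h' ds x : Csm b U h -> Csm b U h' -> U x ->
 pds ds (fun x => h x - h' x) x = pds ds h x - pds ds h' x.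
move=>hs hs' Ux;have hN: Csm b U (fun x => -1 * h' x) by move=>k;exact: CnZ.
rewrite -[X in _ + X]mulN1r -pdsZ // -pdsD //;apply: (pds_eqon oU)=>// y _;by rewrite mulN1r.
Qed.

Lemma pds_cst0 ds x : U x -> pds ds (fun _ => 0) x = 0 :> R.
move=>Ux;have H:=@pdsZ 0 (fun _ => 0) ds x (fun k => Cn_cst b oU k 0) Ux.
rewrite -[RHS](mul0r (pds ds (fun=> 0 : R) x)) -H;apply: (pds_eqon oU)=>// y _.
by rewrite mul0r.
Qed.

Lemma pds_sum (I : Type) (r : seq I) (h : I -> 'rV[R]_m -> R) ds x : (forall j, Csm b U (h j)) -> U x ->
 pds ds (fun x => \sum_(j <- r) h j x) x = \sum_(j <- r) pds ds (h j) x.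
move=>hs Ux;elim: r=>[|j r IH].
 by rewrite big_nil -[RHS](pds_cst0 ds Ux);apply: (pds_eqon oU)=>// y _;rewrite big_nil.
rewrite big_cons -IH -pdsD //;first by apply: (pds_eqon oU)=>// y _;rewrite big_cons.
by move=>k;apply: Cn_sum=>// l _;exact: hs.
Qed.

End PdsLinear.

Lemma tsum_shift (c : R) (u : nat -> R) k d : geo c u -> geo d (fun i => u (k + i)%N) ->
 tsum u - \sum_(0 <= j < k) u j = tsum (fun i => u (k + i)%N).
move=>uc ud;apply: (tsum_uniq (C := 2 * c) ud) => l.
have -> : tsum u - \sum_(0 <= j < k) u j - \sum_(0 <= j < l) u (k + j)%N =
  tsum u - \sum_(0 <= j < k + l) u j.
 rewrite -addrA -opprD;congr (_ - _);rewrite [RHS](@big_cat_nat _ _ _ k) ?leq_addr //=.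
 by congr (_ + _);rewrite -{2}[k]add0n big_addn addKn;apply: eq_bigr => i _;rewrite addnC.
apply: le_trans (tsum_tail _ uc) _.
have c0: 0 <= c by have := uc 0%N;rewrite expr0 mulr1;apply: le_trans.
rewrite ler_wpM2l ?mulr_ge0 // exprD ler_piMl ?exprn_ge0 ?invr_ge0 //.
by rewrite exprn_ile1 ?invr_ge0 // invf_le1 // ler1n.
Qed.

(** A derivative of given order is controlled for all but finitely many terms; the remaining ones
    are absorbed by the constant, through their own bounds rescaled by 2^j. *)
Lemma geofam_of m (U : set 'rV[R]_m) (f : nat -> 'rV[R]_m -> R) : (forall j, Csm true U (f j)) ->
 (forall j ds x, U x -> (size ds <= j)%N -> `|pds ds (f j) x| <= 2^-1 ^+ j) -> geofam U f.
move=>fs fb;split=>// ds.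
have /choice[B HB] : forall j, exists B, forall x, U x -> `|pds ds (f j) x| <= B.
 by move=>j;have [_ /(_ isT)[B HB]]:=Cn_C0 (Csm_pds ds (fs j) 0%N);exists B.
have h0 (j : nat) : 0 < (2^-1 : R) ^+ j by rewrite exprn_gt0 // invr_gt0.
exists (1 + \sum_(j < size ds) `|B j| / 2^-1 ^+ j) => x Ux j.
have S0: 0 <= \sum_(j < size ds) `|B j| / 2^-1 ^+ j.
 by apply: sumr_ge0 => i _;rewrite divr_ge0 // ltW.
have [js|js]:=leqP (size ds) j;first by apply: le_trans (fb _ _ _ Ux js) _;rewrite ler_peMl ?(ltW (h0 j)) // lerDl.
apply: le_trans (HB j x Ux) _;apply: le_trans (ler_norm _) _;rewrite -ler_pdivrMr //.
rewrite (bigD1 (Ordinal js)) //= addrCA lerDl addr_ge0 // sumr_ge0 // => i _;rewrite divr_ge0 // ltW.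
Qed.

Lemma pds_cg m (U : set 'rV[R]_m) (oU : open U) (f g : 'rV[R]_m -> R) ds x :
 (forall y, U y -> f y = g y) -> U x -> pds ds f x = pds ds g x.
exact: (pds_eqon oU). Qed.
Arguments pds_cg {m U} oU {f g ds x}.

(** * Condition R forces estimates with finitely many derivatives *)

Section UniformBoundedness.
Variable n : nat.
Local Notation V := 'rV[R]_(n + n).
Implicit Types (P H : V -> R[i]).

Variable U : set V.
(** Bounded derivatives stand for smoothness up to the boundary; at generic corners [upto_CS]
    identifies the two notions. *)
Definition CS P := forall k, CC true U k P.
Definition nrm (M : nat) P (B : R) := forall ds, (size ds <= M)%N -> forall x, U x ->
 `|pds ds (fun x => Re (P x)) x| <= B /\ `|pds ds (fun x => Im (P x)) x| <= B.

Hypotheses (oU : open U) (bU : bounded_set U).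

Lemma CS_CC P b k : CS P -> CC b U k P.
move=>Ps;have [p1 p2]:=Ps k.
case: b;split;[exact: p1|exact: p2|exact: Cn_unbounded p1|exact: Cn_unbounded p2].
Qed.

Lemma lint_bounded_on (a : V -> R) C : C0 false U a -> (forall x, U x -> `|a x| <= C) -> lint (zext U a).
move=>a0 aC;have [M HM]:=(bounded_setP U).1 bU.
apply: (@lint_bounded _ _ `|C| M);first exact: (C0_meas oU a0).
 move=>x;have [Ux|nUx]:=pselect (U x);last by rewrite zextF // normr0.
 by rewrite zextT //;apply: le_trans (aC x Ux) (ler_norm _).
by move=>x Mx;rewrite zextF // =>/HM;rewrite leNgt Mx.
Qed.

Definition vU := rint (zext U (fun _ => 1)).

Lemma lint_CS P B : CC false U 0 P -> (forall x, U x -> `|Re (P x)| <= B /\ `|Im (P x)| <= B) ->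
 lint (zext U (fun x => nsq (P x))) /\
 rint (zext U (fun x => nsq (P x))) <= 2 * B ^+ 2 * vU.
move=>cP PB;have H x: U x -> nsq (P x) <= 2 * B ^+ 2.
 move=>Ux;have [h1 h2]:=PB x Ux;rewrite mulr_natl mulr2n;apply: lerD.
  by rewrite -real_normK ?num_real // lerXn2r ?nnegrE // (le_trans _ h1).
 by rewrite -[leLHS]real_normK ?num_real // lerXn2r ?nnegrE // (le_trans _ h2).
have l1: lint (zext U (fun x => nsq (P x))).
 apply: (@lint_bounded_on _ (2 * B ^+ 2));first exact: Cn_C0 (Cn_nsq oU cP).
 by move=>x Ux;rewrite ger0_norm ?nsq_ge0 ?H.
split=>//;have l2: lint (zext U (fun _ => 1 : R)).
 apply: (@lint_bounded_on _ 1)=>[|x _];last by rewrite normr1.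
 exact: Cn_C0 (Cn_cst false oU 0 1).
rewrite -rintZ //;apply: rint_le=>// [|x];first exact: lintZ.
have [Ux|nUx]:=pselect (U x);last by rewrite !zextF // mulr0.
by rewrite !zextT // mulr1 H.
Qed.

Lemma CS_lint P : CS P -> lint (zext U (fun x => nsq (P x))).
move=>Ps;have [[_ /(_ isT)[B1 H1]] [_ /(_ isT)[B2 H2]]]:=((Cn_C0 (Ps 0%N).1), (Cn_C0 (Ps 0%N).2)).
have [] // := @lint_CS P (Num.max B1 B2) (CS_CC false 0 Ps) _.
by move=>x Ux;rewrite !le_max H1 // H2 // orbT.
Qed.

Lemma cRe_subM (X Y c : R[i]) : Re (X - c * Y) = Re X - (Re c * Re Y - Im c * Im Y).
by rewrite cReD cReN cReM. Qed.

Lemma cIm_subM (X Y c : R[i]) : Im (X - c * Y) = Im X - (Re c * Im Y + Im c * Re Y).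
by rewrite cImD cImN cImM. Qed.

Lemma A2_lin c F K : A2 U F -> A2 U K -> A2 U (fun x => F x - c * K x).
move=>[hF lF] [hK lK];have hcK: A2 U (fun x => c * K x).
 split;first by apply: holM=>//;exact: hol_cst.
 rewrite (@zext_eq _ U _ (fun x => nsq c * nsq (K x))) ?zextZ;last by move=>x _;exact: normsqM.
 exact: lintZ.
exact: A2B.
Qed.

Lemma isproj_lin P H P' H' c : CC false U 0 P -> lint (zext U (fun x => nsq (P x))) ->
 CC false U 0 P' -> lint (zext U (fun x => nsq (P' x))) ->
 isproj U P H -> isproj U P' H' -> isproj U (fun x => P x - c * P' x) (fun x => H x - c * H' x).
move=>cP lP cP' lP' [aH pH] [aH' pH'];split;first exact: A2_lin.
move=>K aK;have [z1 z2]:=pH K aK;have [z3 z4]:=pH' K aK.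
have cH:=hol_CC oU 0 aH.1;have cH':=hol_CC oU 0 aH'.1;have cK:=hol_CC oU 0 aK.1.
have [l1 l2]:=lint_mulconj oU (CCD oU cP (CCN oU cH)) cK (lint_nsqB oU cP cH lP aH.2) aK.2.
have [l3 l4]:=lint_mulconj oU (CCD oU cP' (CCN oU cH')) cK (lint_nsqB oU cP' cH' lP' aH'.2) aK.2.
have E x: (P x - c * P' x - (H x - c * H' x)) * (K x)^* =
  (P x - H x) * (K x)^* - c * ((P' x - H' x) * (K x)^*).
 by move: (P x) (P' x) (H x) (H' x) (K x)^* => p p' h h' k;ring.
split.
 rewrite (_ : zext U _ = fun x => zext U (fun x => Re ((P x - H x) * (K x)^*)) x -
  (Re c * zext U (fun x => Re ((P' x - H' x) * (K x)^*)) x -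
  Im c * zext U (fun x => Im ((P' x - H' x) * (K x)^*)) x));last first.
  apply/funext => x;have [Ux|nUx]:=pselect (U x);last by rewrite !zextF // !mulr0 !subr0.
  by rewrite !zextT // E cRe_subM.
 rewrite !rintB ?rintZ ?z1 ?z3 ?z4 ?mulr0 ?subrr //;do ?[exact: lintZ|apply: lintB].
rewrite (_ : zext U _ = fun x => zext U (fun x => Im ((P x - H x) * (K x)^*)) x -
  (Re c * zext U (fun x => Im ((P' x - H' x) * (K x)^*)) x +
  Im c * zext U (fun x => Re ((P' x - H' x) * (K x)^*)) x));last first.
 apply/funext => x;have [Ux|nUx]:=pselect (U x);last by rewrite !zextF // !mulr0 !addr0 subr0.
 by rewrite !zextT // E cIm_subM.
rewrite rintB ?rintD ?rintZ ?z2 ?z3 ?z4 ?mulr0 ?addr0 ?subrr //;do ?[exact: lintZ|apply: lintD].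
Qed.

Lemma CS_lin c P P' : CS P -> CS P' -> CS (fun x => P x - c * P' x).
move=>p p' k;apply: (CCD oU (p k));apply: (CCN oU);apply: (CCM oU)=>//.
by apply: CC_cst;exact: oU.
Qed.

(** Condition R with bounded derivatives in place of boundary limits; see [condition_RP] for the
    equivalence. *)
Definition RC := forall P, CS P -> exists H, isproj U P H /\ forall k, CC true U k H.

Hypothesis rc : RC.

Lemma isproj_CS_uniq P H H' : CS P -> isproj U P H -> isproj U P H' -> forall x, U x -> H x = H' x.
by move=>p h h';apply: (isproj_uniq oU (CS_CC false 0 p) (CS_lint p) h h'). Qed.

(** At a fixed interior point the projection is controlled by the sup norm alone: projecting does
    not increase the L^2 norm, and the parameter of [hol_bound2] taken equal to [B] makes the bound
    homogeneous in [B]. *)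
Lemma proj_point ds x : U x -> exists2 C, 0 <= C & forall P H B, CS P -> isproj U P H -> nrm 0 P B -> 0 < B ->
 `|pds ds (fun y => Re (H y)) x| <= C * B.
move=>Ux;have [r r0 rU] : exists2 r : R, 0 < r & cube x r `<=` U.
 have /nbhs_ballP[d /= d0 Hd] := near_in oU Ux;exists (d / 2);first by rewrite divr_gt0.
 move=>y xy;apply: Hd;rewrite ball_lt.
 by apply: le_lt_trans xy _;rewrite gtr_pMr // invf_lt1 // ltr1n.
have [C C0 HC]:=hol_bound2 ds r0.
have v0: 0 <= vU by apply: rint_ge0_zext => y _.
exists (C * (1 + 2 * vU))=>[|P H B p h PB B0];first by rewrite mulr_ge0 // addr_ge0 // mulr_ge0.
apply: le_trans (HC U H x B oU h.1 rU B0) _;rewrite -mulrA ler_wpM2l // mulrDl mul1r lerD2l.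
have PB' y: U y -> `|Re (P y)| <= B /\ `|Im (P y)| <= B by move=>Uy;exact: (PB [::] isT y Uy).
have [lP iP]:=lint_CS (CS_CC false 0 p) PB'.
have := le_trans (isproj_norm oU (CS_CC false 0 p) lP h) iP => iH.
apply: le_trans (_ : B^-1 * (2 * B ^+ 2 * vU) <= _);first by rewrite ler_wpM2l // invr_ge0 ltW.
rewrite (_ : _ * (_ * _ * _) = 2 * vU * B) //;move: vU => w;field;exact: lt0r_neq0.
Qed.

Lemma proj_bounded ds P H : CS P -> isproj U P H -> exists B, forall x, U x ->
 `|pds ds (fun y => Re (H y)) x| <= B.
move=>p h;have [H' [h' s']]:=rc p.
have [_ /(_ isT)[B HB]]:=Cn_C0 (Csm_pds ds (fun k => (s' k).1) 0%N).
exists B => x Ux;rewrite (pds_cg oU (g := fun y => Re (H' y))) //;first exact: HB.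
by move=>y Uy;rewrite (isproj_CS_uniq p h h').
Qed.

Definition fsumC (P : nat -> V -> R[i]) x : R[i] := fsum (fun j x => Re (P j x)) x +i* fsum (fun j x => Im (P j x)) x.

(** The gliding hump. [d] bounds the k-th term in C^k, [c] is the constant of evaluation at [x k],
    [b] bounds the derivative of the k-th projection on all of [U]. In the projection of the sum of
    all terms, seen at [x k], the k-th contribution exceeds the earlier ones by more than k + 1 and
    the tail costs at most 1, so the derivative is unbounded. *)
Lemma no_hump ds (P H : nat -> V -> R[i]) (x : nat -> V) (b c d : nat -> R) :
 (forall k, [/\ CS (P k), isproj U (P k) (H k) & U (x k)]) ->
 (forall k, 0 < d k /\ 0 <= c k) -> d 0%N <= 1 -> (forall k, d k.+1 * (2 * (1 + c k)) <= d k) ->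
 (forall k, nrm k (P k) (d k)) ->
 (forall k P H B, CS P -> isproj U P H -> nrm 0 P B -> 0 < B ->
  `|pds ds (fun y => Re (H y)) (x k)| <= c k * B) ->
 (forall k y, U y -> `|pds ds (fun y => Re (H k y)) y| <= b k) ->
 (forall k, k%:R + 1 + \sum_(0 <= j < k) b j < `|pds ds (fun y => Re (H k y)) (x k)|) -> False.
move=>PHx dc d1 dS Pd Hc Hb big.
have dgeo k j: d (k + j)%N <= d k * 2^-1 ^+ j.
 elim: j=>[|j IH];first by rewrite addn0 expr0 mulr1.
 rewrite addnS exprS mulrCA -[2^-1 * _]mulrC ler_pdivlMr //;apply: le_trans IH.
 apply: le_trans (dS _);rewrite ler_wpM2l ?(ltW (dc _).1) // ler_peMr // lerDl.
 exact: (dc _).2.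
have d2 j: d j <= 2^-1 ^+ j.
 by have := dgeo 0%N j;rewrite add0n=>/le_trans;apply;rewrite ler_piMl ?exprn_ge0 // invr_ge0.
have g1: geofam U (fun j x => Re (P j x)).
 apply: geofam_of=>[j k|j es y Uy s];first by have [/(_ k)[]]:=PHx j.
 by apply: le_trans (d2 j);exact: (Pd j es s y Uy).1.
have g2: geofam U (fun j x => Im (P j x)).
 apply: geofam_of=>[j k|j es y Uy s];first by have [/(_ k)[]]:=PHx j.
 by apply: le_trans (d2 j);exact: (Pd j es s y Uy).2.
pose S:=fsumC P;have Ss: CS S.
 by move=>k;split;[exact: (fsum_Csm oU g1 k)|exact: (fsum_Csm oU g2 k)].
have [K [SK Ks]]:=rc Ss.
pose tl k y:=S y - \sum_(0 <= j < k) P j y;pose tk k y:=K y - \sum_(0 <= j < k) H j y.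
have tlk k: CS (tl k) /\ isproj U (tl k) (tk k).
 elim: k=>[|k [s p]].
  have -> : tl 0%N = S by apply/funext => y;rewrite /tl big_geq // subr0.
  by have -> : tk 0%N = K by apply/funext => y;rewrite /tk big_geq // subr0.
 have -> : tl k.+1 = fun y => tl k y - 1 * P k y.
  by apply/funext => y;rewrite /tl big_nat_recr //= opprD addrA mul1r.
 have -> : tk k.+1 = fun y => tk k y - 1 * H k y.
  by apply/funext => y;rewrite /tk big_nat_recr //= opprD addrA mul1r.
 have [Pk Hk _]:=PHx k;split;first exact: CS_lin.
 by apply: isproj_lin=>//;[exact: CS_CC|exact: CS_lint|exact: CS_CC|exact: CS_lint].
have tlb k: nrm 0 (tl k) (2 * d k).
 move=>es;case: es=>// _ y Uy /=.
 have gk (a : nat -> R) : (forall j, `|a j| <= d j) -> geo 1 a /\ geo (d k) (fun i => a (k + i)%N).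
  move=>ad;split=>j;first by rewrite mul1r;apply: le_trans (d2 j).
  exact: le_trans (ad _) (dgeo _ _).
 have [a1 a2]:=gk _ (fun j => (Pd j [::] isT y Uy).1);have [a3 a4]:=gk _ (fun j => (Pd j [::] isT y Uy).2).
 rewrite /tl cReD cReN cRe_sum cImD cImN cIm_sum /= /fsum;split.
  by rewrite (tsum_shift a1 a2);exact: tsum_le.
 by rewrite (tsum_shift a3 a4);exact: tsum_le.
have Hs j: Csm false U (fun y => Re (H j y)).
 by move=>k;have [_ h _]:=PHx j;exact: (hol_CC oU k h.1.1).1.
have Ksm: Csm false U (fun y => Re (K y)) by move=>k;exact: (hol_CC oU k SK.1.1).1.
have [B HB]:=proj_bounded ds Ss SK.
have [k Bk] : exists k : nat, B < k%:R.
 by exists (Num.truncn `|B|).+1;apply: le_lt_trans (ler_norm B) _;exact: truncnS_gt.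
have [s p]:=tlk k.+1;have [_ _ Uk]:=PHx k.
(* The tail is itself smooth and projects onto the projection of the sum minus finitely many terms,
   so the point estimate applies to it without any continuity of the projection. *)
have := Hc k _ _ _ s p (tlb k.+1) (mulr_gt0 (ltr0Sn R 1) (dc _).1).
have Tk: pds ds (fun y => Re (tk k.+1 y)) (x k) =
  pds ds (fun y => Re (K y)) (x k) - \sum_(0 <= j < k.+1) pds ds (fun y => Re (H j y)) (x k).
 rewrite -(pds_sum oU _ _ Hs Uk) -(pdsB oU ds Ksm _ Uk).
  by apply: (pds_cg oU)=>// y _;rewrite /tk cReD cReN cRe_sum.
 by move=>l;apply: (Cn_sum oU)=>// j _;exact: Hs.
rewrite Tk big_nat_recr //=;have := HB _ Uk;have := big k.
have : `|\sum_(0 <= j < k) pds ds (fun y => Re (H j y)) (x k)| <= \sum_(0 <= j < k) b j.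
 by apply: le_trans (ler_norm_sum _ _ _) _;apply: ler_sum => j _;exact: Hb.
have : c k * (2 * d k.+1) <= 1.
 have h1: (2^-1 : R) ^+ k <= 1 by rewrite exprn_ile1 // ?invr_ge0 // invf_le1 // ler1n.
 apply: le_trans (le_trans (dS k) (le_trans (d2 k) h1));have dk:=ltW (dc k.+1).1;rewrite -subr_ge0.
 by rewrite (_ : _ - _ = 2 * d k.+1) ?mulr_ge0 //;move: (c k) (d k.+1) => p1 p2;ring.
move: (pds ds _ _) (pds ds _ _) (\sum_(0 <= j < k) _) (\sum_(0 <= j < k) _) (c k * _) => p1 p2 s1 s2 e.
move: Bk;move: (k%:R : R) => kk;clear;rewrite !ler_norml => ? ? /andP[? ?] + /andP[? ?] /andP[? ?].
by rewrite ltr_normr=>/orP[] ?;lra.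
Qed.

(** If no order and constant worked, terms arbitrarily small in C^k with arbitrarily large
    derivative of the projection could be chosen one after the other, each after the constants of
    its predecessors are known. *)
Lemma ubp_re ds : exists M C, 0 <= C /\ forall P H B, CS P -> isproj U P H -> nrm M P B -> 0 < B ->
 forall x, U x -> `|pds ds (fun y => Re (H y)) x| <= C * B.
apply: contrapT => noM.
have Phi k (e N : R) : exists t : (V -> R[i]) * (V -> R[i]) * V, 0 < e ->
 [/\ CS t.1.1, isproj U t.1.1 t.1.2, U t.2, nrm k t.1.1 e & N < `|pds ds (fun y => Re (t.1.2 y)) t.2|].
 have [e0|]:=ltP 0 e;last by exists (fun=> 0, fun=> 0, 0).
 apply: contrapT => noT;apply: noM;exists k, (`|N| / e);split;first by rewrite divr_ge0 // ltW.
 move=>P H B p h PB B0 x Ux;rewrite leNgt;apply/negP => lt;apply: noT.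
 (* The counterexample is rescaled to C^k size [e]; the sign matches linearity in the form
    [0 - c * P]. *)
 pose c : R[i] := (- (e / B))%:C.
 exists (fun y => 0 - c * P y, fun y => 0 - c * H y, x) => _ /=.
 have CS0: CS (fun _ => 0 : R[i]) by move=>l;apply: CC_cst;exact: oU.
 have eB: 0 < e / B by rewrite divr_gt0.
 have cRe y (F : V -> R[i]) : Re (0 - c * F y) = e / B * Re (F y).
  by rewrite cReD cReN cReM /= mul0r subr0 add0r mulNr opprK.
 have cIm y (F : V -> R[i]) : Im (0 - c * F y) = e / B * Im (F y).
  by rewrite cImD cImN cImM /= mul0r addr0 add0r mulNr opprK.
 have Ps1: Csm true U (fun y => Re (P y)) by move=>l;exact: (p l).1.
 have Ps2: Csm true U (fun y => Im (P y)) by move=>l;exact: (p l).2.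
 split=>//;first exact: CS_lin.
 - apply: isproj_lin=>//;[exact: CS_CC|exact: CS_lint|exact: CS_CC|exact: CS_lint|].
  have a0: A2 U (fun _ => 0 : R[i]).
   split;first exact: hol_cst.
   rewrite (@zext_eq _ U _ (fun _ => 0))=>[|y _];last by rewrite /nsq /= expr0n addr0.
   by rewrite (_ : zext U _ = fun _ => 0) ?lint0 //;apply/funext => y;rewrite /zext mulr0.
  split=>// F aF;split;rewrite (_ : zext U _ = fun _ => 0) ?(@rint0 (n + n)) //;
   by apply/funext => y;rewrite /zext subrr mul0r mulr0.
 - move=>es sz y Uy;have [h1 h2]:=PB es sz y Uy;rewrite /= (pds_cg oU (g := fun y => e / B * Re (P y))) //.
  have -> : pds es (fun x => Im (0 - c * P x)) y = pds es (fun y => e / B * Im (P y)) y.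
   by apply: (pds_cg oU)=>// z _;exact: cIm.
  rewrite (pdsZ oU _ _ Ps1) // (pdsZ oU _ _ Ps2) // !(normrM (e / B)) !(gtr0_norm eB).
  by split;rewrite mulrAC ler_pdivrMr // ler_wpM2l // ltW.
 - rewrite (pds_cg oU (g := fun y => e / B * Re (H y))) //.
  have Hs: Csm false U (fun y => Re (H y)) by move=>l;exact: (hol_CC oU l h.1.1).1.
  rewrite (pdsZ oU _ _ Hs) // (normrM (e / B)) (gtr0_norm eB);apply: le_lt_trans (ler_norm N) _.
  have := lt;rewrite -(ltr_pM2l eB);congr (_ < _).
  by move: (`|N|) => w;field;rewrite !lt0r_neq0.
have [Psi HPsi]:=choice (fun a : nat * R * R => Phi a.1.1 a.1.2 a.2).
have /choice[c0 Hc0] : forall x : V, exists c : R, U x -> 0 <= c /\ forall P H B, CS P -> isproj U P H ->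
  nrm 0 P B -> 0 < B -> `|pds ds (fun y => Re (H y)) x| <= c * B.
 move=>x;have [Ux|nUx]:=pselect (U x);last by exists 0.
 by have [C C1 C2]:=proj_point ds Ux;exists C.
have /choice[b0 Hb0] : forall PH : (V -> R[i]) * (V -> R[i]), exists b : R, CS PH.1 -> isproj U PH.1 PH.2 ->
  forall y, U y -> `|pds ds (fun y => Re (PH.2 y)) y| <= b.
 move=>-[P H] /=;have [p|np]:=pselect (CS P);last by exists 0.
 have [h|nh]:=pselect (isproj U P H);last by exists 0.
 by have [B HB]:=proj_bounded ds p h;exists B.
(* The state of the recursion: the size allowed to the next term and the sum of the bounds of all
   earlier projections. *)
pose st:=fix st k : R * R := match k with 0 => (1, 0) | k'.+1 =>
 let s := st k' in let t := Psi (k', s.1, k'%:R + 1 + s.2) in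
 (s.1 / (2 * (1 + c0 t.2)), s.2 + b0 t.1) end.
pose it k:=Psi (k, (st k).1, k%:R + 1 + (st k).2).
have stS k: st k.+1 = ((st k).1 / (2 * (1 + c0 (it k).2)), (st k).2 + b0 (it k).1) by [].
have d0 k: 0 < (st k).1.
 elim: k=>[|k IH] //;rewrite stS /= divr_gt0 // mulr_gt0 // ltr_wpDr //.
 by have [_ _ Ux _ _]:=HPsi (k, (st k).1, k%:R + 1 + (st k).2) IH;have []:=Hc0 _ Ux.
have Hit k:=HPsi (k, (st k).1, k%:R + 1 + (st k).2) (d0 k).
have cge k: 0 <= c0 (it k).2 by have [_ _ Ux _ _]:=Hit k;have []:=Hc0 _ Ux.
have sE k: (st k).2 = \sum_(0 <= j < k) b0 (it j).1.
 by elim: k=>[|k IH];[rewrite big_geq|rewrite big_nat_recr //= -IH].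
apply: (@no_hump ds (fun k => (it k).1.1) (fun k => (it k).1.2) (fun k => (it k).2)
 (fun k => b0 (it k).1) (fun k => c0 (it k).2) (fun k => (st k).1))=>//.
- by move=>k;have []:=Hit k.
- by move=>k;rewrite stS /= mulfVK // lt0r_neq0 // mulr_gt0 // ltr_wpDr.
- by move=>k;have []:=Hit k.
- by move=>k;have [_ _ Ux _ _]:=Hit k;have [_]:=Hc0 _ Ux.
- by move=>k;have [p h _ _ _]:=Hit k;exact: Hb0.
- by move=>k;rewrite -sE;have []:=Hit k.
Qed.

(** Imaginary parts are real parts after multiplication by -i, which commutes with the projection
    and exchanges the two components of [P] up to sign. *)
Lemma ubp ds : exists M C, 0 <= C /\ forall P H B, CS P -> isproj U P H -> nrm M P B -> 0 < B ->
 forall x, U x -> `|pds ds (fun y => Re (H y)) x| <= C * B /\ `|pds ds (fun y => Im (H y)) x| <= C * B.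
have [M [C [C0 HC]]]:=ubp_re ds;exists M, C;split=>// P H B p h PB B0 x Ux;split;first exact: HC h PB B0 x Ux.
have E (F : V -> R[i]) y : Re (0 - 'i * F y) = Im (F y).
 by rewrite cReD cReN cReM /= mul0r mul1r add0r opprB subr0.
have E' (F : V -> R[i]) y : Im (0 - 'i * F y) = -1 * Re (F y).
 by rewrite cImD cImN cImM /= mul0r mul1r add0r add0r mulN1r.
have CS0: CS (fun _ => 0 : R[i]) by move=>l;apply: CC_cst;exact: oU.
have a0: A2 U (fun _ => 0 : R[i]).
 split;first exact: hol_cst.
 rewrite (@zext_eq _ U _ (fun _ => 0))=>[|y _];last by rewrite /nsq /= expr0n addr0.
 by rewrite (_ : zext U _ = fun _ => 0) ?lint0 //;apply/funext => y;rewrite /zext mulr0.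
have p0: isproj U (fun _ => 0) (fun _ => 0 : R[i]).
 split=>// F aF;split;rewrite (_ : zext U _ = fun _ => 0) ?(@rint0 (n + n)) //;
  by apply/funext => y;rewrite /zext subrr mul0r mulr0.
have p1: isproj U (fun y => 0 - 'i * P y) (fun y => 0 - 'i * H y).
 by apply: isproj_lin=>//;[exact: CS_CC|exact: CS_lint|exact: CS_CC|exact: CS_lint].
have := HC _ _ B (CS_lin 'i CS0 p) p1 _ B0 x Ux.
rewrite (pds_cg oU (g := fun y => Im (H y))) //;apply=> es sz y Uy.
have [h1 h2]:=PB es sz y Uy;rewrite (pds_cg oU (g := fun y => Im (P y))) //.
split=>//;rewrite (pds_cg oU (g := fun y => -1 * Re (P y))) // (@pdsZ _ true _ oU) //.
 by rewrite normrM normrN1 mul1r.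
by move=>l;exact: (p l).1.
Qed.

End UniformBoundedness.

(** * Cut-offs in one variable and divergence of complex vector fields *)

Section OneVariable.

Definition bd1 (G : R -> R) := smooth1 G /\ forall k, exists C, forall t, `|G^`(k)%classic t| <= C.

Lemma bd1_derive G : bd1 G -> bd1 (G^`()%classic).
move=>[sG bG];split=>k;first by have := sG k.+1;rewrite derive1Sn.
by have [C HC]:=bG k.+1;exists C => t;rewrite -derive1Sn.
Qed.

Lemma near_gt1 (t : R) : 1 < `|t| -> \forall s \near t, 1 < `|s|.
move=>t1;apply/nbhs_ballP;exists (`|t| - 1)=>/=;first by rewrite subr_gt0.
move=>s;rewrite -ball_normE /ball_ /= ltrBrDl -ltrBrDr => h;apply: lt_le_trans h _.
by rewrite lerBlDr -{1}(subrK s t) addrC ler_normD.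
Qed.

Lemma bd1_is_derive G (t : R) : bd1 G -> is_derive t 1 G (G^`()%classic t).
by move=>[sG _];have := sG 0%N t=>/= D;split=>//;rewrite derive1E. Qed.

Lemma bd1_of_csupp (G : R -> R) : smooth1 G -> (forall t, 1 <= `|t| -> G t = 0) -> bd1 G.
move=>sG G0;split=>// k.
have z j t: 1 < `|t| -> G^`(j)%classic t = 0.
 elim: j t=>[|j IH] t t1;first by rewrite /= G0 // ltW.
 rewrite derive1nS derive1E (@near_eq_derive _ _ _ _ (cst 0)) ?oner_neq0 ?derive_cst //.
 by have := near_gt1 t1;apply: filterS => s;exact: IH.
have cK: compact (G^`(k)%classic @` `[-1, 1]%classic).
 by apply: continuous_compact;[apply: continuous_subspaceT;exact: smooth1_cont|exact: segment_compact].
have [M [_ HM]]:=compact_bounded cK.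
exists (`|M| + 1) => t;have [t1|t1]:=leP `|t| 1;last by rewrite z // normr0 addr_ge0.
apply: (HM (`|M| + 1));first by rewrite (le_lt_trans (ler_norm M)) // ltrDl.
by exists t=>//=;rewrite in_itv /= -ler_norml.
Qed.

Lemma smooth1_mon_bump1 b : smooth1 (fun t : R => t ^+ b * bump1 t).
apply: smooth1_of_rV => k;have oT:=@openT 'rV[R]_1.
have c1: Cn false setT k (fun x : 'rV[R]_1 => x ord0 ord0) by exact: Cn_coord.
have e1: Cn false setT k (fun x : 'rV[R]_1 => eta (2 * (1 + x ord0 ord0))).
 apply: (Cn_comp1 oT eta_smooth);apply: CnZ=>//;apply: CnD=>//;exact: Cn_cst.
have e2: Cn false setT k (fun x : 'rV[R]_1 => eta (2 * (1 - x ord0 ord0))).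
 apply: (Cn_comp1 oT eta_smooth);apply: CnZ=>//;apply: CnB=>//;exact: Cn_cst.
apply: CnM=>//;last exact: CnM.
elim: b=>[|b IH];first by apply: Cn_eq (Cn_cst false oT k 1)=>// x _;rewrite expr0.
by apply: Cn_eq (CnM oT c1 IH)=>// x _;rewrite exprS.
Qed.

Lemma bd1_mon_bump1 b : bd1 (fun t : R => t ^+ b * bump1 t).
by apply: (bd1_of_csupp (@smooth1_mon_bump1 b)) => t t1;rewrite bump1_out // mulr0. Qed.

Lemma bd1_bump1 : bd1 (@bump1).
by have := bd1_mon_bump1 0;under eq_fun do rewrite expr0 mul1r. Qed.

(** Removes a neighbourhood of 0: zero for |t| <= e/2 and one for |t| >= e. Applied to a defining
    function it keeps away from the boundary. *)
Definition kap (e t : R) : R := 1 - bump1 (t / e).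

Lemma kap_small e t : 0 < e -> `|t| <= e / 2 -> kap e t = 0.
move=>e0 te;rewrite /kap bump1_in ?subrr // normrM normfV (gtr0_norm e0).
by rewrite ler_pdivrMr // mulrC.
Qed.

Lemma kap_big e t : 0 < e -> e <= `|t| -> kap e t = 1.
move=>e0 te;rewrite /kap bump1_out ?subr0 // normrM normfV (gtr0_norm e0).
by rewrite ler_pdivlMr // mul1r.
Qed.

Lemma kap_ge0 e t : 0 <= kap e t. Proof. by rewrite subr_ge0 bump1_le1. Qed.
Lemma kap_le1 e t : kap e t <= 1. Proof. by rewrite gerBl bump1_ge0. Qed.

Definition kap' (e t : R) : R := - (bump1^`()%classic (t / e) / e).

Lemma kap_dv e (t : R) : is_derive t (1 : R) (kap e) (kap' e t).
have d1: is_derive t (1 : R) (fun t => t / e) (1 / e).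
 by apply: dv_eq (dvM (dv_id t) (dv_cst t (1 : R) (e^-1))) _ _=>//;rewrite mulr0 addr0.
have D:=@dv_comp1 _ t (1 : R) _ (fun t => t / e) _ _ (bd1_is_derive (t / e) bd1_bump1) d1.
by apply: dv_eq (dvB (dv_cst t (1 : R) (1 : R)) D) _ _=>//;rewrite sub0r mul1r.
Qed.

Lemma kap'_big e t : 0 < e -> e < `|t| -> kap' e t = 0.
move=>e0 te;rewrite /kap' derive1E (@near_eq_derive _ _ _ _ (cst 0)) ?oner_neq0 ?derive_cst ?mul0r ?oppr0 //.
have tW: 1 < `|t / e| by rewrite normrM normfV (gtr0_norm e0) ltr_pdivlMr // mul1r.
by have := near_gt1 tW;apply: filterS => s /ltW;exact: bump1_out.
Qed.

(** The derivative is of size 1/e but lives in |t| <= e, so one factor [t] makes it bounded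
    uniformly in [e]. The masks below therefore carry a power of the defining function. *)
Lemma kap'_bound : exists C : R, forall e t, 0 < e -> `|t * kap' e t| <= C.
have [C HC]:=bd1_bump1.2 1%N;exists C => e t e0.
have C0': 0 <= C by apply: le_trans (HC 0);exact: normr_ge0.
have [te|te]:=leP `|t| e;last by rewrite kap'_big // mulr0 normr0.
rewrite /kap' mulrN normrN mulrCA mulrA -mulrA normrM;have := HC (t / e);rewrite derive1n1.
move: (_^`()%classic _) => w wC;apply: le_trans (_ : C * 1 <= _);last by rewrite mulr1.
rewrite ler_pM // normrM normfV (gtr0_norm e0) ler_pdivrMr //;by rewrite mul1r.
Qed.

End OneVariable.

Lemma smooth_Csm m (U : set 'rV[R]_m) h : open U -> bounded_set U -> smooth_on setT h -> Csm true U h.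
move=>oU bU hs;apply/bounded_pdsP;split.
 by apply/smooth_onP => k;apply: Cn_sub (@subsetT _ _) _;exact: (smooth_onP _ _).1.
move=>ds;have [_ hc]:=hs ds.
have [C HC]:=@cont_bounded m _ (pds ds h) (closure_compact bU) (fun x _ => hc x I).
by exists C => x Ux;apply: HC;exact: subset_closure.
Qed.

Section Divergence.
Variable n : nat.
Local Notation V := 'rV[R]_(n + n).
Implicit Types (F H : V -> R[i]).
Variable U : set V.
Hypotheses (oU : open U) (bU : bounded_set U).

Lemma dzM k F H x : CC false U 1 F -> CC false U 1 H -> U x ->
 dz k (fun y => F y * H y) x = dz k F x * H x + F x * dz k H x.
move=>F1 H1 Ux;have D i:=dvC_pd (dvCM (CC_dv i F1 Ux) (CC_dv i H1 Ux)).
rewrite /dz !D;move: (pdC _ F x) (pdC _ H x) (pdC _ F x) (pdC _ H x) (F x) (H x).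
by move=>a b c d p q;rewrite -!mulrA;ring.
Qed.

Lemma dz_conj k F x : hol U F -> U x -> dz k (fun y => conjc (F y)) x = 0.
move=>hF Ux;have D i:=dvC_pd (dvC_conj (hol_dv oU i hF Ux)).
rewrite /dz !D (hol_CR k hF Ux);have -> (c : R[i]) : conjc c - 'i * conjc ('i * c) = 0;last by rewrite mulr0.
by case: c => u v;apply: complexP;rewrite ?(cReD,cImD,cReN,cImN,cReM,cImM) /=;ring.
Qed.

Lemma CC_dz b k l F : CC b U k.+1 F -> CC b U k (dz l F).
move=>Fk;apply: CCM=>//;first exact: CC_cst.
apply: CCD=>//;first exact: CC_pd.
by apply: CCN=>//;apply: CCM=>//;[exact: CC_cst|exact: CC_pd].
Qed.

Lemma dz_supp K F l x : closed K -> (forall x, U x -> ~ K x -> F x = 0) -> U x -> ~ K x -> dz l F x = 0.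
move=>cK F0 Ux Kx;rewrite /dz /pdC.
have z1 i:=@supp_pd _ U K (fun x => Re (F x)) i oU cK (fun y Uy Ky => congr1 Re (F0 y Uy Ky)) x Ux Kx.
have z2 i:=@supp_pd _ U K (fun x => Im (F x)) i oU cK (fun y Uy Ky => congr1 Im (F0 y Uy Ky)) x Ux Kx.
by rewrite !z1 !z2 mulr0 subr0 mulr0.
Qed.

Lemma int_dz K F l : compact K -> K `<=` U -> (forall x, U x -> ~ K x -> F x = 0) -> CC false U 1 F ->
 [/\ lint (zext U (fun x => Re (dz l F x))), rint (zext U (fun x => Re (dz l F x))) = 0,
   lint (zext U (fun x => Im (dz l F x))) & rint (zext U (fun x => Im (dz l F x))) = 0].
move=>cK KU F0 [F1 F2].
have s1: supp_in U K (fun x => Re (F x)) by move=>x Ux /(F0 x Ux) ->.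
have s2: supp_in U K (fun x => Im (F x)) by move=>x Ux /(F0 x Ux) ->.
have I1 i:=rint_pd_on i oU cK KU s1 F1;have I2 i:=rint_pd_on i oU cK KU s2 F2.
have E1: zext U (fun x => Re (dz l F x)) = fun x => 2^-1 * (zext U (pd (xi l) (fun x => Re (F x))) x +
  zext U (pd (yi l) (fun x => Im (F x))) x).
 apply/funext => x;have [Ux|nUx]:=pselect (U x);last by rewrite !zextF // addr0 mulr0.
 by rewrite !zextT // Re_dz.
have E2: zext U (fun x => Im (dz l F x)) = fun x => 2^-1 * (zext U (pd (xi l) (fun x => Im (F x))) x -
  zext U (pd (yi l) (fun x => Re (F x))) x).
 apply/funext => x;have [Ux|nUx]:=pselect (U x);last by rewrite !zextF // subr0 mulr0.
 by rewrite !zextT // Im_dz.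
have [a1 a2]:=I1 (xi l);have [b1 b2]:=I2 (yi l);have [c1 c2]:=I2 (xi l);have [d1 d2]:=I1 (yi l).
rewrite E1 E2;split;do ?[exact: lintZ|apply: lintZ|exact: lintD|exact: lintB].
 by rewrite rintZ ?rintD ?a2 ?b2 ?addr0 ?mulr0 //;exact: lintD.
by rewrite rintZ ?rintB ?c2 ?d2 ?subr0 ?mulr0 //;exact: lintB.
Qed.

End Divergence.

(** * Integration by parts along a field transverse to one face of a corner *)

Section BellStep.
Variable n : nat.
Local Notation V := 'rV[R]_(n + n).
Variables (N : nat) (r : 'I_N -> V -> R) (U : set V).
Hypotheses (oU : open U) (bU : bounded_set U) (rs : forall j, smooth_on setT (r j)).
Hypothesis UE : U = [set x | forall j, r j x < 0].
Variables (S : {set 'I_N}) (p : V) (d : R).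
Hypothesis off : forall j x, j \notin S -> cube p d x -> r j x < 0.

Definition rC j (x : V) : R[i] := (r j x)%:C.

Lemma r_CS j : Csm true U (r j). Proof. exact: smooth_Csm. Qed.

Lemma mask_dz (h : 'I_N -> R -> R) (h' : 'I_N -> R) l x : U x ->
 (forall j, is_derive (r j x) (1 : R) (h j) (h' j)) ->
 dz l (fun y => (\prod_(j in S) h j (r j y))%:C) x =
 \sum_(j in S) (h' j * \prod_(i in S | i != j) h i (r i x))%:C * dz l (rC j) x.
move=>Ux hd.
have D i j: dvC i (fun y => (h j (r j y))%:C) x ((h' j)%:C * pdC i (rC j) x).
 have D0:=Cn_derive i (r_CS j 1%N) Ux.
 have z0: Im (pdC i (rC j) x) = 0 by have [_ H]:=dv_cst x (ebasis R i) (0 : R);exact: H.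
 split;last by apply: dv_eq (dv_cst x _ (0 : R)) _ _=>//;rewrite cImM z0 mulr0 mul0r addr0.
 by apply: dv_eq (dv_comp1 (hd j) D0) _ _=>//;rewrite cReM /= mul0r subr0.
have P i: pdC i (fun y => (\prod_(j in S) h j (r j y))%:C) x =
 \sum_(j in S) ((h' j)%:C * pdC i (rC j) x) * (\prod_(i in S | i != j) h i (r i x))%:C.
 apply: dvC_pd;have := dvC_prod (enum_uniq (mem S)) (D i).
 move/dvC_eq;apply=> [y|];first by rewrite big_enum rmorph_prod.
 by rewrite big_enum;apply: eq_bigr => j jS;congr (_ * _);rewrite rmorph_prod big_enum_cond.
rewrite {1}/dz !P [X in _ - X]mulr_sumr -sumrB mulr_sumr;apply: eq_bigr => j _.
rewrite rmorphM /= /dz;move: (pdC _ _ _) (pdC _ _ _) (_%:C) (_%:C) => a b c e;ring.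
Qed.

Definition Psi (e : 'I_N -> nat) x : R := \prod_(j in S) r j x ^+ e j.

Variables (k : 'I_N) (X : 'I_n -> V -> R[i]).
Hypotheses (kS : k \in S) (Xs : forall l, CS U (X l)).
Hypothesis Xr : forall j x, j \in S -> U x -> cube p d x -> \sum_l X l x * dz l (rC j) x = (j == k)%:R.
Variable a : V -> R[i].
Hypotheses (as_ : CS U a) (a0 : forall x, U x -> ~ cube p d x -> a x = 0).

Definition divX x : R[i] := \sum_l dz l (fun y => X l y * a y) x.

Lemma divX_CS : CS U divX.
by move=>q;apply: CC_sum=>// l _;apply: CC_dz=>//;apply: CCM=>//;exact: Xs. Qed.

Lemma divX_supp x : U x -> ~ cube p d x -> divX x = 0.
move=>Ux px;apply: big1 => l _;apply: (dz_supp (K := cube p d) oU) Ux px=>//;[exact: cube_closed|move=>y Uy py].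
by rewrite a0 // mulr0.
Qed.

Variable e : 'I_N -> nat.
(** The exponents with one more factor [r k], the factor that keeps the derivative of the mask
    bounded. *)
Definition e1 j := (e j + (j == k))%N.
Let he (t : R) j s := s ^+ e1 j * kap t s.
Let he' (t : R) j s := s ^+ (e1 j).-1 *+ e1 j * kap t s + s ^+ e1 j * kap' t s.

Lemma he_dv t j (s : R) : is_derive s (1 : R) (he t j) (he' t j s).
apply: dv_eq (dvM (dvX (e1 j) (dv_id s)) (kap_dv t s)) _ _=>//.
rewrite /he';move: (kap _ _) (kap' _ _) (s ^+ _) (s ^+ _) => u v w z;ring.
Qed.

Let Pt t x := \prod_(j in S) he t j (r j x).
Let Ct t x := he' t k (r k x) * \prod_(i in S | i != k) he t i (r i x).

(** The field [X] differentiates [r k] only, with derivative 1, and d/dz kills the conjugate of [g];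
    what remains is the derivative of the mask and the divergence of [X a]. Outside the cube
    everything vanishes with [a]. *)
Lemma bell_integrand t (g : V -> R[i]) x : hol U g -> U x ->
 \sum_l dz l (fun y => (Pt t y)%:C * (X l y * a y) * conjc (g y)) x =
 ((Ct t x)%:C * a x + (Pt t x)%:C * divX x) * conjc (g x).
move=>hg Ux.
have P1: CC false U 1 (fun y => (Pt t y)%:C).
 apply: CC_real=>//;apply: (Cn_prod oU) => j _;have r1:=Csm_Cn (r_CS j).
 have rX q: Cn false U 1 (fun y => r j y ^+ q).
  elim: q=>[|q IH];first by apply: Cn_eq (Cn_cst false oU 1 1)=>// y _;rewrite expr0.
  by apply: Cn_eq (CnM oU (r1 1%N) IH)=>// y _;rewrite exprS.
 apply: (CnM oU)=>//;apply: (CnB oU);first exact: Cn_cst.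
 apply: (Cn_comp1 oU bd1_bump1.1);apply: Cn_eq (CnZ oU t^-1 (r1 1%N))=>// y _.
 exact: mulrC.
have A1 l: CC false U 1 (fun y => X l y * a y).
 by apply: CCM=>//;[exact: (CS_CC false 1 (Xs l))|exact: (CS_CC false 1 as_)].
have g1: CC false U 1 (fun y => conjc (g y)) by apply: CC_conj=>//;exact: hol_CC.
have E l: dz l (fun y => (Pt t y)%:C * (X l y * a y) * conjc (g y)) x =
 (dz l (fun y => (Pt t y)%:C) x * X l x) * (a x * conjc (g x)) +
 dz l (fun y => X l y * a y) x * ((Pt t x)%:C * conjc (g x)).
 rewrite (dzM (U := U)) //;last exact: CCM.
 rewrite (dz_conj oU l hg Ux) mulr0 addr0 (dzM (U := U)) //.
 by move: (dz _ _ _) (dz _ _ _) (_%:C) (X l x) (a x) (conjc _) => u v w z b c;ring.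
rewrite (eq_bigr _ (fun l _ => E l)) big_split /= -!mulr_suml -/(divX x).
suff -> : (\sum_l dz l (fun y => (Pt t y)%:C) x * X l x) * (a x * conjc (g x)) =
  (Ct t x)%:C * (a x * conjc (g x)).
 by move: (_%:C) (_%:C) (divX x) (a x) (conjc _) => u v w b c;ring.
have [px|npx]:=pselect (cube p d x);last by rewrite a0 // mul0r !mulr0.
congr (_ * _).
have F l: dz l (fun y => (Pt t y)%:C) x * X l x = \sum_(j in S)
  (he' t j (r j x) * \prod_(i in S | i != j) he t i (r i x))%:C * (X l x * dz l (rC j) x).
 rewrite (mask_dz l Ux (fun j => he_dv t j (r j x))) mulr_suml;apply: eq_bigr => j _.
 by rewrite -mulrA [dz _ _ _ * _]mulrC.
rewrite (eq_bigr _ (fun l _ => F l)) exchange_big /= (bigD1 k) //= [X in _ + X]big1 ?addr0.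
 by rewrite -mulr_sumr Xr // eqxx mulr1.
by move=>j /andP[jS jk];rewrite -mulr_sumr Xr // (negbTE jk) mulr0.
Qed.

(** On [U] this is the divergence of [Psi e1 * X * a], written out with the help of X r_j = 1 for j
    = k and 0 otherwise. It trades the function (e_k + 1) [Psi e] a for one that carries an
    additional factor [r k]. *)
Definition bellf x : R[i] := ((e k).+1%:R * Psi e x)%:C * a x + (Psi e1 x)%:C * divX x.

Lemma r_bound : exists2 B, 1 <= B & forall j x, U x -> `|r j x| <= B.
have /choice[C HC] : forall j, exists C, forall x, U x -> `|r j x| <= C.
 by move=>j;have [_ /(_ isT)]:=Cn_C0 (r_CS j 0%N).
exists (1 + \sum_j `|C j|)=>[|j x Ux];first by rewrite lerDl sumr_ge0.
apply: le_trans (HC j x Ux) _;apply: le_trans (ler_norm _) _.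
by rewrite (bigD1 j) //= addrCA lerDl addr_ge0 // sumr_ge0.
Qed.

Lemma dct_stationary (F : nat -> V -> R) f g : (forall m, C0 false U (F m)) -> C0 false U f ->
 (forall x, U x -> \forall m \near \oo, F m x = f x) -> (forall m x, U x -> `|F m x| <= g x) ->
 lint (zext U g) -> (forall m, rint (zext U (F m)) = 0) -> rint (zext U f) = 0.
move=>cF cf Ff Fg lg F0.
have D: (fun m => rint (zext U (F m))) @ \oo --> rint (zext U f).
 apply: (rint_dct (g := zext U g))=>[m|||m x|//].
 - exact: C0_meas oU (cF m).
 - exact: C0_meas oU cf.
 - move=>x;have [Ux|nUx]:=pselect (U x);last first.
   by rewrite zextF //;under eq_fun do rewrite zextF //;exact: cvg_cst.
  rewrite zextT //;under eq_fun do rewrite zextT //.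
  by apply: cvg_near_cst;exact: Ff.
 - have [Ux|nUx]:=pselect (U x);last by rewrite !zextF // normr0.
  by rewrite !zextT // Fg.
have E: (fun m => rint (zext U (F m))) = fun _ => 0 by apply/funext => m;rewrite F0.
by rewrite E in D;have /cvg_lim := D => <- //;rewrite lim_cst.
Qed.

Lemma Psi_Csm f : Csm true U (Psi f).
move=>q;apply: (Cn_prod oU) => j _;elim: (f j)=>[|m IH].
 by apply: Cn_eq (Cn_cst true oU q 1)=>// y _;rewrite expr0.
by apply: Cn_eq (CnM oU (r_CS j q) IH)=>// y _;rewrite exprS.
Qed.

Lemma bellf_CS : CS U bellf.
move=>q;apply: CCD=>//;apply: CCM=>//;do ?[exact: divX_CS];apply: CC_real=>//.
 by apply: CnZ=>//;exact: Psi_Csm.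
exact: Psi_Csm.
Qed.

(** Inside the cube only the faces in [S] can reach the boundary, so requiring r_j <= -t/2 there
    cuts out a compact part of [U]. *)
Lemma mask_compact t : 0 < t -> exists K, [/\ compact K, K `<=` U &
 forall x, U x -> ~ K x -> cube p d x -> \prod_(j in S) kap t (r j x) = 0].
move=>t0;exists (cube p d `&` [set x | forall j, j \in S -> r j x <= - (t / 2)]);split.
- apply/rV_compactP;split.
  apply: closedI;first exact: cube_closed.
  have -> : [set x | forall j, j \in S -> r j x <= - (t / 2)] =
    \bigcap_(j in [set j | j \in S]) [set x | r j x <= - (t / 2)] by apply/seteqP;split.
  apply: closed_bigI => j _;apply: (@closed_comp _ _ (r j) [set s | s <= - (t / 2)]);last exact: closed_le.
  by move=>x _;exact: (rs j [::]).2.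
 apply/bounded_setP;have [M HM]:=(bounded_setP _).1 ((rV_compactP _).1 (@cube_compact _ p d)).2.
 by exists M => x [/HM].
- move=>x [px xS];rewrite UE => j;have [jS|jS]:=boolP (j \in S);last exact: off.
 by apply: le_lt_trans (xS j jS) _;rewrite oppr_lt0 divr_gt0.
move=>x Ux nK px;have [j jS rj] : exists2 j, j \in S & - (t / 2) < r j x.
 apply: contrapT => H;apply: nK;split=>// j jS;rewrite leNgt;apply/negP => rj;apply: H;by exists j.
rewrite (bigD1 j) //= kap_small ?mul0r //;move: Ux;rewrite UE=>/(_ j) rn.
by rewrite ltr0_norm // lerNl ltW.
Qed.

(** The divergence form of [bellf] is integrated against conj(K) with masks that give compact
    support, where the integral vanishes. Letting the masks tend to 1 by dominated convergence asks
    nothing of [K] at the boundary beyond square integrability. *)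
Lemma bell_step K : A2 U K -> orth U bellf K.
move=>aK;pose t m : R := m.+1%:R^-1;have t0 m: 0 < t m by rewrite invr_gt0.
have t1 m: t m <= 1 by rewrite invf_le1 // ler1n.
pose F m x:=\sum_l dz l (fun y => (Pt (t m) y)%:C * (X l y * a y) * conjc (K y)) x.
have cK:=hol_CC oU 0 aK.1;have cK1:=hol_CC oU 1 aK.1.
have PtE s x: Pt s x = Psi e1 x * \prod_(j in S) kap s (r j x) by rewrite /Pt /Psi -big_split.
have cQ m l: CC false U 1 (fun y => (Pt (t m) y)%:C * (X l y * a y) * conjc (K y)).
 apply: CCM=>//;last exact: CC_conj.
 apply: CCM=>//;last by apply: CCM=>//;[exact: (CS_CC false 1 (Xs l))|exact: (CS_CC false 1 as_)].
 apply: CC_real=>//;suff : Cn false U 1 (fun x => Psi e1 x * \prod_(j in S) kap (t m) (r j x)).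
  by apply: Cn_eq=>// y _;rewrite PtE.
 apply: CnM=>//;first exact: Cn_unbounded (Psi_Csm e1 1%N).
 apply: (Cn_prod oU) => j _;apply: (CnB oU);first exact: Cn_cst.
 apply: (Cn_comp1 oU bd1_bump1.1);apply: Cn_eq (CnZ oU (t m)^-1 (Cn_unbounded (r_CS j 1%N)))=>// y _.
 exact: mulrC.
have cF m: CC false U 0 (F m) by apply: CC_sum=>// l _;exact: CC_dz.
have cB: CC false U 0 (fun x => bellf x * conjc (K x)).
 by apply: CCM=>//;[exact: (CS_CC false 0 bellf_CS)|exact: CC_conj].
(* At a fixed point of [U] all masks are equal to 1 once [t m] is below every |r_j x|, so the
   integrands become stationary. *)
have ev x: U x -> \forall m \near \oo, F m x = bellf x * conjc (K x).
 move=>Ux;have [c c0 Hc]:=pos_lower_bound (s := enum 'I_N) (f := fun j => - r j x)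
  (fun j _ => ltac:(by rewrite oppr_gt0;move: Ux;rewrite UE)).
 near=> m;rewrite /F bell_integrand //;last exact: aK.1.
 have tc: t m < c by near: m;exact: (near_infty_natSinv_lt (PosNum c0)).
 have tr j: t m < `|r j x|.
  rewrite -normrN;apply: lt_le_trans tc _;apply: le_trans (ler_norm _);apply: Hc.
  by rewrite mem_enum.
 congr ((_%:C * _ + _%:C * _) * _).
  have -> : Psi e x = r k x ^+ e k * \prod_(i in S | i != k) r i x ^+ e i by rewrite /Psi (bigD1 k).
  rewrite /Ct /he' kap'_big // mulr0 addr0 kap_big ?(ltW (tr k)) // mulr1 [RHS]mulrA.
  congr (_ * _);first by rewrite /e1 eqxx addn1 /= mulr_natl.
  by apply: eq_bigr => i /andP[_ ik];rewrite /he kap_big ?(ltW (tr i)) // mulr1 /e1 (negbTE ik) addn0.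
 by rewrite /Pt /Psi;apply: eq_bigr => j _;rewrite /he kap_big ?(ltW (tr j)) // mulr1.
(* Uniformity in [m] rests on [kap'_bound]: one factor [r k] is spent on the derivative of the
   mask. *)
have [C HC] : exists C, forall m x, U x -> nsq ((Ct (t m) x)%:C * a x + (Pt (t m) x)%:C * divX x) <= C.
 have [B B1 HB]:=r_bound;have [Ck HCk]:=kap'_bound.
 have [_ /(_ isT)[A HA]]:=Cn_C0 (Cn_nsq oU (as_ 0%N)).
 have [_ /(_ isT)[A' HA']]:=Cn_C0 (Cn_nsq oU (divX_CS 0%N)).
 pose B2:=\prod_(j in S) B ^+ e1 j.
 pose B1':=((e1 k)%:R * B ^+ (e1 k).-1 + B ^+ (e1 k).-1 * Ck) * \prod_(i in S | i != k) B ^+ e1 i.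
 exists (2 * (B1' ^+ 2 * A + B2 ^+ 2 * A')) => m x Ux.
 have kap1 s: `|kap (t m) s| <= 1 by rewrite ger0_norm ?kap_ge0 // kap_le1.
 have rX j q: `|r j x ^+ q| <= B ^+ q by rewrite normrX lerXn2r ?nnegrE ?HB // (le_trans ler01).
 have heB i: `|he (t m) i (r i x)| <= B ^+ e1 i.
  by rewrite /he normrM -[leRHS]mulr1 ler_pM.
 have B0 q: 0 <= B ^+ q by rewrite exprn_ge0 // (le_trans ler01).
 have PB: `|Pt (t m) x| <= B2.
  by rewrite /Pt normr_prod;apply: ler_prod => j _;rewrite normr_ge0 heB.
 have CB: `|Ct (t m) x| <= B1'.
  rewrite /Ct normrM;apply: ler_pM=>//;last first.
   by rewrite normr_prod;apply: ler_prod => j _;rewrite normr_ge0 heB.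
  rewrite /he';apply: le_trans (ler_normD _ _) _;apply: lerD.
   rewrite -mulr_natl -mulrA normrM normr_nat ler_wpM2l // normrM -[leRHS]mulr1;exact: ler_pM.
  have -> : r k x ^+ e1 k = r k x ^+ (e1 k).-1 * r k x by rewrite -exprSr prednK // /e1 eqxx addn1.
  by rewrite -mulrA normrM ler_pM // HCk.
 have := normsqB_le ((Ct (t m) x)%:C * a x) (- ((Pt (t m) x)%:C * divX x));rewrite opprK.
 move/le_trans;apply;rewrite ler_wpM2l // -mulN1r !normsqM.
 have nr (s : R) : nsq s%:C = s ^+ 2 by rewrite /nsq /= expr0n addr0.
 have -> : nsq (-1) = 1 :> R by rewrite /nsq /= oppr0 expr0n addr0 sqrrN expr1n.
 rewrite !nr mul1r;have sq (s u : R) : `|s| <= u -> s ^+ 2 <= u ^+ 2.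
  by move=>su;rewrite -real_normK ?num_real // lerXn2r ?nnegrE // (le_trans _ su).
 by apply: lerD;apply: ler_pM;rewrite ?sqr_ge0 ?nsq_ge0 ?sq //;
  [have := HA x Ux|have := HA' x Ux];apply: le_trans;exact: ler_norm.
have lg: lint (zext U (fun x => C + nsq (K x))).
 rewrite zextD;apply: lintD;last exact: aK.2.
 by apply: (lint_bounded_on oU bU (C := `|C|))=>//;exact: Cn_C0 (Cn_cst false oU 0 C).
have bd m x: U x -> `|Re (F m x)| <= C + nsq (K x) /\ `|Im (F m x)| <= C + nsq (K x).
 move=>Ux;rewrite /F bell_integrand //;last exact: aK.1.
 have [h1 h2]:=normsq_mul_le ((Ct (t m) x)%:C * a x + (Pt (t m) x)%:C * divX x) (K x).
 by split;[apply: le_trans h1 _|apply: le_trans h2 _];rewrite lerD2r HC.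
have I m: rint (zext U (fun x => Re (F m x))) = 0 /\ rint (zext U (fun x => Im (F m x))) = 0.
 have [Km [cKm KU Ksup]]:=mask_compact (t0 m).
 have Q0 l x: U x -> ~ Km x -> (Pt (t m) x)%:C * (X l x * a x) * conjc (K x) = 0.
  move=>Ux nK;have [px|px]:=pselect (cube p d x);last by rewrite (a0 Ux px) !(mulr0, mul0r).
  by rewrite PtE (Ksup x Ux nK px) mulr0 mul0r mul0r.
 have J' l:=@int_dz n U oU Km _ l cKm KU (Q0 l) (cQ m l).
 split.
  rewrite (_ : zext U _ = fun x => \sum_l zext U (fun x => Re (dz l
   (fun y => (Pt (t m) y)%:C * (X l y * a y) * conjc (K y)) x)) x).
   by rewrite rint_sum=>[|l _];[apply: big1 => l _;have []:=J' l|have []:=J' l].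
  apply/funext => x;have [Ux|nUx]:=pselect (U x).
   by rewrite zextT // /F cRe_sum;apply: eq_bigr => l _;rewrite zextT.
  by rewrite zextF // big1 // => l _;rewrite zextF.
 rewrite (_ : zext U _ = fun x => \sum_l zext U (fun x => Im (dz l
  (fun y => (Pt (t m) y)%:C * (X l y * a y) * conjc (K y)) x)) x).
  by rewrite rint_sum=>[|l _];[apply: big1 => l _;have []:=J' l|have []:=J' l].
 apply/funext => x;have [Ux|nUx]:=pselect (U x).
  by rewrite zextT // /F cIm_sum;apply: eq_bigr => l _;rewrite zextT.
 by rewrite zextF // big1 // => l _;rewrite zextF.
split.
 apply: (dct_stationary (fun m => Cn_C0 (cF m).1) (Cn_C0 cB.1) _ _ lg)=>[x Ux|m x Ux|m].
 - by have := ev x Ux;apply: filterS => m ->.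
 - exact: (bd m x Ux).1.
 - exact: (I m).1.
apply: (dct_stationary (fun m => Cn_C0 (cF m).2) (Cn_C0 cB.2) _ _ lg)=>[x Ux|m x Ux|m].
- by have := ev x Ux;apply: filterS => m ->.
- exact: (bd m x Ux).2.
- exact: (I m).2.
Unshelve. all: by end_near. Qed.

End BellStep.

Opaque dz.

(** * Families depending on a scale and powers of the scale *)

Section Families.
Variable m : nat.
Local Notation V := 'rV[R]_m.
Variable U : set V.
Hypothesis oU : open U.
Implicit Types w : R -> V -> R.

Definition tin (t : R) := 0 < t <= 1.
Definition Smf w := forall t, tin t -> Csm true U (w t).

(** Reads w_t = O(t^p) in C^M, uniformly for 0 < t <= 1; it keeps count of the powers of the scale
    lost by differentiating cut-offs. *)
Fixpoint Fam (M p : nat) w : Prop :=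
 (exists C, forall t x, tin t -> U x -> `|w t x| <= C * t ^+ p) /\
 match M with 0 => True | M'.+1 => forall i, Fam M' p (fun t => pd i (w t)) end.

Lemma Smf_pd w i : Smf w -> Smf (fun t => pd i (w t)).
by move=>ws t t0;exact: Csm_pd (ws t t0). Qed.

Lemma Fam_eq M p w w' : (forall t x, tin t -> U x -> w t x = w' t x) -> Fam M p w -> Fam M p w'.
elim: M w w'=>[|M IH] w w' E [[C HC] H];split=>//;try by exists C => t x t0 Ux;rewrite -E // HC.
move=>i;apply: IH (H i) => t x t0 Ux;apply: (pd_eqon oU)=>// y Uy;exact: E.
Qed.

Lemma Fam_pred M p w : Fam M.+1 p w -> Fam M p w.
by elim: M w=>[|M IH] w [H1 H2];split=>// i;apply: IH;exact: H2. Qed.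

Lemma FamD M p w w' : Smf w -> Smf w' -> Fam M p w -> Fam M p w' -> Fam M p (fun t x => w t x + w' t x).
elim: M w w'=>[|M IH] w w' s s' [[C HC] H] [[C' HC'] H'];split=>//;
 try by exists (C + C') => t x t0 Ux;rewrite mulrDl;apply: le_trans (ler_normD _ _) _;rewrite lerD ?HC ?HC'.
move=>i;apply: Fam_eq (IH _ _ (Smf_pd i s) (Smf_pd i s') (H i) (H' i)) => t x t0 Ux.
by have [_ D]:=dvD (Cn_derive i (s t t0 1%N) Ux) (Cn_derive i (s' t t0 1%N) Ux);exact: esym D.
Qed.

Lemma SmfM w w' : Smf w -> Smf w' -> Smf (fun t x => w t x * w' t x).
by move=>s s' t t0 k;apply: CnM=>//;[exact: s|exact: s']. Qed.

Lemma FamM M p p' w w' : Smf w -> Smf w' -> Fam M p w -> Fam M p' w' ->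
 Fam M (p + p') (fun t x => w t x * w' t x).
elim: M w w'=>[|M IH] w w' s s' H H';split=>//;
 try by have [[[C HC] _] [[C' HC'] _]]:=(H, H');exists (C * C') => t x t0 Ux;
 rewrite normrM exprD mulrACA ler_pM ?HC ?HC'.
move=>i;have [_ /(_ i) Hi]:=H;have [_ /(_ i) Hi']:=H'.
have si:=Smf_pd i s;have si':=Smf_pd i s'.
apply: Fam_eq (FamD (SmfM si s') (SmfM s si') (IH _ _ si s' Hi (Fam_pred H')) (IH _ _ s si' (Fam_pred H) Hi')).
move=>t x t0 Ux.
by have [_ D]:=dvM (Cn_derive i (s t t0 1%N) Ux) (Cn_derive i (s' t t0 1%N) Ux);exact: esym D.
Qed.

Lemma Fam_cst M h : Csm true U h -> Fam M 0 (fun _ => h).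
elim: M h=>[|M IH] h hs;split=>//;try by have [_ /(_ isT)[C HC]]:=Cn_C0 (hs 0%N);exists C => t x _ Ux;
 rewrite expr0 mulr1 HC.
by move=>i;apply: IH;exact: Csm_pd.
Qed.

Lemma Fam_weak M p w : Fam M p w -> Fam M 0 w.
elim: M w=>[|M IH] w [[C HC] H];split=>//;try by exists `|C| => t x t0 Ux;rewrite expr0 mulr1;
 apply: le_trans (HC t x t0 Ux) _;have [t1 t2]:=andP t0;apply: le_trans (_ : `|C| * t ^+ p <= _);
 [rewrite ler_wpM2r ?ler_norm // exprn_ge0 // ltW|rewrite ler_piMr // exprn_ile1 // ltW].
by move=>i;apply: IH;exact: H.
Qed.

Lemma Fam_sup M p w : Fam M p w -> exists2 C, 0 <= C & forall t ds x, tin t -> (size ds <= M)%N -> U x ->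
 `|pds ds (w t) x| <= C * t ^+ p.
elim: M w=>[|M IH] w [[C HC] H].
 exists `|C|=>// t ds x t0;rewrite leqn0=>/nilP -> Ux;apply: le_trans (HC t x t0 Ux) _.
 by rewrite ler_wpM2r ?ler_norm // exprn_ge0 // ltW //;case/andP: t0.
have /choice[B HB] : forall i, exists B, 0 <= B /\ forall t ds x, tin t -> (size ds <= M)%N -> U x ->
  `|pds ds (pd i (w t)) x| <= B * t ^+ p by move=>i;have [B B0 HB]:=IH _ (H i);exists B.
have S0: 0 <= \sum_i B i by apply: sumr_ge0 => i _;exact: (HB i).1.
exists (`|C| + \sum_i B i)=>[|t ds x t0];first by rewrite addr_ge0.
have tp: 0 <= t ^+ p by rewrite exprn_ge0 // ltW //;case/andP: t0.
case/lastP: ds=>[|ds i];first by move=>_ Ux;apply: le_trans (HC t x t0 Ux) _;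
 rewrite ler_wpM2r // (le_trans (ler_norm _)) // lerDl.
rewrite size_rcons pds_rcons => dM Ux;apply: le_trans ((HB i).2 t ds x t0 dM Ux) _.
by rewrite ler_wpM2r // (bigD1 i) //= addrCA lerDl addr_ge0 // sumr_ge0 // => j _;exact: (HB j).1.
Qed.

(** A profile in r/t with a power of [t] in front that pays for its derivatives. *)
Definition scaled (r : V -> R) b (G : R -> R) t x := t ^+ b * G (t^-1 * r x).

Lemma scaled_Smf r b G : Csm true U r -> bd1 G -> Smf (scaled r b G).
move=>rs [sG _] t t0 k;apply: CnZ=>//;apply: Cn_comp1=>//;apply: CnZ=>//;exact: rs.
Qed.

(* Each derivative costs one factor [t^-1], so [t ^+ (M + p)] leaves [t ^+ p] after [M] of them. *)
Lemma scaled_Fam r M p G : Csm true U r -> bd1 G -> Fam M p (scaled r (M + p) G).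
move=>rs;have B q H: bd1 H -> exists C, forall t x, tin t -> U x -> `|scaled r (q + p) H t x| <= C * t ^+ p.
 move=>bH;have [C HC]:=bH.2 0%N;exists C => t x t0 Ux;have [t1 t2]:=andP t0.
 have tp l: 0 <= t ^+ l by rewrite exprn_ge0 // ltW.
 rewrite /scaled normrM ger0_norm // mulrC ler_pM ?HC //;by rewrite exprD ler_piMl // exprn_ile1 // ltW.
elim: M G=>[|M IH] G bG;split=>//;do ?exact: B.
move=>i;have H:=FamM (scaled_Smf (M + p) rs (bd1_derive bG)) (fun t _ => Csm_pd i rs)
 (IH _ (bd1_derive bG)) (Fam_cst M (Csm_pd i rs)).
rewrite addn0 in H;apply: Fam_eq H => t x t0 Ux;have t1: t != 0 by rewrite gt_eqF //;case/andP: t0.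
have D:=dvZ t^-1 (Cn_derive i (rs 1%N) Ux).
have [_ D1]:=dvZ (t ^+ (M.+1 + p)) (@dv_comp1 _ x (ebasis R i) G (fun y => t^-1 * r y) _ _ (bd1_is_derive (t^-1 * r x) bG) D).
apply: etrans (esym D1);rewrite /scaled addSn exprS;move: (G^`()%classic _) (pd i r x) (t ^+ _) => u v z;by field.
Qed.

End Families.

Lemma far_half (u v c : R) : v = 2 * c -> `|u - v| <= c -> c <= u.
by move=>->;rewrite ler_norml=>/andP[+ _];lra. Qed.

(** Independence over C of the complex gradients, in the real form of the definition of generic
    corners. *)
Definition cr_free n N (r : 'I_N -> 'rV[R]_(n + n) -> R) (S : {set 'I_N}) p := forall a b : 'I_N -> R,
 (forall k : 'I_n,
  \sum_(j in S) (a j * dbar_re (r j) p k - b j * dbar_im (r j) p k) = 0 /\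
  \sum_(j in S) (a j * dbar_im (r j) p k + b j * dbar_re (r j) p k) = 0) ->
 forall j, j \in S -> a j = 0 /\ b j = 0.

(** * Approximation modulo the kernel of the Bergman projection *)

Section LocalModel.
Variable n : nat.
Local Notation V := 'rV[R]_(n + n).
Variables (N : nat) (r : 'I_N -> V -> R) (U : set V).
Hypotheses (oU : open U) (bU : bounded_set U) (rs : forall j, smooth_on setT (r j)).
Hypothesis UE : U = [set x | forall j, r j x < 0].

Section Fields.
Variables (S : {set 'I_N}) (p : V).
Hypothesis CR : cr_free r S p.

Definition dA j l x : R[i] := dz l (rC r j) x.

(** The Gram matrix of the complex gradients of the faces in [S], completed by the identity so that
    its size does not vary with [S]. *)
Definition Gm x : 'M[R[i]]_N := \matrix_(j, k)
 if (j \in S) && (k \in S) then \sum_l dA j l x * conjc (dA k l x) else (j == k)%:R.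

Lemma dAE j l x : dA j l x = dbar_re (r j) x l -i* dbar_im (r j) x l.
have z0 i: pd i (fun x => Im (rC r j x)) x = 0 by have [_ H]:=dv_cst x (ebasis R i) (0 : R);exact: H.
by apply: complexP;rewrite ?Re_dz ?Im_dz !z0 ?addr0 ?sub0r ?mulrN.
Qed.

(** A null vector [v] of the Gram matrix yields a combination of the gradients of zero norm, hence
    zero; independence over C forces [v] to vanish on [S], and the identity block does so
    elsewhere. *)
Lemma Gm_det : \det (Gm p) != 0.
apply/negP=>/det0P[v v0 vG];move/negP: v0;apply;apply/eqP/rowP => k;rewrite mxE.
have E j: \sum_i v ord0 i * Gm p i j = 0 by have := congr1 (fun M : 'rV_N => M ord0 j) vG;rewrite !mxE.
have vout j: j \notin S -> v ord0 j = 0.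
 move=>jS;have := E j;rewrite (bigD1 j) //= [X in _ + X]big1 ?addr0.
  by rewrite mxE (negbTE jS) /= eqxx mulr1.
 by move=>i ij;rewrite mxE (negbTE jS) andbF (negbTE ij) mulr0.
have [kS|kS]:=boolP (k \in S);last exact: vout.
pose wv l:=\sum_(j in S) v ord0 j * dA j l p.
have w0: \sum_l nsq (wv l) = 0.
 have : \sum_l (nsq (wv l))%:C = 0 :> R[i].
  transitivity (\sum_(j in S) conjc (v ord0 j) * \sum_(i in S) v ord0 i * Gm p i j).
   transitivity (\sum_l \sum_(j in S) conjc (v ord0 j) * (\sum_(i in S) v ord0 i * (dA i l p * conjc (dA j l p)))).
    apply: eq_bigr => l _;rewrite -mulCJ {2}/wv rmorph_sum mulr_sumr;apply: eq_bigr => j jS.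
    rewrite rmorphM mulrCA;congr (_ * _);rewrite /wv mulr_suml;apply: eq_bigr => i iS;exact/esym/mulrA.
   rewrite exchange_big /=;apply: eq_bigr => j jS;rewrite -mulr_sumr exchange_big /=;congr (_ * _).
   by apply: eq_bigr => i iS;rewrite mxE jS iS /= mulr_sumr.
  apply: big1 => j jS;rewrite -[RHS](mulr0 (conjc (v ord0 j))) -[in RHS](E j);congr (_ * _).
  rewrite [RHS](bigID (mem S)) /= [X in _ + X]big1 ?addr0 // => i iS;by rewrite vout // mul0r.
 by rewrite -rmorph_sum=>/(congr1 Re).
have wl l: wv l = 0.
 apply/eqP;rewrite -nsq_eq0;apply/eqP.
 by have /psumr_eq0P -> := w0=>// i _;exact: nsq_ge0.
have [|h1 h2]:=@CR (fun j => Re (v ord0 j)) (fun j => - Im (v ord0 j)) _ k kS;last first.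
 by apply: complexP=>//;apply/eqP;rewrite -oppr_eq0;apply/eqP.
move=>l;have := wl l;rewrite /wv => W;split.
 have H: Re _ = 0 := congr1 Re W;rewrite -[RHS]H cRe_sum;apply: eq_bigr => j _.
 by rewrite cReM dAE /=;ring.
have H: Im _ = 0 := congr1 Im W;apply/eqP;rewrite -oppr_eq0 -sumrN -[X in _ == X]H cIm_sum;apply/eqP.
by apply: eq_bigr => j _;rewrite cImM dAE /=;ring.
Qed.

Lemma dA_CC b k (W : set V) j l : open W -> (forall q, Cn b W q (r j)) -> CC b W k (dA j l).
by move=>oW rj;apply: CC_dz=>//;apply: CC_real=>//;exact: rj. Qed.

Lemma Gm_CC b k (W : set V) i j : open W -> (forall q l, Cn b W q (r l)) -> CC b W k (fun x => Gm x i j).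
move=>oW rj;have [iS|iS]:=boolP ((i \in S) && (j \in S)).
 apply: (@CC_eq _ _ _ oW _ (fun x => \sum_l dA i l x * conjc (dA j l x)))=>[x _|];first by rewrite mxE iS.
 by apply: CC_sum=>// l _;apply: CCM=>//;[|apply: CC_conj=>//];apply: dA_CC=>// q.
by apply: (@CC_eq _ _ _ oW _ (fun x => (i == j)%:R))=>[x _|];[rewrite mxE (negbTE iS)|exact: CC_cst].
Qed.

(** The dual basis: conjugate gradients combined by the inverse Gram matrix. Near [p] that inverse
    exists by continuity of the determinant. *)
Lemma corner_fields e : 0 < e -> exists d (X : 'I_N -> 'I_n -> V -> R[i]), [/\ 0 < d, d <= e,
 forall k l, CS U (X k l) & forall k j x, k \in S -> j \in S -> cube p d x ->
  \sum_l X k l x * dA j l x = (j == k)%:R].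
move=>e0;pose c:=nsq (\det (Gm p)) / 2.
have c0: 0 < c by rewrite divr_gt0 // lt0r nsq_ge0 nsq_eq0 Gm_det.
have rT q l: Cn false setT q (r l) by exact: (smooth_onP _ _).1.
have gT:=Cn_nsq openT (CC_det openT (fun i j => Gm_CC 0 i j openT rT)).
have [d1 d10 Hd1]:=(cont_epsP _ _).1 ((Cn_C0 gT).1 p I) _ c0.
pose d2:=Num.min (d1 / 2) e;have d20: 0 < d2 by rewrite lt_min divr_gt0.
have big x: `|x - p| <= d2 -> c <= nsq (\det (Gm x)).
 move=>xp;have /Hd1 : `|x - p| < d1.
  by apply: le_lt_trans xp _;rewrite gt_min ltr_pdivrMr // ltr_pMr // ltr1n.
 have E: nsq (\det (Gm p)) = 2 * c by rewrite /c mulrCA divff ?mulr1.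
 exact: far_half.
(* The denominator |det|^2, made positive away from [p] by adding 1 minus a bump. The fields are
   then smooth on all of [U], and nothing changes within [d2 / 2] of [p]. *)
pose tau x : R := nsq (\det (Gm x)) + (1 - bump p d2 x).
have tau0 x: Num.min c 1 <= tau x.
 rewrite ge_min;have [xp|xp]:=leP `|x - p| d2.
  by rewrite ler_wpDr ?big // subr_ge0 bump_le1.
 by rewrite [X in _ || X](_ : _ = true) ?orbT // /tau bump_out ?(ltW xp) // subr0 lerDr nsq_ge0.
have m0: 0 < Num.min c 1 by rewrite lt_min c0 ltr01.
have rU q l: Cn true U q (r l) by exact: smooth_Csm.
exists (d2 / 2), (fun k l x => (\sum_(j in S) conjc (dA j l x) * (\adj (Gm x)) j k) *
 (conjc (\det (Gm x)) * ((tau x)^-1)%:C));split.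
- by rewrite divr_gt0.
- by rewrite ler_pdivrMr // (@le_trans _ _ e) ?ge_min ?lexx ?orbT // ler_peMr ?ler1n // ltW.
- move=>k l q;have dC:=CC_det oU (fun i j => Gm_CC q i j oU rU).
 apply: CCM=>//;last first.
  apply: CCM=>//;first exact: CC_conj.
  apply: CC_real=>//;apply: (CnV oU m0);last by move=>_ x _;rewrite ger0_norm ?tau0 // (le_trans (ltW m0)).
   apply: CnD=>//;first exact: Cn_nsq.
   apply: CnB=>//;first exact: Cn_cst.
   by apply: Cn_sub (@subsetT _ _) _;exact: bump_smooth.
  by move=>x _;rewrite gt_eqF // (lt_le_trans m0).
 apply: CC_sum=>// j _;apply: CCM=>//;first by apply: CC_conj=>//;apply: dA_CC.
 apply: (@CC_eq _ _ _ oU _ (fun x => (-1) ^+ (k + j) * \det (row' k (col' j (Gm x)))))=>[x _|].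
  by rewrite mxE.
 apply: CCM=>//;first exact: CC_cst.
 apply: CC_det=>// a b';apply: (@CC_eq _ _ _ oU _ (fun x => Gm x (lift k a) (lift j b')))=>[x _|].
  by rewrite !mxE.
 exact: Gm_CC.
move=>k j x kS jS xp;have dx:=big x (le_trans xp _).
have dn: nsq (\det (Gm x)) != 0.
 by rewrite gt_eqF // (lt_le_trans c0) // dx // ler_pdivrMr // ler_peMr ?ler1n // ltW.
have tx: tau x = nsq (\det (Gm x)) by rewrite /tau bump_in ?subrr ?addr0.
have M: \sum_(i in S) Gm x j i * (\adj (Gm x)) i k = \det (Gm x) * (j == k)%:R.
 have := congr1 (fun A : 'M[R[i]]_N => A j k) (mul_mx_adj (Gm x));rewrite !mxE mulr_natr => <-.
 rewrite [RHS](bigID (mem S)) /= [X in _ + X]big1 ?addr0 // => i iS.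
 have ji: (j == i) = false by apply/negbTE;apply: contraNneq iS => <-.
 by rewrite [Gm x j i]mxE (negbTE iS) andbF ji mul0r.
transitivity ((\sum_(i in S) Gm x j i * (\adj (Gm x)) i k) * (conjc (\det (Gm x)) * ((tau x)^-1)%:C)).
 rewrite mulr_suml;under eq_bigr => l _ do rewrite mulrAC mulr_suml mulr_suml.
 rewrite exchange_big /=;apply: eq_bigr => i iS;rewrite [Gm x j i]mxE jS iS /=.
 rewrite -mulrA mulr_suml;apply: eq_bigr => l _.
 by move: (conjc (\det (Gm x)) * _) (conjc (dA i l x)) (dA j l x) (\adj _ _ _) => z u v w;ring.
rewrite M tx mulrAC mulrA mulCJ -rmorphM /= divff // mul1r //.
Qed.

End Fields.

Definition perp P := isproj U P (fun _ => 0).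

Lemma perp_lin c P Q : CS U P -> CS U Q -> perp P -> perp Q -> perp (fun x => P x - c * Q x).
move=>p q pP pQ;have := isproj_lin oU c (CS_CC false 0 p) (CS_lint oU bU p) (CS_CC false 0 q) (CS_lint oU bU q) pP pQ.
by under [X in isproj _ _ X -> _]eq_fun do rewrite mulr0 subr0.
Qed.

Lemma perp_eq P Q : P =1 Q -> perp P -> perp Q.
by move=>/funext ->. Qed.

Lemma A2_0 : A2 U (fun _ => 0 : R[i]).
split;first exact: hol_cst.
rewrite (@zext_eq _ U _ (fun _ => 0))=>[|y _];last by rewrite /nsq /= expr0n addr0.
by rewrite (_ : zext U _ = fun _ => 0) ?lint0 //;apply/funext => y;rewrite /zext mulr0.
Qed.

Lemma perp_orth P : (forall K, A2 U K -> orth U P K) -> perp P.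
by move=>oP;split=>[|K aK];[exact: A2_0|under eq_fun do rewrite subr0;exact: oP]. Qed.

Lemma perp0 : perp (fun _ => 0 : R[i]).
apply: perp_orth => K aK;split;rewrite (_ : zext U _ = fun _ => 0) ?(@rint0 (n + n)) //;
 by apply/funext => y;rewrite /zext mul0r mulr0.
Qed.

Section Approximation.
Variables (S : {set 'I_N}) (p : V) (d : R) (X : 'I_N -> 'I_n -> V -> R[i]).
Hypotheses (off : forall j x, j \notin S -> cube p d x -> r j x < 0).
Hypothesis Xs : forall k l, CS U (X k l).
Hypothesis Xr : forall k j x, k \in S -> j \in S -> cube p d x -> \sum_l X k l x * dz l (rC r j) x = (j == k)%:R.

Definition localized (a : V -> R[i]) := CS U a /\ forall x, U x -> ~ cube p d x -> a x = 0.

(** Modulo functions that project to 0, each use of [bell_step] multiplies by one more defining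
    function; the list [ks] says in which order the faces are treated. *)
Lemma bell_iter (ks : seq 'I_N) a : {subset ks <= S} -> localized a -> exists2 a', localized a' &
 perp (fun x => a x - (Psi r S (fun l => count_mem l ks) x)%:C * a' x).
elim: ks a=>[|k ks IH] a kS la.
 exists a=>//;apply: perp_eq perp0 => x;rewrite /Psi big1 ?mul1r ?subrr // => j _;exact: expr0.
have [|a' la' pa']:=IH a _ la;first by move=>j jk;apply: kS;rewrite inE jk orbT.
have kk: k \in S by apply: kS;rewrite mem_head.
pose e l:=count_mem l ks;have [as' a0']:=la'.
have Xk j x: j \in S -> U x -> cube p d x -> \sum_l X k l x * dz l (rC r j) x = (j == k)%:R.
 by move=>jS _ px;exact: Xr.
have dC:=divX_CS oU (Xs k) as'.
have PC f: CS U (fun x => (Psi r S f x)%:C) by move=>q;apply: CC_real=>//;exact: Psi_Csm.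
have bC: CS U (bellf r S k (X k) a' e) by apply: bellf_CS.
have pb: perp (bellf r S k (X k) a' e).
 by apply: perp_orth => K aK;exact: (bell_step oU bU rs UE off kk (Xs k) Xk as' a0' e aK).
(* Normalised so that the term (e_k + 1) [Psi e] a' of [bellf] cancels the current one. *)
pose c : R[i] := (- (e k).+1%:R^-1)%:C.
exists (fun x => c * divX (X k) a' x).
 split=>[q|x Ux px];first exact: (CCM oU (CC_cst true oU q c) (dC q)).
 by rewrite (divX_supp oU (X k) a0' Ux px) mulr0.
have cC f: CS U f -> CS U (fun x => a x - f x).
 by move=>fs q;apply: CCD=>//;[exact: la.1|apply: CCN=>//;exact: fs].
have := perp_lin c (cC _ (fun q => CCM oU (PC e q) (as' q))) bC pa' pb.
apply: perp_eq => x;rewrite /bellf -/e (_ : e1 k e = fun l => count_mem l (k :: ks));last first.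
 by apply/funext => l;rewrite /e1 /e /= addnC eq_sym.
have c1: c * ((e k).+1%:R * Psi r S e x)%:C = - (Psi r S e x)%:C.
 by rewrite /c -rmorphM mulNr mulrA mulVf ?mul1r ?rmorphN // pnatr_eq0.
rewrite mulrDr;have -> : c * (((e k).+1%:R * Psi r S e x)%:C * a' x) = - ((Psi r S e x)%:C * a' x).
 by rewrite mulrA c1 mulNr.
clear c1;move: (_%:C) (_%:C) (a x) (a' x) (divX _ _ _) (c) => u v w z b c0;ring.
Qed.

Variable M : nat.
(** The power of [r j] cut off at distance [t] from its zero set, written as the power minus a
    scaled profile in order to be estimated as a family; [TmE] gives the multiplicative form. *)
Definition Tm j t x : R := r j x ^+ M.+1 - scaled (r j) M.+1 (fun s => s ^+ M.+1 * bump1 s) t x.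

Lemma TmE j t x : tin t -> Tm j t x = r j x ^+ M.+1 * kap t (r j x).
case/andP=> t0 _;rewrite /Tm /scaled /kap (mulrC t^-1) mulrBr mulr1 [X in _ - X]mulrA -exprMn.
by rewrite [t * _]mulrCA divff ?mulr1 // gt_eqF.
Qed.

(** A power M + 1 pays for M derivatives at scale [t] and leaves a factor [t]; the product over the
    faces is replaced one factor at a time. *)
Lemma Tm_Fam (l : seq 'I_N) : Smf U (fun t x => \prod_(j <- l) Tm j t x) /\
 Fam U M 1 (fun t x => \prod_(j <- l) Tm j t x - \prod_(j <- l) r j x ^+ M.+1).
have rM j: Csm true U (fun x => r j x ^+ M.+1).
 move=>q;elim: (M.+1)=>[|k IH];first by apply: Cn_eq (Cn_cst true oU q 1)=>// y _;rewrite expr0.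
 by apply: Cn_eq (CnM oU (smooth_Csm oU bU (rs j) q) IH)=>// y _;rewrite exprS.
have Ss j: Smf U (scaled (r j) M.+1 (fun s => s ^+ M.+1 * bump1 s)).
 by apply: scaled_Smf=>//;[exact: smooth_Csm|exact: bd1_mon_bump1].
have FS j: Fam U M 1 (scaled (r j) M.+1 (fun s => s ^+ M.+1 * bump1 s)).
 have := scaled_Fam oU M 1 (smooth_Csm oU bU (rs j)) (bd1_mon_bump1 M.+1);by rewrite addn1.
have cN w: Smf U w -> Smf U (fun t x => -1 * w t x) by move=>s t t0 q;apply: CnZ=>//;exact: s.
have one q: Csm true U (fun _ => q : R) by move=>k;exact: Cn_cst.
have FN w: Smf U w -> Fam U M 1 w -> Fam U M 1 (fun t x => -1 * w t x).
 by move=>s f;exact: (FamM oU (fun t _ => one (-1)) s (Fam_cst M (one (-1))) f).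
have Ts j: Smf U (Tm j) by move=>t t0 q;apply: CnB=>//;[exact: rM|exact: Ss].
elim: l=>[|j l [IHs IHf]].
 split=>[t t0 q|];first by apply: Cn_eq (one 1 q)=>// x _;rewrite big_nil.
 apply: (@Fam_eq _ _ oU _ _ (fun t x => -1 * scaled (fun _ => 0) (M + 1) (fun _ => 0) t x)).
  by move=>t x _ _;rewrite !big_nil subrr /scaled mulr0 mulr0.
 have b0: bd1 (fun _ : R => 0 : R).
  have E k: (fun _ : R => 0 : R)^`(k)%classic = fun _ => 0.
   by elim: k=>// k IH;rewrite derive1nS IH;apply/funext => t;rewrite derive1_cst.
  by split=>[k x|k];[rewrite E|exists 0 => t;rewrite E normr0].
 by apply: FN;[exact: scaled_Smf|exact: scaled_Fam].
have Ps: Csm true U (fun x => \prod_(i <- l) r i x ^+ M.+1) by move=>q;apply: Cn_prod=>// i _;exact: rM.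
split=>[t t0 q|].
 by apply: Cn_eq (CnM oU (Ts j t t0 q) (IHs t t0 q))=>// x _;rewrite big_cons.
have FT: Fam U M 0 (Tm j).
 apply: Fam_eq (FamD oU (fun t _ => rM j) (cN _ (Ss j)) (Fam_cst M (rM j)) (Fam_weak (FN _ (Ss j) (FS j))))=>//.
 by move=>t x _ _;rewrite /Tm mulN1r.
have sD: Smf U (fun t x => \prod_(i <- l) Tm i t x - \prod_(i <- l) r i x ^+ M.+1).
 by move=>t t0 q;apply: CnB=>//;exact: IHs.
have H1:=FamM oU (Ts j) sD FT IHf.
have H2:=FamM oU (cN _ (Ss j)) (fun t _ => Ps) (FN _ (Ss j) (FS j)) (Fam_cst M Ps).
apply: Fam_eq (FamD oU (SmfM oU (Ts j) sD) (SmfM oU (cN _ (Ss j)) (fun t _ => Ps)) H1 H2)=>// t x _ _.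
rewrite !big_cons /Tm;move: (\prod_(i <- l) _) (\prod_(i <- l) _) (scaled _ _ _ _ _) (_ ^+ _) => u v w z;ring.
Qed.

(** Up to functions projecting to 0, [a] is replaced by a function vanishing to order M + 1 on each
    active face. Cutting it off near the faces then costs only O(t) in C^M. *)
Lemma localized_approx a : localized a -> exists P C, [/\ CS U P, perp (fun x => a x - P x), 0 <= C &
 forall t, tin t -> exists th K, [/\ CS U th, compact K, K `<=` U, (forall x, U x -> ~ K x -> th x = 0) &
  nrm U M (fun x => P x - th x) (C * t)]].
(* Every active face occurs M + 1 times in the list. *)
move=>la;have [|a' [as' a0'] pa']:=@bell_iter (flatten (nseq M.+1 (enum S))) a _ la.
 by move=>k /flattenP[s];rewrite mem_nseq=>/andP[_ /eqP ->];rewrite mem_enum.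
pose Q (x : V) : R := \prod_(j <- enum S) r j x ^+ M.+1.
have QE x: Psi r S (fun l => count_mem l (flatten (nseq M.+1 (enum S)))) x = Q x.
 rewrite /Psi /Q [RHS]big_enum;apply: eq_bigr => j jS;congr (_ ^+ _).
 rewrite count_flatten map_nseq (count_uniq_mem _ (enum_uniq _)) mem_enum jS.
 by elim: (M.+1)=>//= k ->;rewrite add1n.
have [TS TF]:=Tm_Fam (enum S).
have Qs: Csm true U Q by move=>q;apply: (Cn_eq oU _ (Psi_Csm oU bU rs S (fun _ => M.+1) q)) => x _;rewrite /Q big_enum.
pose PT t x : R := \prod_(j <- enum S) Tm j t x.
have sD: Smf U (fun t x => PT t x - Q x) by move=>t t0 q;apply: CnB=>//;exact: TS.
have [a1 a2] : Csm true U (fun x => Re (a' x)) /\ Csm true U (fun x => Im (a' x)).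
 by split=>q;[exact: (as' q).1|exact: (as' q).2].
have [C1 C10 H1]:=Fam_sup (FamM oU sD (fun t _ => a1) TF (Fam_cst M a1)).
have [C2 C20 H2]:=Fam_sup (FamM oU sD (fun t _ => a2) TF (Fam_cst M a2)).
exists (fun x => (Q x)%:C * a' x), (C1 + C2);split;[| |exact: addr_ge0|].
- by move=>q;apply: CCM=>//;apply: CC_real.
- by apply: perp_eq pa' => x;rewrite QE.
move=>t tt;have t0: 0 < t by case/andP: tt.
have [K [cK KU Ksup]]:=mask_compact rs UE off t0.
exists (fun x => (PT t x)%:C * a' x), K;split=>//.
- by move=>q;apply: CCM=>//;apply: CC_real=>//;exact: TS.
- move=>x Ux nK;have [px|px]:=pselect (cube p d x);last by rewrite a0' // mulr0.
 rewrite (_ : PT t x = 0) ?mul0r //;rewrite /PT (eq_bigr _ (fun j _ => TmE j x tt)) big_split /=.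
 by rewrite [X in _ * X]big_enum Ksup // mulr0.
have E x: (Q x)%:C * a' x - (PT t x)%:C * a' x =
  (-1 * ((PT t x - Q x) * Re (a' x))) +i* (-1 * ((PT t x - Q x) * Im (a' x))).
 by apply: complexP;rewrite ?cReD ?cImD ?cReN ?cImN ?cReM ?cImM /=;ring.
move=>ds dM x Ux;have sx: Csm true U (fun x => (PT t x - Q x) * Re (a' x)) by move=>q;apply: CnM=>//;exact: sD.
have sy: Csm true U (fun x => (PT t x - Q x) * Im (a' x)) by move=>q;apply: CnM=>//;exact: sD.
have tp: t ^+ (1 + 0) = t by rewrite addn0 expr1.
have h1:=H1 t ds x tt dM Ux;have h2:=H2 t ds x tt dM Ux;rewrite tp in h1 h2.
split.
 rewrite (pds_cg oU (g := fun x => -1 * ((PT t x - Q x) * Re (a' x)))) // =>[|y _];last by rewrite E.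
 by rewrite (pdsZ oU _ _ sx) // normrM normrN1 mul1r (le_trans h1) // ler_wpM2r ?lerDl // ltW.
rewrite (pds_cg oU (g := fun x => -1 * ((PT t x - Q x) * Im (a' x)))) // =>[|y _];last by rewrite E.
by rewrite (pdsZ oU _ _ sy) // normrM normrN1 mul1r (le_trans h2) // ler_wpM2r ?lerDr // ltW.
Qed.

End Approximation.

(** For every order M, [a] has the same projection as some [P] that is a C^M limit of functions with
    compact support. *)
Definition approximable a := forall M, exists P C, [/\ CS U P, perp (fun x => a x - P x), 0 <= C &
 forall t, tin t -> exists th K, [/\ CS U th, compact K, K `<=` U, (forall x, U x -> ~ K x -> th x = 0) &
  nrm U M (fun x => P x - th x) (C * t)]].

Lemma CS_D P Q : CS U P -> CS U Q -> CS U (fun x => P x + Q x).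
by move=>p q k;apply: CCD. Qed.

Lemma CS_cst c : CS U (fun _ => c).
by move=>k;apply: CC_cst. Qed.

Lemma nrmD M P Q B B' : CS U P -> CS U Q -> nrm U M P B -> nrm U M Q B' -> nrm U M (fun x => P x + Q x) (B + B').
move=>p q hP hQ ds dM x Ux;have [p1 p2]:=hP ds dM x Ux;have [q1 q2]:=hQ ds dM x Ux.
split.
 rewrite (pds_cg oU (g := fun x => Re (P x) + Re (Q x))) // =>[|y _];last by rewrite cReD.
 by rewrite (pdsD oU ds (fun k => (p k).1) (fun k => (q k).1) Ux) (le_trans (ler_normD _ _)) // lerD.
rewrite (pds_cg oU (g := fun x => Im (P x) + Im (Q x))) // =>[|y _];last by rewrite cImD.
by rewrite (pdsD oU ds (fun k => (p k).2) (fun k => (q k).2) Ux) (le_trans (ler_normD _ _)) // lerD.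
Qed.

Lemma approximableD a b : CS U a -> CS U b -> approximable a -> approximable b -> approximable (fun x => a x + b x).
move=>as_ bs ha hb M;have [P [C [Ps pP C0 HP]]]:=ha M;have [Q [C' [Qs pQ C0' HQ]]]:=hb M.
have cN f g: CS U f -> CS U g -> CS U (fun x => f x - g x).
 by move=>fs gs q;apply: CCD=>//;apply: CCN.
exists (fun x => P x + Q x), (C + C');split;[exact: CS_D| |exact: addr_ge0|].
 apply: perp_eq (perp_lin (-1) (cN _ _ as_ Ps) (cN _ _ bs Qs) pP pQ) => x.
 by rewrite mulN1r opprK opprD addrACA.
move=>t tt;have [th [K [ths cK KU thK n1]]]:=HP t tt;have [th' [K' [ths' cK' KU' thK' n2]]]:=HQ t tt.
exists (fun x => th x + th' x), (K `|` K');split.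
- exact: CS_D.
- exact: compactU.
- by move=>x [/KU|/KU'].
- by move=>x Ux /not_orP[h1 h2];rewrite thK // thK' // addr0.
rewrite mulrDl;under [X in nrm _ _ X]eq_fun do rewrite opprD addrACA.
by apply: nrmD=>//;exact: cN.
Qed.

Lemma approximable_sum (I : eqType) (s : seq I) (a : I -> V -> R[i]) : (forall i, i \in s -> CS U (a i)) ->
 (forall i, i \in s -> approximable (a i)) -> approximable (fun x => \sum_(i <- s) a i x).
have z0: approximable (fun _ => 0).
 move=>M;exists (fun _ => 0), 0;split=>//;[exact: CS_cst|by apply: perp_eq perp0 => x;rewrite subr0|].
 move=>t _;exists (fun _ => 0), set0;split=>//;[exact: CS_cst|exact: compact0|].
 by move=>ds _ x Ux;rewrite subr0 mul0r /= !(pds_cst0 true oU) // normr0.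
elim: s=>[|i s IH] as_ ha;first by under [X in approximable X]eq_fun do rewrite big_nil.
under [X in approximable X]eq_fun do rewrite big_cons.
apply: approximableD;[exact: as_ (mem_head _ _)| |exact: ha (mem_head _ _)|].
 have : forall i, i \in s -> CS U (a i) by move=>j js;apply: as_;rewrite inE js orbT.
 elim: s {IH as_ ha}=>[|j s IH] h;first by under [X in CS U X]eq_fun do rewrite big_nil;exact: CS_cst.
 under [X in CS U X]eq_fun do rewrite big_cons.
 by apply: CS_D;[exact: h (mem_head _ _)|apply: IH => l ls;apply: h;rewrite inE ls orbT].
by apply: IH => j js;[apply: as_|apply: ha];rewrite inE js orbT.
Qed.

Hypothesis CR : forall (S : {set 'I_N}) p, (forall j, j \in S -> r j p = 0) -> cr_free r S p.

Lemma closure_le0 p j : closure U p -> r j p <= 0.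
move=>cp;rewrite leNgt;apply/negP => rp.
have /cp[x [Ux]] : nbhs p [set x | 0 < r j x].
 exact: (rs j [::]).2 p I _ (lt_nbhsr rp).
by move: Ux;rewrite UE=>/(_ j) /= /lt_trans h /h;rewrite ltxx.
Qed.

Lemma CS_approximable_near p : closure U p -> exists2 d, 0 < d & forall a, CS U a ->
 (forall x, U x -> ~ cube p d x -> a x = 0) -> approximable a.
move=>cp;pose S:=[set j | r j p == 0]%SET.
have Sp j: j \in S -> r j p = 0 by rewrite inE=>/eqP.
have /choice[e0 He0] : forall j, exists e, 0 < e /\ (j \notin S -> forall x, `|x - p| < e -> r j x < 0).
 move=>j;have [jS|jS]:=boolP (j \in S);first by exists 1.
 have rp: r j p < 0 by rewrite lt_neqAle closure_le0 // andbT;rewrite inE in jS.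
 have /nbhs_ballP[e /= e0 He] : nbhs p [set x | r j x < 0].
  exact: (rs j [::]).2 p I _ (lt_nbhsl rp).
 exists e;split=>// _ x xp;apply: He;by rewrite ball_lt.
have [e e1 He]:=@pos_lower_bound _ (enum 'I_N) e0 (fun j _ => (He0 j).1).
have e2: 0 < e / 2 by rewrite divr_gt0.
have [d [X [d0 de Xs Xr]]]:=corner_fields (CR Sp) e2.
exists d=>// a as_ a0 M;apply: (@localized_approx S p d X)=>// j x jS px.
apply: (He0 j).2=>//;apply: lt_le_trans (He j _);last by rewrite mem_enum.
by apply: le_lt_trans px (le_lt_trans de _);rewrite gtr_pMr // invf_lt1 // ltr1n.
Qed.

(** Corners of the closure and interior points are treated alike, an interior point having no active
    face; a partition of unity near the compact closure adds the local results. *)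
Lemma CS_approximable a : CS U a -> approximable a.
move=>as_;have /choice[d Hd] : forall p, exists d, closure U p -> 0 < d /\ forall a, CS U a ->
  (forall x, U x -> ~ cube p d x -> a x = 0) -> approximable a.
 move=>p;have [cp|ncp]:=pselect (closure U p);last by exists 0.
 by have [d d0 H]:=CS_approximable_near cp;exists d.
have [s [e [Hs _ e0 Hsum]]]:=partition_of_unity (closure_compact bU) (fun p cp => (Hd p cp).1).
have sa pc: pc \in s -> CS U (fun x => (pc.2 x)%:C * a x).
 move=>ps q;have [_ cs _]:=Hs pc ps;apply: CCM=>//;apply: CC_real=>//.
 by apply: Cn_sub (@subsetT _ _) _;exact: cs.
have H: approximable (fun x => \sum_(pc <- s) (pc.2 x)%:C * a x).
 apply: approximable_sum=>// pc ps;have [cp cs c0]:=Hs pc ps.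
 apply: (Hd pc.1 cp).2=>[|x Ux px];first exact: sa.
 by rewrite c0 ?mul0r // ltW // ltNge;apply/negP.
have E x: U x -> \sum_(pc <- s) (pc.2 x)%:C * a x = a x.
 move=>Ux;rewrite -mulr_suml -rmorph_sum (Hsum x x) ?mul1r //;first exact: subset_closure.
 by rewrite subrr normr0.
have perp_eqU P Q: (forall x, U x -> P x = Q x) -> perp P -> perp Q.
 move=>PQ [_ oP];apply: perp_orth => K aK;have [q1 q2]:=oP K aK;split.
  by rewrite -[RHS]q1;congr rint;apply: zext_eq => x Ux;rewrite PQ // subr0.
 by rewrite -[RHS]q2;congr rint;apply: zext_eq => x Ux;rewrite PQ // subr0.
move=>M;have [P [C [Ps pP C0 HP]]]:=H M;exists P, C;split=>//.
by apply: perp_eqU pP => x Ux;rewrite E.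
Qed.

(** [P] projects onto [h] because [h - P] projects to 0, so [h - H] is the projection of [P - th].
    That difference is small in C^M, with M the order that the uniform estimate asks for derivatives
    up to the first. *)
Lemma bell_density h (e : R) : RC U -> CS U h -> hol U h -> 0 < e -> exists th K H,
 [/\ CS U th, compact K /\ K `<=` U, (forall x, U x -> ~ K x -> th x = 0), isproj U th H &
  CS U H /\ forall ds x, (size ds <= 1)%N -> U x ->
  `|pds ds (fun x => Re (h x) - Re (H x)) x| <= e /\ `|pds ds (fun x => Im (h x) - Im (H x)) x| <= e].
(* An option indexes the multi-indices of order at most 1: the function itself and its partial
   derivatives. *)
move=>rc hs hh e0;pose dl (o : option 'I_(n + n)) := if o is Some i then [:: i] else [::].
have /choice[MC HMC] : forall o, exists MC : nat * R, 0 <= MC.2 /\ forall P H B, CS U P -> isproj U P H ->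
  nrm U MC.1 P B -> 0 < B -> forall x, U x -> `|pds (dl o) (fun y => Re (H y)) x| <= MC.2 * B /\
  `|pds (dl o) (fun y => Im (H y)) x| <= MC.2 * B.
 by move=>o;have [M [C H]]:=ubp oU bU rc (dl o);exists (M, C).
pose M:=\sum_o (MC o).1;pose A:=\sum_o (MC o).2.
have A0: 0 <= A by apply: sumr_ge0 => o _;exact: (HMC o).1.
have [P [C [Ps pP C0 HP]]]:=CS_approximable hs M.
(* [A] dominates all the constants of the uniform estimates, so a C^M error [B] gives an error at
   most [e]; [t] below makes the cut-off error at most [B]. *)
pose B:=e / (1 + A);have B0: 0 < B by rewrite divr_gt0 // ltr_pwDl.
pose t:=Num.min 1 (B / (1 + C)).
have tt: tin t by rewrite /tin lt_min ltr01 divr_gt0 ?ge_min ?lexx // ltr_pwDl.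
have [th [K [ths cK KU thK nt]]]:=HP t tt.
have [H [pH Hs]]:=rc th ths;exists th, K, H;split=>//;split=>//.
have CtB: C * t <= B.
 apply: le_trans (_ : C * (B / (1 + C)) <= _);first by rewrite ler_wpM2l // ge_min lexx orbT.
 rewrite mulrCA ler_piMr ?(ltW B0) // ler_pdivrMr ?mul1r ?lerDr // ltr_pwDl //.
have aH: A2 U h by split=>//;exact: CS_lint.
have ph: isproj U h h.
 split=>// L aL;split;rewrite (_ : zext U _ = fun _ => 0) ?(@rint0 (n + n)) //;
 by apply/funext => y;rewrite /zext subrr mul0r mulr0.
have cN f g: CS U f -> CS U g -> CS U (fun x => f x - g x) by move=>fs gs q;apply: CCD=>//;apply: CCN.
have lin f F g G:=fun (fs : CS U f) (gs : CS U g) => @isproj_lin n U oU f F g G 1 (CS_CC false 0 fs)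
 (CS_lint oU bU fs) (CS_CC false 0 gs) (CS_lint oU bU gs).
have pPh: isproj U P h.
 have := lin _ _ _ _ hs (cN _ _ hs Ps) ph pP.
 rewrite (_ : (fun x => h x - 1 * (h x - P x)) = P);last by apply/funext => x;rewrite mul1r subKr.
 by rewrite (_ : (fun x => h x - 1 * 0) = h) //;apply/funext => x;rewrite mul1r subr0.
have pd:=lin _ _ _ _ Ps ths pPh pH.
have nB o: nrm U (MC o).1 (fun x => P x - 1 * th x) B.
 move=>ds dM x Ux;under eq_fun do rewrite mul1r;under [X in _ /\ `|pds _ X _| <= _]eq_fun do rewrite mul1r.
 have dM': (size ds <= M)%N by apply: leq_trans dM _;rewrite /M (bigD1 o) //= leq_addr.
 by have [h1 h2]:=nt ds dM' x Ux;split;[apply: le_trans h1 _|apply: le_trans h2 _].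
have D: CS U (fun x => P x - 1 * th x) by under [X in CS U X]eq_fun do rewrite mul1r;exact: cN.
have AB o: (MC o).2 * B <= e.
 rewrite /B mulrCA ler_piMr ?(ltW e0) // ler_pdivrMr ?ltr_pwDl // mul1r /A (bigD1 o) //= addrCA lerDl.
 by rewrite addr_ge0 // sumr_ge0 // => i _;exact: (HMC i).1.
have fin o x: U x -> `|pds (dl o) (fun x => Re (h x) - Re (H x)) x| <= e /\
  `|pds (dl o) (fun x => Im (h x) - Im (H x)) x| <= e.
 move=>Ux;have [h1 h2]:=(HMC o).2 _ _ B D pd (nB o) B0 x Ux;split.
  rewrite (pds_cg oU (g := fun y => Re (h y - 1 * H y))) ?(le_trans h1) // => y _.
  by rewrite mul1r cReD cReN.
 rewrite (pds_cg oU (g := fun y => Im (h y - 1 * H y))) ?(le_trans h2) // => y _.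
 by rewrite mul1r cImD cImN.
by case=>[|i [|j ds]] x // _;[exact: (fin None)|exact: (fin (Some i))].
Qed.

End LocalModel.

Lemma pdE m (h : 'rV[R]_m -> R) x i d : is_derive x (ebasis R i) h d -> pd i h x = d.
by case. Qed.

(** * Inward directions at a corner *)

Section CornerGeometry.
Variable n : nat.
Local Notation V := 'rV[R]_(n + n).
Variables (N : nat) (r : 'I_N -> V -> R) (U : set V).
Hypotheses (oU : open U) (bU : bounded_set U) (rs : forall j, smooth_on setT (r j)).
Hypothesis UE : U = [set x | forall j, r j x < 0].
Hypothesis CR : forall (S : {set 'I_N}) p, (forall j, j \in S -> r j p = 0) -> cr_free r S p.

Lemma le0_closed x : closure U x -> forall j, r j x <= 0.
by move=>cx j;exact: (closure_le0 rs UE). Qed.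

Definition dirv (v : V) (h : V -> R) x : R := \sum_i v ord0 i * pd i h x.

(** Independence of the complex gradients provides a single direction along which all active
    defining functions decrease at a definite rate near [p]. *)
Lemma inward p : (forall j, r j p <= 0) -> exists v d, 0 < d /\ forall j,
 (r j p = 0 /\ forall x, `|x - p| <= d -> dirv v (r j) x <= -1) \/ (forall x, `|x - p| <= d -> r j x < 0).
move=>cp;pose S:=[set j | r j p == 0]%SET.
have Sp j: j \in S -> r j p = 0 by rewrite inE=>/eqP.
have [d0 [X [d00 _ _ Xr]]]:=corner_fields oU bU rs (CR Sp) ltr01.
pose w l : R[i] := \sum_(k in S) X k l p.
(* The sum [w] of the dual fields pairs to 1 with every active complex gradient. For a real vector
   with complex coordinates -2 w the real derivative is twice the real part of the pairing, that is
   -4, which leaves room for continuity. *)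
pose v : V := \row_i match fintype.split i with inl l => - 2 * Re (w l) | inr l => - 2 * Im (w l) end.
have vx l: v ord0 (xi l) = - 2 * Re (w l) by rewrite mxE (unsplitK (inl l)).
have vy l: v ord0 (yi l) = - 2 * Im (w l) by rewrite mxE (unsplitK (inr l)).
have rC1 j: Cn false setT 1 (r j) by exact: (smooth_onP _ _).1.
have vr j: j \in S -> dirv v (r j) p = - 4.
 move=>jS;have E: \sum_l w l * dA r j l p = 1.
  transitivity (\sum_(k in S) \sum_l X k l p * dA r j l p).
   by rewrite exchange_big /=;apply: eq_bigr => l _;rewrite mulr_suml.
  rewrite (bigD1 j) //= [X in _ + X]big1 ?addr0;first by rewrite Xr ?eqxx // /cube /= subrr normr0 ltW.
  move=>k /andP[kS kj].
  by rewrite Xr // ?[j == k]eq_sym ?(negbTE kj) // /cube /= subrr normr0 ltW.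
 have := congr1 Re E;rewrite cRe_sum /= => E1.
 transitivity (- 4 * \sum_l Re (w l * dA r j l p));last by rewrite E1 mulr1.
 rewrite /dirv sum_xy mulr_sumr;apply: eq_bigr => l _.
 by rewrite vx vy cReM dAE /= /dbar_re /dbar_im;field.
have H j: exists d, 0 < d /\ ((r j p = 0 /\ forall x, `|x - p| <= d -> dirv v (r j) x <= -1) \/
  (forall x, `|x - p| <= d -> r j x < 0)).
 have half (e : R) x : 0 < e -> `|x - p| <= e / 2 -> `|x - p| < e.
  by move=>e0 h;apply: le_lt_trans h _;rewrite gtr_pMr // invf_lt1 // ltr1n.
 have [jS|jS]:=boolP (j \in S).
  have cv: {for p, continuous (dirv v (r j))}.
   apply: sum_continuous => i _;apply: continuousM;first exact: cst_continuous.
   by have [[+ _] _]:=Cn_pd i (rC1 j);apply.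
  have [d d1 Hd]:=(cont_epsP _ _).1 cv _ ltr01.
  exists (d / 2);split;first by rewrite divr_gt0.
  left;split=>[|x /(half _ _ d1)/Hd];first exact: Sp.
  by rewrite vr // ler_norml=>/andP[_];lra.
 have rp: r j p < 0 by rewrite lt_neqAle cp andbT;rewrite inE in jS.
 have /nbhs_ballP[e /= e0 He] : nbhs p [set x | r j x < 0] by exact: (rs j [::]).2 p I _ (lt_nbhsl rp).
 exists (e / 2);split;[by rewrite divr_gt0|right=> x /(half _ _ e0) xp].
 by apply: He;rewrite ball_lt.
have /choice[d Hd] := H.
have [e e0 He]:=@pos_lower_bound _ (enum 'I_N) d (fun j _ => (Hd j).1).
exists v, e;split=>// j;have ej: e <= d j by apply: He;rewrite mem_enum.
by case: (Hd j).2=>[[rp h]|h];[left;split=>// x xe|right=> x xe];apply: h;exact: le_trans ej.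
Qed.

Lemma descend v (d : R) p j x s : (forall x, `|x - p| <= d -> dirv v (r j) x <= -1) -> 0 <= s ->
 (forall t, 0 <= t <= s -> `|t *: v + x - p| <= d) -> r j (s *: v + x) <= r j x - s.
move=>Hv s0 seg;have r1: Cn false setT 1 (r j) by exact: (smooth_onP _ _).1.
have [t t01|t t01 E]:=@MVT_seg _ (r j) x (s *: v).
 by have []:=csm_derive (s *: v) openT r1 (I : setT (t *: (s *: v) + x)).
have [_ D]:=csm_derive (s *: v) openT r1 (I : setT (t *: (s *: v) + x)).
have [t0 t1]:=andP t01.
have E2: r j (s *: v + x) - r j x = s * dirv v (r j) ((t * s) *: v + x).
 rewrite E D /dirv mulr_sumr scalerA;apply: eq_bigr => i _;by rewrite mxE mulrA.
have -> : r j (s *: v + x) = r j x + s * dirv v (r j) ((t * s) *: v + x) by rewrite -E2 [RHS]addrC subrK.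
by rewrite lerD2l -mulrN1 ler_wpM2l // Hv // seg // mulr_ge0 //= ler_piMl.
Qed.

(** One inward vector serves a whole neighbourhood: moving by a small positive multiple of it sends
    every point with all r_j <= 0 into [U]. *)
Lemma push p : (forall j, r j p <= 0) -> exists v d s0, [/\ 0 < d, 0 < s0 & forall x, `|x - p| < d ->
 (forall j, r j x <= 0) -> forall s, 0 < s <= s0 -> U (s *: v + x)].
move=>cp;have [v [d [d0 Hv]]]:=inward cp.
have v1: 0 < 1 + `|v| by rewrite ltr_pwDl.
exists v, (d / 2), (d / 2 / (1 + `|v|));split;rewrite ?divr_gt0 // => x xp x0 s /andP[s0 s1].
have seg t: 0 <= t <= s -> `|t *: v + x - p| <= d.
 move=>/andP[t0 ts];rewrite -addrA;apply: le_trans (ler_normD _ _) _.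
 have : `|t *: v| <= d / 2.
  rewrite normrZ ger0_norm //;apply: le_trans (_ : d / 2 / (1 + `|v|) * (1 + `|v|) <= _).
   by rewrite ler_pM // ?(le_trans ts) // lerDr.
  by rewrite divfK // gt_eqF.
 by move: xp;lra.
rewrite UE => j;case: (Hv j)=>[[_ h]|h];last by apply: h;apply: seg;rewrite lexx ltW.
by apply: le_lt_trans (descend h (ltW s0) seg) _;have := x0 j;lra.
Qed.

End CornerGeometry.

(** * Taylor polynomials along a transverse direction *)

Section Taylor.
Variable n : nat.
Local Notation V := 'rV[R]_(n + n).
Variables (U : set V) (v : V).
Hypothesis oU : open U.
Implicit Types H : V -> R.

Definition dirn k H : V -> R := iter k (dirv v) H.

Lemma dirv_Csm b W H : open W -> Csm b W H -> Csm b W (dirv v H).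
by move=>oW Hs k;apply: (Cn_sum oW) => i _;apply: (CnZ oW);exact: Csm_pd. Qed.

Lemma dirn_Csm H k : Csm true U H -> Csm true U (dirn k H).
by move=>Hs;elim: k=>// k;exact: dirv_Csm. Qed.

Lemma pd_dirv H i x : Csm true U H -> U x -> pd i (dirv v H) x = dirv v (pd i H) x.
move=>Hs Ux;apply: pdE;apply: dv_sum => k _;rewrite (pd_swap k i oU (Hs 2%N) Ux).
by apply: dvZ;exact: Cn_derive (Csm_pd _ Hs 1%N) Ux.
Qed.

Lemma dirv_eq H K x : (forall y, U y -> H y = K y) -> U x -> dirv v H x = dirv v K x.
by move=>E Ux;apply: eq_bigr => i;rewrite (pd_eqon oU i E Ux). Qed.

Lemma pds_dirv H ds x : Csm true U H -> U x -> pds ds (dirv v H) x = dirv v (pds ds H) x.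
move=>Hs;elim: ds x=>[|i ds IH] x Ux //=.
by rewrite (pd_eqon oU i IH Ux) pd_dirv //;exact: Csm_pds.
Qed.

Lemma pds_dirn H ds k x : Csm true U H -> U x -> pds ds (dirn k H) x = dirn k (pds ds H) x.
move=>Hs;elim: k x=>[|k IH] x Ux //=.
rewrite pds_dirv //;last exact: dirn_Csm.
exact: dirv_eq.
Qed.

Lemma dirv_line H x (t : R) : Csm true U H -> U (t *: v + x) ->
 is_derive t (1 : R) (fun s => H (s *: v + x)) (dirv v H (t *: v + x)).
move=>Hs Ut;have [D E]:=csm_derive v oU (Hs 1%N) Ut.
by apply: is_derive_line.
Qed.

Lemma shift_Csm (X : set V) w H : open X -> (forall x, X x -> U (w + x)) -> Csm true U H ->
 Csm true X (fun x => H (w + x)).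
move=>oX XU Hs k;have {}Hs:=Hs k;elim: k H Hs=>[|k IH] H Hs.
 have [Hc Hb]:=Cn_C0 Hs;split=>//;split=>[x Xx|/Hb [C HC]];last by exists C => x /XU;exact: HC.
 apply/cont_epsP => e e0;have [d d0 Hd]:=(cont_epsP _ _).1 (Hc _ (XU x Xx)) e e0.
 by exists d=>// z zx;apply: Hd;rewrite addrAC opprD !addrA subrr add0r addrC.
apply: (@Cn_intro _ _ _ oX _ _ (fun i x => pd i H (w + x))).
- exact: Cn_C0 (IH _ (CnW Hs)).
- move=>x i Xx;have := @dv_shift _ H x (- w) (ebasis R i) (pd i H (w + x));rewrite opprK addrC.
 move=>/(_ (Cn_derive i Hs (XU x Xx))) D;by apply: dv_eq=>// y;rewrite addrC.
- by move=>i;apply: IH;exact: Cn_pd.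
Qed.

Lemma shift_pds (X : set V) w H ds x : open X -> (forall x, X x -> U (w + x)) -> Csm true U H -> X x ->
 pds ds (fun x => H (w + x)) x = pds ds H (w + x).
move=>oX XU Hs;elim: ds x=>[|i ds IH] x Xx //=.
rewrite (pd_eqon oX i IH Xx);apply: pdE.
have := @dv_shift _ (pds ds H) x (- w) (ebasis R i) (pd i (pds ds H) (w + x));rewrite opprK addrC.
move=>/(_ (Cn_derive i (Csm_pds ds Hs 1%N) (XU x Xx))) D;by apply: dv_eq=>// y;rewrite addrC.
Qed.

(* Degree [M] Taylor polynomial of [s |-> H (s v + x)] at [s], evaluated at [0]. *)
Definition tay M s H x : R := \sum_(k < M.+1) ((- s) ^+ k / k`!%:R) * dirn k H (s *: v + x).

Lemma tayS M s H x : tay M.+1 s H x = tay M s H x + ((- s) ^+ M.+1 / M.+1`!%:R) * dirn M.+1 H (s *: v + x).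
by rewrite /tay big_ord_recr. Qed.

Lemma tay0 M H x : tay M 0 H x = H x.
rewrite /tay big_ord_recl big1=>[|i _];first by rewrite invr1 mulr1 mul1r scale0r add0r addr0.
by rewrite oppr0 expr0n mul0r mul0r.
Qed.

(** When the base point moves, the derivative of each term cancels against a part of the next one,
    and only the top order survives. *)
Lemma tay_dv M H x (t : R) : Csm true U H -> U (t *: v + x) ->
 is_derive t (1 : R) (fun s => tay M s H x) ((- t) ^+ M / M`!%:R * dirn M.+1 H (t *: v + x)).
move=>Hs Ut;elim: M=>[|M IH].
 have E s: H (s *: v + x) = tay 0 s H x by rewrite /tay big_ord1 invr1 mulr1 mul1r.
 by apply: dv_eq (dirv_line Hs Ut) E _;rewrite invr1 mulr1 mul1r.
have D1: is_derive t (1 : R) (fun s : R => - s) (-1) by exact: dvN.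
have D2:=dvM (dvZ (M.+1`!%:R^-1) (dvX M.+1 D1)) (dirv_line (dirn_Csm M.+1 Hs) Ut).
apply: dv_eq (dvD IH D2) _ _=>[s|];first by rewrite tayS;congr (_ + _ * _);exact: mulrC.
rewrite -[dirv v (dirn M.+1 H)]/(dirn M.+2 H).
have f0: (M`!%:R : R) != 0 by rewrite pnatr_eq0 -lt0n fact_gt0.
have f1: (M.+1%:R : R) != 0 by rewrite pnatr_eq0.
move: (dirn M.+1 H _) (dirn M.+2 H _) => a c;rewrite factS natrM -[M.+1.-1]/M.
move: f0 f1;move: (M`!%:R : R) (M.+1%:R : R) => p q p0 q0.
by rewrite exprS;field;rewrite p0.
Qed.

Lemma dirn_bound H k : Csm true U H -> exists2 C, 0 <= C & forall x, U x -> `|dirn k H x| <= C.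
move=>Hs;have [_ /(_ isT) [C HC]]:=Cn_C0 (dirn_Csm k Hs 0%N).
by exists `|C|=>// x Ux;exact: le_trans (HC x Ux) (ler_norm _).
Qed.

Lemma pow_fact_le (t s : R) k : 0 <= t <= s -> `|(- t) ^+ k / k`!%:R| <= s ^+ k.
move=>/andP[t0 ts];rewrite normrM normrX normrN (ger0_norm t0) [`|_^-1|]ger0_norm //.
apply: le_trans (_ : t ^+ k <= _);last by rewrite lerXn2r // nnegrE (le_trans t0).
by rewrite ler_pdivrMr // ler_peMr ?exprn_ge0 // ler1n fact_gt0.
Qed.

Lemma tay_step H M : Csm true U H -> exists2 C, 0 <= C & forall x s1 s2, 0 <= s1 <= s2 ->
 (forall t, s1 <= t <= s2 -> U (t *: v + x)) -> `|tay M s1 H x - tay M s2 H x| <= C * s2 ^+ M.+1.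
move=>Hs;have [C C0 HC]:=dirn_bound M.+1 Hs;exists C=>// x s1 s2 /andP[s10 s12] HU.
have s20:=le_trans s10 s12.
have [->|ne]:=eqVneq s1 s2;first by rewrite subrr normr0 mulr_ge0 // exprn_ge0.
have lt: s1 < s2 by rewrite lt_neqAle ne.
have D t: s1 <= t <= s2 -> is_derive t (1 : R) (fun s => tay M s H x) ((- t) ^+ M / M`!%:R * dirn M.+1 H (t *: v + x)).
 by move=>h;apply: tay_dv=>//;exact: HU.
have [t||c]:=@MVT R (fun s => tay M s H x) (fun t => (- t) ^+ M / M`!%:R * dirn M.+1 H (t *: v + x)) s1 s2 lt.
- by rewrite /= =>/andP[a b];apply: D;rewrite !ltW.
- by apply: derivable_within_continuous => t;rewrite /= =>/D.
rewrite in_itv /= =>/andP[c1 c2] E;rewrite distrC E normrM normrM.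
have c12: s1 <= c <= s2 by rewrite !ltW.
have k1: `|(- c) ^+ M / M`!%:R| <= s2 ^+ M by apply: pow_fact_le;rewrite (le_trans s10) ltW.
have k2:=HC _ (HU c c12).
have k3: `|s2 - s1| <= s2 by rewrite ger0_norm ?subr_ge0 // gerBl.
apply: le_trans;last by rewrite exprSr mulrA [C * _]mulrC.
by apply: ler_pM;rewrite //;apply: ler_pM.
Qed.

(** Passing to a higher order at the same base point adds terms that each carry at least s^(M+1). *)
Lemma tay_up H M M' : Csm true U H -> (M <= M')%N -> exists2 C, 0 <= C & forall x s, 0 < s <= 1 ->
 U (s *: v + x) -> `|tay M' s H x - tay M s H x| <= C * s ^+ M.+1.
move=>Hs;elim: M'=>[|M' IH];first by rewrite leqn0=>/eqP ->;exists 0=>// x s;rewrite subrr normr0 mul0r.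
rewrite leq_eqVlt=>/predU1P[->|];first by exists 0=>// x s;rewrite subrr normr0 mul0r.
rewrite ltnS => MM;have [C C0 HC]:=IH MM;have [B B0 HB]:=dirn_bound M'.+1 Hs.
exists (C + B)=>[|x s s01 Us];first exact: addr_ge0.
have [s0 s1]:=andP s01;rewrite tayS addrAC mulrDl;apply: le_trans (ler_normD _ _) _.
apply: lerD;first exact: HC.
rewrite normrM mulrC;apply: ler_pM=>//;first exact: HB.
apply: le_trans (@pow_fact_le s s M'.+1 _) _;first by rewrite lexx ltW.
by apply: ler_wiXn2l;rewrite // ltW.
Qed.

Lemma tay_Csm (X : set V) M s H : open X -> (forall x, X x -> U (s *: v + x)) -> Csm true U H ->
 Csm true X (tay M s H).
move=>oX XU Hs k;apply: (Cn_sum oX) => i _;apply: (CnZ oX).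
exact: (shift_Csm oX XU (dirn_Csm i Hs)).
Qed.

Lemma tay_pds (X : set V) M s H ds x : open X -> (forall x, X x -> U (s *: v + x)) -> Csm true U H -> X x ->
 pds ds (tay M s H) x = tay M s (pds ds H) x.
move=>oX XU Hs Xx;have S k:=shift_Csm oX XU (dirn_Csm k Hs).
rewrite (@pds_sum _ true X oX _ _ (fun (k : 'I_M.+1) y => ((- s) ^+ k / k`!%:R) * dirn k H (s *: v + y)) ds x _ Xx);last first.
 by move=>k q;exact: (CnZ oX _ (S k q)).
apply: eq_bigr => k _;rewrite (pdsZ oX _ _ (S k) Xx) (shift_pds ds oX XU (dirn_Csm k Hs) Xx).
by rewrite pds_dirn //;exact: XU.
Qed.

End Taylor.

Lemma pds_mul_bound m (X : set 'rV[R]_m) a c (A B : R) K : open X -> Csm true X a -> Csm true X c ->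
 0 <= A -> 0 <= B ->
 (forall ds x, (size ds <= K)%N -> X x -> `|pds ds a x| <= A) ->
 (forall ds x, (size ds <= K)%N -> X x -> `|pds ds c x| <= B) ->
 forall ds x, (size ds <= K)%N -> X x -> `|pds ds (fun y => a y * c y) x| <= 2 ^+ size ds * (A * B).
move=>oX + + A0 B0 + + ds;elim/last_ind: ds K a c=>[|ds i IH] K a c as_ cs Ha Hc x.
 by move=>_ Xx;rewrite mul1r normrM;apply: ler_pM=>//;[exact: (Ha [::])|exact: (Hc [::])].
rewrite size_rcons => sK Xx;case: K Ha Hc sK=>// K Ha Hc sK;rewrite pds_rcons.
have E y: X y -> pd i (fun y => a y * c y) y = pd i a y * c y + a y * pd i c y.
 by move=>Xy;apply: pdE;exact: dvM (Cn_derive i (as_ 1%N) Xy) (Cn_derive i (cs 1%N) Xy).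
have sa:=Csm_pd i as_;have sc:=Csm_pd i cs.
have m1: Csm true X (fun y => pd i a y * c y) by move=>k;apply: (CnM oX).
have m2: Csm true X (fun y => a y * pd i c y) by move=>k;apply: (CnM oX).
rewrite (pds_cg oX E Xx) (pdsD oX _ m1 m2 Xx) exprS -mulrA mulr_natl mulr2n.
apply: le_trans (ler_normD _ _) _;apply: lerD;apply: (IH K)=>//.
- by move=>y s' Xy;rewrite -pds_rcons;apply: Ha;rewrite ?size_rcons.
- by move=>y s' Xy;apply: Hc=>//;exact: leqW.
- by move=>y s' Xy;apply: Ha=>//;exact: leqW.
- by move=>y s' Xy;rewrite -pds_rcons;apply: Hc;rewrite ?size_rcons.
Qed.

(** The order is raised only when the next constant is already below 2^i. It tends to infinity
    slowly enough for constants of arbitrary growth to be beaten by a geometric factor. *)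
Lemma slow_order (C : nat -> R) : exists M : nat -> nat,
 (forall i, M i.+1 = M i \/ M i.+1 = (M i).+1) /\
 forall q, exists i0, forall i, (i0 <= i)%N -> (q <= M i)%N /\ C (M i) <= 2 ^+ i.
pose M:=fix M i := if i is i'.+1 then (if C (M i').+1 <= 2 ^+ i' then (M i').+1 else M i') else 0%N.
have MS i: M i.+1 = if C (M i).+1 <= 2 ^+ i then (M i).+1 else M i by [].
have mon i j: (i <= j)%N -> (M i <= M j)%N.
 move=>ij;rewrite -(subnKC ij);elim: (j - i)%N=>[|k IH];first by rewrite addn0.
 by rewrite addnS MS;case: ifP => _;rewrite ?(leqW IH).
have big (B : R) : exists i, B <= 2 ^+ i.
 exists (Num.bound `|B|);apply: le_trans (ler_norm B) _;apply: le_trans (ltW (archi_boundP (normr_ge0 B))) _.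
 by rewrite -natrX ler_nat ltnW // ltn_expl.
exists M;split=>[i|q];first by rewrite MS;case: ifP => _;[right|left].
have un: exists i, (q <= M i)%N.
 elim: q=>[|q [i Hi]];first by exists 0%N.
 have [k Hk]:=big (C q.+1);pose l:=maxn i k.
 have Hl: (q <= M l)%N by apply: leq_trans (mon _ _ (leq_maxl i k)).
 have [h|h]:=ltnP q (M l);first by exists l.
 have e: M l = q by apply/eqP;rewrite eqn_leq h.
 exists l.+1;rewrite MS e ifT //;apply: le_trans Hk _.
 by rewrite ler_eXn2l ?ltr1n // leq_maxr.
have cb i: (0 < M i)%N -> C (M i) <= 2 ^+ i.
 elim: i=>// i IH;rewrite MS;case: ifP => h p0.
  by apply: le_trans h _;rewrite ler_eXn2l ?ltr1n.
 by apply: le_trans (IH p0) _;rewrite ler_eXn2l ?ltr1n.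
have [i Hi]:=un;have [k Hk]:=big (C 0%N).
exists (maxn i k) => l;rewrite geq_max=>/andP[il kl];split;first exact: leq_trans (mon _ _ il).
have [e|]:=posnP (M l);last exact: cb.
by rewrite e;apply: le_trans Hk _;rewrite ler_eXn2l ?ltr1n.
Qed.

Lemma eventually_geo (u : nat -> R) i0 : (forall i, 0 <= u i) ->
 (forall i, (i0 <= i)%N -> u i <= 2^-1 ^+ i) -> exists c, geo c u.
move=>u0 Hu;exists (1 + \sum_(i < i0) u i * 2 ^+ i) => i.
have h0 k: 0 <= u k * 2 ^+ k by rewrite mulr_ge0.
have s0: 0 <= \sum_(k < i0) u k * 2 ^+ k by exact: sumr_ge0.
rewrite ger0_norm //;have [h|h]:=leqP i0 i.
 by apply: le_trans (Hu i h) _;rewrite ler_peMl // lerDl.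
have -> : u i = u i * 2 ^+ i * 2^-1 ^+ i by rewrite -mulrA -exprMn mulfV // expr1n mulr1.
apply: ler_wpM2r;first by rewrite ?invr_ge0.
rewrite (bigD1 (Ordinal h)) //= addrCA lerDl addr_ge0 //.
by apply: sumr_ge0 => k.
Qed.

Lemma bd1_step : bd1 (fun u : R => 1 - eta (2 * u)).
have sG: smooth1 (fun u : R => 1 - eta (2 * u)).
 apply: smooth1_of_rV => k;have oT:=@openT 'rV[R]_1.
 apply: (CnB oT);first exact: Cn_cst.
 by apply: (Cn_comp1 oT eta_smooth);apply: (CnZ oT);exact: Cn_coord.
have z t: 1 <= `|t| -> (fun u : R => 1 - eta (2 * u))^`()%classic t = 0.
 move=>t1;have h: 2^-1 < `|t| by apply: lt_le_trans t1;rewrite invf_lt1 // ltr1n.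
 have [c Hc] : exists c : R, \forall s \near t, 1 - eta (2 * s) = c.
  have [tp|tn]:=ltP 0 t.
   exists 0;have : \forall s \near t, 2^-1 < s by apply: lt_nbhsr;rewrite gtr0_norm in h.
   by apply: filterS => s hs;rewrite eta_ge1 ?subrr // -ler_pdivrMl // mulr1 ltW.
  exists 1;have : \forall s \near t, s < 0.
   by apply: lt_nbhsl;rewrite lt_neqAle tn andbT;apply: contraTN t1=>/eqP ->;rewrite normr0 -ltNge.
  by apply: filterS => s hs;rewrite eta_le0 ?subr0 // mulr_ge0_le0 // ltW.
 by rewrite derive1E (@near_eq_derive _ _ _ _ (cst c)) ?derive_cst.
have [_ B] : bd1 ((fun u : R => 1 - eta (2 * u))^`()%classic).
 by apply: (bd1_of_csupp _ z) => k x;rewrite -derive1Sn;exact: sG.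
split=>// -[|k];last by have [C HC]:=B k;exists C => t;rewrite derive1Sn.
by exists 1 => t /=;rewrite ger0_norm ?subr_ge0 ?eta_le1 // gerBl eta_ge0.
Qed.

Lemma seqs_uniform m (P : seq 'I_m -> R -> Prop) K :
 (forall ds C C', C <= C' -> P ds C -> P ds C') -> (forall ds, exists2 C, 0 <= C & P ds C) ->
 exists2 C, 0 <= C & forall ds, (size ds <= K)%N -> P ds C.
elim: K P=>[|K IH] P mon ex;have [C C0 HC]:=ex [::];first by exists C=>// -[|].
have /choice[c Hc] : forall i : 'I_m, exists c, 0 <= c /\ forall ds, (size ds <= K)%N -> P (i :: ds) c.
 move=>i;have []:=IH (fun ds => P (i :: ds));first by move=>ds;exact: mon.
  by move=>ds;exact: ex.
 by move=>c c0 Hc;exists c.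
have s0: 0 <= \sum_i c i by apply: sumr_ge0 => i _;have []:=Hc i.
exists (C + \sum_i c i)=>[|[_|i ds ss]];first exact: addr_ge0.
 by apply: mon HC;rewrite lerDl.
apply: mon (_ : P (i :: ds) (c i));last by have [_]:=Hc i;apply.
rewrite (bigD1 i) //= addrCA lerDl addr_ge0 //.
by apply: sumr_ge0 => k _;have []:=Hc k.
Qed.

(** Points of [W] outside [X] have a neighbourhood where [f] is zero, so smoothness and the bounds
    on [X] are all that is at stake. *)
Lemma Csm_glue0 m (W X : set 'rV[R]_m) f : open W -> open X -> Csm true X f ->
 (forall x, W x -> ~ X x -> exists Z, [/\ open Z, Z x & forall y, Z y -> f y = 0]) ->
 Csm true W f /\ forall ds x, W x -> ~ X x -> pds ds f x = 0.
move=>oW oX Xs H.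
have z ds x: W x -> ~ X x -> pds ds f x = 0.
 by move=>Wx /(H _ Wx)[Z [oZ Zx Z0]];rewrite (pds_cg oZ Z0 Zx) (pds_cst0 true oZ ds Zx).
split=>//;apply/bounded_pdsP;split=>[|ds].
 apply/smooth_onP;apply: Csm_local => x Wx;have [Xx|nX]:=pselect (X x).
  by exists X;split=>//;exact: Csm_Cn Xs.
 have [Z [oZ Zx Z0]]:=H x Wx nX;exists Z;split=>// k.
 by apply: (Cn_eq oZ (f := fun _ => 0))=>[y /Z0|];[|exact: Cn_cst].
have [_ /(_ ds)[M HM]]:=(bounded_pdsP _ _).1 Xs.
exists `|M| => x Wx;have [Xx|nX]:=pselect (X x);last by rewrite z // normr0.
exact: le_trans (HM x Xx) (ler_norm M).
Qed.

Lemma smooth_upto_eq m (U : set 'rV[R]_m) (h k : 'rV[R]_m -> R) : open U -> (forall x, U x -> h x = k x) -> smooth_upto U h -> smooth_upto U k.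
move=>oU hk [hs hl];split;first by apply/smooth_onP;apply: (Csm_eq oU hk);exact: (smooth_onP _ _).1.
move=>ds p cp;have [l Hl]:=hl ds p cp;exists l;apply: cvg_trans Hl;apply: near_eq_cvg.
by rewrite near_withinE;apply: nearW => x Ux;exact: (pds_eqon oU).
Qed.

Lemma restrict_upto m (U : set 'rV[R]_m) k : open U -> Csm true setT k -> smooth_upto U k.
move=>oU ks;split.
 by apply/smooth_onP => q;apply: (Cn_sub (@subsetT _ U));exact: Csm_Cn ks q.
move=>ds p _;exists (pds ds k p);apply: cvg_within_filter.
exact: (Cn_C0 (Csm_pds ds ks 0%N)).1.
Qed.

(** * Smooth extension across corners and equivalence of the two forms of Condition R *)

Section Extension.
Variable n : nat.
Local Notation V := 'rV[R]_(n + n).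
Variables (N : nat) (r : 'I_N -> V -> R) (U : set V).
Hypotheses (oU : open U) (bU : bounded_set U) (rs : forall j, smooth_on setT (r j)).
Hypothesis UE : U = [set x | forall j, r j x < 0].

Section Local.
Variables (p v : V) (d t0 : R) (act : seq 'I_N).
Hypothesis d0 : 0 < d.
Hypothesis Ha : forall j, j \in act -> forall x, `|x - p| <= d -> dirv v (r j) x <= -1.
Hypothesis Hn : forall j, j \notin act -> forall x, `|x - p| <= d -> r j x < 0.
Hypotheses (t00 : 0 < t0) (t01 : t0 <= 1).
Hypothesis t0v : forall t x, 0 <= t <= t0 -> `|x - p| < d / 2 -> `|t *: v + x - p| <= d.

Definition Wl : set V := [set x | `|x - p| < d / 2].
(** Points that may lie outside [U], but by less than [s] in each active defining function: moving
    them by at least [s] along [v] brings them back into [U]. *)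
Definition Wt s : set V := [set x | Wl x /\ forall j, j \in act -> r j x < s].

Lemma r_cont j : continuous (r j). Proof. by move=>x;exact: (rs j [::]).2. Qed.

Lemma Wl_open : open Wl.
exact: open_ball_lt.
Qed.

Lemma Wt_open s : open (Wt s).
have -> : Wt s = Wl `&` [set x | forall j, j \in act -> r j x < s] by [].
apply: openI;first exact: Wl_open.
elim: act=>[|j l IH].
 by have -> : [set x : V | forall j, j \in [::] -> r j x < s] = setT by apply/seteqP;split.
have -> : [set x | forall k, k \in j :: l -> r k x < s] = (r j @^-1` [set u | u < s]) `&` [set x | forall k, k \in l -> r k x < s].
 apply/seteqP;split=>[x h|x [h1 h2] k].
  by split=>[|k kl];apply: h;rewrite inE ?eqxx // kl orbT.
 by rewrite inE=>/predU1P[->|/h2].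
by apply: openI=>//;apply: (open_comp (f := r j))=>[y _|];[exact: r_cont|exact: open_lt].
Qed.

Arguments Wt_open : clear implicits.

Lemma Wl_bounded : bounded_set Wl.
apply/bounded_setP;exists (`|p| + d) => x /= xp;rewrite -(subrK p x) addrC.
apply: le_trans (ler_normD _ _) _;rewrite lerD2l;apply: le_trans (ltW xp) _.
by rewrite ler_pdivrMr // mulr_natr mulr2n lerDl ltW.
Qed.

Lemma Wt_push s t x : Wt s x -> 0 <= s -> s <= t <= t0 -> U (t *: v + x).
move=>[Wx xs] s0 /andP[st tt];have tp:=le_trans s0 st.
rewrite UE => j;have [ja|ja]:=boolP (j \in act);last by apply: (Hn ja);apply: t0v=>//;rewrite tp.
apply: le_lt_trans (descend rs (Ha ja) tp _) _.
 by move=>u /andP[u0 ut];apply: t0v=>//;rewrite u0 (le_trans ut).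
by rewrite subr_lt0;exact: lt_le_trans (xs j ja) st.
Qed.

(** Equal to 1 where the active functions are nonpositive, hence on [U], and to 0 as soon as one of
    them reaches [t0 * t / 2]. Multiplied by it, a function defined on [Wt (t0 * t)] extends by
    zero. *)
Definition chi t x : R := \prod_(j <- act) (1 - eta (2 * (t^-1 * (t0^-1 * r j x)))).

Lemma chi1 t x : 0 < t -> (forall j, j \in act -> r j x <= 0) -> chi t x = 1.
move=>tp H;rewrite /chi big_seq big1 // => j /H rj.
by rewrite eta_le0 ?subr0 // pmulr_rle0 // pmulr_rle0 ?invr_gt0 // pmulr_rle0 ?invr_gt0.
Qed.

Lemma chi0 t x j : 0 < t -> j \in act -> t0 * t / 2 <= r j x -> chi t x = 0.
move=>tp ja h;apply/eqP;rewrite /chi prodf_seq_eq0;apply/hasP;exists j=>//=.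
rewrite eta_ge1 ?subrr // -ler_pdivrMl // mulr1 ler_pdivlMl // ler_pdivlMl //.
by rewrite mulrA.
Qed.

Lemma scaled_prod K l : Smf Wl (fun t x => \prod_(j <- l) scaled (fun x => t0^-1 * r j x) (K + 0) (fun u : R => 1 - eta (2 * u)) t x)
 /\ Fam Wl K 0 (fun t x => \prod_(j <- l) scaled (fun x => t0^-1 * r j x) (K + 0) (fun u : R => 1 - eta (2 * u)) t x).
have oW:=Wl_open.
elim: l=>[|j l [IHs IHf]].
 have E t x: (\prod_(j <- [::]) scaled (fun x => t0^-1 * r j x) (K + 0) (fun u : R => 1 - eta (2 * u)) t x) = 1 by rewrite big_nil.
 split=>[t tt k|];first by apply: (Cn_eq oW (f := fun _ => 1))=>//;exact: Cn_cst.
 apply: (Fam_eq oW (w := fun _ _ => 1))=>[t x _ _|];first by rewrite E.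
 by apply: Fam_cst => k;exact: Cn_cst.
have rW: Csm true Wl (fun x => t0^-1 * r j x).
 by move=>k;apply: (CnZ oW);exact: smooth_Csm oW Wl_bounded (rs j) k.
have S:=scaled_Smf oW (K + 0) rW bd1_step.
have F:=scaled_Fam oW K 0 rW bd1_step.
have E t x: scaled (fun x => t0^-1 * r j x) (K + 0) (fun u : R => 1 - eta (2 * u)) t x *
 (\prod_(j <- l) scaled (fun x => t0^-1 * r j x) (K + 0) (fun u : R => 1 - eta (2 * u)) t x) =
 \prod_(j <- j :: l) scaled (fun x => t0^-1 * r j x) (K + 0) (fun u : R => 1 - eta (2 * u)) t x by rewrite big_cons.
split=>[t tt k|];first by apply: (Cn_eq oW (fun x _ => E t x));exact: (SmfM oW S IHs tt k).
by apply: (Fam_eq oW (fun t x _ _ => E t x));exact: (FamM oW S IHs F IHf).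
Qed.

Lemma scaled_prodE K t x : (\prod_(j <- act) scaled (fun x => t0^-1 * r j x) (K + 0) (fun u : R => 1 - eta (2 * u)) t x) =
 t ^+ (K * size act) * chi t x.
by rewrite /scaled big_split /= big_const_seq count_predT iter_mulr_1 addn0 exprM. Qed.

Lemma chi_Csm t : tin t -> Csm true Wl (chi t).
move=>tt k;apply: (Cn_eq Wl_open) ((scaled_prod 0 act).1 t tt k) => x _.
by rewrite scaled_prodE mul0n expr0 mul1r.
Qed.

(** Each of the factors is allowed to lose t^-K, whence the exponent K times the number of active
    faces; this crude count fixes the order of the Taylor polynomials. *)
Lemma chi_bound K : exists2 C, 0 <= C & forall t ds x, tin t -> (size ds <= K)%N -> Wl x ->
 `|pds ds (chi t) x| <= C * t^-1 ^+ (K * size act).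
have [C C0 HC]:=Fam_sup (scaled_prod K act).2;exists C=>// t ds x tt sK Wx;have /andP[tp _] := tt.
have E y: Wl y -> \prod_(j <- act) scaled (fun x => t0^-1 * r j x) (K + 0) (fun u : R => 1 - eta (2 * u)) t y =
 t ^+ (K * size act) * chi t y by move=>_;exact: scaled_prodE.
have := HC t ds x tt sK Wx;rewrite (pds_cg Wl_open E Wx) (pdsZ Wl_open _ ds (chi_Csm tt) Wx) expr0 mulr1 normrM.
rewrite (ger0_norm (exprn_ge0 _ (ltW tp))) exprVn => h.
by rewrite ler_pdivlMr ?exprn_gt0 // mulrC.
Qed.

Lemma half_tin (t : R) : tin t -> tin (t / 2).
by move=>/andP[a b];rewrite /tin divr_gt0 //= ler_pdivrMr // mul1r (le_trans b) // ler1n. Qed.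

Lemma cut_Csm t c : tin t -> Csm true (Wt (t0 * t)) c ->
 Csm true Wl (fun x => chi t x * c x) /\ forall ds x, Wl x -> ~ Wt (t0 * t) x -> pds ds (fun x => chi t x * c x) x = 0.
move=>tt cs;have /andP[tp _] := tt;have oX:=Wt_open (t0 * t).
apply: (Csm_glue0 Wl_open oX)=>[k|x Wx nx].
 by apply: (CnM oX)=>//;apply: (Cn_sub (U := Wl))=>[y []//|];exact: chi_Csm.
have [j ja jx] : exists2 j, j \in act & t0 * t <= r j x.
 have [/allP h|/allPn[j ja]]:=boolP (all (fun j => r j x < t0 * t) act);first by case: nx.
 by rewrite -leNgt;exists j.
exists (r j @^-1` [set u | t0 * t / 2 < u]);split.
- by apply: (open_comp (f := r j))=>[y _|];[exact: r_cont|exact: open_gt].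
- by rewrite /=;apply: lt_le_trans jx;rewrite gtr_pMr ?mulr_gt0 // invf_lt1 // ltr1n.
- by move=>y /= h;rewrite (chi0 tp ja) ?mul0r // ltW.
Qed.

Variable h : V -> R.
Hypothesis hs : Csm true U h.

(** Two stages differ by O(t^(ord K + 1)) and K derivatives of the cut-off cost t^(-K * size act): a
    factor t^2 is left over. *)
Definition ord K := (K * size act).+1.
Definition stage K t x : R := tay v (ord K) (t0 * t) h x.
Definition piece K K' t x : R := chi (t / 2) x * (stage K' (t / 2) x - stage K t x).

Lemma stage_Csm K t t' : tin t -> 0 < t' <= t -> Csm true (Wt (t0 * t')) (stage K t).
move=>/andP[tp t1] /andP[t'0 t't];apply: (tay_Csm oU _ (Wt_open _) _ hs) => x Wx.
apply: (Wt_push Wx);first by rewrite mulr_ge0 // ltW.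
by rewrite ler_pM2l // t't /= ger_pMr.
Qed.

Lemma half_le (t : R) : tin t -> 0 < t / 2 <= t.
by move=>/andP[a b];rewrite divr_gt0 //= ler_pdivrMr // ler_peMr ?ltW // ltr1n. Qed.

Lemma diff_Csm K K' t : tin t -> Csm true (Wt (t0 * (t / 2))) (fun x => stage K' (t / 2) x - stage K t x).
move=>tt k;have /andP[a _] := half_le tt.
by apply: (CnB (Wt_open _));apply: stage_Csm;rewrite ?half_tin ?half_le ?a ?lexx.
Qed.

Lemma piece_Csm K K' t : tin t -> Csm true Wl (piece K K' t).
by move=>tt;exact: (cut_Csm (half_tin tt) (diff_Csm K K' tt)).1. Qed.

Lemma diff_bound K K' : (K <= K')%N -> exists2 C, 0 <= C & forall ds, (size ds <= K)%N -> forall t x, tin t ->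
 Wt (t0 * (t / 2)) x -> `|pds ds (fun x => stage K' (t / 2) x - stage K t x) x| <= C * t ^+ (ord K).+1.
move=>KK;apply: seqs_uniform=>[ds C C' CC H t x tt Wx|ds].
 by apply: le_trans (H t x tt Wx) _;rewrite ler_wpM2r // exprn_ge0 //;have /andP[/ltW] := tt.
have dh:=Csm_pds ds hs.
have oo: (ord K <= ord K')%N by rewrite ltnS leq_mul2r KK orbT.
have [C C0 HC]:=tay_up v oU dh oo;have [B B0 HB]:=tay_step v oU (ord K) dh.
exists (C + B)=>[|t x tt Wx];first exact: addr_ge0.
have /andP[tp t1] := tt;have /andP[h0 h1] := half_le tt;have oX:=Wt_open (t0 * (t / 2)).
have P s: t0 * (t / 2) <= s <= t0 -> forall y, Wt (t0 * (t / 2)) y -> U (s *: v + y).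
 by move=>st y Wy;apply: (Wt_push Wy)=>//;rewrite mulr_ge0 // ltW.
have tt1: t0 * t <= t0 by rewrite ger_pMr.
have th1: t0 * (t / 2) <= t0 * t by rewrite ler_pM2l.
have P1:=P (t0 * (t / 2));rewrite lexx (le_trans th1 tt1) in P1;have {}P1:=P1 isT.
have P2:=P (t0 * t);rewrite th1 tt1 in P2;have {}P2:=P2 isT.
have S1: Csm true (Wt (t0 * (t / 2))) (stage K' (t / 2)) by apply: stage_Csm;rewrite ?half_tin // h0 lexx.
have S2: Csm true (Wt (t0 * (t / 2))) (stage K t) by apply: stage_Csm;rewrite ?h0.
rewrite (pdsB oX ds S1 S2 Wx) (tay_pds oU _ ds oX P1 hs Wx) (tay_pds oU _ ds oX P2 hs Wx).
have e1:=HC x (t0 * (t / 2)) _ (P1 x Wx);have e2:=HB x (t0 * (t / 2)) (t0 * t).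
have q0: 0 < t0 * (t / 2) by rewrite mulr_gt0.
rewrite q0 (le_trans th1 (le_trans tt1 t01)) /= in e1;have {}e1:=e1 isT.
rewrite (ltW q0) th1 /= in e2;have {}e2:=e2 isT (fun s st => P s (introT andP (conj (proj1 (andP st)) (le_trans (proj2 (andP st)) tt1))) x Wx).
rewrite -(subrKA (tay v (ord K) (t0 * (t / 2)) (pds ds h) x)) mulrDl.
apply: le_trans (ler_normD _ _) _;apply: lerD;[apply: le_trans e1 _|apply: le_trans e2 _].
- by rewrite ler_wpM2l // lerXn2r ?nnegrE ?(ltW q0) ?(ltW tp) // (le_trans th1) // ger_pMl.
- by rewrite ler_wpM2l // lerXn2r ?nnegrE ?(ltW tp) ?(ltW (mulr_gt0 t00 tp)) // ger_pMl.
Qed.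

Lemma piece_bound K K' : (K <= K')%N -> exists2 C, 0 <= C & forall t ds x, tin t -> (size ds <= K)%N -> Wl x ->
 `|pds ds (piece K K' t) x| <= C * t ^+ 2.
move=>KK;have [C C0 HC]:=diff_bound KK;have [B B0 HB]:=chi_bound K.
exists (2 ^+ K * (B * 2 ^+ (K * size act) * C))=>[|t ds x tt sK Wx];first by rewrite !mulr_ge0 ?exprn_ge0.
have /andP[tp t1] := tt;have ht:=half_tin tt;have oX:=Wt_open (t0 * (t / 2)).
have r0: 0 <= 2 ^+ K * (B * 2 ^+ (K * size act) * C) * t ^+ 2.
 by apply: mulr_ge0;rewrite ?sqr_ge0 // !mulr_ge0 ?exprn_ge0.
have [Xx|nx]:=pselect (Wt (t0 * (t / 2)) x);last first.
 by rewrite /piece (cut_Csm ht (diff_Csm K K' tt)).2 ?normr0.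
have cs: Csm true (Wt (t0 * (t / 2))) (chi (t / 2)).
 by move=>k;apply: (Cn_sub (U := Wl))=>[y []//|];exact: chi_Csm.
have A0: 0 <= B * (t / 2)^-1 ^+ (K * size act) by rewrite mulr_ge0 // exprn_ge0 // invr_ge0 ltW // divr_gt0.
have B1: 0 <= C * t ^+ (ord K).+1 by rewrite mulr_ge0 // exprn_ge0 // ltW.
apply: le_trans (pds_mul_bound oX cs (diff_Csm K K' tt) A0 B1 _ _ sK Xx) _.
- by move=>ds' y s' [Wy _];exact: HB.
- by move=>ds' y s' Xy;exact: HC.
have -> : B * (t / 2)^-1 ^+ (K * size act) * (C * t ^+ (ord K).+1) = B * 2 ^+ (K * size act) * C * t ^+ 2.
 have -> : (ord K).+1 = (K * size act + 2)%N by rewrite addn2.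
 rewrite exprD invf_div exprMn exprVn;move: (K * size act)%N => q.
 have : t ^+ q != 0 by rewrite expf_neq0 // gt_eqF.
 by move: (t ^+ q) (2 ^+ q) => x1 y1 ne;field.
rewrite [leLHS]mulrA;apply: ler_wpM2r;first exact: sqr_ge0.
apply: ler_wpM2r;first by rewrite !mulr_ge0 ?exprn_ge0.
by rewrite ler_eXn2l ?ltr1n.
Qed.

(** Outside [U] the value is taken from Taylor polynomials based at points pushed inside by t0 2^-i,
    of slowly increasing order. On [U] all cut-offs are 1 and the series of pieces telescopes to the
    limit of the stages, which is [h]; across the boundary the pieces form a geometric family to
    every order. *)
Lemma local_extension : exists2 k, Csm true Wl k & forall x, Wl x -> U x -> k x = h x.
have /choice[C HC] : forall K, exists C, [/\ 0 <= C,
 forall K' t ds x, K' = K \/ K' = K.+1 -> tin t -> (size ds <= K)%N -> Wl x -> `|pds ds (piece K K' t) x| <= C * t ^+ 2 &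
 forall t x, tin t -> Wl x -> U x -> `|stage K t x - h x| <= C * t ^+ 2].
 move=>K;have [B1 p1 H1]:=piece_bound (leqnn K);have [B2 p2 H2]:=piece_bound (leqnSn K).
 have [B3 p3 H3]:=tay_step v oU (ord K) hs.
 exists (B1 + B2 + B3);split=>[|K' t ds x [->|->] tt sK Wx|t x tt Wx Ux];rewrite ?addr_ge0 //.
 - by apply: le_trans (H1 t ds x tt sK Wx) _;rewrite ler_wpM2r ?sqr_ge0 // -addrA lerDl addr_ge0.
 - by apply: le_trans (H2 t ds x tt sK Wx) _;rewrite ler_wpM2r ?sqr_ge0 // addrAC lerDr addr_ge0.
 have /andP[tp t1] := tt;have q0: 0 <= t0 * t by rewrite mulr_ge0 // ltW.
 rewrite distrC -(tay0 v (ord K) h x);apply: le_trans (H3 x 0 (t0 * t) _ _) _;rewrite ?lexx //.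
  move=>s /andP[s0 st];apply: (@Wt_push 0);rewrite ?lexx //.
   by split=>// j _;move: Ux;rewrite UE;exact.
  by rewrite s0 (le_trans st) // ger_pMr.
 apply: ler_pM;rewrite ?exprn_ge0 //;first by rewrite lerDr addr_ge0.
 apply: le_trans (_ : t ^+ (ord K).+1 <= _);first by rewrite lerXn2r ?nnegrE ?(ltW tp) // ger_pMl.
 by apply: ler_wiXn2l;rewrite // ltW.
have [M [M1 M2]]:=slow_order C.
pose tt i : R := 2^-1 ^+ i.
have ti i: tin (tt i) by rewrite /tin exprn_gt0 ?invr_gt0 // exprn_ile1 // ?invr_ge0 // invf_le1 // ler1n.
have tS i: tt i / 2 = tt i.+1 by rewrite /tt exprSr.
have small i K: C K <= 2 ^+ i -> C K * tt i ^+ 2 <= tt i.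
 move=>h1;have [q0 _]:=andP (ti i);rewrite expr2 mulrA ger_pMl //.
 apply: le_trans (_ : 2 ^+ i * tt i <= 1);first by rewrite ler_pM2r.
 by rewrite /tt -exprMn mulfV ?pnatr_eq0 // expr1n.
pose f i:=piece (M i) (M i.+1) (tt i).
have gf: geofam Wl f.
 split=>[i|ds];first exact: piece_Csm.
 have [i0 Hi]:=M2 (size ds).
 have /choice[u Hu] : forall i, exists B, [/\ 0 <= B, forall x, Wl x -> `|pds ds (f i) x| <= B & (i0 <= i)%N -> B <= tt i].
  move=>i;have [h1|h1]:=leqP i0 i.
   have [s1 s2]:=Hi i h1;have [c0 c1 _]:=HC (M i).
   exists (C (M i) * tt i ^+ 2);split=>[|x Wx|_];[by rewrite mulr_ge0 ?sqr_ge0|exact: c1|exact: small].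
  have [_ /(_ ds)[B HB]]:=(bounded_pdsP _ _).1 (piece_Csm (M i) (M i.+1) (ti i)).
  by exists `|B|;split=>// x Wx;exact: le_trans (HB x Wx) (ler_norm B).
 have [c Hc]:=@eventually_geo u i0 (fun i => let: And3 a _ _ := Hu i in a) (fun i => let: And3 _ _ a := Hu i in a).
 exists c => x Wx i;have [a b _]:=Hu i;apply: le_trans (b x Wx) _.
 by have := Hc i;rewrite ger0_norm.
have t1i: tin (1 : R) by rewrite /tin ltr01 lexx.
exists (fun x => chi 1 x * stage (M 0%N) 1 x + fsum f x).
 move=>k;apply: (CnD Wl_open);last exact: (fsum_Csm Wl_open gf).
 by apply: (cut_Csm t1i _).1;apply: stage_Csm;rewrite ?ltr01 ?lexx.
move=>x Wx Ux;have r0 j: j \in act -> r j x <= 0 by move=>_;apply: ltW;move: Ux;rewrite UE;exact.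
rewrite chi1 // mul1r.
have fE i: f i x = stage (M i.+1) (tt i.+1) x - stage (M i) (tt i) x.
 by have /andP[q _] := half_tin (ti i);rewrite /f /piece (chi1 q r0) mul1r tS.
have [c Hc]:=gf.2 [::].
have [i0 Hi]:=M2 0%N.
have [B HB]:=@eventually_geo (fun i => `|stage (M i) (tt i) x - h x|) i0 (fun i => normr_ge0 _)
 (fun i ii => le_trans (let: And3 _ _ a := HC (M i) in a (tt i) x (ti i) Wx Ux) (small i _ (Hi i ii).2)).
have E: h x - stage (M 0%N) 1 x = fsum f x.
 apply: (tsum_uniq (Hc x Wx) (C := B)) => k;rewrite (eq_bigr _ (fun i _ => fE i)).
 rewrite (telescope_sumr (fun i => stage (M i) (tt i) x)) // /tt expr0 opprB addrA subrK distrC.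
 by have := HB k;rewrite ger0_norm.
by rewrite -E addrC subrK.
Qed.

End Local.

Hypothesis CR : forall (S : {set 'I_N}) p, (forall j, j \in S -> r j p = 0) -> cr_free r S p.

Lemma seg_small (v : V) (d : R) : 0 < d -> exists t0 : R, [/\ 0 < t0, t0 <= 1 &
 forall t p x, 0 <= t <= t0 -> `|x - p| < d / 2 -> `|t *: v + x - p| <= d].
move=>d0;have v1: 0 < 1 + `|v| by rewrite ltr_pwDl.
have h0: 0 < d / 2 / (1 + `|v|) by rewrite !divr_gt0.
exists (Num.min 1 (d / 2 / (1 + `|v|)));split;first by rewrite lt_min ltr01.
 by rewrite ge_min lexx.
move=>t p x /andP[t0 tt] xp;rewrite -addrA;apply: le_trans (ler_normD _ _) _.
have : `|t *: v| <= d / 2.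
 rewrite normrZ ger0_norm //;apply: le_trans (_ : t * (1 + `|v|) <= _);first by rewrite ler_wpM2l // lerDr.
 by rewrite -ler_pdivlMr //;apply: le_trans tt _;rewrite ge_min lexx orbT.
by move: xp;move: (`|t *: v|) (`|x - p|) => a b;lra.
Qed.

(** The local extensions are patched by a partition of unity on a neighbourhood of the compact
    closure; each agrees with [h] on [U], so their combination does. *)
Theorem smooth_extension h : Csm true U h -> exists2 k, Csm true setT k & forall x, U x -> k x = h x.
move=>hs.
have /choice[dk Hdk] : forall p, exists dk : R * (V -> R), closure U p ->
  [/\ 0 < dk.1, Csm true [set x | `|x - p| < dk.1] dk.2 & forall x, `|x - p| < dk.1 -> U x -> dk.2 x = h x].
 move=>p;have [cp|]:=pselect (closure U p);last by exists (0, fun _ => 0).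
 have [v [d [d0 Hv]]]:=inward oU bU rs CR (fun j => closure_le0 rs UE j cp).
 have [t0 [t00 t01 Ht]]:=seg_small v d0.
 pose act:=[seq j <- enum 'I_N | r j p == 0].
 have Ha j: j \in act -> forall x, `|x - p| <= d -> dirv v (r j) x <= -1.
  rewrite mem_filter=>/andP[/eqP rj _];have [[_ //]|H]:=Hv j.
  by have := H p;rewrite subrr normr0 ltW // rj ltxx=>/(_ isT).
 have Hn j: j \notin act -> forall x, `|x - p| <= d -> r j x < 0.
  by rewrite mem_filter mem_enum andbT => rj;have [[/eqP E]|//]:=Hv j;rewrite E in rj.
 have [k k1 k2]:=local_extension d0 Ha Hn t00 t01 (fun t x => Ht t p x) hs.
 by exists (d / 2, k) => _;split=>//=;rewrite divr_gt0.
have cK:=closure_compact bU.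
have [p0 p1] : (forall p, closure U p -> 0 < (dk p).1 / 2) /\ (forall p, closure U p -> (dk p).1 / 2 < (dk p).1).
 by split=>p /Hdk[a _ _];rewrite ?divr_gt0 // gtr_pMr // invf_lt1 // ltr1n.
have [s [e [s1 s2 e0 s3]]]:=partition_of_unity cK p0.
pose B p:=[set x : V | `|x - p| < (dk p).1].
have oB p: open (B p) by exact: open_ball_lt.
exists (fun x => \sum_(pc <- s) zext (B pc.1) (fun x => pc.2 x * (dk pc.1).2 x) x).
 move=>k;apply: (Cn_eq openT (f := fun x => \sum_(pc <- s) (if pc \in s then zext (B pc.1) (fun x => pc.2 x * (dk pc.1).2 x) else fun _ => 0) x)).
  by move=>x _;apply: eq_big_seq => pc ->.
 apply: (Cn_sum openT) => pc _;case: ifP=>[ps|_];last exact: Cn_cst.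
 have [cp cs c0]:=s1 pc ps;have [d1 ks _]:=Hdk _ cp.
 apply: (Csm_zext (U := B pc.1) (K := cube pc.1 ((dk pc.1).1 / 2)) (b := true))=>//.
 - exact: cube_compact.
 - by move=>x;rewrite /cube /= => h1;apply: le_lt_trans h1 (p1 _ cp).
 - by move=>x _;rewrite /cube /= =>/negP;rewrite -ltNge => h1;rewrite c0 ?mul0r // ltW.
 - move=>q;apply: (CnM (oB _))=>//;exact: (Cn_sub (U := setT)) (cs q).
move=>x Ux;have cx: closure U x by exact: subset_closure.
rewrite -[RHS]mul1r -(s3 x x cx) ?subrr ?normr0 // mulr_suml;apply: eq_big_seq => pc ps.
have [cp cs c0]:=s1 pc ps;have [d1 _ kE]:=Hdk _ cp.
have [Bx|nB]:=pselect (B pc.1 x);first by rewrite zextT // kE.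
rewrite zextF // c0 ?mul0r //;move: nB;rewrite /B /= =>/negP;rewrite -leNgt => h1.
by apply: le_trans h1;rewrite ltW // p1.
Qed.

Lemma Csm_upto h : Csm true U h -> smooth_upto U h.
by move=>/smooth_extension[k ks kE];apply: (smooth_upto_eq oU kE);exact: restrict_upto.
Qed.

Lemma upto_Csm h : smooth_upto U h -> Csm true U h.
move=>[hs hl];apply/bounded_pdsP;split=>// ds.
have [d d0 Hd] : exists2 d : R, 0 < d & forall p x, closure U p -> `|x - p| < d -> U x -> `|pds ds h x| <= d^-1.
 (* The bound is encoded as the inverse of the radius, so that one application yields a uniform
    bound together with the radius. *)
 have [||d d0 Hd]:=@compact_radius _ _ (fun x d => 0 < d -> U x -> `|pds ds h x| <= d^-1) (closure_compact bU).
 - move=>p d e ed H e0 Ux;apply: le_trans (H (lt_le_trans e0 ed) Ux) _.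
  by rewrite lef_pV2 ?posrE // (lt_le_trans e0).
 - move=>p cp;have [l Hl]:=hl ds p cp.
  have /cvgrPdist_le/(_ 1 ltr01) := Hl;rewrite /= near_withinE=>/nbhs_ballP[e /= e0 He].
  have l1: 0 < `|l| + 1 by rewrite ltr_wpDl.
  exists (Num.min e (`|l| + 1)^-1);first by rewrite lt_min e0 invr_gt0.
  move=>x;rewrite lt_min=>/andP[xe _] m0 Ux.
  have h1: `|l - pds ds h x| <= 1 by apply: He=>//;rewrite ball_lt.
  apply: le_trans (_ : `|l| + 1 <= _);last first.
   by rewrite -[leLHS]invrK lef_pV2 ?posrE ?invr_gt0 // ge_min lexx orbT.
  by rewrite -[pds ds h x](subKr l) (le_trans (ler_normB _ _)) // lerD2l.
 by exists d=>// p x cp xp;exact: (Hd p x cp xp d0).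
exists d^-1 => x Ux;apply: (Hd x x)=>//;first exact: subset_closure.
by rewrite subrr normr0.
Qed.

Lemma upto_CS P : upto U P <-> CS U P.
split=>[[p1 p2] k|p];first by split;exact: upto_Csm.
by split;apply: Csm_upto => k;[exact: (p k).1|exact: (p k).2].
Qed.

Lemma L2_orthP P H : CC false U 0 P -> CC false U 0 H -> lint (zext U (fun x => nsq (P x))) ->
 lint (zext U (fun x => nsq (H x))) ->
 (L2_orth U (fun x => Re (P x)) (fun x => Im (P x)) (fun x => Re (H x)) (fun x => Im (H x)) <-> orth U P H).
move=>cP cH lP lH;have [l1 l2]:=lint_mulconj oU cP cH lP lH.
have E1: (fun x => Defs.indic U x * (Re (P x) * Re (H x) + Im (P x) * Im (H x))) =
  zext U (fun x => Re (P x * conjc (H x))).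
 by apply/funext => x;rewrite /zext cReM;case: (P x) (H x)=>[a b] [c e] /=;congr (_ * _);ring.
have E2: (fun x => Defs.indic U x * (Im (P x) * Re (H x) - Re (P x) * Im (H x))) =
  zext U (fun x => Im (P x * conjc (H x))).
 by apply/funext => x;rewrite /zext cImM;case: (P x) (H x)=>[a b] [c e] /=;congr (_ * _);ring.
rewrite /L2_orth /orth E1 E2 !int_Rm_rint //.
split=>[[h1 h2]|[h1 h2]];first by split;[exact: (EFin_inj h1)|exact: (EFin_inj h2)].
by split;[exact: (congr1 EFin h1)|exact: (congr1 EFin h2)].
Qed.

Lemma L2_onP F : hol U F -> (L2_on U (fun x => Re (F x)) (fun x => Im (F x)) <-> lint (zext U (fun x => nsq (F x)))).
move=>hF;apply: int_nonneg_lint=>[|x].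
 exact: C0_meas oU (Cn_C0 (Cn_nsq oU (hol_CC oU 0 hF))).
by apply: mulr_ge0;[rewrite /Defs.indic;case: ifP|exact: nsq_ge0].
Qed.

(** Besides the change of representation, the content is [upto_CS]: limits of derivatives at the
    boundary give bounds by compactness, and bounds give limits through the extension. *)
Lemma condition_RP : condition_R U <-> RC U.
split=>[cR P Ps|rc pu pv us vs].
 have [p1 p2]:=(upto_CS P).2 Ps.
 have [hu [hv [hh [lh [oh [su sv]]]]]]:=cR _ _ p1 p2;exists (fun x => hu x +i* hv x).
 have aH: A2 U (fun x => hu x +i* hv x) by split=>//;apply/L2_onP.
 split;last by apply/upto_CS;split.
 split=>// K [hK lK];have cH:=hol_CC oU 0 aH.1;have cP:=CS_CC false 0 Ps.
 apply/L2_orthP=>//;[|exact: hol_CC|exact: (lint_nsqB oU cP cH (CS_lint oU bU Ps) aH.2)|].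
  by apply: CCD=>//;apply: CCN.
 have := oh (fun x => Re (K x)) (fun x => Im (K x)) hK ((L2_onP hK).2 lK).
 by under [X in L2_orth _ X _ _ _ -> _]eq_fun => x do rewrite -[hu x]/(Re (hu x +i* hv x)) -cReN -cReD;
  under [X in L2_orth _ _ X _ _ -> _]eq_fun => x do rewrite -[hv x]/(Im (hu x +i* hv x)) -cImN -cImD.
pose P x:=pu x +i* pv x;have Ps: CS U P by apply/upto_CS;split.
have [H [[aH oH] Hs]]:=rc P Ps;have [s1 s2]:=(upto_CS H).2 Hs.
exists (fun x => Re (H x)), (fun x => Im (H x));split;first exact: aH.1.
split;first exact/(L2_onP aH.1)/aH.2.
split=>// gu gv hg lg;pose K x:=gu x +i* gv x;have hK: hol U K by [].
have lK:=(L2_onP hK).1 lg;have cH:=hol_CC oU 0 aH.1;have cP:=CS_CC false 0 Ps.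
have : orth U (fun x => P x - H x) K by exact: oH.
move/(L2_orthP (CCD oU cP (CCN oU cH)) (hol_CC oU 0 hK) (lint_nsqB oU cP cH (CS_lint oU bU Ps) aH.2) lK).
by under [X in L2_orth _ X _ _ _ -> _]eq_fun do rewrite cReD cReN;
 under [X in L2_orth _ _ X _ _ -> _]eq_fun do rewrite cImD cImN.
Qed.

End Extension.

(** Continuity of the determinant at the identity, with matrices read as real row vectors in order
    to reuse the calculus there. The value at the identity is 1, and a tolerance of 3/4 leaves
    1/4. *)
Lemma det_near (n : nat) : exists2 e : R, 0 < e & forall A : 'M[R[i]]_n,
 (forall i j, `|Re (A i j - (i == j)%:R)| <= e /\ `|Im (A i j - (i == j)%:R)| <= e) ->
 4^-1 <= nsq (\det A).
pose V2:='rV[R]_(n * n + n * n).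
pose M (x : V2) : 'M[R[i]]_n := \matrix_(i, j)
 (x ord0 (lshift (n * n) (mxvec_index i j)) +i* x ord0 (rshift (n * n) (mxvec_index i j))).
pose co (A : 'M[R[i]]_n) : V2 := \row_k match fintype.split k with
 inl a => Re (mxvec A ord0 a) | inr a => Im (mxvec A ord0 a) end.
have coK A: M (co A) = A.
 apply/matrixP => i j;rewrite !mxE (unsplitK (inl _)) (unsplitK (inr _)) !mxvecE.
 by case: (A i j).
have cM: CC false setT 0 (fun x => \det (M x)).
 apply: (CC_det openT) => i j;apply: (CC_eq openT (F := fun x : V2 =>
  x ord0 (lshift (n * n) (mxvec_index i j)) +i* x ord0 (rshift (n * n) (mxvec_index i j)))).
  by move=>x _;rewrite mxE.
 by split;apply: Cn_coord.
have e34: 0 < (3 / 4 : R) by rewrite divr_gt0.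
have [d d0 Hd]:=(cont_epsP _ _).1 ((Cn_C0 (Cn_nsq openT cM)).1 (co 1%:M) I) _ e34.
exists (d / 2)=>[|A HA];first by rewrite divr_gt0.
have E1: nsq (\det (M (co 1%:M))) = 1 by rewrite coK det1 /nsq /= expr1n expr0n addr0.
have /Hd : `|co A - co 1%:M| < d.
 apply/(rV_norm_lt _ d0) => k;rewrite !mxE;apply: le_lt_trans (_ : _ <= d / 2) _;last by rewrite gtr_pMr // invf_lt1 // ltr1n.
 case: (fintype.split k) => a;case/mxvec_indexP: a => i j;rewrite !mxvecE mxE.
  by have [+ _]:=HA i j;rewrite cReD cReN.
 by have [_]:=HA i j;rewrite cImD cImN.
rewrite coK E1 ler_norml=>/andP[+ _];move: (nsq _) => u;clear;lra.
Qed.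

Definition bell_dense n (U : set 'rV[R]_(n + n)) := forall (h : 'rV[R]_(n + n) -> R[i]) e,
 CS U h -> hol U h -> 0 < e -> exists th K H,
 [/\ CS U th, compact K /\ K `<=` U, (forall x, U x -> ~ K x -> th x = 0), isproj U th H &
  CS U H /\ forall ds x, (size ds <= 1)%N -> U x ->
  `|pds ds (fun x => Re (h x) - Re (H x)) x| <= e /\ `|pds ds (fun x => Im (h x) - Im (H x)) x| <= e].

Lemma wronskian_CS n (U : set 'rV[R]_(n + n)) P Q i : open U -> CS U P -> CS U Q ->
 CS U (fun y => pdC i P y * Q y - P y * pdC i Q y).
move=>oU p q k;apply: (CCD oU (CCM oU (CC_pd i (p k.+1)) (q k))).
exact: (CCN oU (CCM oU (p k) (CC_pd i (q k.+1)))).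
Qed.

(** * Condition R on both sides makes the biholomorphic map smooth up to the boundary *)

Section Regularity.
Variable n : nat.
Local Notation V := 'rV[R]_(n + n).

Section Pull.
Variables (D G : set V) (f g : V -> V).
Hypotheses (oD : open D) (oG : open G) (cD : connected D) (cG : connected G) (D0 : D !=set0).
Hypotheses (bD : bounded_set D) (bG : bounded_set G).
Hypotheses (hf : holomorphic_map_on D f) (hg : holomorphic_map_on G g).
Hypotheses (fD : forall x, D x -> G (f x)) (gG : forall y, G y -> D (g y)).
Hypotheses (gf : forall x, D x -> g (f x) = x) (fg : forall y, G y -> f (g y) = y).
Hypotheses (rD : RC D) (dG : bell_dense G).

Lemma comp_CC k F : CC false G k F -> CC false D k (fun x => F (f x)).
by move=>[F1 F2];split;[apply: (Cn_comp (h := fun y => Re (F y)) oD oG fD F1)|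
 apply: (Cn_comp (h := fun y => Im (F y)) oD oG fD F2)] => l;exact: map_comp.
Qed.

(** The pull-back of a compactly supported [th] has compact support in [D], so its smoothness up to
    bD is free; Condition R on [D] then applies, and the transformation formula names its
    projection. *)
Lemma pull_CS th K H : CS G th -> compact K -> K `<=` G -> (forall x, G x -> ~ K x -> th x = 0) ->
 isproj G th H -> CS D (pull f H).
move=>ths cK KG thK pH;have [chi [Kx ex]]:=exhaustion_exists oD.
have pl:=transfer oD oG cD cG D0 hf hg fD gG gf fg ex (CS_CC false 0 ths) (CS_lint oG bG ths) pH.
have cg:=compact_image oG hg cK KG.
have gD: g @` K `<=` D by move=>_ [y /KG Gy <-];exact: gG.
have ps k: CC false D k (pull f th).
 by apply: CCM=>//;[apply: hol_CC=>//;exact: hol_jac|exact: comp_CC (CS_CC false k ths)].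
have sp x: D x -> ~ (g @` K) x -> pull f th x = 0.
 move=>Dx nK;rewrite /pull thK ?mulr0 //;first exact: fD.
 by move=>Kf;apply: nK;exists (f x)=>//;exact: gf.
have cs: CS D (pull f th).
 move=>k;split.
  have s1: supp_in D (g @` K) (fun x => Re (pull f th x)) by move=>x Dx /(sp x Dx) ->.
  apply: (Cn_eq oD _ (Cn_sub (@subsetT _ _) (Csm_zext oD cg gD s1 (fun q => (ps q).1) k))) => x Dx.
  by rewrite zextT.
 have s2: supp_in D (g @` K) (fun x => Im (pull f th x)) by move=>x Dx /(sp x Dx) ->.
 apply: (Cn_eq oD _ (Cn_sub (@subsetT _ _) (Csm_zext oD cg gD s2 (fun q => (ps q).2) k))) => x Dx.
 by rewrite zextT.
have [H2 [pH2 Hs]]:=rD cs;move=>k;apply: (CC_eq oD _ (Hs k)) => x Dx.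
exact: (isproj_CS_uniq oD bD cs pH2 pl).
Qed.

Lemma one_approx e : 0 < e -> exists H, [/\ CS G H, hol G H, CS D (pull f H) &
 forall ds x, (size ds <= 1)%N -> G x -> `|pds ds (fun x => 1 - Re (H x)) x| <= e /\
  `|pds ds (fun x => 0 - Im (H x)) x| <= e].
move=>e0;have [|th [K [H [ths [cK KG] thK pH [Hs He]]]]]:=@dG (fun _ => 1) e _ (hol_cst oG 1) e0.
 by move=>k;exact: CC_cst.
by exists H;split=>//;[exact: pH.1.1|exact: (pull_CS ths cK KG thK pH)].
Qed.

Lemma near1_normsq (a b : R) : `|1 - a| <= 2^-1 -> 4^-1 <= a ^+ 2 + b ^+ 2.
rewrite ler_norml=>/andP[_ h];have a1: 2^-1 <= a by lra.
have : 2^-1 ^+ 2 <= a ^+ 2 by rewrite lerXn2r ?nnegrE ?invr_ge0 // (le_trans _ a1).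
by have -> : (2^-1 : R) ^+ 2 = 4^-1 by [field];have := sqr_ge0 b;lra.
Qed.

(** For [H] within 1/2 of 1, the bounded function u (H o f) dominates |u| / 2. *)
Lemma jac_bounded : exists2 C : R, 0 < C & forall x, D x -> nsq (jac f x) <= C.
have [|H [Hs hH ps He]]:=@one_approx 2^-1;first by rewrite invr_gt0.
have [_ /(_ isT)[C HC]]:=Cn_C0 (Cn_nsq oD (ps 0%N)).
exists (4 * `|C| + 1)=>[|x Dx];first by rewrite ltr_wpDl // mulr_ge0.
have := HC x Dx;rewrite ger0_norm ?nsq_ge0 // /pull normsqM => h.
have h4: 4^-1 <= nsq (H (f x)) by apply: near1_normsq;have []:=He [::] (f x) isT (fD Dx).
have : nsq (jac f x) * 4^-1 <= `|C|.
 by apply: le_trans (le_trans h (ler_norm C));rewrite ler_wpM2l // nsq_ge0.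
by rewrite ler_pdivrMr // mulrC;lra.
Qed.

End Pull.

Lemma near_one_le (p q e : R) : `|1 - p| <= e -> `|0 - q| <= e -> e <= 2^-1 -> `|p| <= 2 /\ `|q| <= 2.
by rewrite !ler_norml=>/andP[? ?] /andP[? ?] ?;split;apply/andP;split;lra.
Qed.

Lemma five_four (e B : R) : (5 + 2 * B) * e = (4 + 2 * B) * e + e.
ring. Qed.

Lemma near_le (p a e w M : R) : `|a - p| <= e -> `|a| <= M -> M <= w -> e <= 2^-1 -> `|p| <= w + 2.
by rewrite !ler_norml=>/andP[? ?] /andP[? ?] ? ?;apply/andP;split;lra. Qed.

Lemma three_small (u1 u2 u3 e B e1 : R) : `|u1| <= 2 * e * 2 -> `|u2| <= e -> `|u3| <= 2 * B * e ->
 (4 + 2 * B) * e + e <= e1 -> `|u1 + u2 - u3| <= e1.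
move=>h1 h2 h3 h4;apply: le_trans (ler_normB _ _) _;apply: le_trans (lerD (ler_normD _ _) (lexx _)) _.
by apply: le_trans (lerD (lerD h1 h2) h3) _;lra.
Qed.

Section Bootstrap.
Variables (D G : set V) (f g : V -> V).
Hypotheses (oD : open D) (oG : open G) (cD : connected D) (cG : connected G) (D0 : D !=set0).
Hypotheses (bD : bounded_set D) (bG : bounded_set G).
Hypotheses (hf : holomorphic_map_on D f) (hg : holomorphic_map_on G g).
Hypotheses (fD : forall x, D x -> G (f x)) (gG : forall y, G y -> D (g y)).
Hypotheses (gf : forall x, D x -> g (f x) = x) (fg : forall y, G y -> f (g y) = y).
Hypotheses (rD : RC D) (dG : bell_dense G).
Hypotheses (rG : RC G) (dD : bell_dense D).

Lemma small_mul (a b : R[i]) (p q : R) : `|Re a| <= p -> `|Im a| <= p -> `|Re b| <= q -> `|Im b| <= q ->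
 `|Re (a * b)| <= 2 * p * q /\ `|Im (a * b)| <= 2 * p * q.
move=>a1 a2 b1 b2;rewrite cReM cImM -mulrA mulr_natl mulr2n.
by split;[apply: le_trans (ler_normB _ _) _|apply: le_trans (ler_normD _ _) _];rewrite !normrM lerD // ler_pM.
Qed.

Lemma hol_coord j : hol G (comp id j).
apply/holP;split=>[|l x _].
 by split;exact: Cn_coord.
have E i: pdC i (comp id j) x = (i == xi j)%:R + 'i * (i == yi j)%:R.
 have c k: pd i (fun y : V => y ord0 k) x = (i == k)%:R by rewrite (pdE (dv_coord x i k)) eq_sym;case: (_ == _).
 apply: complexP;rewrite /pdC /comp /= !c ?cReD ?cImD ?cReM ?cImM /=;
 by do 2!case: (_ == _)=>/=;rewrite ?(mul0r, mul1r, mulr0, mulr1, addr0, add0r, subr0, sub0r, oppr0).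
have nx k l': (xi k == yi l' :> 'I_(n + n)) = false by apply/eqP=>/(congr1 val) /= H;have := ltn_ord k;rewrite H ltnNge leq_addr.
rewrite !E nx [yi l == xi j]eq_sym nx /xi /yi !(inj_eq (@lshift_inj _ _)) !(inj_eq (@rshift_inj _ _)).
by rewrite add0r mulr0 addr0.
Qed.

(** The quotient of u (H_j o f) by u (H_0 o f) is (H_j / H_0) o f, free of [u]. Differentiating it
    without dividing gives the Wronskian identity [WE], from which f' is expressed by functions with
    bounded derivatives and functions of [f]. If [f] has k bounded derivatives then so does f', and
    induction concludes. *)
Lemma Csm_map : forall l, Csm true D (fun x => f x ord0 l).
(* [B] bounds the approximants of the coordinates: |z_j| is at most |M| and the error at most
   1/2. *)
have [M HM]:=(bounded_setP _).1 bG;pose B:=`|M| + 2.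
have B0: 0 < B by rewrite ltr_wpDl.
have coB x l: G x -> `|x ord0 l| <= M by move=>Gx;apply: le_trans (coord_le _ _) (HM x Gx).
have [e1 e10 Hdet]:=@det_near n.
(* An entry of [Mx] differs from that of the identity by at most 4e from (d_m H_j - delta) H_0, e
   from delta (H_0 - 1) and 2Be from H_j d_m H_0. *)
pose e:=Num.min 2^-1 (e1 / (5 + 2 * B)).
have B4: 0 < 5 + 2 * B by rewrite addr_gt0 // mulr_gt0.
have e0: 0 < e by rewrite lt_min invr_gt0 ltr0Sn divr_gt0.
have e2: e <= 2^-1 by rewrite ge_min lexx.
have eB: (4 + 2 * B) * e + e <= e1.
 have : (5 + 2 * B) * e <= e1 by rewrite mulrC -ler_pdivlMr // ge_min lexx orbT.
 by rewrite five_four.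
have [H0 [H0s hH0 p0s H0e]]:=one_approx oD oG cD cG D0 bD bG hf hg fD gG gf fg rD dG e0.
have /choice[H HP] : forall j : 'I_n, exists H, [/\ CS G H, hol G H, CS D (pull f H) &
  forall ds x, (size ds <= 1)%N -> G x -> `|pds ds (fun x => Re (comp id j x) - Re (H x)) x| <= e /\
  `|pds ds (fun x => Im (comp id j x) - Im (H x)) x| <= e].
 move=>j;have cj: CS G (comp id j).
  by move=>k;split;apply: Cn_coord=>// _;exists M => x Gx;exact: coB.
 have [th [K [H [ths [cK KG] thK pH [Hs He]]]]]:=dG cj (hol_coord j) e0.
 by exists H;split=>//;[exact: pH.1.1|exact: (pull_CS oD oG cD cG D0 bD bG hf hg fD gG gf fg rD ths cK KG thK pH)].
(* The Wronskians on [G]; they would be the identity if [H_0] were 1 and [H_j] the j-th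
   coordinate. *)
pose Mx (y : V) : 'M[R[i]]_n := \matrix_(j, m) (pdC (xi m) (H j) y * H0 y - H j y * pdC (xi m) H0 y).
have MCS j m: CS G (fun y => Mx y j m).
 move=>k;have [Hs _ _ _]:=HP j.
 apply: (CC_eq oG (F := fun y => pdC (xi m) (H j) y * H0 y - H j y * pdC (xi m) H0 y)).
  by move=>y _;rewrite mxE.
 exact: wronskian_CS.
have detM y: G y -> 4^-1 <= nsq (\det (Mx y)).
 move=>Gy;apply: Hdet => j m;rewrite !mxE;have [Hs hH _ He]:=HP j.
 have D1 i:=CC_dv i (CS_CC false 1 Hs) Gy;have D2 i:=CC_dv i (CS_CC false 1 H0s) Gy.
 have Dj i:=CC_dv i (hol_CC oG 1 (hol_coord j)) Gy.
 have [a1 a2]:=He [:: xi m] y isT Gy;have [b1 b2]:=H0e [:: xi m] y isT Gy.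
 have [c1 c2]:=H0e [::] y isT Gy;have [d1 d2]:=He [::] y isT Gy;rewrite /= in a1 a2 b1 b2 c1 c2 d1 d2.
 have Ed: pdC (xi m) (comp id j) y = (j == m)%:R.
  apply: complexP;rewrite /pdC /comp /= (pdE (dv_coord y (xi m) _)).
   by rewrite /xi (inj_eq (@lshift_inj _ _));case: (_ == _).
  have -> : (yi j == xi m :> 'I_(n + n)) = false.
   by apply/eqP=>/(congr1 val) /= E;have := ltn_ord m;rewrite -E ltnNge leq_addr.
  by case: (_ == _).
 rewrite (pdE (dvB (Dj (xi m)).1 (D1 (xi m)).1)) Ed in a1;rewrite (pdE (dvB (Dj (xi m)).2 (D1 (xi m)).2)) Ed in a2.
 rewrite (pdE (dvB (dv_cst y (ebasis R (xi m)) (1 : R)) (D2 (xi m)).1)) in b1.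
 rewrite (pdE (dvB (dv_cst y (ebasis R (xi m)) (0 : R)) (D2 (xi m)).2)) in b2.
 have P1: `|Re (pdC (xi m) (H j) y - (j == m)%:R)| <= e /\ `|Im (pdC (xi m) (H j) y - (j == m)%:R)| <= e.
  by rewrite cReD cReN cImD cImN;split;rewrite distrC.
 have P2: `|Re (pdC (xi m) H0 y)| <= e /\ `|Im (pdC (xi m) H0 y)| <= e.
  by move: b1 b2;rewrite !sub0r !normrN.
 have P3: `|Re (H0 y)| <= 2 /\ `|Im (H0 y)| <= 2.
  exact: near_one_le c1 c2 e2.
 have P4: `|Re (H j y)| <= B /\ `|Im (H j y)| <= B.
  by split;[exact: near_le d1 (coB y (xi j) Gy) (ler_norm M) e2|exact: near_le d2 (coB y (yi j) Gy) (ler_norm M) e2].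
 have P5: `|Re (H0 y - 1)| <= e /\ `|Im (H0 y - 1)| <= e.
  rewrite cReD cReN cImD cImN /= subr0;split;first by rewrite distrC.
  by move: c2;rewrite sub0r normrN.
 have [q1 q2]:=small_mul P1.1 P1.2 P3.1 P3.2;have [q3 q4]:=small_mul P4.1 P4.2 P2.1 P2.2.
 have E: pdC (xi m) (H j) y * H0 y - H j y * pdC (xi m) H0 y - (j == m)%:R =
   (pdC (xi m) (H j) y - (j == m)%:R) * H0 y + (j == m)%:R * (H0 y - 1) - H j y * pdC (xi m) H0 y.
  move: (pdC _ _ _) (pdC _ _ _) (H0 y) (H j y) (_%:R) => u v w z k;ring.
 have q5: `|Re ((j == m)%:R * (H0 y - 1))| <= e /\ `|Im ((j == m)%:R * (H0 y - 1))| <= e.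
  by case: (j == m);rewrite ?mul1r // mul0r /= normr0 ltW.
 rewrite E;rewrite !cReD !cImD !cReN !cImN.
 by split;[exact: three_small q1 q5.1 q3 eB|exact: three_small q2 q5.2 q4 eB].
(* An upper bound for the Jacobian of the inverse map is a lower bound for [jac f]; here Condition R
   on [G] and density on [D] are used. *)
have [C C0 HC]:=jac_bounded oG oD cG cD (let: ex_intro x Dx := D0 in ex_intro _ (f x) (fD Dx)) bG bD hg hf gG fD fg gf rG dD.
have jlow x: D x -> C^-1 <= nsq (jac f x).
 move=>Dx;have := HC (f x) (fD Dx);have := congr1 nsq (jac_inv oD oG hf hg fD gf Dx).
 rewrite normsqM [nsq 1]/nsq /= expr1n expr0n addr0 => E h.
 by rewrite -div1r ler_pdivrMr // -E mulrC ler_wpM2l // nsq_ge0.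
pose K j:=pull f (H j);pose K0:=pull f H0.
(* The Wronskians on [D], smooth up to the boundary because they are built from the pull-backs; the
   terms with derivatives of [jac f] cancel in them. *)
pose W (x : V) : 'M[R[i]]_n := \matrix_(j, l) (pdC (xi l) (K j) x * K0 x - K j x * pdC (xi l) K0 x).
have WE x: D x -> W x = (jac f x ^+ 2) *: (Mx (f x) *m jacm f x).
 move=>Dx;apply/matrixP => j l;rewrite !mxE.
 have [_ hH _ _]:=HP j;have hj:=hol_jac oD hf.
 have P F: hol G F -> pdC (xi l) (pull f F) x =
   pdC (xi l) (jac f) x * F (f x) + jac f x * \sum_m pdC (xi m) F (f x) * pdC (xi l) (comp f m) x.
  move=>hF;rewrite -(pdC_comp oD (xi l) oG hf fD hF Dx).
  exact: (dvC_pd (dvCM (hol_dv oD (xi l) hj Dx) (hol_dv oD (xi l) (hol_comp oD oG hf fD hF) Dx))).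
 rewrite (P _ hH) (P _ hH0) /K /K0 /pull.
 have E: \sum_m Mx (f x) j m * jacm f x m l = (\sum_m pdC (xi m) (H j) (f x) * pdC (xi l) (comp f m) x) * H0 (f x) -
  H j (f x) * \sum_m pdC (xi m) H0 (f x) * pdC (xi l) (comp f m) x.
  rewrite mulr_suml mulr_sumr -sumrB;apply: eq_bigr => m _;rewrite !mxE.
  by move: (pdC _ _ _) (pdC _ _ _) (pdC _ _ _) (H0 _) (H j _) => u v w z k;ring.
 rewrite E;move: (pdC _ (jac f) x) (\sum_m _) (\sum_m _) (H0 _) (H j _) (jac f x) => u v w z k q;ring.
have H0low x: D x -> 4^-1 <= nsq (H0 (f x)).
 move=>Dx;apply: near1_normsq;have [h _]:=H0e [::] (f x) isT (fD Dx);exact: le_trans h e2.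
have jacE x l m: D x -> pdC (xi l) (comp f m) x =
  (jac f x ^+ 2 * \det (Mx (f x)))^-1 * (\adj (Mx (f x)) *m W x) m l.
 move=>Dx;rewrite WE // -scalemxAr mulmxA mul_adj_mx mul_scalar_mx !mxE.
 rewrite (mulrA (jac f x ^+ 2)) mulrA mulVf ?mul1r // mulf_neq0 //.
  by rewrite expf_neq0 // (jac_neq0 oD oG hf hg fD gf).
 by rewrite -nsq_eq0 gt_eqF // (lt_le_trans _ (detM _ (fD Dx))) // invr_gt0.
suff step k : forall l, Cn true D k (fun x => f x ord0 l) by move=>l k;exact: step.
elim: k=>[|k IH] l.
 split=>//;split;first exact: (Cn_C0 (map_comp oD 0 hf l)).1.
 by move=>_;exists M => x Dx;apply: coB;exact: fD.
have cmp F: CS G F -> CC true D k (fun x => F (f x)).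
 move=>Fs;have [F1 F2]:=Fs k.
 by split;[exact: (Cn_comp (h := fun y => Re (F y)) oD oG fD F1 IH)|exact: (Cn_comp (h := fun y => Im (F y)) oD oG fD F2 IH)].
have WCS j q: CS D (fun x => W x j q).
 move=>s;have [_ _ ps _]:=HP j.
 apply: (CC_eq oD (F := fun x => pdC (xi q) (K j) x * K0 x - K j x * pdC (xi q) K0 x)).
  by move=>y _;rewrite mxE.
 exact: wronskian_CS.
have dC: CC true D k (fun x => \det (Mx (f x))) by apply: CC_det=>// i j;exact: (cmp (fun y => Mx y i j)).
have invC: CC true D k (fun x => (jac f x ^+ 2 * \det (Mx (f x)))^-1).
 have K0C: CC true D k (fun x => (K0 x * K0 x * \det (Mx (f x)))^-1).
  pose c:=(4^-1 * C^-1) * (4^-1 * C^-1) * 4^-1.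
  have c0: 0 < c by rewrite !mulr_gt0 ?invr_gt0.
  have low x: D x -> c <= nsq (K0 x * K0 x * \det (Mx (f x))).
   move=>Dx;have kl: 4^-1 * C^-1 <= nsq (K0 x).
    by rewrite /K0 /pull normsqM mulrC ler_pM ?invr_ge0 ?(ltW C0) ?jlow ?H0low.
   have u0: 0 <= 4^-1 * C^-1 by rewrite mulr_ge0 // invr_ge0 ?ltW.
   rewrite (normsqM _ (\det _)) (normsqM (K0 x));apply: (ler_pM (mulr_ge0 u0 u0) _ (ler_pM u0 u0 kl kl) (detM _ (fD Dx))).
   by rewrite invr_ge0.
  apply: (CCV oD c0)=>[|x Dx|_ x Dx];[|by rewrite -nsq_eq0 gt_eqF // (lt_le_trans c0) // low|exact: low].
  by apply: CCM=>//;apply: CCM=>//;exact: p0s.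
 (* The square of the Jacobian is replaced by that of [K0], known to be smooth up to the boundary,
    at the price of a factor H_0(f)^2 covered by the induction hypothesis. *)
 apply: (CC_eq oD (F := fun x => (H0 (f x) * H0 (f x)) * (K0 x * K0 x * \det (Mx (f x)))^-1)).
  move=>x Dx;have h0: H0 (f x) != 0 by rewrite -nsq_eq0 gt_eqF // (lt_le_trans _ (H0low x Dx)) // invr_gt0.
  have j0:=jac_neq0 oD oG hf hg fD gf Dx.
  have d0: \det (Mx (f x)) != 0 by rewrite -nsq_eq0 gt_eqF // (lt_le_trans _ (detM _ (fD Dx))) // invr_gt0.
  rewrite /K0 /pull;move: h0 j0 d0;move: (H0 _) (jac f x) (\det _) => u v w u0 v0 w0.
  by field;rewrite u0 v0 w0.
 by apply: CCM=>//;apply: CCM=>//;exact: cmp.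
have jC m l': CC true D k (fun x => pdC (xi l') (comp f m) x).
 apply: (CC_eq oD (F := fun x => (jac f x ^+ 2 * \det (Mx (f x)))^-1 * \sum_i \adj (Mx (f x)) m i * W x i l')).
  by move=>x Dx;rewrite jacE // !mxE.
 apply: CCM=>//;apply: CC_sum=>// i _;apply: CCM=>//;last exact: WCS.
 apply: (CC_eq oD (F := fun x => (-1) ^+ (i + m) * \det (row' i (col' m (Mx (f x))))))=>[x _|].
  by rewrite mxE.
 apply: CCM=>//;first exact: CC_cst.
 apply: CC_det=>// a b;apply: (CC_eq oD (F := fun x => Mx (f x) (lift i a) (lift m b)))=>[x _|].
  by rewrite !mxE.
 exact: (cmp (fun y => Mx y (lift i a) (lift m b))).
have all m i: CC true D k (fun x => pdC i (comp f m) x).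
 case: (split_ordP i) => l' ->;first exact: jC.
 apply: (CC_eq oD (F := fun x => 'i * pdC (xi l') (comp f m) x))=>[x Dx|].
  by rewrite (hol_CR l' (hol_map m hf) Dx).
 by apply: CCM=>//;exact: CC_cst.
split;first exact: Cn_C0 (IH l).
split=>[x Dx i|i];first exact: Cn_derivable (map_comp oD 1 hf l) Dx.
by case: (split_ordP l) => m ->;have [h1 h2]:=all m i;[exact: h1|exact: h2].
Qed.

End Bootstrap.

Implicit Types (U : set V) (f : V -> V).

Lemma cont_zero_closure (D : set V) (u : V -> R) p : {for p, continuous u} -> (forall x, D x -> u x = 0) ->
 closure D p -> u p = 0.
move=>uc u0 cp;apply/eqP;rewrite -normr_le0;apply/ler_addgt0Pl => e e0;rewrite addr0.
have [d d0 Hd]:=(cont_epsP _ _).1 uc e e0;have [x Dx xp]:=closure_pick cp d0.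
by have := Hd x xp;rewrite u0 // sub0r normrN.
Qed.

Lemma map_cont (F : V -> V) x : (forall l, Csm true setT (fun x => F x ord0 l)) -> {for x, continuous F}.
by move=>Fs;apply: rV_continuous => l;exact: (Cn_C0 (Fs l 0%N)).1. Qed.

Lemma map_extension U (h : V -> V) : (forall l, exists2 k, Csm true setT k & forall x, U x -> k x = h x ord0 l) ->
 exists F : V -> V, (forall l, Csm true setT (fun x => F x ord0 l)) /\ forall x, U x -> F x = h x.
move=>H;have /choice[k Hk] : forall l, exists k, Csm true setT k /\ forall x, U x -> k x = h x ord0 l.
 by move=>l;have [k]:=H l;exists k.
exists (fun x => \row_l k l x);split=>[l q|x Ux];last by apply/rowP => l;rewrite mxE (Hk l).2.
by apply: (Cn_eq openT _ ((Hk l).1 q)) => x _;rewrite mxE.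
Qed.

(** Both relations hold on [A] and pass to its closure by continuity of the extensions. *)
Lemma extension_cancel (A B : set V) (F F' h h' : V -> V) x : (forall l, Csm true setT (fun x => F x ord0 l)) ->
 (forall l, Csm true setT (fun x => F' x ord0 l)) -> (forall x, A x -> F x = h x) -> (forall x, B x -> F' x = h' x) ->
 (forall x, A x -> B (h x)) -> (forall x, A x -> h' (h x) = x) -> closure A x -> closure B (F x) /\ F' (F x) = x.
move=>Fs Fs' FE FE' AB hh cx;split.
 apply: closure_intro => e e0;have /cvgrPdist_le/(_ e e0)/nbhs_ballP[d /= d0 Hd] := @map_cont F x Fs.
 have [y Ay yx]:=closure_pick cx d0;exists (F y);first by rewrite FE //;exact: AB.
 by rewrite distrC;apply: Hd;rewrite ball_lt.
apply/rowP => l;apply/eqP;rewrite -subr_eq0;apply/eqP.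
apply: (@cont_zero_closure A (fun x => F' (F x) ord0 l - x ord0 l)) cx=>[|y Ay];last by rewrite FE // FE' ?hh ?subrr //;exact: AB.
apply: continuousB;last exact: coord_cont.
apply: (@continuous_comp _ _ _ F (fun y => F' y ord0 l));first exact: map_cont.
exact: (Cn_C0 (Fs' l 0%N)).1.
Qed.

Lemma extends_of_extension (D G : set V) f (g : V -> V) : open D -> open G -> (forall x, D x -> G (f x)) -> (forall y, G y -> D (g y)) ->
 (forall x, D x -> g (f x) = x) -> (forall y, G y -> f (g y) = y) ->
 (forall l, exists2 k, Csm true setT k & forall x, D x -> k x = f x ord0 l) ->
 (forall l, exists2 k, Csm true setT k & forall x, G x -> k x = g x ord0 l) -> extends_smooth_diffeo D G f.
move=>oD oG fD gG gf fg /map_extension[F [Fs FE]] /map_extension[H [Hs HE]].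
have C1 x:=extension_cancel (x := x) Fs Hs FE HE fD gf;have C2 x:=extension_cancel (x := x) Hs Fs HE FE gG fg.
exists F, H;split=>//;split;first by move=>x /C1[].
split;first by move=>x /C2[].
split;first by move=>x /C1[].
split;first by move=>x /C2[].
split;first by apply: continuous_subspaceT => x;exact: map_cont.
split;first by apply: continuous_subspaceT => x;exact: map_cont.
by split=>k;[exact: restrict_upto (Fs k)|exact: restrict_upto (Hs k)].
Qed.

Theorem diffeo_of_condition_R D G f : generic_corners D -> condition_R D -> biholomorphic D G f ->
 generic_corners G -> condition_R G -> extends_smooth_diffeo D G f.
move=>[[oD [cD D0]] [bD [N [r [rs [_ [_ [DE [_ CR]]]]]]]]] rD [hf [g [hg [fD [gG [gf fg]]]]]].
move=>[[oG [cG G0]] [bG [N' [r' [rs' [_ [_ [GE [_ CR']]]]]]]]] rG.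
have RD:=(condition_RP oD bD rs DE CR).1 rD;have RG:=(condition_RP oG bG rs' GE CR').1 rG.
have dD: bell_dense D by move=>h e hs hh e0;exact: (bell_density oD bD rs DE CR RD hs hh e0).
have dG: bell_dense G by move=>h e hs hh e0;exact: (bell_density oG bG rs' GE CR' RG hs hh e0).
apply: (extends_of_extension oD oG fD gG gf fg) => l.
 apply: (smooth_extension oD bD rs DE CR).
 exact: (Csm_map oD oG cD cG D0 bD bG hf hg fD gG gf fg RD dG RG dD).
apply: (smooth_extension oG bG rs' GE CR').
exact: (Csm_map oG oD cG cD G0 bG bD hg hf gG fD fg gf RG dD RD dG).
Qed.

End Regularity.

(** * Inverse function theorem with uniform radii *)

Lemma mulmx_bound m (B : 'M[R]_m) (b : R) : (forall i l, `|B i l| <= b) -> 0 <= b ->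
 forall u : 'rV[R]_m, `|u *m B| <= m%:R * b * `|u|.
move=>HB b0 u;apply/(rV_norm_le _ (mulr_ge0 (mulr_ge0 (ler0n R m) b0) (normr_ge0 u))) => l;rewrite mxE;apply: le_trans (ler_norm_sum _ _ _) _.
have -> : m%:R * b * `|u| = \sum_(i < m) b * `|u| by rewrite sumr_const card_ord -mulrA mulr_natl.
apply: ler_sum => i _;rewrite normrM mulrC;apply: ler_pM=>//.
exact: coord_le.
Qed.

Lemma cube_seg m (p y z : 'rV[R]_m) (d s : R) : cube p d y -> cube p d z -> 0 <= s <= 1 ->
 cube p d (s *: (y - z) + z).
rewrite /cube /= => yp zp /andP[s0 s1].
have -> : s *: (y - z) + z - p = s *: (y - p) + (1 - s) *: (z - p).
 by apply/rowP => k;rewrite !mxE;ring.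
apply: le_trans (ler_normD _ _) _;rewrite !normrZ ger0_norm // [`|1 - s|]ger0_norm ?subr_ge0 //.
have e1: s * `|y - p| <= s * d by rewrite ler_wpM2l.
have e2: (1 - s) * `|z - p| <= (1 - s) * d by rewrite ler_wpM2l ?subr_ge0.
by apply: le_trans (lerD e1 e2) _;rewrite -mulrDl subrKC mul1r.
Qed.

Lemma Cn_det b m (W : set 'rV[R]_m) k q (A : 'rV[R]_m -> 'M[R]_q) : open W ->
 (forall i j, Cn b W k (fun x => A x i j)) -> Cn b W k (fun x => \det (A x)).
move=>oW HA;apply: (Cn_sum oW) => s _;apply: (CnM oW);first exact: Cn_cst.
exact: (Cn_prod oW).
Qed.

Lemma Cn_invmx m (W : set 'rV[R]_m) k q (A : 'rV[R]_m -> 'M[R]_q) i l : open W ->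
 (forall i j, Cn false W k (fun x => A x i j)) -> (forall x, W x -> A x \in unitmx) ->
 Cn false W k (fun x => invmx (A x) i l).
move=>oW HA uA.
have d0 x: W x -> \det (A x) != 0 by move/uA;rewrite unitmxE unitfE.
apply: (Cn_eq oW (f := fun x => (\det (A x))^-1 * ((-1) ^+ (l + i) * \det (row' l (col' i (A x)))))).
 by move=>x Wx;rewrite /invmx uA // !mxE /cofactor.
apply: (CnM oW);first by apply: (CnV oW (c := 1))=>//;exact: Cn_det.
apply: (CnM oW);first exact: Cn_cst.
apply: (Cn_det oW) => a c;by apply: (Cn_eq oW _ (HA (lift l a) (lift i c))) => x _;rewrite !mxE.
Qed.

Section LocalInverse.
Variable m : nat.
Local Notation V := 'rV[R]_m.
Variable Phi : V -> V.
Hypothesis Ps : forall l, Csm true setT (fun x => Phi x ord0 l).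

(** Row vectors are used, so the differential acts by [u |-> u *m Jm x] and the matrix is the
    transpose of the usual Jacobian. *)
Definition Jm x : 'M[R]_m := \matrix_(i, l) pd i (fun y => Phi y ord0 l) x.

(** One matrix [B] is an approximate inverse of the differential on the whole cube: [y - Phi y *m B]
    is Lipschitz with constant 1/2, and the last clause forces [Jm y] to be invertible there. *)
Definition good p d := exists (B : 'M[R]_m) (M : R), [/\ B \in unitmx, 0 < M, forall u : V, `|u *m B| <= M * `|u|,
 forall y z, cube p d y -> cube p d z -> `|y - z - (Phi y - Phi z) *m B| <= 2^-1 * `|y - z| &
 forall y (u : V), cube p d y -> `|u - u *m Jm y *m B| <= 2^-1 * `|u|].

Lemma good_sub p d q e : cube q e `<=` cube p d -> good p d -> good q e.
move=>sub [B [M [h1 h2 h3 h4 h5]]];exists B, M;split=>// [y z /sub yp /sub|y u /sub];[exact: h4|exact: h5].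
Qed.

Lemma Phi_bounds : exists2 C, 0 <= C & forall i k l x,
 `|pd i (fun y => Phi y ord0 l) x| <= C /\ `|pd k (pd i (fun y => Phi y ord0 l)) x| <= C.
have /choice[c Hc] : forall l, exists C, 0 <= C /\ forall ds, (size ds <= 2)%N -> forall x, `|pds ds (fun y => Phi y ord0 l) x| <= C.
 move=>l;have [|ds|C C0 HC]:=@seqs_uniform m (fun ds C => forall x, `|pds ds (fun y => Phi y ord0 l) x| <= C) 2.
 - by move=>ds C C' CC H x;exact: le_trans (H x) CC.
 - have [_ /(_ ds)[M HM]]:=(bounded_pdsP _ _).1 (Ps l).
  by exists `|M|=>// x;exact: le_trans (HM x I) (ler_norm M).
 by exists C.
have s0: 0 <= \sum_l c l by apply: sumr_ge0 => l _;have []:=Hc l.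
have cl l: c l <= \sum_l c l.
 by rewrite (bigD1 l) //= lerDl;apply: sumr_ge0 => k _;have []:=Hc k.
exists (\sum_l c l)=>// i k l x;have [_ H]:=Hc l.
by split;apply: le_trans (cl l);[exact: (H [:: i])|exact: (H [:: k;i])].
Qed.

Lemma Phi_lip : exists2 L, 0 <= L & forall x y, `|Phi x - Phi y| <= L * `|x - y|.
have [C C0 HC]:=Phi_bounds;have L0: 0 <= m%:R * C by rewrite mulr_ge0.
exists (m%:R * C)=>// x y;apply/(rV_norm_le _ (mulr_ge0 L0 (normr_ge0 _))) => l;rewrite !mxE.
by apply: (csm_lipschitz openT (Ps l 1%N))=>// i z _;have []:=HC i i l z.
Qed.

Lemma Phi_cont x : {for x, continuous Phi}.
by apply: rV_continuous => l;exact: (Cn_C0 (Ps l 0%N)).1. Qed.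

Lemma Phi_frechet q (x : V) (t : R) : 0 < t -> \forall u \near (0 : V),
 `|Phi (u + x) ord0 q - Phi x ord0 q - lincomb (fun k => pd k (fun y => Phi y ord0 q) x) u| <= t * `|u|.
move=>t0;apply: (frechet_of_partials (f := fun y => Phi y ord0 q) t0).
 have := near_in openT (I : setT x);apply: filterS => y _ k;exact: Cn_derivable (Ps q 1%N) (I : setT y).
by move=>k;exact: (Cn_C0 (Csm_pd k (Ps q) 0%N)).1.
Qed.

Lemma small_radius (C b : R) : 0 <= C -> 0 <= b -> exists2 d : R, 0 < d & m%:R * (m%:R * (m%:R * C * (3 * d) * b)) <= 2^-1.
move=>C0 b0;pose c:=m%:R * (m%:R * (m%:R * C * 3 * b));have c0: 0 <= c by rewrite !mulr_ge0.
exists (2^-1 / (1 + c));first by rewrite divr_gt0 ?invr_gt0 // ltr_pwDl.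
have -> : m%:R * (m%:R * (m%:R * C * (3 * (2^-1 / (1 + c))) * b)) = c / (1 + c) * 2^-1.
 by move: (1 + c)^-1 (2^-1 : R) => x y;rewrite /c;ring.
by rewrite ger_pMl ?invr_gt0 // ler_pdivrMr ?ltr_pwDl // mul1r lerDr.
Qed.

(** The radius depends only on the second derivatives of [Phi] and on the bound [b], and the inverse
    is required at a nearby point [x0], not at [p]. Boundary points can thus be served by interior
    ones. The 3d is d for [x0] plus 2d for the enlarged cube. *)
Lemma good_of_inverse b : 0 <= b -> exists2 d : R, 0 < d & forall p x0 (B : 'M[R]_m), `|x0 - p| <= d ->
 Jm x0 *m B = 1%:M -> (forall i l, `|B i l| <= b) -> good p d.
move=>b0;have [C C0 HC]:=Phi_bounds;have [d d0 Hd]:=small_radius C0 b0.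
exists d=>// p x0 B xp JB HB.
have E y k l: `|y - p| <= 2 * d -> `|(1%:M - Jm y *m B) k l| <= m%:R * (m%:R * C * (3 * d) * b).
 move=>yp;rewrite -JB -mulmxBl mxE;apply: le_trans (ler_norm_sum _ _ _) _.
 have -> : m%:R * (m%:R * C * (3 * d) * b) = \sum_(i < m) m%:R * C * (3 * d) * b by rewrite sumr_const card_ord mulr_natl.
 apply: ler_sum => i _;rewrite normrM;apply: ler_pM=>//;rewrite !mxE.
 have h:=csm_lipschitz (x := x0) (y := y) openT (Csm_pd k (Ps i) 1%N) (fun _ _ => I) (fun q z _ => (HC k q i z).2).
 apply: le_trans h _;rewrite ler_wpM2l ?mulr_ge0 //.
 have -> : x0 - y = (x0 - p) - (y - p) by rewrite opprB addrA subrK.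
 apply: le_trans (ler_normB _ _) _;apply: le_trans (lerD xp yp) _.
 by rewrite -[X in X + _]mul1r -mulrDl.
have b1: 0 <= m%:R * (m%:R * C * (3 * d) * b) by rewrite !mulr_ge0 // ltW.
have d2: d <= 2 * d by rewrite ler_peMl ?ltW // ltr1n.
exists B, (m%:R * b + 1);split.
- by have []:=mulmx1_unit JB.
- by rewrite ltr_wpDl // mulr_ge0.
- move=>u;apply: le_trans (mulmx_bound HB b0 u) _;by rewrite ler_wpM2r // lerDl.
- move=>y z yp zp;apply/(rV_norm_le _ (mulr_ge0 _ (normr_ge0 _)))=>[|l];first by rewrite invr_ge0.
 pose Psi (x : V) := x ord0 l - \sum_i Phi x ord0 i * B i l.
 have Dk x k: is_derive x (ebasis R k) Psi ((1%:M - Jm x *m B) k l).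
  have D1:=dv_coord x k l.
  have D2: is_derive x (ebasis R k) (fun x => \sum_i Phi x ord0 i * B i l) (\sum_i Jm x k i * B i l).
   apply: dv_sum => i _;rewrite mxE mulrC.
   by apply: dv_eq (dvZ (B i l) (Cn_derive k (Ps i 1%N) (I : setT x))) _ _=>// q;rewrite mulrC.
  by apply: dv_eq (dvB D1 D2) _ _=>//;rewrite !mxE eq_sym;case: eqP.
 have oB: open [set x : V | `|x - p| < 2 * d] by exact: open_ball_lt.
 have sm: Cn false [set x : V | `|x - p| < 2 * d] 1 Psi.
  have cc i: Cn false [set x : V | `|x - p| < 2 * d] 1 (fun x => Phi x ord0 i).
   by apply: (Cn_sub (U := setT))=>//;exact: Csm_Cn (Ps i) 1%N.
  apply: (CnB oB);first exact: Cn_coord.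
  by apply: (Cn_sum oB) => i _;apply: (CnM oB)=>//;exact: Cn_cst.
 have -> : (y - z - (Phi y - Phi z) *m B) ord0 l = Psi y - Psi z.
  rewrite /Psi !mxE;under eq_bigr do rewrite !mxE mulrBl.
  by rewrite sumrB;move: (\sum_(i < m) _) (\sum_(i < m) _) => a c;ring.
 apply: le_trans (csm_lipschitz (C := m%:R * (m%:R * C * (3 * d) * b)) oB sm _ _) _.
 - move=>s s01;have := cube_seg yp zp s01;rewrite /cube /= => h;apply: le_lt_trans h _.
  by rewrite ltr_pMl // ltr1n.
 - by move=>i x xp';rewrite (pdE (Dk x i));apply: E;exact: ltW.
 by rewrite ler_wpM2r.
- move=>y u yp;have -> : u - u *m Jm y *m B = u *m (1%:M - Jm y *m B) by rewrite mulmxBr mulmx1 mulmxA.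
 apply: le_trans (mulmx_bound (fun k l => E y k l (le_trans yp d2)) b1 u) _.
 by rewrite ler_wpM2r.
Qed.

Lemma good_inj p d : good p d -> exists2 C, 0 < C & forall y z, cube p d y -> cube p d z -> `|y - z| <= C * `|Phi y - Phi z|.
move=>[B [M [_ M0 HM Hc _]]];exists (2 * M)=>[|y z yp zp];first by rewrite mulr_gt0.
have h1:=Hc y z yp zp;have h2:=HM (Phi y - Phi z).
have : `|y - z| <= `|y - z - (Phi y - Phi z) *m B| + `|(Phi y - Phi z) *m B|.
 by have := ler_normD (y - z - (Phi y - Phi z) *m B) ((Phi y - Phi z) *m B);rewrite subrK.
by move: h1 h2;move: `|y - z| `|Phi y - Phi z| `|(Phi y - Phi z) *m B| `|y - z - (Phi y - Phi z) *m B| => a b c e;lra.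
Qed.

Lemma good_unit p d y : good p d -> cube p d y -> Jm y \in unitmx.
move=>[B [M [_ _ _ _ H]]] yp;rewrite unitmxE unitfE;apply/negP=>/det0P[u u0 uJ].
have := H y u yp;rewrite uJ mul0mx subr0 => h;move/negP: u0;apply;rewrite -normr_eq0.
have := normr_ge0 u;move: h;move: `|u| => a h1 h2;apply/eqP;lra.
Qed.

(** The map [y - (Phi y - w) *m B] preserves the cube and halves the defect |(Phi y - w) B|. A
    solution is found by compactness instead of a limit of iterates. *)
Lemma good_solve p d : good p d -> 0 < d -> exists2 e : R, 0 < e & forall w, `|w - Phi p| < e -> exists2 y, cube p d y & Phi y = w.
move=>[B [M [uB M0 HM Hc _]]] d0;exists (d / 2 / M)=>[|w ww];first by rewrite !divr_gt0.
pose S y:=y - (Phi y - w) *m B.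
have SS y z: S y - S z = y - z - (Phi y - Phi z) *m B.
 rewrite /S !mulmxBl;move: (Phi y *m B) (Phi z *m B) (w *m B) => a b c;apply/rowP => k;rewrite !mxE;ring.
have pp: cube p d p by rewrite /cube /= subrr normr0 ltW.
have SU: {homo S : y / cube p d y}.
 move=>y yp;rewrite /cube /=;have -> : S y - p = (S y - S p) - (Phi p - w) *m B.
  by rewrite /S;move: ((Phi y - w) *m B) ((Phi p - w) *m B) => a b;apply/rowP => k;rewrite !mxE;ring.
 apply: le_trans (ler_normB _ _) _;have h1:=Hc y p yp pp;rewrite -SS in h1.
 have h2: `|(Phi p - w) *m B| <= d / 2.
  by apply: le_trans (HM _) _;rewrite mulrC -ler_pdivlMr // distrC ltW.
 by move: h1 h2 (yp : `|y - p| <= d);move: `|S y - S p| `|y - p| `|(Phi p - w) *m B| => a b c;lra.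
pose h y:=`|(Phi y - w) *m B|.
have hS y: cube p d y -> h (S y) <= 2^-1 * h y.
 move=>yp;have -> : h y = `|S y - y| by rewrite /h /S addrAC subrr sub0r normrN.
 rewrite (_ : h (S y) = `|S y - y - (Phi (S y) - Phi y) *m B|);first exact: Hc (SU y yp) yp.
 rewrite /h -normrN /S !mulmxBl;congr `| _ |;apply/rowP => k;rewrite !mxE;ring.
have y0 k: cube p d (iter k S p) /\ h (iter k S p) <= h p * 2^-1 ^+ k.
 elim: k=>[|k [yp IH]];first by rewrite expr0 mulr1.
 split;first exact: SU;apply: le_trans (hS _ yp) _.
 by rewrite exprS mulrCA ler_pM2l ?invr_gt0.
(* A positive continuous defect would have a bounded inverse on the compact cube, against its
   geometric decay along the iterates. *)
have [y yp hy] : exists2 y, cube p d y & h y = 0.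
 apply: contrapT => no;have hn y: cube p d y -> 0 < h y.
  by move=>yp;rewrite lt_neqAle normr_ge0 andbT eq_sym;apply/eqP => e;apply: no;exists y.
 have hc y: {for y, continuous h}.
  apply/cont_epsP => e e0;have [L L0 HL]:=Phi_lip.
  exists (e / (M * L + 1))=>[|z zy];first by rewrite divr_gt0 // ltr_wpDl // mulr_ge0 // ltW.
  apply: le_trans (ler_dist_dist _ _) _;rewrite -mulmxBl opprB addrA subrK;apply: le_trans (HM _) _.
  apply: le_trans (ler_wpM2l (ltW M0) (HL _ _)) _;rewrite mulrA.
  apply: le_trans (_ : (M * L + 1) * `|z - y| <= _);first by rewrite ler_wpM2r // lerDl.
  by rewrite mulrC -ler_pdivlMr ?ltW // ltr_wpDl // mulr_ge0 // ltW.
 have [A HA]:=cont_bounded (@cube_compact _ p d) (fun y yp => continuousV (lt0r_neq0 (hn y yp)) (hc y)).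
 have A1: 0 < (`|A| + 1)^-1 by rewrite invr_gt0 ltr_wpDl.
 have [k Hk]:=half_pow_small (h p) (divr_gt0 A1 (ltr0Sn R 1));have [yk h1]:=y0 k;have h0:=hn _ yk.
 have h2:=HA _ yk;rewrite gtr0_norm ?invr_gt0 // in h2.
 have : (`|A| + 1)^-1 <= h (iter k S p).
  rewrite -[leRHS]invrK lef_pV2 ?posrE ?invr_gt0 ?ltr_wpDl //.
  by apply: le_trans h2 _;apply: le_trans (ler_norm A) _;rewrite lerDl.
 have := le_trans h1 Hk;move: A1;move: (h _) ((`|A| + 1)^-1) => a b;lra.
exists y=>//;have : (Phi y - w) *m B = 0 by apply/eqP;rewrite -normr_eq0;apply/eqP.
move=>/(congr1 (mulmx^~ (invmx B)));rewrite mulmxK // mul0mx=>/eqP;rewrite subr_eq0=>/eqP.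
exact.
Qed.

(* Two nested compactness arguments: first with [p0] fixed, then over all of [C]. *)
Lemma injective_near (C : set V) d : compact C -> 0 < d -> (forall p q, C p -> C q -> Phi p = Phi q -> p = q) ->
 exists2 e : R, 0 < e & forall p q x y, C p -> C q -> `|x - p| < e -> `|y - q| < e -> Phi x = Phi y -> `|x - y| < d.
move=>cC d0 inj;have [L L0 HL]:=Phi_lip.
have pt p q: C p -> C q -> exists2 e : R, 0 < e & forall x y, `|x - p| < e -> `|y - q| < e -> Phi x = Phi y -> `|x - y| < d.
 move=>Cp Cq;have [E|ne]:=pselect (p = q).
  exists (d / 2)=>[|x y xp yq _];first by rewrite divr_gt0.
  have -> : x - y = (x - p) - (y - q) by rewrite E opprB addrA subrK.
  by apply: le_lt_trans (ler_normB _ _) _;move: xp yq;move: `|x - p| `|y - q| => a b;lra.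
 pose g:=`|Phi p - Phi q|;have g0: 0 < g.
  by rewrite normr_gt0 subr_eq0;apply/eqP=>/(inj _ _ Cp Cq).
 have K0: 0 < 2 * L + 1 by rewrite ltr_wpDl // mulr_ge0.
 exists (g / (2 * L + 1))=>[|x y];first by rewrite divr_gt0.
 rewrite !ltr_pdivlMr // => xp yq E;exfalso.
 have h1:=HL x p;have h2:=HL y q;move: h1 h2;rewrite E distrC => h1 h2.
 have : g <= `|Phi p - Phi y| + `|Phi y - Phi q|.
  by apply: le_trans (ler_normD _ _);rewrite addrA subrK.
 move: h1 h2 xp yq g0 L0 (normr_ge0 (x - p)) (normr_ge0 (y - q));move: g `|Phi p - Phi y| `|Phi y - Phi q| `|x - p| `|y - q| => g' a b s t;nra.
have [||e e0 He]:=@compact_radius m C (fun x e => forall q y, C q -> `|y - q| < e -> Phi x = Phi y -> `|x - y| < d) cC.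
- by move=>x e e' ee H q y Cq yq;apply: (H q)=>//;exact: lt_le_trans ee.
- move=>p Cp.
 have [||e e0 He]:=@compact_radius m C (fun y e => forall x, `|x - p| < e -> Phi x = Phi y -> `|x - y| < d) cC.
 + by move=>y e e' ee H x xp;apply: H;exact: lt_le_trans ee.
 + by move=>q Cq;have [e e0 He]:=pt p q Cp Cq;exists e=>// y yq x xp;exact: He.
 by exists e=>// x xp q y Cq yq E;apply: (He q).
by exists e=>// p q x y Cp Cq xp yq E;exact: (He p x Cp xp q).
Qed.

Section Global.
Variable N : set V.
Hypothesis oN : open N.
Hypothesis Ninj : forall x y, N x -> N y -> Phi x = Phi y -> x = y.
Hypothesis Ngood : forall x, N x -> exists2 d : R, 0 < d & good x d.

Lemma solve_near x : N x -> exists C e : R, [/\ 0 < C, 0 < e & forall w, `|w - Phi x| < e ->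
 exists y, [/\ N y, Phi y = w & `|y - x| <= C * `|w - Phi x|]].
move=>Nx;have [d d0 gd]:=Ngood Nx.
have /nbhs_ballP[d' /= d'0 Hd] := open_nbhs_nbhs (conj oN Nx).
pose d2:=Num.min d (d' / 2);have d20: 0 < d2 by rewrite lt_min d0 divr_gt0.
have sub: cube x d2 `<=` cube x d by move=>y h;rewrite /cube /=;apply: le_trans h _;rewrite ge_min lexx.
have g2:=good_sub sub gd;have [C C0 HC]:=good_inj g2;have [e e0 He]:=good_solve g2 d20.
exists C, e;split=>// w /He[y yx Ey];exists y;split=>//;last first.
 by rewrite -Ey;apply: HC=>//;rewrite /cube /= subrr normr0 ltW.
apply: Hd;rewrite ball_lt;apply: le_lt_trans yx _.
by rewrite gt_min ltr_pdivrMr // ltr_pMr // ltr1n orbT.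
Qed.

(** Solvability gives openness of the image and the Lipschitz bound gives continuity of the inverse;
    its derivative is the inverse matrix of [Jm] at [K w], and this formula raises the order of
    smoothness by induction. *)
Theorem smooth_inverse : exists K : V -> V, [/\ open (Phi @` N), forall x, N x -> K (Phi x) = x &
 forall k l, Cn false (Phi @` N) k (fun w => K w ord0 l)].
have /choice[K HK] : forall w, exists x, (Phi @` N) w -> N x /\ Phi x = w.
 by move=>w;have [[x Nx E]|nW]:=pselect ((Phi @` N) w);[exists x|exists 0].
have oW: open (Phi @` N).
 rewrite openE => _ [x Nx <-];have [C [e [C0 e0 He]]]:=solve_near Nx.
 apply/nbhs_ballP;exists e=>//= w;rewrite ball_lt=>/He[y [Ny Ey _]].
 by exists y.
have KP x: N x -> K (Phi x) = x.
 by move=>Nx;have [|N1 E1]:=HK (Phi x);[exists x|exact: Ninj].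
have Kc w: (Phi @` N) w -> exists C e : R, [/\ 0 < C, 0 < e & forall w', `|w' - w| < e -> (Phi @` N) w' /\ `|K w' - K w| <= C * `|w' - w|].
 move=>[x Nx <-];have [C [e [C0 e0 He]]]:=solve_near Nx;exists C, e;split=>// w' /He[y [Ny <- yx]].
 by split;[exists y|rewrite !KP].
have KC0 l: C0 false (Phi @` N) (fun w => K w ord0 l).
 split=>// w Ww;have [C [e [C0 e0 He]]]:=Kc w Ww;apply/cont_epsP => s s0.
 exists (Num.min e (s / C))=>[|w'];first by rewrite lt_min e0 divr_gt0.
 rewrite lt_min=>/andP[w1 w2];have [_ h]:=He w' w1.
 have := coord_le (K w' - K w) l;rewrite !mxE => h2;apply: le_trans h2 _;apply: le_trans h _.
 by rewrite mulrC -ler_pdivlMr // ltW.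
have Ju w: (Phi @` N) w -> Jm (K w) \in unitmx.
 move=>[x Nx <-];rewrite KP //;have [d d0 gd]:=Ngood Nx.
 by apply: (good_unit gd);rewrite /cube /= subrr normr0 ltW.
have Kd w i l: (Phi @` N) w -> is_derive w (ebasis R i) (fun w => K w ord0 l) (invmx (Jm (K w)) i l).
 move=>Ww;have [C [e [C0 e0 He]]]:=Kc w Ww;have [Nx Ex]:=HK w Ww.
 set x := K w in Nx Ex *;pose b:=\sum_i \sum_l `|invmx (Jm x) i l|.
 have b0: 0 <= b by apply: sumr_ge0 => a _;apply: sumr_ge0.
 have HB a c: `|invmx (Jm x) a c| <= b.
  rewrite /b (bigD1 a) //= (bigD1 c) //= -addrA lerDl addr_ge0 //;first exact: sumr_ge0.
  by apply: sumr_ge0 => k _;apply: sumr_ge0.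
 apply: is_derive_eps => s s0.
 pose t:=s / (C * (m%:R * b + 1));have mb: 0 < m%:R * b + 1 by rewrite ltr_wpDl // mulr_ge0.
 have t0: 0 < t by rewrite divr_gt0 // mulr_gt0.
 have : \forall u \near (0 : V), forall q, `|Phi (u + x) ord0 q - Phi x ord0 q - lincomb (fun k => pd k (fun y => Phi y ord0 q) x) u| <= t * `|u|.
  near=> u;move=>q;move: q;near: u;apply: filter_forall => q;exact: Phi_frechet.
 move=>/nbhs_ballP[f /= f0 Hf].
 exists (Num.min e (f / C))=>[|h];first by rewrite lt_min e0 divr_gt0.
 rewrite lt_min=>/andP[h1 h2];have hn: `|h *: ebasis R i| <= `|h| by rewrite normrZ ler_piMr ?norm_ebasis.
 have hw: h *: ebasis R i + w - w = h *: ebasis R i by rewrite addrK.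
 have [|Ww' hK]:=He (h *: ebasis R i + w);first by rewrite hw;exact: le_lt_trans hn h1.
 rewrite hw in hK;pose u:=K (h *: ebasis R i + w) - x.
 have uC: `|u| <= C * `|h| by apply: le_trans hK _;rewrite ler_pM2l.
 have ub: ball (0 : V) f u.
  rewrite -ball_normE /ball_ /= sub0r normrN;apply: le_lt_trans uC _.
  by rewrite mulrC -ltr_pdivlMr.
 have [Nx' Ex']:=HK _ Ww'.
 (* First order expansion of [Phi] at [x], read along the displacement [u] of the inverse, whose
    size is already known to be O(|h|). *)
 have res: `|h *: ebasis R i - u *m Jm x| <= t * `|u|.
  apply/(rV_norm_le _ (mulr_ge0 (ltW t0) (normr_ge0 _))) => q;have := Hf u ub q.
  rewrite subrK Ex' Ex !mxE addrK /lincomb.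
  move=>h3;rewrite (eq_bigr (fun j => u ord0 j * pd j (fun y => Phi y ord0 q) x)) // => j _.
  by rewrite [Jm x j q]mxE.
 have -> : K (h *: ebasis R i + w) ord0 l - K w ord0 l - h * invmx (Jm x) i l =
   (- ((h *: ebasis R i - u *m Jm x) *m invmx (Jm x))) ord0 l.
  rewrite mulmxBl mulmxK ?Ju // opprB -scalemxAl !mxE;congr (_ - h * _).
  rewrite (bigD1 i) //= big1=>[|k ki];first by rewrite mxE eqxx mul1r addr0.
  by rewrite mxE (negbTE ki) mul0r.
 apply: le_trans (coord_le _ l) _;rewrite normrN;apply: le_trans (mulmx_bound HB b0 _) _.
 apply: le_trans (_ : (m%:R * b + 1) * (t * (C * `|h|)) <= _).
  by apply: ler_pM;rewrite ?mulr_ge0 // ?lerDl //;apply: le_trans res _;rewrite ler_wpM2l // ltW.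
 rewrite /t;have : C != 0 /\ m%:R * b + 1 != 0 by rewrite !gt_eqF.
 by move: (m%:R * b + 1) `|h| => a c [n1 n2];rewrite le_eqVlt;apply/orP;left;apply/eqP;field;rewrite n1 n2.
exists K;split=>// k;elim: k=>[|k IH] l;first by split=>//;exact: KC0.
apply: (Cn_intro oW (df := fun i w => invmx (Jm (K w)) i l))=>// i.
apply: Cn_invmx=>// a c.
have E w: (Phi @` N) w -> pd a (fun y => Phi y ord0 c) (K w) = Jm (K w) a c by move=>_;rewrite mxE.
apply: (Cn_eq oW E);apply: (Cn_comp oW openT)=>//.
exact: Csm_Cn (Csm_pd a (Ps c)) k.
Unshelve. all: by end_near. Qed.

End Global.
End LocalInverse.

(** * Stability and transport of independence of the complex gradients *)

Section CRIndependence.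
Variable n : nat.
Local Notation V := 'rV[R]_(n + n).
Variable N : nat.
Implicit Types (r : 'I_N -> V -> R) (S : {set 'I_N}).

Lemma cr_free_of_det r S p : \det (Gm r S p) != 0 -> cr_free r S p.
move=>d0 a b H j jS;pose z : 'rV[R[i]]_N := \row_k (if k \in S then a k -i* b k else 0).
have zG: z *m Gm r S p = 0.
 apply/rowP => k;rewrite !mxE.
 have [kS|kS]:=boolP (k \in S);last first.
  by apply: big1 => i _;rewrite !mxE (negbTE kS) andbF;case: eqP=>[->|_];rewrite ?(negbTE kS) ?mul0r ?mulr0.
 transitivity (\sum_l (\sum_(i in S) (a i -i* b i) * dA r i l p) * conjc (dA r k l p)).
  under [RHS]eq_bigr do rewrite mulr_suml.
  rewrite exchange_big /= [RHS]big_mkcond;apply: eq_bigr => i _;rewrite !mxE kS andbT.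
  by case: ifP => iS;rewrite ?mul0r // mulr_sumr;apply: eq_bigr => l _;rewrite mulrA.
 apply: big1 => l _;have [h1 h2]:=H l;rewrite (_ : \sum_(i in S) _ = 0) ?mul0r //.
 apply: complexP;rewrite ?cRe_sum ?cIm_sum /=.
  by rewrite -[RHS]h1;apply: eq_bigr => i _;rewrite dAE cReM /=;ring.
 by rewrite -[RHS]oppr0 -[in RHS]h2 -sumrN;apply: eq_bigr => i _;rewrite dAE cImM /=;ring.
have z0: z = 0.
 apply/eqP;apply: contraNT d0 => zn;apply/eqP/eqP/det0P;by exists z.
have := congr1 (fun z : 'rV_N => z ord0 j) z0;rewrite !mxE jS => -[-> /eqP].
by rewrite oppr_eq0=>/eqP.
Qed.

Lemma cr_free_open r S (W : set V) p : open W -> (forall k l, Cn false W k (r l)) -> W p -> cr_free r S p ->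
 exists2 d : R, 0 < d & forall x, `|x - p| < d -> W x /\ cr_free r S x.
move=>oW rW Wp Hp;have /nbhs_ballP[d1 /= d10 Hd1] := open_nbhs_nbhs (conj oW Wp).
have d0: 0 < nsq (\det (Gm r S p)) / 2.
 by rewrite divr_gt0 // lt0r nsq_ge0 nsq_eq0 (Gm_det Hp).
have gW:=Cn_nsq oW (CC_det oW (fun i j => Gm_CC S 0 i j oW rW)).
have [d2 d20 Hd2]:=(cont_epsP _ _).1 ((Cn_C0 gW).1 p Wp) _ d0.
exists (Num.min d1 d2)=>[|x];first by rewrite lt_min d10.
rewrite lt_min=>/andP[x1 x2];split;first by apply: Hd1;rewrite ball_lt.
apply: cr_free_of_det;rewrite -nsq_eq0 gt_eqF //;apply: lt_le_trans d0 _.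
by apply: far_half (Hd2 x x2);rewrite mulrC divfK.
Qed.

(** The Cauchy-Riemann matrix with entries [s] and [t] commutes with multiplication by i, so both
    real equations are combinations of the two given ones. *)
Lemma rotate_cr (ax bx ay bY s t : R) : ax - bY = 0 -> ay + bx = 0 ->
 s * ax + t * ay - (- t * bx + s * bY) = 0 /\ - t * ax + s * ay + (s * bx + t * bY) = 0.
move=>h1 h2;split.
 have -> : s * ax + t * ay - (- t * bx + s * bY) = s * (ax - bY) + t * (ay + bx) by ring.
 rewrite h1 h2;ring.
have -> : - t * ax + s * ay + (s * bx + t * bY) = s * (ay + bx) - t * (ax - bY) by ring.
 rewrite h1 h2;ring.
Qed.

(* Pulling back along [Phi] only uses that [Phi] satisfies the Cauchy-Riemann equations at [p] itself,
   which holds on the closure of [D] by continuity. *)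
Lemma cr_free_push (D X W : set V) (Phi : V -> V) r r' S p : open X -> open W -> X p -> (forall x, X x -> W (Phi x)) ->
 (forall l, Csm true setT (fun x => Phi x ord0 l)) -> holomorphic_map_on D Phi -> closure D p ->
 (forall k l, Cn false W k (r' l)) -> (forall l x, X x -> r l x = r' l (Phi x)) ->
 cr_free r S p -> cr_free r' S (Phi p).
move=>oX oW Xp XW Ps hP cp rW rE Hp a b H;apply: Hp => k.
pose P i l:=pd i (fun y => Phi y ord0 l) p.
have ch i j: pd i (r j) p = \sum_l pd l (r' j) (Phi p) * P i l.
 rewrite (pd_eqon oX i (rE j) Xp);apply: pdE.
 apply: (C1_chain oX oW (rW 1%N j))=>[l|];last exact: XW.
 exact: Cn_derivable (Ps l 1%N) (I : setT p).
have pc i l: {for p, continuous (pd i (fun y => Phi y ord0 l))} by exact: (Cn_C0 (Csm_pd i (Ps l) 0%N)).1.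
have CR1 q: P (xi k) (xi q) = P (yi k) (yi q).
 apply/eqP;rewrite -subr_eq0;apply/eqP;apply: (cont_zero_closure (u := fun x => pd (xi k) (fun y => Phi y ord0 (xi q)) x - pd (yi k) (fun y => Phi y ord0 (yi q)) x)) cp;first exact: continuousB.
 by move=>x Dx;have [_ [_ /(_ k x Dx)[e _]]]:=hP q;apply/eqP;rewrite subr_eq0;apply/eqP;exact: e.
have CR2 q: P (yi k) (xi q) = - P (xi k) (yi q).
 apply/eqP;rewrite -addr_eq0;apply/eqP;apply: (cont_zero_closure (u := fun x => pd (yi k) (fun y => Phi y ord0 (xi q)) x + pd (xi k) (fun y => Phi y ord0 (yi q)) x)) cp;first exact: continuousD.
 by move=>x Dx;have [_ [_ /(_ k x Dx)[_ e]]]:=hP q;apply/eqP;rewrite addr_eq0;apply/eqP;exact: e.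
have T (f : 'I_N -> R) i : \sum_(j in S) f j * (2^-1 * pd i (r j) p) =
  \sum_q (P i (xi q) * \sum_(j in S) f j * (2^-1 * pd (xi q) (r' j) (Phi p)) +
      P i (yi q) * \sum_(j in S) f j * (2^-1 * pd (yi q) (r' j) (Phi p))).
 rewrite -(sum_xy (fun l => P i l * \sum_(j in S) f j * (2^-1 * pd l (r' j) (Phi p)))).
 under [RHS]eq_bigr do rewrite mulr_sumr.
 rewrite exchange_big /=;apply: eq_bigr => j _;rewrite ch !mulr_sumr;apply: eq_bigr => l _.
 by move: (pd l _ _) (P i l) (2^-1 : R) => x y z;ring.
pose c (f : 'I_N -> R) l := \sum_(j in S) f j * (2^-1 * pd l (r' j) (Phi p)).
have Hc q: c a (xi q) - c b (yi q) = 0 /\ c a (yi q) + c b (xi q) = 0.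
 by rewrite /c -sumrB -big_split;exact: H q.
rewrite sumrB big_split /= /dbar_re /dbar_im !T -sumrB -big_split /=.
split;apply: big1 => q _;have [h1 h2]:=Hc q;rewrite CR2 -CR1.
 exact: (rotate_cr _ _ h1 h2).1.
exact: (rotate_cr _ _ h1 h2).2.
Qed.

End CRIndependence.

(** The coefficients of a combination of the new gradients are regrouped as coefficients of the old
    gradients: a diagonal part, for indices in [S], and a common part proportional to the sum of the
    a_j A_j. *)
Lemma active_independent N (S S0 : {set 'I_N}) (al g A t a : 'I_N -> R) :
 (forall k, k \notin S0 -> al k = 0 /\ g k = 0) ->
 \sum_(j in S) a j * (al j * t j + A j * \sum_k g k * t k) =
 \sum_(k in S0) ((if k \in S then a k * al k else 0) + (\sum_(j in S) a j * A j) * g k) * t k.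
move=>H0;under eq_bigr do rewrite mulrDr mulrA [X in _ + X]mulrA.
rewrite big_split /= -mulr_suml [in LHS]big_mkcond mulr_sumr -big_split /= [RHS]big_mkcond.
apply: eq_bigr => k _;have [kS0|/H0[al0 g0]]:=boolP (k \in S0);last by rewrite al0 g0 mulr0 !mul0r mulr0;case: ifP;rewrite ?addr0.
by case: ifP => _;rewrite mulrDl mulrA ?mul0r.
Qed.

(** * Defining functions confined to a neighbourhood of the closure *)

Section Defining.
Variable n : nat.
Local Notation V := 'rV[R]_(n + n).
Variables (N : nat) (A : 'I_N -> R) (dl : R).
Hypotheses (A1 : forall j, 1 <= A j) (Ai : injective A) (dl0 : 0 < dl).

(* Vanishes on the face [r j = 0] only as far as the other [r k] stay small: this confines the corners of the new
   defining functions to a neighbourhood of the old ones. *)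
Definition rho (u : 'I_N -> R) j := flat (u j + dl) - flat dl + A j * \sum_(k | k != j) flat (u k).

Lemma rho_lt0 u j : rho u j < 0 -> u j < 0.
apply: contraTT;rewrite -!leNgt => u0;rewrite /rho addr_ge0 //.
 by rewrite subr_ge0 flat_le // lerDr.
by rewrite mulr_ge0 ?(le_trans _ (A1 j)) // sumr_ge0 // => k _;exact: flat_ge0.
Qed.

Lemma rho_le0 u j : rho u j <= 0 -> u j <= 0 /\ \sum_k flat (u k) <= flat dl.
have s0: 0 <= \sum_(k | k != j) flat (u k) by rewrite sumr_ge0 // => k _;exact: flat_ge0.
have As: \sum_(k | k != j) flat (u k) <= A j * \sum_(k | k != j) flat (u k) by rewrite ler_peMl.
rewrite /rho => h;have uj: u j <= 0.
 rewrite leNgt;apply/negP => u0;have : flat dl < flat (u j + dl) by apply: flat_lt;rewrite ?addr_gt0 // ltrDr.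
 by move: s0 As h;move: (A j * _) => x;move: (\sum_(k | k != j) flat (u k)) (flat dl) (flat (u j + dl)) => y z w;lra.
split=>//;rewrite (bigD1 j) //= flat_le0 // add0r.
have := flat_ge0 (u j + dl);move: As h;move: (A j * _) => x;move: (\sum_(k | k != j) flat (u k)) (flat dl) (flat (u j + dl)) => y z w;lra.
Qed.

Lemma rho_neg u j : (forall k, u k < 0) -> rho u j < 0.
move=>H;rewrite /rho big1 ?mulr0 ?addr0=>[|k _];last by rewrite flat_le0 // ltW.
by rewrite subr_lt0 flat_lt // gtrDr.
Qed.

(** Coordinates below -dl contribute nothing to either kind of flat term, so it is harmless if they
    increase as long as they stay there. *)
Lemma rho_le u w j : (forall k, u k <= w k \/ u k <= - dl) -> rho u j <= rho w j.
move=>H;have F k: flat (u k) <= flat (w k) /\ flat (u k + dl) <= flat (w k + dl).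
 have [h|h]:=H k;first by rewrite !flat_le // lerD2r.
 have h1: u k <= 0 by rewrite (le_trans h) // oppr_le0 ltW.
 have h2: u k + dl <= 0 by rewrite -lerBrDr sub0r.
 by rewrite (flat_le0 h1) (flat_le0 h2) !flat_ge0.
rewrite /rho lerD ?lerB ?(F _).2 // ler_wpM2l ?(le_trans _ (A1 j)) //.
by apply: ler_sum => k _;exact: (F k).1.
Qed.

Lemma rho_Csm (U : set V) (r : 'I_N -> V -> R) j k : open U -> (forall l, Cn false U k (r l)) -> Cn false U k (fun x => rho (r^~ x) j).
move=>oU rU;have F c l: Cn false U k (fun x => flat (r l x + c)).
 by apply: (Cn_comp1 oU flat_smooth);apply: (CnD oU)=>//;exact: Cn_cst.
apply: (CnD oU);first by apply: (CnB oU)=>//;exact: Cn_cst.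
apply: (CnZ oU);apply: (Cn_sum oU) => l _;apply: (Cn_eq oU _ (F 0 l)) => x _;by rewrite addr0.
Qed.

Lemma rho_pd (U : set V) (r : 'I_N -> V -> R) j i x : open U -> (forall l, Cn false U 1 (r l)) -> U x -> r j x <= 0 ->
 pd i (fun x => rho (r^~ x) j) x = flat^`()%classic (r j x + dl) * pd i (r j) x +
  A j * \sum_k flat^`()%classic (r k x) * pd i (r k) x.
move=>oU rU Ux rj;have D l:=Cn_derive i (rU l) Ux.
rewrite (bigD1 j) //= [flat^`()%classic (r j x)]derive1_flat_le0 // mul0r add0r.
have F k (c : R) d : is_derive x (ebasis R i) (fun x => r k x + c) d ->
  is_derive x (ebasis R i) (fun x => flat (r k x + c)) (flat^`()%classic (r k x + c) * d).
 exact: (@dv_comp1 _ x (ebasis R i) flat (fun x => r k x + c) _ _ (is_derive_flat (r k x + c))).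
have D2: is_derive x (ebasis R i) (fun x => \sum_(k | k != j) flat (r k x)) (\sum_(k | k != j) flat^`()%classic (r k x) * pd i (r k) x).
 by apply: dv_sum => k _;exact: (@dv_comp1 _ x (ebasis R i) flat (r k) _ _ (is_derive_flat (r k x)) (D k)).
apply: pdE;apply: dv_eq (dvD (dvB (F j dl _ (dvD (D j) (dv_cst x _ dl))) (dv_cst x _ (flat dl))) (dvZ (A j) D2)) _ _=>//.
by rewrite addr0 subr0.
Qed.

(** The new gradients are al_j dr_j + A_j (sum of g_k dr_k) over the old ones, and the old ones are
    independent on [S0]. For j in [S] this gives f_j al_j = 0, for k outside [S] that g_k kills the
    sum of the f_i A_i. Only an index with al_j = 0 is delicate, and distinct weights [A] leave at
    most one such index. *)
Lemma rho_cr_free (r q : 'I_N -> V -> R) (S S0 : {set 'I_N}) x :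
 (forall j i, j \in S -> pd i (q j) x = flat^`()%classic (r j x + dl) * pd i (r j) x +
  A j * \sum_k flat^`()%classic (r k x) * pd i (r k) x) ->
 (forall k, k \notin S0 -> r k x <= - dl) -> (forall j, j \in S -> rho (r^~ x) j = 0) ->
 cr_free r S0 x -> cr_free q S x.
move=>qE out z H a b E.
pose al k:=flat^`()%classic (r k x + dl);pose g k:=flat^`()%classic (r k x).
have H0 k: k \notin S0 -> al k = 0 /\ g k = 0.
 move=>/out h;split;apply: derive1_flat_le0;first by rewrite -lerBrDr sub0r.
 by apply: le_trans h _;rewrite oppr_le0 ltW.
pose cf (f : 'I_N -> R) k := (if k \in S then f k * al k else 0) + (\sum_(j in S) f j * A j) * g k.
have T (f : 'I_N -> R) i : \sum_(j in S) f j * (2^-1 * pd i (q j) x) = \sum_(k in S0) cf f k * (2^-1 * pd i (r k) x).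
 rewrite -(active_independent S A (fun k => 2^-1 * pd i (r k) x) f H0);apply: eq_bigr => j jS;rewrite (qE j i jS).
 rewrite (_ : \sum_k g k * (2^-1 * _) = 2^-1 * \sum_k g k * pd i (r k) x);last first.
  by rewrite mulr_sumr;apply: eq_bigr => k _;rewrite mulrCA.
 by rewrite -/(al j) /g;move: (\sum_k _) (pd i (r j) x) (2^-1 : R) => s t h;ring.
have cf0 k: cf a k = 0 /\ cf b k = 0.
 have [kS0|/H0[e1 e2]]:=boolP (k \in S0);last by rewrite /cf e1 e2 !mulr0;case: ifP;rewrite addr0.
 apply: H kS0 => l;have [h1 h2]:=E l.
 by split;[rewrite -[RHS]h1 !sumrB;congr (_ - _)|rewrite -[RHS]h2 !big_split;congr (_ + _)];exact: esym (T _ _).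
have r0 j: j \in S -> r j x <= 0 by move=>/z e;have []:=rho_le0 (_ : rho (r^~ x) j <= 0);rewrite ?e.
have fin f: (forall k, cf f k = 0) -> forall j, j \in S -> f j = 0.
 move=>fz j jS;have c1 k: k \in S -> f k * al k = 0.
  by move=>kS;have := fz k;rewrite /cf kS /g derive1_flat_le0 ?r0 // mulr0 addr0.
 have bal k: k \in S -> al k = 0 -> A k * \sum_k flat (r k x) = flat dl.
  move=>kS ak;have rk: r k x + dl <= 0.
   by rewrite leNgt;apply/negP=>/derive1_flat_gt0;rewrite -/(al k) ak ltxx.
  have := z k kS;rewrite /rho (flat_le0 rk) sub0r=>/eqP;rewrite addrC subr_eq0=>/eqP <-.
  by rewrite [in LHS](bigD1 k) //= flat_le0 ?r0 // add0r.
 have [aj|aj]:=eqVneq (al j) 0;last by have /eqP := c1 j jS;rewrite mulf_eq0 (negbTE aj) orbF=>/eqP.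
 have fd:=flat_gt0 dl0;have bj:=bal j jS aj.
 (* When al_j vanishes, the equation of the face says that A_j times the sum of the flat terms
    equals flat dl > 0, so some r_k is positive and its g_k nonzero. *)
 have [k gk] : exists k, g k != 0.
  apply: contrapT => nk;move: fd;rewrite -bj big1 ?mulr0 ?ltxx // => k _.
  apply: flat_le0;rewrite leNgt;apply/negP=>/derive1_flat_gt0 h.
  by apply: nk;exists k;rewrite gt_eqF.
 have kS: k \notin S by apply: contra gk => kS;rewrite /g derive1_flat_le0 // r0.
 have := fz k;rewrite /cf (negbTE kS) add0r=>/eqP;rewrite mulf_eq0 (negbTE gk) orbF (bigD1 j) //=.
 rewrite big1 ?addr0=>[|i /andP[iS ij]].
  by rewrite mulf_eq0 [A j == 0]gt_eqF ?orbF ?(lt_le_trans ltr01) // =>/eqP.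
 have /eqP := c1 i iS;rewrite mulf_eq0=>/orP[/eqP ->|/eqP ai];first by rewrite mul0r.
 (* A second index with al_i = 0 would satisfy the same balance with the same sum, hence have the
    same weight. *)
 case/eqP: ij;apply: Ai;have s0: \sum_k flat (r k x) != 0.
  by apply: contraTneq fd => e;rewrite -bj e mulr0 ltxx.
 by apply: (mulIf s0);rewrite bal.
by move=>j jS;split;apply: fin=>// k;have []:=cf0 k.
Qed.

End Defining.

Lemma flat_small (e m : R) : 0 < e -> 0 < m -> exists d, [/\ 0 < d, d <= e & flat d < m].
move=>e0 m0;have /cvgrPdist_lt/(_ m m0)/nbhs_ballP[d /= d0 Hd] := @smooth1_cont flat 0 flat_smooth 0.
exists (Num.min e (d / 2));split;first by rewrite lt_min e0 divr_gt0.
 by rewrite ge_min lexx.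
have d2: 0 < Num.min e (d / 2) by rewrite lt_min e0 divr_gt0.
have := Hd (Num.min e (d / 2));rewrite /ball /= sub0r normrN gtr0_norm // (flat_le0 (lexx 0)) sub0r normrN ger0_norm ?flat_ge0 //.
by apply;rewrite gt_min ltr_pdivrMr // ltr_pMr // ltr1n orbT.
Qed.

(** * The image of a domain with generic corners under a diffeomorphism of closures *)

Section Image.
Variable n : nat.
Local Notation V := 'rV[R]_(n + n).
Variables (N : nat) (r : 'I_N -> V -> R) (D : set V).
Hypotheses (oD : open D) (cD : connected D) (D0 : D !=set0) (bD : bounded_set D).
Hypotheses (rs : forall j, smooth_on setT (r j)) (DE : D = [set x | forall j, r j x < 0]).
Hypothesis CR : forall (S : {set 'I_N}) p, (forall j, j \in S -> r j p = 0) -> cr_free r S p.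

Definition thick (e : R) : set V := [set x | exists2 p, closure D p & `|x - p| < e].

Lemma thick_open e : open (thick e).
rewrite openE => x [p cp xp];apply/nbhs_ballP;exists (e - `|x - p|)=>/=;first by rewrite subr_gt0.
move=>y;rewrite ball_lt ltrBrDr => yx;exists p=>//.
by apply: le_lt_trans yx;rewrite -[y - p](subrKA x) ler_normD.
Qed.

Lemma thick_le e e' : e <= e' -> thick e `<=` thick e'.
by move=>ee x [p cp xp];exists p=>//;exact: lt_le_trans ee. Qed.

Lemma closure_thick e p : 0 < e -> closure D p -> thick e p.
by move=>e0 cp;exists p;rewrite ?subrr ?normr0. Qed.

(** Every point with all r_j <= 0 is a limit of points of [D] reached along the inward direction, so
    the closed inequalities describe exactly the closure. *)
Lemma le0_closure x : (forall j, r j x <= 0) -> closure D x.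
move=>x0;have [v [d [s0 [d0 s00 H]]]]:=push oD bD rs DE CR x0.
apply: closure_intro => e e0;have v1: 0 < 1 + `|v| by rewrite ltr_pwDl.
have q0: 0 < Num.min s0 (e / (1 + `|v|)) by rewrite lt_min s00 divr_gt0.
exists (Num.min s0 (e / (1 + `|v|)) *: v + x);first by apply: H;rewrite ?subrr ?normr0 // q0 ge_min lexx.
rewrite addrK normrZ gtr0_norm //;apply: le_trans (_ : Num.min s0 (e / (1 + `|v|)) * (1 + `|v|) <= _).
 by rewrite ler_pM2l // lerDr.
by rewrite -ler_pdivlMr // ge_min lexx orbT.
Qed.

Variables (Phi : V -> V) (d0 : R).
Hypothesis Ps : forall l, Csm true setT (fun x => Phi x ord0 l).
Hypothesis hPhi : holomorphic_map_on D Phi.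
Hypothesis inj : forall p q, closure D p -> closure D q -> Phi p = Phi q -> p = q.
Hypotheses (d00 : 0 < d0) (gd : forall p, closure D p -> good Phi p d0).

(** Injectivity on the compact closure together with local injectivity at the uniform scale [d0]
    gives injectivity on a thin neighbourhood: points with equal images are first shown to be close,
    then equal. *)
Lemma inverse_near : exists2 e : R, 0 < e & forall e', 0 < e' <= e -> exists K : V -> V,
 [/\ open (Phi @` thick e'), forall x, thick e' x -> K (Phi x) = x &
   forall k l, Cn false (Phi @` thick e') k (fun w => K w ord0 l)].
have h0: 0 < d0 / 2 by rewrite divr_gt0.
have [e e0 He]:=injective_near Ps (closure_compact bD) h0 inj.
exists (Num.min e (d0 / 2))=>[|e' /andP[e'0]];first by rewrite lt_min e0.
rewrite le_min=>/andP[e'e e'd];apply: (smooth_inverse Ps (thick_open (e := e')))=>[x y [p cp xp] [q cq yq] E|x [p cp xp]].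
 have xe:=lt_le_trans xp e'e;have := lt_le_trans yq e'e => ye.
 have xy:=He p q x y cp cq xe ye E.
 have [C C0 HC]:=good_inj (gd cp);apply/eqP;rewrite -subr_eq0 -normr_le0.
 have xd:=lt_le_trans xp e'd;have := HC x y;rewrite E subrr normr0 mulr0=>-> //;rewrite /cube /=.
  by move: xd;move: (`|x - p|) => a;move: d00;lra.
 have -> : y - p = (x - p) - (x - y) by apply/rowP => k;rewrite !mxE;ring.
 by apply: le_trans (ler_normB _ _) _;move: xd xy;move: (`|x - p|) (`|x - y|) => a b;lra.
exists (d0 / 2)=>//;apply: good_sub (gd cp) => y;rewrite /cube /= => yx.
rewrite -[y - p](subrKA x);apply: le_trans (ler_normD _ _) _.
by move: (lt_le_trans xp e'd) yx;move: (`|x - p|) (`|y - x|) => a b;lra.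
Qed.

(* Near a boundary point a short move along [v] either keeps [r k] negative or decreases it at unit rate. *)
Definition slides (x : V) (e B : R) (v : V) (s0 : R) := [/\ e <= s0, s0 * `|v| <= B & forall k,
 (forall s, 0 <= s <= s0 -> r k (s *: v + x) < - e) \/ (forall s, 0 <= s <= s0 -> r k (s *: v + x) <= r k x - s)].

(** Active functions decrease along the inward vector; inactive ones are bounded away from 0 near
    [p] and remain so over a short displacement. All the thresholds are merged into one radius so
    that compactness can make it uniform. *)
Lemma slides_at p B : closure D p -> 0 < B -> exists2 e : R, 0 < e & forall x, `|x - p| < e ->
 (forall k, r k p <> 0 -> r k x < - e) /\ exists v s0, slides x e B v s0.
move=>cp B0;have p0:=le0_closed rs DE cp;have [v [d [dp Hv]]]:=inward oD bD rs CR p0.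
have /choice[ek Hek] : forall k, exists e, 0 < e /\ (r k p <> 0 -> forall x, `|x - p| < e -> r k x < - e).
 move=>k;have [E|ne]:=pselect (r k p = 0);first by exists 1.
 have rk: 0 < - r k p / 2 by rewrite divr_gt0 // oppr_gt0 lt_neqAle p0 andbT;apply/eqP.
 have [d1 d10 Hd1]:=(cont_epsP _ _).1 ((rs k [::]).2 p I) _ rk.
 exists (Num.min d1 (- r k p / 4));split=>[|_ x];first by rewrite lt_min d10 divr_gt0 // oppr_gt0 -[r k p]opprK oppr_lt0;move: rk;lra.
 rewrite lt_min=>/andP[/Hd1 + _];rewrite ltrNr gt_min => h;apply/orP;right.
 by move: h rk;rewrite /= ler_norml=>/andP[_];move: (r k x) (r k p) => a b;lra.
have [e e0 He]:=@pos_lower_bound _ (enum 'I_N) ek (fun k _ => (Hek k).1).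
pose t:=Num.min d e / 2;have m0: 0 < Num.min d e by rewrite lt_min dp.
have t0: 0 < t by rewrite divr_gt0.
have v1: 0 < 1 + `|v| by rewrite ltr_pwDl.
pose s0:=Num.min B t / (1 + `|v|);have s00: 0 < s0 by rewrite divr_gt0 // lt_min B0.
have sv: s0 * `|v| <= Num.min B t.
 apply: le_trans (_ : s0 * (1 + `|v|) <= _);first by rewrite ler_pM2l // lerDr.
 by rewrite divfK // gt_eqF.
have far k: r k p <> 0 -> forall x, `|x - p| < Num.min d e -> r k x < - e.
 move=>ne x;rewrite lt_min=>/andP[_ xe];have ee: e <= ek k by apply: He;rewrite mem_enum.
 by apply: lt_le_trans ((Hek k).2 ne x (lt_le_trans xe ee)) _;rewrite lerN2.
have min_e: Num.min d e <= e by rewrite ge_min lexx orbT.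
exists (Num.min t s0)=>[|x];first by rewrite lt_min t0.
rewrite lt_min=>/andP[xt xs].
have te: Num.min t s0 <= e by rewrite ge_min (le_trans _ min_e) // ler_pdivrMr // ler_peMr ?(ltW m0) // ler1n.
have near_p s: 0 <= s <= s0 -> `|s *: v + x - p| < Num.min d e.
 move=>/andP[sp ss];rewrite -addrA;apply: le_lt_trans (ler_normD _ _) _.
 have : `|s *: v| <= t.
  rewrite normrZ ger0_norm //;apply: le_trans (_ : s0 * `|v| <= _);first by rewrite ler_wpM2r.
  by apply: le_trans sv _;rewrite ge_min lexx orbT.
 by move: xt;rewrite /t;move: (Num.min d e) (`|s *: v|) (`|x - p|) => a b c;lra.
have far' k s: r k p <> 0 -> 0 <= s <= s0 -> r k (s *: v + x) < - Num.min t s0.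
 by move=>ne /near_p h;apply: lt_le_trans (far k ne _ h) _;rewrite lerN2.
split=>[k ne|];first by have := far' k 0 ne;rewrite scale0r add0r=>-> //;rewrite lexx ltW.
exists v, s0;split=>[||k];first by rewrite ge_min lexx orbT.
 by apply: le_trans sv _;rewrite ge_min lexx.
have [E|ne]:=pselect (r k p = 0);last by left => s;exact: far'.
right => s /andP[sp ss];have [[_ Hd]|H]:=Hv k;last first.
 by have := H p;rewrite subrr normr0 E ltxx=>/(_ (ltW dp)).
apply: (descend rs Hd sp) => u /andP[u0 us];apply: ltW;apply: lt_le_trans (near_p u _) _.
 by rewrite u0 (le_trans us).
by rewrite ge_min lexx.
Qed.

Lemma slides_le x e e' B v s0 : e <= e' -> slides x e' B v s0 -> slides x e B v s0.
move=>ee [h1 h2 h3];split=>//;first exact: le_trans h1.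
by move=>k;have [H|H]:=h3 k;[left=> s /H h;apply: lt_le_trans h _;rewrite lerN2|right].
Qed.

Variable G : set V.
Hypotheses (dG : domain G) (GE : G = Phi @` D).

Lemma cr_free_real (q : 'I_N -> V -> R) S p : cr_free q S p -> forall c : 'I_N -> R,
 \sum_(j in S) c j *: grad (q j) p = 0 -> forall j, j \in S -> c j = 0.
move=>H c E j jS;have F i: \sum_(j in S) c j * (2^-1 * pd i (q j) p) = 0.
 have := congr1 (fun z : V => 2^-1 * z ord0 i) E;rewrite mxE mulr0 summxE mulr_sumr => h;rewrite -[RHS]h.
 by apply: eq_bigr => k _;rewrite !mxE mulrCA.
have [] // := H c (fun _ => 0) _ j jS => k;split.
 by rewrite -[RHS](F (xi k));apply: eq_bigr => i _;rewrite mul0r subr0.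
by rewrite -[RHS](F (yi k));apply: eq_bigr => i _;rewrite mul0r addr0.
Qed.

(** Each set {q_j < 0} must be a domain; it suffices to join every one of its points, inside it, to
    the connected set contained in it. *)
Lemma connected_from (A B : set V) : connected B -> B !=set0 ->
 (forall w, A w -> exists C, [/\ connected C, C w, C `<=` A & C `&` B !=set0]) -> B `<=` A -> connected A.
move=>cB [b Bb] H BA.
have -> : A = \bigcup_(C in [set C : set V | [/\ connected C, C `<=` A & B `<=` C]]) C.
 apply/seteqP;split=>[w /H[C [cC Cw CA CB]]|w [C [_ CA _] Cw]];last exact: CA.
 exists (C `|` B);last by left.
 by split=>[|x [/CA|/BA]|x Bx] //;[exact: connectedU|right].
by apply: bigcup_connected=>[|C []] //;exists b => C [_ _];exact.
Qed.

Lemma path_connected x v (s0 : R) : connected ((fun s => Phi (s *: v + x)) @` `[0, s0]%classic).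
apply: connected_continuous_connected;first exact: segment_connected.
apply: continuous_subspaceT => s;apply: continuous_comp;first exact: line_continuous.
exact: Phi_cont.
Qed.

Lemma image_bounded : bounded_set G.
have [L L0 HL]:=Phi_lip Ps;have [M HM]:=(bounded_setP _).1 bD.
apply/bounded_setP;exists (`|Phi 0| + L * M) => y;rewrite GE => -[x Dx <-].
rewrite -(subrK (Phi 0) (Phi x)) addrC;apply: le_trans (ler_normD _ _) _;rewrite lerD2l.
by apply: le_trans (HL _ _) _;rewrite subr0 ler_wpM2l // HM.
Qed.

(** The functions r_j o K exist only near the closure of [G], and nothing confines their common
    corners to that neighbourhood. The modification [rho] does so, after which a cut-off extends
    them to the whole space by the value 1. *)
Theorem image_corners : generic_corners G.
have ez (a : R) : a = 0 -> a <= 0 by move=>->.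
have [e1 e10 He1]:=inverse_near;have [|K [oW KP Ks]]:=He1 e1;first by rewrite e10 lexx.
set W := Phi @` thick e1 in oW Ks.
have [c [Kc [e2 [cs c01 [cK KN] c0 [e20 c1]]]]]:=compact_cutoff (closure_compact bD) (@thick_open e1) (fun p => @closure_thick e1 p e10).
pose r' l w:=r l (K w).
have r'W k l: Cn false W k (r' l).
 by apply: (Cn_comp oW openT)=>//;exact: (smooth_onP _ _).1.
have r'E x: thick e1 x -> r'^~ (Phi x) = r^~ x by move=>xt;apply/funext => l;rewrite /r' KP.
(* What must hold uniformly near the closure: inactive faces stay below -e, active complex gradients
   are independent after transport, and a short inward slide exists. *)
pose Q (x : V) (e : R) := exists (S : {set 'I_N}) (v : V) (s0 : R), [/\ forall k, k \notin S -> r k x < - e, cr_free r' S (Phi x) & slides x e (e2 / 4) v s0].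
have [||e3 e30 He3]:=@compact_radius _ _ Q (closure_compact bD).
- move=>p e e' ee [S [v [s0 [h1 h2 h3]]]];exists S, v, s0;split=>//;last exact: slides_le h3.
 by move=>k /h1 h;apply: lt_le_trans h _;rewrite lerN2.
- move=>p cp;have e24: 0 < e2 / 4 by rewrite divr_gt0.
 have [e e0 He]:=slides_at cp e24;pose S:=[set k | r k p == 0]%SET.
 have crp: cr_free r' S (Phi p).
  apply: (cr_free_push (@thick_open e1) oW (closure_thick e10 cp) _ Ps hPhi cp r'W)=>[x xt|l x xt|].
  + by exists x.
  + by rewrite /r' KP.
  + by apply: CR => j;rewrite inE=>/eqP.
 have Wp: W (Phi p) by exists p=>//;exact: closure_thick.
 have [d dp Hd]:=cr_free_open oW r'W Wp crp.
 have /cvgrPdist_lt/(_ d dp)/nbhs_ballP[d' /= d'0 Hd'] := @Phi_cont _ Phi Ps p.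
 exists (Num.min e d')=>[|x];first by rewrite lt_min e0.
 rewrite lt_min=>/andP[xe xd];have [h1 [v [s0 h2]]]:=He x xe.
 have le_e: Num.min e d' <= e by rewrite ge_min lexx.
 exists S, v, s0;split;last exact: slides_le h2.
 + by move=>k;rewrite inE=>/eqP /h1 h;apply: lt_le_trans h _;rewrite lerN2.
 + have [|_ //]:=Hd (Phi x);rewrite distrC;apply: Hd'.
  by rewrite ball_lt.
pose e5:=Num.min e3 (Num.min e1 e2 / 2).
have e120: 0 < Num.min e1 e2 by rewrite lt_min e10.
have e50: 0 < e5 by rewrite lt_min e30 divr_gt0.
have e53: e5 <= e3 by rewrite ge_min lexx.
have e512: e5 <= Num.min e1 e2 / 2 by rewrite ge_min lexx orbT.
have e12h: Num.min e1 e2 / 2 <= Num.min e1 e2 by rewrite ler_pdivrMr // ler_peMr ?ltW // ltr1n.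
have le1: Num.min e1 e2 <= e1 by rewrite ge_min lexx.
have le2: Num.min e1 e2 <= e2 by rewrite ge_min lexx orbT.
have cQ: compact (Kc `&` ~` thick e5) by apply: compact_closedI=>//;apply: open_closedC;exact: thick_open.
pose sm x:=\sum_k flat (r k x).
have smc x: {for x, continuous sm}.
 apply: sum_continuous => k _;apply: continuous_comp;first exact: r_cont.
 exact: (@smooth1_cont flat 0 flat_smooth).
have smp x: (Kc `&` ~` thick e5) x -> 0 < sm x.
 move=>[_ nt];rewrite lt_neqAle sumr_ge0 ?andbT=>[|k _];last exact: flat_ge0.
 apply/negP=>/eqP /esym s0;apply: nt;apply: (closure_thick e50);apply: le0_closure => j.
 have /psumr_eq0P h := s0;have fj: flat (r j x) = 0 by apply: h=>// k _;exact: flat_ge0.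
 by rewrite leNgt;apply/negP=>/flat_gt0;rewrite fj ltxx.
have [M HM]:=@cont_bounded _ _ (fun x => (sm x)^-1) cQ (fun x Qx => continuousV (lt0r_neq0 (smp x Qx)) (smc x)).
have M1: 0 < `|M| + 1 by rewrite ltr_wpDl.
have smb x: (Kc `&` ~` thick e5) x -> (`|M| + 1)^-1 <= sm x.
 move=>Qx;have s0:=smp x Qx;rewrite -[leRHS]invrK lef_pV2 ?posrE ?invr_gt0 //.
 have := HM x Qx;rewrite gtr0_norm ?invr_gt0 // => h;apply: le_trans h _.
 by apply: le_trans (ler_norm M) _;rewrite lerDl.
have e32: 0 < e3 / 2 by rewrite divr_gt0.
have iM: 0 < (`|M| + 1)^-1 by rewrite invr_gt0.
(* [flat dl] is below the minimum of the sum of flat terms on the support of the cut-off away from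
   the closure, so a point with rho <= 0 is close to the closure; [dl < e3] lets a slide of length
   at least [e3] end in [D]. *)
have [dl [dl0 dl3 dlm]]:=flat_small e32 iM.
have dle: dl < e3 by apply: le_lt_trans dl3 _;rewrite gtr_pMr // invf_lt1 // ltr1n.
(* Any distinct weights at least 1 would do. *)
pose A (j : 'I_N) : R := j.+1%:R.
have A1 j: 1 <= A j by rewrite /A ler1n.
have Ai: injective A by move=>i j /eqP;rewrite /A eqr_nat eqSS=>/eqP /val_inj.
(* A convex combination of [rho] and 1: equal to [rho] near the closure of [G], and to 1 off the
   image of the neighbourhood. *)
pose q j w:=1 + zext W (fun w => c (K w) * (rho A dl (r'^~ w) j - 1)) w.
have cKc x: c x != 0 -> Kc x by move=>cx;apply: contrapT=>/c0 /eqP;rewrite (negbTE cx).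
have t21 x: thick e2 x -> c x = 1 /\ thick e1 x.
 move=>[p cp xp];have cx:=c1 p x cp xp;split=>//.
 by apply: KN;apply: cKc;rewrite cx oner_neq0.
have qE j x: thick e2 x -> q j (Phi x) = rho A dl (r^~ x) j.
 move=>/t21[cx xt];rewrite /q zextT;last by exists x.
 by rewrite r'E // KP // cx mul1r addrC subrK.
have rsmall x k: sm x <= flat dl -> r k x <= dl.
 move=>h;rewrite leNgt;apply/negP => h2;have : flat dl < flat (r k x) by apply: flat_lt=>//;exact: lt_trans h2.
 rewrite ltNge;apply/negP;rewrite negbK;apply: le_trans h;rewrite /sm (bigD1 k) //= lerDl sumr_ge0 // => i _;exact: flat_ge0.
(* If q_j <= 0 then rho <= 0, since q_j lies between rho and 1; the bound on the sum of flat terms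
   then places the point near the closure, where q_j equals rho. *)
have q0 j w: q j w <= 0 -> exists2 x, thick e5 x /\ sm x <= flat dl & Phi x = w.
 move=>h;have [Ww|nW]:=pselect (W w);last by move: h;rewrite /q zextF // addr0 ler10.
 have [x xt E]:=Ww;move: h;rewrite /q zextT // -E KP // r'E //.
 have /andP[cp cle] := c01 x;move=>h;have rx: rho A dl (r^~ x) j <= 0.
  rewrite leNgt;apply/negP => rp;move: h;apply/negP;rewrite -ltNge.
  by move: rp cp cle;move: (rho _ _ _ _) (c x) => a b;nra.
 have cn: c x != 0 by apply: contraTneq h=>->;rewrite mul0r addr0 ler10.
 have [_ sd]:=rho_le0 A1 dl0 rx;exists x=>//;split=>//;apply: contrapT => nt.
 by have := le_lt_trans (le_trans (smb x (conj (cKc x cn) nt)) sd) dlm;rewrite ltxx.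
have t5: thick e5 `<=` thick e2 by apply: thick_le;exact: le_trans (le_trans e512 e12h) le2.
have Dt x: D x -> thick e2 x by move=>Dx;apply: closure_thick=>//;exact: subset_closure.
have qG j w: G w -> q j w < 0.
 by rewrite GE => -[x Dx <-];rewrite (qE j x (Dt x Dx));apply: (rho_neg A dl0) => k;move: Dx;rewrite DE;exact.
have qs j: smooth_on setT (q j).
 apply/smooth_onP => k;apply: (CnD openT);first exact: Cn_cst.
 apply: (Cn_unbounded (b := true));apply: (Csm_zext (b := false) (K := Phi @` Kc) oW).
 - by apply: continuous_compact=>//;apply: continuous_subspaceT => x;exact: Phi_cont.
 - by move=>_ [x /KN xt <-];exists x.
 - move=>w [x xt <-] nK;rewrite KP // c0 ?mul0r // => Kx;by apply: nK;exists x.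
 - move=>k';apply: (CnM oW);first by apply: (Cn_comp oW openT)=>//;exact: Csm_Cn cs k'.
  by apply: (CnB oW);[exact: rho_Csm|exact: Cn_cst].
have qcr (S : {set 'I_N}) w : (forall j, j \in S -> q j w = 0) -> cr_free q S w.
 move=>z;have [->|[j0 j0S]]:=set_0Vmem S;first by move=>a b _ j;rewrite inE.
 have [x [xt sx] E]:=q0 j0 w (ez _ (z j0 j0S)).
 have x2:=t5 _ xt;have [_ x1]:=t21 _ x2;have [p cp xp]:=xt.
 have [S0 [v [s0 [h1 h2 _]]]]:=He3 p x cp (lt_le_trans xp e53).
 have [|_ [oW2 _ _]]:=He1 (Num.min e1 e2);first by rewrite e120.
 set W2 := Phi @` _ in oW2.
 have W2W: W2 `<=` W by move=>_ [y /(thick_le le1) yt <-];exists y.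
 have W2w: W2 w by exists x=>//;apply: thick_le xt;exact: le_trans e12h.
 have qE2 j y: W2 y -> q j y = rho A dl (r'^~ y) j.
  by move=>[u ut <-];rewrite (qE j u (thick_le le2 ut)) (r'E u (thick_le le1 ut)).
 have rz j: j \in S -> rho A dl (r'^~ w) j = 0 by move=>jS;rewrite -(qE2 j w W2w) z.
 rewrite -E in h2 *;rewrite E in h2 *;apply: (rho_cr_free A1 Ai dl0 _ _ rz h2)=>[j i jS|k kS].
  have rW2 l: Cn false W2 1 (r' l) by exact: Cn_sub W2W (r'W 1%N l).
  have rj: r' j w <= 0 by have []:=rho_le0 A1 dl0 (ez _ (rz j jS)).
  by rewrite (pd_eqon oW2 i (qE2 j) W2w);exact: (@rho_pd n N A dl W2 r' j i w oW2 rW2 W2w rj).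
 by rewrite -E /r' KP // ltW // (lt_le_trans (h1 k kS)) // lerN2 ltW.
split=>//;split;first exact: image_bounded.
have [oG [cG G0]]:=dG.
exists N, q;split=>//;split=>[j|].
 split;last split.
 - have -> : [set x | q j x < 0] = q j @^-1` [set t | t < 0] by [].
  by apply: (open_comp (f := q j))=>[x _|];[exact: ((qs j) [::]).2|exact: open_lt].
 (* Along the slide every r_k decreases or stays below -e3, so rho_j does not increase; at the end
    all r_k are negative because they started at most at dl < s0. *)
 - apply: (@connected_from _ G)=>// [w qw|w Gw];last exact: qG.
  have [x [xt sx] E]:=q0 j w (ltW qw);have [p cp xp]:=xt.
  have [S0 [v [s0 [_ _ [s3 sv H]]]]]:=He3 p x cp (lt_le_trans xp e53).
  have s00: 0 < s0 by exact: lt_le_trans s3.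
  have st s: 0 <= s <= s0 -> thick e2 (s *: v + x).
   move=>/andP[sp ss];exists p=>//;rewrite -addrA;apply: le_lt_trans (ler_normD _ _) _.
   have : `|s *: v| <= e2 / 4.
    by rewrite normrZ ger0_norm //;apply: le_trans sv;rewrite ler_wpM2r.
   have := le_trans e512 (_ : _ <= e2 / 2);rewrite ler_pM2r ?invr_gt0 // =>/(_ le2).
   by move: xp e20;move: (`|s *: v|) (`|x - p|) => a b;lra.
  exists ((fun s => Phi (s *: v + x)) @` `[0, s0]%classic);split;first exact: path_connected.
  + by exists 0;rewrite ?scale0r ?add0r //= in_itv /= lexx ltW.
  + move=>_ [s /= + <-];rewrite in_itv /= => s01;rewrite /= (qE j _ (st s s01)).
   apply: le_lt_trans (_ : rho A dl (r^~ x) j < 0);last by rewrite -(qE j x (t5 _ xt)) E.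
   apply: (rho_le A1 dl0) => k;have [/(_ s s01) h|/(_ s s01) h]:=H k.
    by right;rewrite ltW // (lt_trans h) // ltrN2.
   by left;apply: le_trans h _;rewrite gerBl;have /andP[] := s01.
  + exists (Phi (s0 *: v + x));split;first by exists s0;rewrite //= in_itv /= lexx ltW.
   rewrite GE;exists (s0 *: v + x)=>//;rewrite DE => k.
   have s01: 0 <= s0 <= s0 by rewrite lexx ltW.
   have [/(_ s0 s01) h|/(_ s0 s01) h]:=H k;first by rewrite (lt_trans h) // oppr_lt0.
   apply: le_lt_trans h _;rewrite subr_lt0;apply: le_lt_trans (rsmall x k sx) _.
   exact: lt_le_trans dle s3.
 - by have [w Gw]:=G0;exists w;exact: qG.
split=>[j p qp|];last split;last split.
- have crj: cr_free q [set j]%SET p by apply: qcr => i;rewrite inE=>/eqP ->.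
 apply/negP=>/eqP g0;have := cr_free_real crj (c := fun _ => 1) _ (set11 j).
 by rewrite big_set1 scale1r g0=>/(_ erefl) /eqP;rewrite oner_eq0.
- apply/seteqP;split=>[w Gw j|w qw];first exact: qG.
 case: (pickP (fun _ : 'I_N => true))=>[j0 _|none].
  have [x [xt _] E]:=q0 j0 w (ltW (qw j0));rewrite GE;exists x=>//;rewrite DE => j.
  have h: rho A dl (r^~ x) j < 0 by rewrite -(qE j x (t5 _ xt)) E;exact: qw.
  exact: (rho_lt0 A1 h).
 (* In the absence of defining functions [D] is the whole space, which is bounded only in dimension
    0, where all points coincide. *)
 have [y Gy]:=G0;suff -> : w = y by [].
 apply/rowP => i;exfalso;have [M' HM']:=(bounded_setP _).1 bD.
 have := HM' (const_mx (`|M'| + 1));rewrite DE=>/(_ (fun j => False_ind _ (notF (esym (none j))))) h.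
 have := le_trans (coord_le (const_mx (`|M'| + 1) : V) i) h;rewrite mxE ger0_norm ?addr_ge0 // => h2.
 by have := le_trans h2 (ler_norm M');rewrite gerDl ler10.
- by move=>S p z;exact: cr_free_real (qcr S p z).
- exact: qcr.
Qed.

End Image.

(** * Transfer of corners and Condition R along a diffeomorphism of closures *)

Section Converse.
Variable n : nat.
Local Notation V := 'rV[R]_(n + n).
Variables (D G : set V) (f g : V -> V).
Hypotheses (oD : open D) (oG : open G) (cD : connected D) (cG : connected G) (D0 : D !=set0).
Hypotheses (bD : bounded_set D) (bG : bounded_set G).
Hypotheses (hf : holomorphic_map_on D f) (hg : holomorphic_map_on G g).
Hypotheses (fD : forall x, D x -> G (f x)) (gG : forall y, G y -> D (g y)).
Hypotheses (gf : forall x, D x -> g (f x) = x) (fg : forall y, G y -> f (g y) = y).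
Hypotheses (fs : forall l, Csm true D (fun x => f x ord0 l)) (gs : forall l, Csm true G (fun x => g x ord0 l)).

(** With [f] and [g] smooth up to the boundary, pull-back preserves smoothness up to the boundary
    both ways. A function on [G] is pulled to [D], projected there and pulled back; the two
    Jacobians cancel on the function itself. *)
Lemma RC_image : RC D -> RC G.
move=>rD P Ps;have [chi [K ex]]:=exhaustion_exists oG.
have pull_Csm (A B : set V) (h : V -> V) (Q : V -> R[i]) : open A -> open B -> (forall x : V, A x -> B (h x)) ->
  (forall l, Csm true A (fun x => h x ord0 l)) -> CS B Q -> CS A (pull h Q).
 move=>oA oB hA hs Qs k;apply: (CCM oA).
  apply: (CC_det oA) => i j;apply: (CC_eq oA (F := pdC (xi j) (comp h i)))=>[x _|];first by rewrite mxE.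
  by apply: CC_pd;split;exact: hs.
 by split;[exact: (Cn_comp oA oB hA (Qs k).1 (fun l => hs l k))|exact: (Cn_comp oA oB hA (Qs k).2 (fun l => hs l k))].
have pP:=pull_Csm D G f P oD oG fD fs Ps;have [H [pH Hs]]:=rD _ pP.
have G0: G !=set0 by have [x Dx]:=D0;exists (f x);exact: fD.
exists (pull g H);split;last exact: (pull_Csm G D g H oG oD gG gs Hs).
have [a o]:=transfer oG oD cG cD G0 hg hf gG fD fg gf ex (CS_CC false 0 pP) (CS_lint oD bD pP) pH.
split=>// Q /o;rewrite /orth.
have E y: G y -> pull g (pull f P) y = P y.
 move=>Gy;have := jac_inv oG oD hg hf gG fg Gy;rewrite /pull fg // => J.
 by rewrite mulrA [_ * jac f _]mulrC J mul1r.
have Z (T : R[i] -> R) : zext G (fun x => T ((pull g (pull f P) x - pull g H x) * conjc (Q x))) =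
  zext G (fun x => T ((P x - pull g H x) * conjc (Q x))).
 by apply/funext => x;have [Gx|nG]:=pselect (G x);rewrite ?(zextT _ Gx) ?(zextF _ nG) // E.
by rewrite (Z Re) (Z Im).
Qed.

Variable Phi : V -> V.
Hypothesis Ps : forall l, Csm true setT (fun x => Phi x ord0 l).
Hypothesis PE : forall x, D x -> Phi x = f x.

(** At interior points the differential of [Phi] is inverted by that of [g], which is bounded on
    [G]. A point of the closure borrows the inverse from a nearby interior point, so the radius is
    uniform. *)
Lemma Phi_good : exists2 d : R, 0 < d & forall p, closure D p -> good Phi p d.
have /choice[c Hc] : forall ql : 'I_(n + n) * 'I_(n + n), exists C, 0 <= C /\ forall y, G y -> `|pd ql.1 (fun y => g y ord0 ql.2) y| <= C.
 move=>[q l];have [_ /(_ isT)[M HM]]:=Cn_C0 (Csm_pd q (gs l) 0%N).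
 by exists `|M|;split=>// y Gy;exact: le_trans (HM y Gy) (ler_norm M).
have b0: 0 <= \sum_ql c ql by apply: sumr_ge0 => i _;have []:=Hc i.
have [d d0 Hd]:=good_of_inverse Ps b0;exists d=>// p cp.
have [x Dx xp]:=closure_pick cp d0.
apply: (Hd p x (Jm g (f x)) (ltW xp))=>[|q l];last first.
 rewrite mxE;have [_ h]:=Hc (q, l);apply: le_trans (h _ (fD Dx)) _.
 by rewrite (bigD1 (q, l)) //= lerDl;apply: sumr_ge0 => i _;have []:=Hc i.
apply/matrixP => i l;rewrite !mxE.
have E1: pd i (fun x => g (f x) ord0 l) x = (i == l)%:R.
 rewrite (pd_eqon oD (g := fun x => x ord0 l) i _ Dx)=>[|y Dy];last by rewrite gf.
 by rewrite (pdE (dv_coord x i l)) eq_sym;case: eqP.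
rewrite -E1;have C:=C1_chain (h := fun y => g y ord0 l) oD oG (gs l 1%N) (fun q => Cn_derivable (i := i) (fs q 1%N) Dx) (fD Dx).
rewrite (pdE C);apply: eq_bigr => q _;rewrite !mxE mulrC;congr (_ * _).
by apply: (pd_eqon oD)=>// y Dy;rewrite PE.
Qed.

Lemma Phi_hol : holomorphic_map_on D Phi.
apply/(holomorphic_mapP _ _) => j;apply: (hol_eq oD _ (hol_map j hf)) => x Dx.
by rewrite /comp PE.
Qed.

Lemma Phi_image : G = Phi @` D.
apply/seteqP;split=>[y Gy|_ [x Dx <-]];last by rewrite PE //;exact: fD.
by exists (g y);rewrite ?PE ?fg //;exact: gG.
Qed.

(** The given extension is continuous on the closure only. By density it coincides there with the
    extension to the whole space, which thereby inherits injectivity on the closure. *)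
Lemma Phi_closure (F : V -> V) : (forall x, D x -> F x = f x) -> {within closure D, continuous F} ->
 forall p, closure D p -> Phi p = F p.
move=>FE /subspace_continuousP Fc p cp;apply/eqP;rewrite -subr_eq0 -normr_le0;apply/ler_addgt0Pl => e e0;rewrite addr0.
have e2: 0 < e / 2 by rewrite divr_gt0.
have Fc': F @ within (closure D) (nbhs p) --> F p by exact: Fc.
have /cvgrPdist_le/(_ _ e2) := Fc';rewrite /= near_withinE=>/nbhs_ballP[d1 /= d10 H1].
have /cvgrPdist_le/(_ _ e2)/nbhs_ballP[d2 /= d20 H2] := @Phi_cont _ Phi Ps p.
have [x Dx] : exists2 x, D x & `|x - p| < Num.min d1 d2 by apply: closure_pick=>//;rewrite lt_min d10.
rewrite lt_min=>/andP[x1 x2];have h1:=H1 x _ (subset_closure Dx);have h2:=H2 x.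
rewrite ball_lt in h1;rewrite ball_lt in h2;rewrite (FE x Dx) -(PE Dx) in h1.
have -> : Phi p - F p = (Phi p - Phi x) - (F p - Phi x) by rewrite opprB addrA subrK.
apply: le_trans (ler_normB _ _) _;have := h1 x1;have := h2 x2.
by move: (`|Phi p - Phi x|) (`|F p - Phi x|) => a b;lra.
Qed.

End Converse.

Theorem condition_R_of_diffeo n (D G : set 'rV[R]_(n + n)) f : generic_corners D -> condition_R D ->
 domain G -> biholomorphic D G f -> extends_smooth_diffeo D G f -> generic_corners G /\ condition_R G.
move=>[[oD [cD D0]] [bD [N [r [rs [_ [_ [DE [_ CR]]]]]]]]] rD dG [hf [g [hg [fD [gG [gf fg]]]]]].
move=>[F [H [FE [_ [_ [HF [_ [Fc [_ [Fs Hs]]]]]]]]]];have [oG [cG G0]]:=dG.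
have fs l: Csm true D (fun x => f x ord0 l).
 by apply: (upto_Csm bD);apply: (smooth_upto_eq oD _ (Fs l)) => x Dx;rewrite /Defs.coord FE.
have [Phi [Ps PE]]:=map_extension (fun l => smooth_extension oD bD rs DE CR (fs l)).
(* Boundedness of [G] is derived: it is the image of the bounded set [D] under a Lipschitz map. *)
have GE:=Phi_image fD gG fg PE;have bG:=image_bounded bD Ps GE.
have gs l: Csm true G (fun x => g x ord0 l).
 apply: (upto_Csm bG);apply: (smooth_upto_eq oG _ (Hs l)) => y Gy.
 by rewrite /Defs.coord -{1}(fg y Gy) -FE ?HF //;[exact: subset_closure (gG y Gy)|exact: gG].
have [d d0 gd]:=Phi_good oD oG fD gf fs gs Ps PE.
have inj p q: closure D p -> closure D q -> Phi p = Phi q -> p = q.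
 by move=>cp cq;rewrite !(Phi_closure Ps PE FE Fc) // => E;rewrite -(HF p cp) -(HF q cq) E.
have gG': generic_corners G := image_corners oD bD rs DE CR Ps (Phi_hol oD hf PE) inj d0 gd dG GE.
split=>//;have [_ [_ [N' [q [qs [_ [_ [GE' [_ CR']]]]]]]]]:=gG'.
apply/(condition_RP oG bG qs GE' CR').
exact: (RC_image oD oG cD cG D0 bD hf hg fD gG gf fg fs gs ((condition_RP oD bD rs DE CR).1 rD)).
Qed.

End Main.

Theorem theorem1p2 (R : realType) (n : nat) (D G : set 'rV[R]_(n + n))
  (f : 'rV[R]_(n + n) -> 'rV[R]_(n + n)) :
  pseudoconvex D -> generic_corners D -> condition_R D ->
  domain G -> biholomorphic D G f ->
  (extends_smooth_diffeo D G f <-> (generic_corners G /\ condition_R G)).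
Proof.
move=> _ gD rD dG bf; split=> [|[gG rG]]; first exact: condition_R_of_diffeo.
exact: diffeo_of_condition_R.
Qed.
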